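(* Let $d=1$ and let the triangular array $X_{t,n}=G_n(t/n,\boldsymbol{\epsilon}_t)$, $t=1,\dots,n$, satisfy assumptions (A.1), (A.2) and (A.3) below for some $q>2$ and some $p\ge 1$. Define the local long-run variance $$\sigma^2(u)=\sum_{h=-\infty}^{\infty}\operatorname{Cov}\big[G(u,\boldsymbol{\epsilon}_h),G(u,\boldsymbol{\epsilon}_0)\big],\qquad u\in[0,1].$$ Then, as $n\to\infty$, $$\frac{1}{\sqrt n}\sum_{t=1}^{\lfloor nv\rfloor}\big[X_{t,n}-\mathbb{E}X_{t,n}\big]\ \rightsquigarrow\ B\Big(\int_0^v\sigma^2(u)\,du\Big),$$ where $B$ is a standard Brownian motion, and the weak convergence holds in the Skorokhod space $D[0,1]$ (as processes in $v\in[0,1]$).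
   Context: Let $(\epsilon_i)_{i\in\mathbb Z}$ be i.i.d. random variables and $(\epsilon_i^* )_{i\in\mathbb Z}$ an independent copy of them. Write $\boldsymbol{\epsilon}_t=(\epsilon_t,\epsilon_{t-1},\dots)\in\mathbb R^\infty$ and, for $j\ge 0$, $\tilde{\boldsymbol{\epsilon}}_{t,j}=(\epsilon_t,\dots,\epsilon_{t-j+1},\epsilon^*_{t-j},\epsilon_{t-j-1},\dots)$ (only the coordinate $\epsilon_{t-j}$ is replaced by its copy). $\mathbb R^\infty$ carries the $\sigma$-algebra generated by finite-dimensional projections. For each $n$, $G_n:\mathbb R\times\mathbb R^\infty\to\mathbb R^d$ is measurable, and $G:\mathbb R\times\mathbb R^\infty\to\mathbb R^d$ is a measurable limiting kernel; $X_{t,n}=G_n(t/n,\boldsymbol{\epsilon}_t)$. For a random vector $Y$, $\|Y\|_{L_q}=(\mathbb E\|Y\|^q)^{1/q}$. The $p$-variation of $G_n$ is $$\|G_n\|_{p\text{-var}}=\sup_{m\in\mathbb N,\,0=u_0<u_1<\dots<u_m=1}\Big(\sum_{i=1}^m\|G_n(u_i,\boldsymbol{\epsilon}_0)-G_n(u_{i-1},\boldsymbol{\epsilon}_0)\|_{L_q}^p\Big)^{1/p}.$$ Assumptions: (A.1) $\sup_{u\in[0,1]}\|G_n(u,\boldsymbol{\epsilon}_0)-G(u,\boldsymbol{\epsilon}_0)\|_{L_q}\to0$ as $n\to\infty$. (A.2) $\sup_n\sup_{u\in[0,1]}\|G_n(u,\boldsymbol{\epsilon}_0)\|_{L_q}+\sup_n\|G_n\|_{p\text{-var}}\le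 C_G<\infty$. (A.3) There is $\rho\in(0,1)$ such that $\|G_n(u,\boldsymbol{\epsilon}_t)-G_n(u,\tilde{\boldsymbol{\epsilon}}_{t,j})\|_{L_q}\le C_G\rho^j$ for all $j,n\in\mathbb N$, $u\in[0,1]$. *)

(* Defs.v *)
From HB Require Import structures.
From mathcomp Require Import all_boot all_order all_algebra.
From mathcomp Require Import all_classical all_reals all_analysis.
Set Implicit Arguments. Unset Strict Implicit. Unset Printing Implicit Defensive.
Import Order.TTheory GRing.Theory Num.Theory.
Import numFieldNormedType.Exports.
Local Open Scope classical_set_scope.
Local Open Scope ring_scope.

(* The finite family X 0, ..., X (m-1) of real random variables is
   (mutually) independent: product rule for every choice of Borel sets
   (taking B i = setT recovers every subfamily). *)
Definition indep_fam {d} {T : measurableType d} {R : realType}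
    (P : probability T R) (m : nat) (X : nat -> T -> R) : Prop :=
  forall B : nat -> set R, (forall i, measurable (B i)) ->
    P (\bigcap_(i in `I_m) (X i @^-1` B i)) =
    (\prod_(i < m) P (X i @^-1` B i))%E.

Definition mutual_indep {d} {T : measurableType d} {R : realType} {I : Type}
    (P : probability T R) (X : I -> T -> R) : Prop :=
  forall (m : nat) (idx : nat -> I),
    (forall i j, (i < m)%N -> (j < m)%N -> idx i = idx j -> i = j) ->
    indep_fam P m (fun i => X (idx i)).

Definition ident_distr {d} {T : measurableType d} {R : realType} {I : Type}
    (P : probability T R) (X : I -> T -> R) : Prop :=
  forall (i j : I) (B : set R), measurable B ->
    P (X i @^-1` B) = P (X j @^-1` B).

Definition joint_family {T R : Type} (eps epss : int -> T -> R) :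
    int + int -> T -> R :=
  fun s => match s with inl i => eps i | inr i => epss i end.

(* R^infty is modelled as nat -> R (coordinate k of eps_t is eps_{t-k});
   generators of the sigma-algebra on R x R^infty: Borel sets in the first
   factor and finite-dimensional (coordinate) projections. *)
Definition cyl_gen {R : realType} : set (set (R * (nat -> R))) :=
  [set A | (exists2 B : set R, measurable B & A = fst @^-1` B) \/
           (exists k : nat, exists2 B : set R, measurable B &
                A = (fun x : R * (nat -> R) => x.2 k) @^-1` B)].

Definition kernel_measurable {R : realType} (G : R -> (nat -> R) -> R) : Prop :=
  forall B : set R, measurable B ->
    <<s cyl_gen >> ((fun x : R * (nat -> R) => G x.1 x.2) @^-1` B).

Definition eps_seq {T R : Type} (eps : int -> T -> R) (t : int) : T -> nat -> R :=
  fun w k => eps (t - k%:Z)%R w.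

Definition eps_tilde {T R : Type} (eps epss : int -> T -> R) (t : int) (j : nat) :
    T -> nat -> R :=
  fun w k => if k == j then epss (t - j%:Z)%R w else eps (t - k%:Z)%R w.

Definition LqN {d} {T : measurableType d} {R : realType}
    (P : probability T R) (q : R) (Y : T -> R) : \bar R :=
  Lnorm P q%:E (EFin \o Y).

(* partitions 0 = u_0 < u_1 < ... < u_m = 1 are 0 :: s with s as below *)
Definition partition01 {R : realType} (s : seq R) : Prop :=
  path <%R 0 s /\ last 0 s = 1.

Definition part_pt {R : realType} (s : seq R) (i : nat) : R := nth 0 (0 :: s) i.

Definition pvar {d} {T : measurableType d} {R : realType}
    (P : probability T R) (q p : R) (Gn : R -> (nat -> R) -> R)
    (e0 : T -> nat -> R) : \bar R :=
  ereal_sup [set ((\sum_(i < size s)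
                    (LqN P q (fun w => (Gn (part_pt s i.+1) (e0 w)
                                       - Gn (part_pt s i) (e0 w))%R)) `^ p)
                   `^ p^-1)%E
            | s in [set s : seq R | partition01 s]].

Definition I01 {R : realType} : set R := [set x | 0 <= x <= 1].

(* cadlag on [0,1] (a path is a function R -> R; only its values on [0,1]
   matter) *)
Definition cadlag {R : realType} (x : R -> R) : Prop :=
  (forall t, 0 <= t < 1 -> x @ at_right t --> x t) /\
  (forall t, 0 < t <= 1 -> exists l : R, x @ at_left t --> l).

Definition time_changes {R : realType} : set (R -> R) :=
  [set lam : R -> R | {within (I01 : set R), continuous lam} /\
             (forall s t, I01 s -> I01 t -> s < t -> lam s < lam t) /\
             lam 0 = 0 /\ lam 1 = 1].

Definition skor_dist {R : realType} (x y : R -> R) : \bar R :=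
  ereal_inf [set maxe (ereal_sup [set `|lam t - t|%:E | t in I01])
                      (ereal_sup [set `|x t - y (lam t)|%:E | t in I01])
            | lam in time_changes].

Definition skor_continuous {R : realType} (f : (R -> R) -> R) : Prop :=
  forall x, cadlag x -> forall e : R, 0 < e ->
    exists2 delta : R, 0 < delta &
      forall y, cadlag y -> (skor_dist x y < delta%:E)%E -> `|f x - f y| < e.

Definition weak_conv_D {d d'} {T : measurableType d} {T' : measurableType d'}
    {R : realType} (P : probability T R) (S : nat -> T -> R -> R)
    (Q : probability T' R) (Y : T' -> R -> R) : Prop :=
  forall f : (R -> R) -> R, (exists M : R, forall x, `|f x| <= M) ->
    skor_continuous f ->
    (fun n => fine ('E_P[fun w => f (S n w)])%E) @ \oo -->
      fine ('E_Q[fun w => f (Y w)])%E.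

Definition std_brownian {d} {T : measurableType d} {R : realType}
    (P : probability T R) (B : R -> T -> R) : Prop :=
  [/\ (forall t, measurable_fun setT (B t)),
      P [set w | B 0 w != 0] = 0%E,
      (forall w, {within [set t : R | 0 <= t], continuous (fun t => B t w)}),
      (forall s t, 0 <= s -> s < t -> forall A : set R, measurable A ->
         P ((fun w => B t w - B s w) @^-1` A) = normal_prob 0 (Num.sqrt (t - s)) A)
    & (forall ts : seq R, path <%R 0 ts ->
         indep_fam P (size ts)
           (fun i w => B (nth 0 ts i) w - B (nth 0 (0 :: ts) i) w))].

(* Main.v *)
Require Import Defs.
From HB Require Import structures.
From mathcomp Require Import all_boot all_order all_algebra.
From mathcomp Require Import all_classical all_reals all_analysis.
From mathcomp Require Import measurable_realfun.
From mathcomp Require Import ring lra zify.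
Set Implicit Arguments. Unset Strict Implicit. Unset Printing Implicit Defensive.
Import Order.TTheory GRing.Theory Num.Theory.
Import numFieldNormedType.Exports.
Local Open Scope classical_set_scope.
Local Open Scope ring_scope.

(* Centre the kernels. Coupling makes the dependence on the past decay geometrically, so the array can be replaced, in L2, by
functionals of finitely many independent letters taking finitely many values; expectations over letters become iterated averages,
and cutting time into long blocks leaves independent centred block sums up to an error that is uniform over partial sums.
The bounded variation of the kernels in time and dominated convergence identify the limiting block variances as increments of
the integrated long-run variance. Lindeberg replacement against quantized Brownian increments gives convergence of finitely many
grouped sums, Ottaviani's inequality controls the path between the group boundaries, and weak convergence in D[0,1] reduces
to expectations of bounded Lipschitz functionals for the uniform distance because the limit is continuous. *)

(** * Finitely additive means and iterated averaging *)

(** Over finite alphabets conditional expectations are finite averages of arbitrary functions, so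
    the swapping arguments raise no measurability question. The price: an L2 approximation with a
    fixed error destroys the geometric coupling bound at large lags; [letter_model] repairs this
    with two nested approximations and an averaging of remote letters. Cutting into blocks of length
    [b] discards, at lag [j], only increments with [i %% b < j]; these are reversed martingale
    differences, so Doob's inequality bounds their partial sums by a multiple of [sqrt (n / b)],
    uniformly in the endpoint. Hence [b] stays fixed while [n] grows, and one block is negligible
    against [sqrt n]. Block sums keep only uniformly integrable squares, so excursions inside a
    group are controlled through the fourth moment of the Gaussian limit: a group of variance of
    order [1/m] has a large excursion with probability of order [1/m^2], and there are [m] groups.
    The integrated variance may be flat, so the grid times receive a small drift [th] before
    Brownian increments are formed. Parameters are fixed in the order [m], [th], [b], [n]. *)

Section Mean.
Context {R : realType} {A : Type}.
Implicit Types (mu : (A -> R) -> R) (f g : A -> R).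

(** An expectation reduced to what the swapping arguments use: linearity, monotonicity and
    normalization, on all functions. The instances built later are finitely supported laws, Dirac
    masses and their iterated averages, so no domain of integrable functions has to be carried
    along. *)
Record is_mean mu : Prop := IsMean {
  mean_lin : forall a f g, mu (fun x => a * f x + g x) = a * mu f + mu g;
  mean_le : forall f g, (forall x, f x <= g x) -> mu f <= mu g;
  mean_cst : forall c, mu (fun=> c) = c }.

Section theory.
Variable mu : (A -> R) -> R.
Hypothesis Hmu : is_mean mu.

Lemma eq_mean f g : f =1 g -> mu f = mu g.
Proof. by move=> /funext ->. Qed.

Lemma meanD f g : mu (fun x => f x + g x) = mu f + mu g.
Proof.
rewrite -[mu f]mul1r -(mean_lin Hmu); apply: eq_mean => x; by rewrite mul1r.
Qed.

Lemma meanZ a f : mu (fun x => a * f x) = a * mu f.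
Proof.
have := mean_lin Hmu a f (fun=> 0); rewrite (mean_cst Hmu) addr0 => <-.
by apply: eq_mean => x; rewrite addr0.
Qed.

Lemma meanZr a f : mu (fun x => f x * a) = mu f * a.
Proof. by rewrite [RHS]mulrC -meanZ; apply: eq_mean => x; rewrite mulrC. Qed.

Lemma meanN f : mu (fun x => - f x) = - mu f.
Proof. by rewrite -mulN1r -meanZ; apply: eq_mean => x; rewrite mulN1r. Qed.

Lemma meanB f g : mu (fun x => f x - g x) = mu f - mu g.
Proof. by rewrite meanD meanN. Qed.

Lemma mean_sum I (r : seq I) (P : pred I) (F : I -> A -> R) :
  mu (fun x => \sum_(i <- r | P i) F i x) = \sum_(i <- r | P i) mu (F i).
Proof.
elim: r => [|i r IH].
  by rewrite big_nil -[RHS](mean_cst Hmu 0); apply: eq_mean => x; rewrite big_nil.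
rewrite big_cons -IH; case: ifP => Pi.
  by rewrite -meanD; apply: eq_mean => x; rewrite big_cons Pi.
by apply: eq_mean => x; rewrite big_cons Pi.
Qed.

Lemma mean_ge0 f : (forall x, 0 <= f x) -> 0 <= mu f.
Proof. by move=> f0; rewrite -(mean_cst Hmu 0); apply: (mean_le Hmu). Qed.

Lemma mean_norm f : `|mu f| <= mu (fun x => `|f x|).
Proof.
rewrite ler_norml -meanN; apply/andP; split; apply: (mean_le Hmu) => x.
  by rewrite lerNl -normrN ler_norm.
exact: ler_norm.
Qed.

Lemma mean_bound f (M : R) : (forall x, `|f x| <= M) -> `|mu f| <= M.
Proof.
move=> fM; apply: (le_trans (mean_norm f)).
by rewrite -[leRHS](mean_cst Hmu M); apply: (mean_le Hmu).
Qed.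

Lemma mean_dist f g (e : R) : (forall x, `|f x - g x| <= e) -> `|mu f - mu g| <= e.
Proof. by rewrite -meanB; exact: mean_bound. Qed.

Lemma mean_sqr f : (mu f) ^+ 2 <= mu (fun x => f x ^+ 2).
Proof.
have := mean_ge0 (fun x => sqr_ge0 (f x - mu f)).
rewrite (eq_mean (g := fun x => (f x ^+ 2 + mu f ^+ 2) + (- 2 * mu f) * f x)); last first.
  by move=> x; ring.
rewrite !meanD (meanZ _ f) (mean_cst Hmu); nra.
Qed.

Lemma mean_L1 f (a : R) : 0 <= a -> mu (fun x => f x ^+ 2) <= a ^+ 2 ->
  mu (fun x => `|f x|) <= a.
Proof.
move=> a0 fa; rewrite -(@ler_pXn2r _ 2)// ?nnegrE ?mean_ge0//.
apply: (le_trans (mean_sqr _)); apply: le_trans fa.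
by apply: (mean_le Hmu) => x; rewrite real_normK// num_real.
Qed.

Lemma mean_CS f g (a b : R) : 0 <= a -> 0 <= b ->
  mu (fun x => f x ^+ 2) <= a ^+ 2 -> mu (fun x => g x ^+ 2) <= b ^+ 2 ->
  mu (fun x => `|f x * g x|) <= a * b.
Proof.
move=> a0 b0 fa gb.
(* The weighted arithmetic-geometric inequality divides by both norms; enlarging them by [e] admits
   [a = 0] or [b = 0]. *)
have key (e : R) : 0 < e -> mu (fun x => `|f x * g x|) <= (a + e) * (b + e).
  move=> e0; set p := a + e; set q := b + e.
  have p0 : 0 < p by rewrite /p; lra.
  have q0 : 0 < q by rewrite /q; lra.
  have H : mu (fun x => `|f x * g x|) <=
     mu (fun x => (q / (2 * p)) * f x ^+ 2 + (p / (2 * q)) * g x ^+ 2).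
    apply: (mean_le Hmu) => x; rewrite normrM.
    rewrite -[f x ^+ 2]real_normK ?num_real// -[g x ^+ 2]real_normK ?num_real//.
    rewrite -subr_ge0.
    have -> : q / (2 * p) * `|f x| ^+ 2 + p / (2 * q) * `|g x| ^+ 2 - `|f x| * `|g x| =
       (2 * p * q)^-1 * (q * `|f x| - p * `|g x|) ^+ 2.
      field; by rewrite !gt_eqF.
    by rewrite mulr_ge0 ?sqr_ge0// invr_ge0 !mulr_ge0// ltW.
  apply: (le_trans H); rewrite (mean_lin Hmu) meanZ.
  have h1 : q / (2 * p) * mu (fun x => f x ^+ 2) <= q / (2 * p) * p ^+ 2.
    apply: ler_wpM2l; first by rewrite divr_ge0 ?mulr_ge0// ltW.
    by apply: (le_trans fa); rewrite ler_pXn2r// ?nnegrE /p; lra.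
  have h2 : p / (2 * q) * mu (fun x => g x ^+ 2) <= p / (2 * q) * q ^+ 2.
    apply: ler_wpM2l; first by rewrite divr_ge0 ?mulr_ge0// ltW.
    by apply: (le_trans gb); rewrite ler_pXn2r// ?nnegrE /q; lra.
  apply: (le_trans (lerD h1 h2)); rewrite le_eqVlt; apply/orP; left; apply/eqP.
  by field; rewrite !gt_eqF.
apply/ler_addgt0Pr => e e0.
(* Since [d <= 1], the excess [d * (a + b) + d ^+ 2] is at most [d * (a + b + 1)], hence at most
   [e]. *)
pose d := Num.min 1 (e / (a + b + 1)).
have ab : 0 < a + b + 1 by lra.
have d0 : 0 < d by rewrite lt_min ltr01 divr_gt0.
apply: (le_trans (key d d0)).
have d1 : d <= 1 by rewrite ge_min lexx.
have d2 : d * (a + b + 1) <= e by rewrite -ler_pdivlMr// ge_min lexx orbT.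
nra.
Qed.

Lemma mean_minkowski f g (a b : R) : 0 <= a -> 0 <= b ->
  mu (fun x => f x ^+ 2) <= a ^+ 2 -> mu (fun x => g x ^+ 2) <= b ^+ 2 ->
  mu (fun x => (f x + g x) ^+ 2) <= (a + b) ^+ 2.
Proof.
move=> a0 b0 fa gb; have H := mean_CS a0 b0 fa gb.
have : mu (fun x => (f x + g x) ^+ 2) <=
  mu (fun x => (f x ^+ 2 + g x ^+ 2) + 2 * `|f x * g x|).
  by apply: (mean_le Hmu) => x; have := ler_norm (f x * g x); nra.
by rewrite !meanD meanZ; nra.
Qed.

Lemma mean_minkowski_sum n (F : nat -> A -> R) (a : nat -> R) :
  (forall i, (i < n)%N -> 0 <= a i) ->
  (forall i, (i < n)%N -> mu (fun x => F i x ^+ 2) <= a i ^+ 2) ->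
  mu (fun x => (\sum_(i < n) F i x) ^+ 2) <= (\sum_(i < n) a i) ^+ 2.
Proof.
elim: n => [|n IH] a0 Fa.
  rewrite big_ord0 expr0n/= (eq_mean (g := fun=> 0)) ?(mean_cst Hmu)// => x.
  by rewrite big_ord0 expr0n.
rewrite big_ord_recr/=.
rewrite (eq_mean (g := fun x => (\sum_(i < n) F i x + F n x) ^+ 2)); last first.
  by move=> x; rewrite big_ord_recr.
apply: mean_minkowski; rewrite ?a0 ?Fa//.
- by apply: sumr_ge0 => i _; rewrite a0// ltnS ltnW.
- by apply: IH => i ni; rewrite ?a0 ?Fa// ltnS ltnW.
Qed.

End theory.
End Mean.

(** * Doob's maximal inequality in L2 *)

Section Doob.
Context {R : realType} {W : Type} (E : (W -> R) -> R).
Hypothesis HE : is_mean E.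
Variables (n : nat) (d : nat -> W -> R).

(** No filtration is named: each increment is orthogonal to every function of the earlier
    increments, which is all that the maximal inequality tests against. *)
Definition mart_diff := forall i, (i < n)%N -> forall z : (nat -> R) -> R,
  (forall x y, (forall k, (k < i)%N -> x k = y k) -> z x = z y) ->
  E (fun w => z (fun k => d k w) * d i w) = 0.

Hypothesis MD : mart_diff.

Let N (x : nat -> R) l : R := \sum_(i < l) x i.
Fixpoint runmax (x : nat -> R) l : R :=
  if l is l'.+1 then Num.max (runmax x l') `|\sum_(i < l) x i| else 0.
Let s := runmax.

Lemma le_runmax (x : nat -> R) l k : (k <= l)%N -> `|\sum_(i < k) x i| <= runmax x l.
Proof.
elim: l k => [|l IH] k.
  by rewrite leqn0 => /eqP ->; rewrite big_ord0 normr0.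
rewrite leq_eqVlt => /orP[/eqP ->|].
  by rewrite /= le_max lexx orbT.
by rewrite ltnS => /IH H; rewrite /= le_max H.
Qed.

Lemma eq_runmax x y l : (forall k, (k < l)%N -> x k = y k) -> runmax x l = runmax y l.
Proof.
elim: l => //= l IH H; rewrite IH; last by move=> k kl; apply: H; rewrite ltnS ltnW.
by congr (Num.max _ `|_|); apply: eq_bigr => i _; exact: H.
Qed.

Lemma runmax_ge0 x l : 0 <= runmax x l.
Proof. by have := @le_runmax x l 0%N isT; rewrite big_ord0 normr0. Qed.

(** A pathwise form of Doob's inequality. The subtracted sum is a martingale transform whose
    coefficients depend on the past only, so it disappears on averaging. In the induction [Num.sg]
    serves as a subgradient of the absolute value, and the running maximum changes only when it
    equals the new absolute partial sum. *)
Lemma doob_pointwise (x : nat -> R) l :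
  0 <= 2 * s x l * `|N x l| - s x l ^+ 2
       - 2 * \sum_(i < l) s x i * (Num.sg (N x i) * x i).
Proof.
elim: l => [|l IH].
  by rewrite /N !big_ord0 /s/=; lra.
rewrite [X in _ - 2 * X]big_ord_recr/=.
have HN : N x l.+1 = N x l + x l by rewrite /N big_ord_recr.
have H2 : Num.sg (N x l) * x l <= `|N x l.+1| - `|N x l|.
  rewrite HN -[N x l in X in _ <= _ - `|X|]mulr1.
  have [->|N0] := eqVneq (N x l) 0; first by rewrite sgr0 mul0r add0r mul0r normr0 subr0.
  rewrite mulr1 [X in _ <= _ - X]normrEsg.
  have : Num.sg (N x l) * (N x l + x l) <= `|N x l + x l|.
    by apply: (le_trans (ler_norm _)); rewrite normrM normr_sg N0 mul1r.
  by lra.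
have s0 := runmax_ge0 x l; have le := @le_runmax x l.+1 l.+1 (leqnn _).
move: IH; rewrite -/s -/(N x l.+1) in s0 le *.
set S := \sum_(i < l) _.
have H3 := ler_wpM2l s0 H2.
by have [h|h] := leP (s x l) `|N x l.+1|; nra.
Qed.

Lemma mart_diff_sqr l : (l <= n)%N ->
  E (fun w => (\sum_(i < l) d i w) ^+ 2) = \sum_(i < l) E (fun w => d i w ^+ 2).
Proof.
elim: l => [|l IH] ln.
  rewrite big_ord0 (eq_mean E (g := fun=> 0)) ?(mean_cst HE)// => w.
  by rewrite big_ord0 expr0n.
rewrite big_ord_recr/= -IH; last exact: ltnW.
rewrite (eq_mean E (g := fun w => (\sum_(i < l) d i w) ^+ 2 + d l w ^+ 2 +
   2 * ((\sum_(i < l) d i w) * d l w))); last first.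
  by move=> w; rewrite big_ord_recr/=; ring.
rewrite !(meanD HE) (meanZ HE) (MD ln (z := fun x => \sum_(i < l) x i)) ?mulr0 ?addr0//.
by move=> x y H; apply: eq_bigr => i _; apply: H.
Qed.

Lemma doob_L2 : E (fun w => runmax (fun i => d i w) n ^+ 2) <=
  4 * \sum_(i < n) E (fun w => d i w ^+ 2).
Proof.
pose B w := \sum_(i < n) s (fun i => d i w) i * (Num.sg (N (fun i => d i w) i) * d i w).
have EB : E B = 0.
  rewrite /B (mean_sum HE (index_enum 'I_n) xpredT (fun (i : 'I_n) w =>
    s (fun i => d i w) i * (Num.sg (N (fun i => d i w) i) * d i w))).
  rewrite big1// => i _.
  rewrite (eq_mean E (g := fun w => (s (fun i => d i w) i * Num.sg (N (fun i => d i w) i)) * d i w)).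
    apply: (MD (ltn_ord i) (z := fun x => s x i * Num.sg (N x i))) => x y H.
    congr (_ * Num.sg _); first exact: eq_runmax.
    by apply: eq_bigr => k _; exact: H.
  by move=> w; rewrite mulrA.
rewrite -mart_diff_sqr//.
apply: (@le_trans _ _ (E (fun w => 4 * (\sum_(i < n) d i w) ^+ 2 + (- 4) * B w))).
  apply: (mean_le HE) => w; have := doob_pointwise (fun i => d i w) n.
  rewrite -/(B w) -/(s (fun i => d i w) n) -/(N (fun i => d i w) n).
  set a := s _ n; set b := N _ n => H.
  (* The square absorbs the cross term [2 * a * |b|] into [a ^+ 2 / 2 + 2 * b ^+ 2]; doubling what
     remains produces the constant 4. *)
  by have := sqr_ge0 (a - 2 * `|b|); rewrite -[b ^+ 2]real_normK ?num_real//; nra.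
by rewrite (meanD HE) !(meanZ HE) EB mulr0 addr0.
Qed.

End Doob.

Definition dep_on {A B : Type} (I : pred nat) (F : (nat -> A) -> B) :=
  forall w w', (forall k, I k -> w k = w' k) -> F w = F w'.

Definition upd {A : Type} (w : nat -> A) i a := fun k => if k == i then a else w k.

Section Coord.
Context {R : realType} {A : Type}.
Variable mu : nat -> (A -> R) -> R.
Implicit Types (F G Z : (nat -> A) -> R) (w : nat -> A).

Definition avg i F w := mu i (fun a => F (upd w i a)).

(** This is the conditional expectation given the coordinates from [s] on. Coordinates will be
    ordered in time, so the remote past is integrated out first and the conditioning shrinks as [s]
    grows: the filtration runs backwards. *)
Fixpoint avgs s F := if s is s'.+1 then avg s' (avgs s' F) else F.

(** A reversed martingale difference: the part of [F] that letter [c] contributes once all later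
    letters are known. *)
Definition mdiff c F w := avgs c F w - avgs c.+1 F w.

Hypothesis Hmu : forall i, is_mean (mu i).

Lemma avgs_local s F G w :
  (forall w', (forall k, (s <= k)%N -> w' k = w k) -> F w' = G w') ->
  avgs s F w = avgs s G w.
Proof.
elim: s w => [|s IH] w H; first exact: H.
rewrite /= /avg; apply: eq_mean => a; apply: IH => w' Hw'; apply: H => k sk.
by rewrite Hw' /upd ?gtn_eqF// ltnW.
Qed.

Lemma avgs_mean s w : is_mean (fun F => avgs s F w).
Proof.
elim: s w => [|s IH] w; first by split.
split => /=.
- move=> a f g; rewrite /avg -(mean_lin (Hmu s)); apply: eq_mean => x.
  exact: (mean_lin (IH _)).
- by move=> f g fg; apply: (mean_le (Hmu s)) => x; apply: (mean_le (IH _)).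
- move=> c; rewrite /avg -[RHS](mean_cst (Hmu s)); apply: eq_mean => x.
  exact: (mean_cst (IH _)).
Qed.

Lemma dep_avgs I s F : dep_on I F -> dep_on (fun k => I k && (s <= k)%N) (avgs s F).
Proof.
move=> dF; elim: s => [|s IH] w w' H.
  by apply: dF => k Ik; apply: H; rewrite Ik.
rewrite /= /avg; apply: eq_mean => a; apply: IH => k /andP[Ik sk].
rewrite /upd; case: eqP => // /eqP ks; apply: H.
by rewrite Ik ltn_neqAle eq_sym ks.
Qed.

Lemma avgs_ge s F w : (forall w', (forall k, (s <= k)%N -> w' k = w k) -> F w' = F w) ->
  avgs s F w = F w.
Proof.
by move=> H; rewrite (avgs_local (G := fun=> F w))// (mean_cst (avgs_mean s w)).
Qed.

Lemma avgs_id s F : avgs s (avgs s F) = avgs s F.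
Proof.
apply/funext => w; apply: avgs_ge => w' H.
have dF : dep_on xpredT F by move=> x y xy; congr F; apply/funext => k; apply: xy.
by apply: (dep_avgs (s := s) dF) => k /=; exact: H.
Qed.

Lemma avgs_avgs s M F : (s <= M)%N -> avgs M (avgs s F) = avgs M F.
Proof.
elim: M => [|M IH]; first by rewrite leqn0 => /eqP ->.
rewrite leq_eqVlt => /orP[/eqP ->|]; first exact: avgs_id.
by rewrite ltnS /= => /IH ->.
Qed.

Lemma avgs_avgs_le s M F : (s <= M)%N -> avgs s (avgs M F) = avgs M F.
Proof.
move=> sM; apply/funext => w; apply: avgs_ge => w' H.
have dF : dep_on xpredT F by move=> x y xy; congr F; apply/funext => k; apply: xy.
by apply: (dep_avgs (s := M) dF) => k /= Mk; apply: H; exact: leq_trans Mk.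
Qed.

Lemma avgs_mul s Z F w : dep_on (leq s) Z ->
  avgs s (fun w => Z w * F w) w = Z w * avgs s F w.
Proof.
move=> dZ; rewrite -(meanZ (avgs_mean s w)); apply: avgs_local => w' H.
by congr (_ * _); apply: dZ.
Qed.

Lemma dep_mdiff I c F : dep_on I F -> dep_on (fun k => I k && (c <= k)%N) (mdiff c F).
Proof.
move=> dF w w' H; congr (_ - _); first exact: dep_avgs dF _ _ H.
apply: (dep_avgs (s := c.+1) dF) => k /andP[Ik ck]; apply: H.
by rewrite Ik ltnW.
Qed.

Lemma mdiff_orth M c Z F w : (c < M)%N -> dep_on (leq c.+1) Z ->
  avgs M (fun w => Z w * mdiff c F w) w = 0.
Proof.
move=> cM dZ; rewrite -(avgs_avgs _ cM) (_ : avgs c.+1 _ = fun=> 0).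
  exact: (mean_cst (avgs_mean M w)).
apply/funext => w'; rewrite avgs_mul// (meanB (avgs_mean c.+1 w')).
by rewrite (avgs_avgs F (leqnSn c)) avgs_id subrr mulr0.
Qed.

Lemma sum_mdiff s F w : \sum_(c < s) mdiff c F w = F w - avgs s F w.
Proof.
rewrite -(big_mkord xpredT (fun c => mdiff c F w)).
have := @telescope_sumr R 0 s (fun c => - avgs c F w) isT.
rewrite opprK addrC => <-; apply: eq_bigr => i _.
by rewrite opprK addrC.
Qed.

Lemma avgs_sqr s M F w : (s <= M)%N ->
  avgs M (fun w => avgs s F w ^+ 2) w <= avgs M (fun w => F w ^+ 2) w.
Proof.
move=> sM; rewrite -(avgs_avgs (fun w => F w ^+ 2) sM).
apply: (mean_le (avgs_mean M w)) => w'; exact: (mean_sqr (avgs_mean s w')).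
Qed.

(** Jensen's inequality for the convex function that squares the excess of the absolute value over
    [c]. Uniform integrability is measured with this function, rather than with a truncated second
    moment, exactly so that it survives conditioning. *)
Lemma avgs_ui s M F w c : (s <= M)%N -> 
  avgs M (fun w => Num.max 0 (`|avgs s F w| - c) ^+ 2) w <=
  avgs M (fun w => Num.max 0 (`|F w| - c) ^+ 2) w.
Proof.
move=> sM; rewrite -(avgs_avgs (fun w => Num.max 0 (`|F w| - c) ^+ 2) sM).
apply: (mean_le (avgs_mean M w)) => w'.
apply: le_trans (mean_sqr (avgs_mean s w') _).
rewrite ler_pXn2r// ?nnegrE ?le_max ?lexx//; last first.
  by apply: (mean_ge0 (avgs_mean s w')) => x; rewrite le_max lexx.
rewrite ge_max; apply/andP; split.
  by apply: (mean_ge0 (avgs_mean s w')) => x; rewrite le_max lexx.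
apply: (@le_trans _ _ (avgs s (fun x => `|F x| - c) w')).
  by rewrite (meanB (avgs_mean s w')) (mean_cst (avgs_mean s w')) lerD2r (mean_norm (avgs_mean s w')).
by apply: (mean_le (avgs_mean s w')) => x; rewrite le_max lexx orbT.
Qed.

Lemma avgs_upd s F w i a : (s <= i)%N ->
  avgs s F (upd w i a) = avgs s (fun w => F (upd w i a)) w.
Proof.
elim: s w => // s IH w si; rewrite /= /avg; apply: eq_mean => b.
rewrite -IH ?(ltnW si)//; congr (avgs _ _ _); apply/funext => k.
rewrite /upd; case: eqP => [->|//]; by rewrite ltn_eqF.
Qed.

Lemma avgs_const s M F w w' : (s <= M)%N -> dep_on (fun k => (k < s)%N) F ->
  avgs M F w = avgs s F w'.
Proof.
move=> sM dF; rewrite -(avgs_avgs _ sM) (_ : avgs s F = fun=> avgs s F w').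
  exact: (mean_cst (avgs_mean M w)).
apply/funext => v; apply: (dep_avgs dF) => k /andP[k1 k2].
by move: k1; rewrite ltnNge k2.
Qed.

End Coord.

Section Blocks.
Context {R : realType} {A B : Type}.
Variable mu : nat -> (A -> R) -> R.
Hypothesis Hmu : forall i, is_mean (mu i).
Variables (c : nat -> nat) (zeta : nat -> (nat -> A) -> B) (w0 : nat -> A).
Hypothesis c_mono : forall i, (c i <= c i.+1)%N.
Hypothesis dep_zeta : forall i, dep_on (fun k => (c i <= k < c i.+1)%N) (zeta i).

Definition block_law i (phi : B -> R) := avgs mu (c i.+1) (fun w => phi (zeta i w)) w0.

Lemma block_law_mean i : is_mean (block_law i).
Proof.
have H := avgs_mean Hmu (c i.+1) w0; split => *.
- exact: (mean_lin H).
- exact: (mean_le H).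
- exact: (mean_cst H).
Qed.

Lemma block_lawE i phi w : avgs mu (c i.+1) (fun w => phi (zeta i w)) w = block_law i phi.
Proof.
have D : dep_on (fun k => (c i <= k < c i.+1)%N) (fun w => phi (zeta i w)).
  by move=> x y xy; congr phi; exact: dep_zeta.
apply: (dep_avgs mu (s := c i.+1) D) => k /andP[/andP[_ k1] k2].
by move: k1; rewrite ltnNge k2.
Qed.

(** Functions of disjoint runs of letters behave as independent variables with laws [block_law]. By
    induction on the number of runs: the letters of the last run are integrated last, and the
    earlier runs do not see them. *)
Lemma avgs_blocks m F w :
  avgs mu (c m) (fun w => F (fun i => zeta i w)) w = avgs block_law m F (fun i => zeta i w).
Proof.
have cm : {homo c : i j / (i <= j)%N >-> (i <= j)%N}.
  by apply: homo_leq => // ? ? ?; exact: leq_trans.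
have dF : dep_on xpredT F by move=> x y xy; congr F; apply/funext => k; apply: xy.
elim: m w => [|m IH] w.
  apply: (avgs_ge Hmu) => w' H; congr F; apply/funext => i; apply: dep_zeta => k /andP[k0 _].
  by apply: H; apply: leq_trans k0; exact: cm.
rewrite -(avgs_avgs Hmu _ (c_mono m)).
rewrite (_ : avgs mu (c m) _ = fun w => avgs block_law m F (zeta^~ w)); last exact/funext.
rewrite /= /avg -[RHS](block_lawE m (fun a => avgs block_law m F (upd (zeta^~ w) m a)) w).
apply: avgs_local => w' H; apply: (dep_avgs block_law dF) => k /= mk.
rewrite /upd; case: eqP => [->//|/eqP km]; apply: dep_zeta => j /andP[j0 _].
by apply: H; apply: leq_trans j0; apply: cm; rewrite ltn_neqAle eq_sym km.
Qed.

End Blocks.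

Lemma sum_arith_geom {R : realType} (r : R) n : 0 < r < 1 ->
  \sum_(j < n) j%:R * r ^+ j <= (1 - r)^-1 ^+ 2.
Proof.
move=> r01.
have H : (1 - r) ^+ 2 * (\sum_(j < n) j%:R * r ^+ j) =
    r - n%:R * r ^+ n * (1 - r) - r ^+ n.+1.
  elim: n => [|n IH]; first by rewrite big_ord0 expr1; ring.
  by rewrite big_ord_recr/= mulrDr IH !exprS -natr1; ring.
have rp : 0 < (1 - r) ^+ 2 by rewrite exprn_gt0//; lra.
rewrite exprVn -[leRHS]mulr1 ler_pdivlMl// H.
have h1 : 0 <= n%:R * r ^+ n * (1 - r).
  by rewrite !mulr_ge0 ?ler0n ?exprn_ge0//; lra.
have h2 : 0 <= r ^+ n.+1 by rewrite exprn_ge0//; lra.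
lra.
Qed.

Lemma sum_geom_le {R : realType} (r : R) n : 0 < r < 1 ->
  \sum_(j < n) r ^+ j <= (1 - r)^-1.
Proof.
move=> r01.
have H : (1 - r) * (\sum_(j < n) r ^+ j) = 1 - r ^+ n.
  elim: n => [|n IH]; first by rewrite big_ord0 expr0; ring.
  by rewrite big_ord_recr/= mulrDr IH !exprS; ring.
have rp : 0 < 1 - r by lra.
rewrite -[leRHS]mulr1 ler_pdivlMl// H.
have h2 : 0 <= r ^+ n by rewrite exprn_ge0//; lra.
lra.
Qed.

Lemma count_block_le (n b j : nat) : (0 < b)%N ->
  (\sum_(i < n) (i %% b < j) <= j * (n %/ b).+1)%N.
Proof.
move=> b0.
have H q : (\sum_(i < q * b) (i %% b < j) <= j * q)%N.
  elim: q => [|q IH]; first by rewrite mul0n big_ord0.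
  rewrite mulSn addnC big_split_ord/= mulnS addnC leq_add//.
  apply: (@leq_trans (\sum_(i < b) (i < j))%N).
    by apply: leq_sum => i _; rewrite modnMDl modn_small.
  rewrite -(big_mkord xpredT (fun i => nat_of_bool (i < j)%N)).
  elim: b {IH b0} => [|b IHb]; first by rewrite big_geq.
  rewrite big_nat_recr//=; have [bj|bj] := ltnP b j.
    rewrite addn1; apply: leq_trans bj; rewrite ltnS.
    apply: (@leq_trans (\sum_(0 <= i < b) 1)%N); first by apply: leq_sum => i _; case: ltnP.
    by rewrite sum_nat_const_nat subn0 muln1.
  by rewrite addn0.
apply: leq_trans (H _).
have nb : (n <= (n %/ b).+1 * b)%N by rewrite ltnW// ltn_ceil.
rewrite -(big_mkord xpredT (fun i => nat_of_bool (i %% b < j)%N)).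
rewrite -(big_mkord xpredT (fun i => nat_of_bool (i %% b < j)%N)).
by rewrite (big_cat_nat (n := n) (p := (n %/ b).+1 * b))//= leq_addr.
Qed.

Lemma count_quot_le (n b q : nat) : (0 < b)%N ->
  (\sum_(i < n) ((i %/ b)%N == q) <= b)%N.
Proof.
move=> b0; pose N := maxn n (q.+1 * b).
apply: (@leq_trans (\sum_(i < N) ((i %/ b)%N == q))%N).
  rewrite -(big_mkord xpredT (fun i => nat_of_bool ((i %/ b)%N == q))).
  rewrite -(big_mkord xpredT (fun i => nat_of_bool ((i %/ b)%N == q))).
  by rewrite (big_cat_nat (n := n) (p := N))//= ?leq_addr// leq_maxl.
rewrite -(big_mkord xpredT (fun i => nat_of_bool ((i %/ b)%N == q))).
rewrite (big_cat_nat (n := q * b))//=; last by rewrite leq_max leq_mul2r leqnSn !orbT.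
rewrite big_nat big1 ?add0n; last first.
  by move=> i /andP[_ ib]; rewrite eqn_leq [(q <= _)%N]leqNgt ltn_divLR// ib andbF.
rewrite (big_cat_nat (n := q.+1 * b))//=; [|by rewrite leq_mul2r leqnSn orbT|by rewrite leq_maxr].
rewrite [X in (_ + X)%N]big_nat [X in (_ + X)%N]big1 ?addn0; last first.
  by move=> i /andP[ib _]; rewrite eqn_leq [(_ <= q)%N]leqNgt leq_divRL// ib.
apply: (@leq_trans (\sum_(q * b <= i < q.+1 * b) 1)%N).
  by apply: leq_sum => i _; case: eqP.
by rewrite sum_nat_const_nat muln1 mulSn addnK.
Qed.

(** * Approximation of a weakly dependent sequence by independent blocks *)

Section BlockApprox.
Context {R : realType} {A : Type}.
Variable mu : nat -> (A -> R) -> R.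
Hypothesis Hmu : forall i, is_mean (mu i).
Variables (n K M b : nat) (X : nat -> (nat -> A) -> R) (w0 : nat -> A) (C rho : R).
Hypotheses (b0 : (0 < b)%N) (nKM : (n + K <= M)%N) (C0 : 0 <= C) (rho01 : 0 < rho < 1).
Hypothesis depX : forall i, dep_on (fun k => (k < (i + K).+1)%N) (X i).
Hypothesis cX : forall i w, avgs mu (i + K).+1 (X i) w = 0.
Let E F := avgs mu M F w0.
Hypothesis hD : forall i c, (i < n)%N -> (c <= i + K)%N ->
  E (fun w => mdiff mu c (X i) w ^+ 2) <= (C * rho ^+ (i + K - c)) ^+ 2.

Let HE : is_mean E := avgs_mean Hmu M w0.

(** The newest letter of [X i] sits at position [i + K], so the block containing index [i] owns the
    letters from here on. Averaging out everything before this position makes the variables of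
    different blocks depend on disjoint letters. *)
Definition bstart i := (K + (i %/ b) * b)%N.
Definition Xb i := avgs mu (bstart i) (X i).
Definition xi k w := \sum_(i < n | (i %/ b)%N == k) Xb i w.

Lemma dep_Xb i : dep_on (fun k => (bstart i <= k < (i + K).+1)%N) (Xb i).
Proof.
move=> w w' H; apply: (dep_avgs mu (@depX i)) => k /andP[k1 k2].
by apply: H; rewrite k1 k2.
Qed.

Lemma dep_xi k : dep_on (fun j => (K + k * b <= j < K + k.+1 * b)%N) (xi k).
Proof.
move=> w w' H; apply: eq_bigr => i /eqP ik; apply: dep_Xb => j.
rewrite /bstart ik => /andP[h1 h2]; apply: H; rewrite h1 (leq_trans h2)//.
rewrite addnC ltn_add2l -ik; exact: ltn_ceil.
Qed.

(** The lag-[j] increment of [X i] is lost by the averaging exactly when its letter [i + K - j]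
    precedes the block start, that is, when [i %% b < j]. *)
Let d j i : (nat -> A) -> R :=
  if (i %% b < j <= i + K)%N then mdiff mu (i + K - j) (X i) else fun=> 0.

Lemma sum_diff_Xb i w : (i < n)%N ->
  X i w - Xb i w = \sum_(j < M) d j i w.
Proof.
move=> ni; rewrite -(big_mkord xpredT (fun j => d j i w)).
have iM : (i + K < M)%N by apply: leq_trans nKM; rewrite ltn_add2r.
have im : (i %% b < (i + K).+1)%N by rewrite ltnS (leq_trans (leq_mod _ _))// leq_addr.
rewrite (big_cat_nat (n := (i %% b).+1))//=; last exact: leq_trans iM.
rewrite big_nat big1 ?add0r; last first.
  by move=> j /andP[_ jb]; rewrite /d ltnNge -ltnS jb.
rewrite (big_cat_nat (n := (i + K).+1))//=.
rewrite [X in _ = _ + X]big_nat [X in _ = _ + X]big1 ?addr0; last first.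
  by move=> j /andP[jb _]; rewrite /d [(j <= _)%N]leqNgt jb andbF.
pose u j := avgs mu ((i + K).+1 - j) (X i) w.
rewrite (eq_big_nat _ _ (F2 := fun j => u j.+1 - u j)); last first.
  move=> j /andP[j1 j2]; rewrite /d j1 -ltnS j2/= /mdiff /u subSS subSn//.
rewrite telescope_sumr// /u subnn/= /Xb; congr (_ - avgs mu _ _ _).
by rewrite subSS /bstart; have := divn_eq i b; lia.
Qed.

(** The index is reversed because the increments are orthogonal to functions of later letters: at a
    fixed lag they form martingale differences only when read from the last index to the first. *)
Let e j k := d j (n - k.+1).

Lemma block_mart_diff j : mart_diff E n (e j).
Proof.
move=> k kn z zP; rewrite /e; set i := (n - k.+1)%N.
have ni : (i < n)%N by rewrite /i ltn_subrL /= (leq_ltn_trans _ kn).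
rewrite {2}/d; case: ifP => [/andP[h1 h2]|_]; last first.
  by rewrite (eq_mean E (g := fun=> 0)) ?(mean_cst HE)// => w; rewrite mulr0.
rewrite (eq_mean E (g := fun w => z (fun k' => if (k' < k)%N then e j k' w else 0) *
   mdiff mu (i + K - j) (X i) w)); last first.
  by move=> w; congr (_ * _); apply: zP => k' ->.
apply: mdiff_orth => //; first by rewrite (leq_trans _ nKM)//; lia.
move=> w w' H; congr z; apply/funext => k'; case: ifP => // kk.
rewrite /e /d; case: ifP => // /andP[_ h3].
apply: (dep_mdiff mu (@depX _)) => l /andP[_ l1]; apply: H.
apply: leq_trans l1; lia.
Qed.

(** At lag [j] at most [j] indices in each period of length [b] contribute; this count is where the
    gain of a factor [b] over the trivial bound [n] comes from. *)
Lemma block_d_sqr j : (j < M)%N ->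
  \sum_(k < n) E (fun w => e j k w ^+ 2) <=
  (j * (n %/ b).+1)%:R * (C * rho ^+ j) ^+ 2.
Proof.
move=> jM.
apply: (@le_trans _ _ (\sum_(i < n) (i %% b < j)%N%:R * (C * rho ^+ j) ^+ 2)).
  rewrite (reindex_inj rev_ord_inj)/=; apply: ler_sum => i _.
  rewrite /e /d; have -> : (n - (n - i.+1).+1)%N = i by have := ltn_ord i; lia.
  case: ifP => [/andP[h1 h2]|_].
    rewrite h1 mul1r; have := @hD i (i + K - j) (ltn_ord i) (leq_subr _ _).
    by rewrite subKn.
  rewrite (eq_mean E (g := fun=> 0)); last by move=> w; rewrite expr0n.
  by rewrite (mean_cst HE) mulr_ge0// sqr_ge0.
rewrite -mulr_suml ler_wpM2r ?sqr_ge0// -natr_sum ler_nat.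
exact: count_block_le.
Qed.

(** A single random variable dominating the replacement error at every endpoint. The factor 2
    appears because an initial segment in natural order is the difference of two initial segments in
    reversed order. *)
Definition dev w := \sum_(j < M) 2 * runmax (fun k => e j k w) n.

Lemma dev_ge l w : (l <= n)%N -> `|\sum_(i < l) (X i w - Xb i w)| <= dev w.
Proof.
move=> ln.
rewrite (eq_bigr (fun i : 'I_l => \sum_(j < M) d j i w)); last first.
  by move=> i _; apply: sum_diff_Xb; apply: leq_trans ln.
rewrite exchange_big/=; apply: (le_trans (ler_norm_sum _ _ _)).
apply: ler_sum => j _.
have -> : \sum_(i < l) d j i w = \sum_(k < n) e j k w - \sum_(k < n - l) e j k w.
  rewrite -(big_mkord xpredT (fun i => d j i w)).
  rewrite -[X in X - _](big_mkord xpredT (fun i => e j i w)).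
  rewrite -[X in _ - X](big_mkord xpredT (fun i => e j i w)).
  rewrite [X in _ = X - _](big_cat_nat (n := (n - l)))//= ?leq_subr// addrAC subrr add0r.
  rewrite [LHS]big_nat_rev/= add0n -{1}[(n - l)%N]add0n big_addn subKn//.
  by apply: eq_big_nat => k /andP[_ kl]; rewrite /e; congr (d j _ w); lia.
rewrite (le_trans (ler_normB _ _))// mulrDl mul1r lerD//; apply: le_runmax => //.
exact: leq_subr.
Qed.

Lemma dev_sqr : E (fun w => dev w ^+ 2) <=
  (4 * C * Num.sqrt (n %/ b).+1%:R * (1 - rho)^-1 ^+ 2) ^+ 2.
Proof.
have r0 : 0 <= rho by case/andP: rho01 => /ltW.
set s : R := Num.sqrt _.
have s0 : 0 <= s by exact: sqrtr_ge0.
have ss : s ^+ 2 = (n %/ b).+1%:R by rewrite sqr_sqrtr.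
apply: (@le_trans _ _ ((\sum_(j < M) 4 * C * s * (j%:R * rho ^+ j)) ^+ 2)).
  apply: (mean_minkowski_sum HE (F := fun j w => 2 * runmax (fun k => e j k w) n)
    (a := fun j => 4 * C * s * (j%:R * rho ^+ j))).
    by move=> j _; rewrite mulr_ge0 ?mulr_ge0 ?exprn_ge0.
  move=> j jM; rewrite (eq_mean E (g := fun w => 4 * runmax (fun k => e j k w) n ^+ 2)); last first.
    by move=> w; rewrite exprMn -natrX.
  rewrite (meanZ HE).
  have := doob_L2 HE (@block_mart_diff j); have := block_d_sqr jM.
  set S := \sum_(k < n) _; set U := E _ => h1 h2.
  have -> : (4 * C * s * (j%:R * rho ^+ j)) ^+ 2 =
    16 * (j%:R * (j%:R * s ^+ 2 * (C * rho ^+ j) ^+ 2)) by ring.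
  rewrite ss -natrM.
  (* Weakening [j] to its square makes the root linear in [j], so that the norms add up to the
     closed form of [sum_arith_geom]. *)
  have h3 : (j * (n %/ b).+1)%:R * (C * rho ^+ j) ^+ 2 <=
     j%:R * ((j * (n %/ b).+1)%:R * (C * rho ^+ j) ^+ 2).
    case: j {jM S U h1 h2} => [|j]; first by rewrite mul0n !mul0r.
    by apply: ler_peMl; rewrite ?ler1n// mulr_ge0 ?sqr_ge0.
  move: h3; set z := _ * (_ ^+ 2) in h1 *; lra.
rewrite -mulr_sumr ler_pXn2r// ?nnegrE.
- by rewrite ler_wpM2l ?mulr_ge0// sum_arith_geom.
- rewrite mulr_ge0 ?mulr_ge0// sumr_ge0// => i _.
  by rewrite mulr_ge0 ?exprn_ge0 ?ler0n//; lra.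
- by apply: mulr_ge0; [rewrite !mulr_ge0 | exact: sqr_ge0].
Qed.

Lemma Xb_xi l w : (l <= n)%N ->
  \sum_(i < l) Xb i w - \sum_(k < l %/ b) xi k w =
  \sum_(i < n | (i < l)%N && ((i %/ b)%N == (l %/ b)%N)) Xb i w.
Proof.
move=> ln.
have -> : \sum_(k < l %/ b) xi k w = \sum_(i < n | (i %/ b < l %/ b)%N) Xb i w.
  rewrite /xi (exchange_big_dep (fun i : 'I_n => (i %/ b < l %/ b)%N))/=; last first.
    by move=> k i _ /eqP ->.
  apply: eq_bigr => i il; rewrite (big_pred1 (Ordinal il))// => k.
rewrite (big_ord_widen _ (fun i => Xb i w) ln).
rewrite (bigID (fun i : 'I_n => (i %/ b < l %/ b)%N))/=.
rewrite [X in X + _ - _](eq_bigl (fun i : 'I_n => (i %/ b < l %/ b)%N)); last first.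
  move=> i; apply/andb_idl; rewrite (ltn_divLR _ _ b0) => h.
  by apply: leq_trans h _; exact: leq_trunc_div.
rewrite addrAC subrr add0r; apply: eq_bigl => i.
have [il|//] := ltnP i l; rewrite /= -leqNgt eqn_leq.
by rewrite (leq_div2r b (ltnW il)).
Qed.

Variables (V0 c delta : R).
Hypotheses (V00 : 0 <= V0) (c0 : 0 <= c).
Hypothesis hX2 : forall i, (i < n)%N -> E (fun w => X i w ^+ 2) <= V0 ^+ 2.
Hypothesis hUI : forall i, (i < n)%N ->
  E (fun w => Num.max 0 (`|X i w| - c) ^+ 2) <= delta.

Let bstart_le i : (i < n)%N -> (bstart i <= M)%N.
Proof.
move=> ni; apply: leq_trans nKM; rewrite /bstart addnC leq_add2r.
by rewrite ltnW// (leq_ltn_trans (leq_trunc_div _ _)).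
Qed.

Lemma Xb_sqr i : (i < n)%N -> E (fun w => Xb i w ^+ 2) <= V0 ^+ 2.
Proof. by move=> ni; apply: le_trans (hX2 ni); exact: avgs_sqr (bstart_le ni). Qed.

Lemma Xb_ui i : (i < n)%N -> E (fun w => Num.max 0 (`|Xb i w| - c) ^+ 2) <= delta.
Proof. by move=> ni; apply: le_trans (hUI ni); exact: avgs_ui (bstart_le ni). Qed.

Let quot_count (P : pred nat) q :
  \sum_(i < n) ((P i && ((i %/ b)%N == q))%:R : R) <= b%:R.
Proof.
rewrite -natr_sum ler_nat; apply: leq_trans (count_quot_le n q b0).
by apply: leq_sum => i _; case: (P i).
Qed.

Lemma block_sum_sqr (P : pred nat) q :
  E (fun w => (\sum_(i < n | P i && ((i %/ b)%N == q)) Xb i w) ^+ 2) <= (b%:R * V0) ^+ 2.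
Proof.
apply: (@le_trans _ _ ((\sum_(i < n) ((P i && ((i %/ b)%N == q))%:R * V0)) ^+ 2)).
  rewrite (eq_mean E (g := fun w => (\sum_(i < n) ((P i && ((i %/ b)%N == q))%:R * Xb i w)) ^+ 2)).
    apply: (mean_minkowski_sum HE (F := fun i w => (P i && ((i %/ b)%N == q))%:R * Xb i w)
       (a := fun i => (P i && ((i %/ b)%N == q))%:R * V0)).
      by move=> i _; rewrite mulr_ge0.
    move=> i ni; case: (P i && _); rewrite ?mul1r ?mul0r.
      rewrite (eq_mean E (g := fun w => Xb i w ^+ 2)); last by move=> w; rewrite mul1r.
      exact: Xb_sqr.
    rewrite (eq_mean E (g := fun w => 0)) ?(mean_cst HE) ?sqr_ge0//.
    by move=> w; rewrite mul0r expr0n.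
  move=> w; rewrite big_mkcond; congr (_ ^+ 2); apply: eq_bigr => i _.
  by case: ifP => _; rewrite ?mul1r ?mul0r.
have h := quot_count P q.
rewrite -mulr_suml ler_pXn2r// ?nnegrE ?mulr_ge0 ?ler0n ?sumr_ge0//.
by rewrite ler_wpM2r.
Qed.

(** A pathwise bound for an incomplete block whose right side does not depend on the block: the
    maximum over all blocks is replaced by a sum of squared excesses. Its mean is small against
    [sqrt n] for uniformly integrable squares, with no higher moment. *)
Lemma block_sum_le (P : pred nat) q (a : R) w : 0 < a ->
  `|\sum_(i < n | P i && ((i %/ b)%N == q)) Xb i w| <=
  b%:R * c + a + b%:R / a * \sum_(i < n) Num.max 0 (`|Xb i w| - c) ^+ 2.
Proof.
move=> a0; apply: (le_trans (ler_norm_sum _ _ _)).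
have bp : 0 < b%:R :> R by rewrite ltr0n.
(* The excess over [c] is split by the arithmetic-geometric inequality with the budget [a / b],
   since a block has at most [b] terms and may spend [a] in total. *)
have key (x : R) : `|x| <= c + a / b%:R + b%:R / a * Num.max 0 (`|x| - c) ^+ 2.
  set m : R := Num.max _ _.
  have m0 : 0 <= m by rewrite le_max lexx.
  have mx : `|x| - c <= m by rewrite le_max lexx orbT.
  have h : 0 <= (a * b%:R)^-1 * (a - b%:R * m) ^+ 2.
    by rewrite mulr_ge0 ?sqr_ge0// invr_ge0 mulr_ge0 ?ltW.
  have eq1 : (a * b%:R)^-1 * (a - b%:R * m) ^+ 2 = a / b%:R + b%:R / a * m ^+ 2 - 2 * m.
    by field; rewrite !gt_eqF.
  lra.
apply: (@le_trans _ _ (\sum_(i < n) (((P i && ((i %/ b)%N == q))%:R : R) * (c + a / b%:R) +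
    b%:R / a * Num.max 0 (`|Xb i w| - c) ^+ 2))).
  rewrite big_mkcond; apply: ler_sum => i _; case: ifP => _; rewrite ?mul1r ?mul0r ?add0r.
    exact: key.
  by rewrite mulr_ge0 ?sqr_ge0// divr_ge0 ?ltW.
rewrite big_split/= -mulr_suml -mulr_sumr lerD2r.
have h := quot_count P q.
have eq1 : b%:R * c + a = b%:R * (c + a / b%:R) by field; rewrite !gt_eqF.
by rewrite eq1 ler_wpM2r// addr_ge0// divr_ge0 ?ltW.
Qed.

Definition tot_dev (a : R) w :=
  dev w + (b%:R * c + a + b%:R / a * \sum_(i < n) Num.max 0 (`|Xb i w| - c) ^+ 2).

Lemma tot_dev_ge (a : R) l w : 0 < a -> (l <= n)%N ->
  `|\sum_(i < l) X i w - \sum_(k < l %/ b) xi k w| <= tot_dev a w.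
Proof.
move=> a0 ln.
rewrite (_ : _ - _ = \sum_(i < l) (X i w - Xb i w) + (\sum_(i < l) Xb i w - \sum_(k < l %/ b) xi k w)); last first.
  by rewrite sumrB; ring.
rewrite (le_trans (ler_normD _ _))// lerD ?dev_ge//.
by rewrite Xb_xi// (block_sum_le (fun i => (i < l)%N)).
Qed.

Let s : R := Num.sqrt (n %/ b).+1%:R.

Lemma tot_dev_mean (a : R) : 0 < a -> E (tot_dev a) <=
  4 * C * s * (1 - rho)^-1 ^+ 2 + (b%:R * c + a + b%:R / a * (n%:R * delta)).
Proof.
move=> a0; rewrite /tot_dev (meanD HE) lerD//.
  have h : 0 <= 4 * C * s * (1 - rho)^-1 ^+ 2.
    by apply: mulr_ge0; [rewrite !mulr_ge0// sqrtr_ge0 | exact: sqr_ge0].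
  apply: le_trans (mean_L1 HE h dev_sqr); apply: (mean_le HE) => w; exact: ler_norm.
rewrite (meanD HE) (mean_cst HE) lerD2l (meanZ HE).
apply: ler_wpM2l; first by rewrite divr_ge0// ltW.
rewrite (mean_sum HE _ xpredT (fun (i : 'I_n) w => Num.max 0 (`|Xb i w| - c) ^+ 2)).
apply: (@le_trans _ _ (\sum_(i < n) delta)); first by apply: ler_sum => i _; exact: Xb_ui.
by rewrite sumr_const card_ord mulr_natl.
Qed.

Lemma tot_sqr l : (l <= n)%N ->
  E (fun w => (\sum_(i < l) X i w - \sum_(k < l %/ b) xi k w) ^+ 2) <=
  (4 * C * s * (1 - rho)^-1 ^+ 2 + b%:R * V0) ^+ 2.
Proof.
move=> ln.
have h : 0 <= 4 * C * s * (1 - rho)^-1 ^+ 2.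
  by apply: mulr_ge0; [rewrite !mulr_ge0// sqrtr_ge0 | exact: sqr_ge0].
rewrite (eq_mean E (g := fun w => (\sum_(i < l) (X i w - Xb i w) +
   \sum_(i < n | (i < l)%N && ((i %/ b)%N == (l %/ b)%N)) Xb i w) ^+ 2)); last first.
  by move=> w; rewrite -Xb_xi// sumrB; congr (_ ^+ 2); ring.
apply: (mean_minkowski HE) => //; first by rewrite mulr_ge0.
  apply: le_trans dev_sqr; apply: (mean_le HE) => w.
  by rewrite -[leLHS]real_normK ?num_real// ler_pXn2r ?nnegrE ?dev_ge// (le_trans _ (dev_ge w ln)).
exact: (block_sum_sqr (fun i => (i < l)%N)).
Qed.

(** The excess of a block sum over [b * c] is at most the sum of the excesses of its terms over [c];
    Cauchy-Schwarz over at most [b] terms then costs the factor [b]. *)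
Lemma xi_tail r : \sum_(k < r) E (fun w => Num.max 0 (`|xi k w| - b%:R * c) ^+ 2) <=
  b%:R * (n%:R * delta).
Proof.
have key k w : Num.max 0 (`|xi k w| - b%:R * c) ^+ 2 <=
   b%:R * \sum_(i < n | (i %/ b)%N == k) Num.max 0 (`|Xb i w| - c) ^+ 2.
  set P := fun i : 'I_n => (i %/ b)%N == k.
  have cnt : \sum_(i < n | P i) (1 : R) <= b%:R.
    have := quot_count xpredT k; rewrite [leRHS]/=; apply: le_trans.
    by rewrite big_mkcond; apply: ler_sum => i _; rewrite /P; case: eqP.
  have h1 : Num.max 0 (`|xi k w| - b%:R * c) <= \sum_(i < n | P i) Num.max 0 (`|Xb i w| - c).
    rewrite ge_max sumr_ge0 ?andTb//; last by move=> i _; rewrite le_max lexx.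
    rewrite lerBlDr (le_trans (ler_norm_sum _ _ _))//.
    apply: (@le_trans _ _ (\sum_(i < n | P i) (Num.max 0 (`|Xb i w| - c) + c * 1))).
      by apply: ler_sum => i _; rewrite mulr1 -lerBlDr le_max lexx orbT.
    by rewrite big_split/= lerD2l -mulr_sumr mulrC ler_wpM2r.
  set Z := \sum_(i < n | P i) _ ^+ 2.
  have h2 : (\sum_(i < n | P i) Num.max 0 (`|Xb i w| - c)) ^+ 2 <= b%:R * Z.
    rewrite /Z; set m := fun i : 'I_n => Num.max 0 (`|Xb i w| - c).
    have bp : 0 < b%:R :> R by rewrite ltr0n.
    set t := \sum_(i < n | P i) m i.
    have : 0 <= \sum_(i < n | P i) (b%:R * m i - t) ^+ 2 by apply: sumr_ge0 => i _; exact: sqr_ge0.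
    rewrite (eq_bigr (fun i => b%:R ^+ 2 * m i ^+ 2 + ((- 2 * b%:R * t) * m i + t ^+ 2 * 1))); last by move=> i _; ring.
    rewrite !big_split/= -!mulr_sumr -/t => h.
    have h' : t ^+ 2 * (\sum_(i < n | P i) 1) <= t ^+ 2 * b%:R by rewrite ler_wpM2l ?sqr_ge0.
    rewrite -(ler_pM2l bp); set z := \sum_(i < n | P i) _ ^+ 2 in h *; nra.
  apply: le_trans h2; rewrite ler_pXn2r// ?nnegrE ?le_max ?lexx//.
  by apply: sumr_ge0 => i _; rewrite le_max lexx.
apply: (@le_trans _ _ (\sum_(k < r) b%:R * \sum_(i < n | (i %/ b)%N == k) delta)).
  apply: ler_sum => k _.
  apply: (@le_trans _ _ (E (fun w => b%:R * \sum_(i < n | (i %/ b)%N == k) Num.max 0 (`|Xb i w| - c) ^+ 2))).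
    by apply: (mean_le HE) => w; exact: key.
  rewrite (meanZ HE) ler_wpM2l//.
  rewrite (mean_sum HE _ (fun i : 'I_n => (i %/ b)%N == k) (fun (i : 'I_n) w => Num.max 0 (`|Xb i w| - c) ^+ 2)).
  by apply: ler_sum => i _; exact: Xb_ui.
rewrite -mulr_sumr ler_wpM2l//.
case: (posnP n) => [n0|np].
  have -> : n%:R = 0 :> R by rewrite n0.
  rewrite mul0r big1// => k _; rewrite big1// => i _.
  by have := leq_ltn_trans (leq0n i) (ltn_ord i); rewrite n0.
have d0 : 0 <= delta.
  by apply: le_trans (hUI np); apply: (mean_ge0 HE) => w; exact: sqr_ge0.
rewrite (exchange_big_dep xpredT)//=.
apply: (@le_trans _ _ (\sum_(i < n) delta)); last by rewrite sumr_const card_ord mulr_natl.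
apply: ler_sum => i _.
have [ir|ir] := ltnP (i %/ b) r.
  rewrite (big_pred1 (Ordinal ir))// => k.
rewrite big_pred0// => k; apply/eqP => ik.
by have := ltn_ord k; rewrite -ik ltnNge ir.
Qed.

(** [Z] forgets every letter on which [X p] depends, and [X p] is centred, so [Z] does not correlate
    with it. The difference [X t - Z] consists of the increments at lags [t - p] and beyond, whose
    norms sum geometrically. *)
Lemma cov_decay p t : (p < t < n)%N ->
  `|E (fun w => X p w * X t w)| <= V0 * C * (1 - rho)^-1 * rho ^+ (t - p).
Proof.
case/andP=> pt tn; have r0 : 0 <= rho by case/andP: rho01 => /ltW.
have r1 : 0 <= 1 - rho by case/andP: rho01 => _ /ltW; rewrite subr_ge0.
have pM : ((p + K).+1 <= M)%N.
  by rewrite (leq_trans _ nKM)// ltn_add2r (ltn_trans pt).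
pose Z := avgs mu (p + K).+1 (X t).
have EZ : E (fun w => X p w * Z w) = 0.
  rewrite /E -(avgs_avgs Hmu _ pM) (_ : avgs mu (p + K).+1 _ = fun=> 0).
    exact: (mean_cst HE).
  apply/funext => w; rewrite (eq_mean (fun F => avgs mu (p + K).+1 F w) (g := fun w => Z w * X p w)).
    rewrite (avgs_mul Hmu) ?cX ?mulr0// => v v' H.
    by apply: (dep_avgs mu (@depX t)) => k /andP[_ k2]; exact: H.
  by move=> v; rewrite mulrC.
have -> : E (fun w => X p w * X t w) = E (fun w => X p w * (X t w - Z w)).
  rewrite [RHS](eq_mean E (g := fun w => X p w * X t w - X p w * Z w)); last by move=> w; rewrite mulrBr.
  by rewrite (meanB HE) EZ subr0.
apply: (le_trans (mean_norm HE _)).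
rewrite -!mulrA; apply: (mean_CS HE) => //.
- by rewrite mulr_ge0// mulr_ge0 ?exprn_ge0// invr_ge0.
- by apply: hX2; exact: ltn_trans tn.
rewrite (eq_mean E (g := fun w => (\sum_(q < (p + K).+1) mdiff mu q (X t) w) ^+ 2)); last first.
  by move=> w; rewrite sum_mdiff.
apply: (le_trans (mean_minkowski_sum HE (F := fun q => mdiff mu q (X t))
  (a := fun q => C * rho ^+ (t + K - q)) _ _)).
- by move=> i _; rewrite mulr_ge0// exprn_ge0.
- move=> i ip; apply: hD => //; lia.
rewrite ler_pXn2r// ?nnegrE.
- rewrite -mulr_sumr ler_wpM2l// mulrC.
  rewrite (reindex_inj rev_ord_inj)/=.
  apply: (@le_trans _ _ (rho ^+ (t - p) * \sum_(q < (p + K).+1) rho ^+ q)).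
    rewrite mulr_sumr; apply: ler_sum => q _; rewrite -exprD.
    by have -> : (t + K - ((p + K).+1 - q.+1) = t - p + q)%N by have := ltn_ord q; lia.
  by rewrite ler_wpM2l ?exprn_ge0// sum_geom_le.
- by apply: sumr_ge0 => i _; rewrite mulr_ge0// exprn_ge0.
- by rewrite mulr_ge0// mulr_ge0 ?exprn_ge0// invr_ge0.
Qed.

End BlockApprox.

(** * Lindeberg replacement and maximal inequality *)

Section Swap.
Context {R : realType}.
Implicit Types (mu nu : nat -> (R -> R) -> R) (Psi phi : R -> R).

(** The size of a second-order Taylor remainder. Taking the minimum with the square keeps its mean
    finite when only second moments exist, which is Lindeberg's condition in integrated form. *)
Definition m3 (x : R) : R := Num.min (x ^+ 2) (`|x| ^+ 3).

(* Smoothness is recorded through second-order Taylor expansions, a property stable under averaging and requiring no derivative. *)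
Definition taylor_cls (c : R) Psi := exists Psi1 Psi2 : R -> R, forall y,
  [/\ `|Psi1 y| <= c, `|Psi2 y| <= c &
      forall x, `|Psi (y + x) - Psi y - Psi1 y * x - Psi2 y * x ^+ 2| <= c * m3 x].

Fixpoint convs mu r Psi (y : R) : R :=
  if r is r'.+1 then mu r' (fun a => convs mu r' Psi (y + a)) else Psi y.

Lemma avgs_sum mu (Hmu : forall i, is_mean (mu i)) r Psi y w :
  avgs mu r (fun w => Psi (y + \sum_(k < r) w k)) w = convs mu r Psi y.
Proof.
elim: r y w => [|r IH] y w; first by rewrite /= big_ord0 addr0.
rewrite /= /avg; apply: eq_mean => a; rewrite -(IH (y + a) (upd w r a)).
apply: avgs_local => w' H; congr Psi.
by rewrite big_ord_recr/= H// /upd eqxx addrAC addrA.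
Qed.

Lemma convs_cls mu (Hmu : forall i, is_mean (mu i)) c r Psi :
  taylor_cls c Psi -> taylor_cls c (convs mu r Psi).
Proof.
move=> cPsi; elim: r => // r [P1 [P2 IH]].
exists (fun y => mu r (fun a => P1 (y + a))), (fun y => mu r (fun a => P2 (y + a))) => y.
split.
- by apply: (mean_bound (Hmu r)) => a; have [] := IH (y + a).
- by apply: (mean_bound (Hmu r)) => a; have [] := IH (y + a).
move=> x; rewrite -!(meanZr (Hmu r)) -!(meanB (Hmu r)).
apply: (mean_bound (Hmu r)) => a; have [_ _] := IH (y + a).
by move/(_ x); rewrite [y + a + x]addrAC.
Qed.

Lemma swap_step (mu nu : (R -> R) -> R) (Hmu : is_mean mu) (Hnu : is_mean nu) c Psi y :
  taylor_cls c Psi ->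
  `|mu (fun x => Psi (y + x)) - nu (fun x => Psi (y + x))| <=
  c * (`|mu id - nu id| + `|mu (fun x => x ^+ 2) - nu (fun x => x ^+ 2)| + mu m3 + nu m3).
Proof.
move=> [P1 [P2 /(_ y)[h1 h2 h3]]].
have key (om : (R -> R) -> R) (Hom : is_mean om) :
   `|om (fun x => Psi (y + x)) - (Psi y + P1 y * om id + P2 y * om (fun x => x ^+ 2))| <= c * om m3.
  rewrite -(meanZ Hom c) -(meanZ Hom (P1 y)) -(meanZ Hom (P2 y)) -[Psi y in X in _ - X](mean_cst Hom).
  rewrite -!(meanD Hom) -(meanB Hom); apply: (le_trans (mean_norm Hom _)).
  apply: (mean_le Hom) => x; have := h3 x; congr (`|_| <= _); rewrite /=; ring.
have := key _ Hmu; have := key _ Hnu.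
set a := mu _; set a1 := mu id; set a2 := mu (fun x => x ^+ 2).
set b := nu _; set b1 := nu id; set b2 := nu (fun x => x ^+ 2) => k1 k2.
have e : a - b = (a - (Psi y + P1 y * a1 + P2 y * a2)) - (b - (Psi y + P1 y * b1 + P2 y * b2))
   + (P1 y * (a1 - b1) + P2 y * (a2 - b2)) by ring.
rewrite e (le_trans (ler_normD _ _))//.
apply: (@le_trans _ _ ((c * mu m3 + c * nu m3) + (c * `|a1 - b1| + c * `|a2 - b2|))).
  apply: lerD; first by rewrite (le_trans (ler_normB _ _))// lerD.
  by rewrite (le_trans (ler_normD _ _))// lerD// normrM ler_wpM2r.
lra.
Qed.

Lemma lindeberg_swap mu nu (Hmu : forall i, is_mean (mu i)) (Hnu : forall i, is_mean (nu i))
    c r Psi y : taylor_cls c Psi ->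
  `|convs mu r Psi y - convs nu r Psi y| <=
  c * \sum_(k < r) (`|mu k id - nu k id| +
     `|mu k (fun x => x ^+ 2) - nu k (fun x => x ^+ 2)| + mu k m3 + nu k m3).
Proof.
move=> cPsi; elim: r y => [|r IH] y; first by rewrite /= subrr normr0 big_ord0 mulr0.
rewrite big_ord_recr/= mulrDr [leRHS]addrC.
rewrite (_ : _ - _ = (mu r (fun a => convs mu r Psi (y + a)) - nu r (fun a => convs mu r Psi (y + a)))
  + (nu r (fun a => convs mu r Psi (y + a)) - nu r (fun a => convs nu r Psi (y + a)))); last by ring.
rewrite (le_trans (ler_normD _ _))// lerD//.
  apply: swap_step => //; exact: convs_cls.
by apply: (mean_dist (Hnu r)) => a; exact: IH.
Qed.

(** Coordinates are exchanged one at a time. After averaging the others, the test function is still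
    bounded by [M] and [L]-Lipschitz in the remaining coordinate, so a one-dimensional comparison
    applies at each stage. *)
Lemma hybrid mu nu (Hmu : forall i, is_mean (mu i)) (Hnu : forall i, is_mean (nu i))
    (M L : R) (e : nat -> R) m (g : (nat -> R) -> R) w :
  (forall w, `|g w| <= M) ->
  (forall w i a b, (i < m)%N -> `|g (upd w i a) - g (upd w i b)| <= L * `|a - b|) ->
  (forall i phi, (i < m)%N -> (forall x, `|phi x| <= M) ->
     (forall x y, `|phi x - phi y| <= L * `|x - y|) -> `|mu i phi - nu i phi| <= e i) ->
  `|avgs mu m g w - avgs nu m g w| <= \sum_(i < m) e i.
Proof.
move=> gM; elim: m w => [|m IH] w gL H; first by rewrite /= subrr normr0 big_ord0.
rewrite big_ord_recr/= [leRHS]addrC.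
rewrite (_ : avg mu _ _ _ - _ = (mu m (fun a => avgs mu m g (upd w m a)) - nu m (fun a => avgs mu m g (upd w m a)))
  + (nu m (fun a => avgs mu m g (upd w m a)) - nu m (fun a => avgs nu m g (upd w m a)))); last by rewrite /avg; ring.
rewrite (le_trans (ler_normD _ _))// lerD//.
  apply: H => // [x|x y]; first by apply: (mean_bound (avgs_mean Hmu m _)).
  by rewrite !avgs_upd//; apply: (mean_dist (avgs_mean Hmu m _)) => w'; exact: gL.
apply: (mean_dist (Hnu m)) => a; apply: IH => [v i b c im|i phi im].
  by apply: gL; exact: ltnW.
by apply: H; exact: ltnW.
Qed.

Fixpoint hit (t : R) r (y : R) (w : nat -> R) : bool :=
  (t <= `|y|) || (if r is r'.+1 then hit t r' (y + w r') w else false).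

Lemma hitPn t r y w j : ~~ hit t r y w -> (j <= r)%N -> `|y + \sum_(j <= k < r) w k| < t.
Proof.
elim: r y => [|r IH] y.
  rewrite /= orbF -ltNge leqn0 => h /eqP ->; by rewrite big_geq// addr0.
rewrite /= negb_or -ltNge => /andP[h1 h2].
rewrite leq_eqVlt => /orP[/eqP ->|jr]; first by rewrite big_geq// addr0.
by rewrite big_nat_recr//= addrA addrAC; exact: IH.
Qed.

Lemma hit_local t r y w w' : (forall k, (k < r)%N -> w k = w' k) -> hit t r y w = hit t r y w'.
Proof.
elim: r y => //= r IH y H; rewrite (IH _ (fun k kr => H k (ltnW kr)))// H//.
Qed.

(** When a suffix sum first reaches [2 * l], the coordinates not yet revealed are independent of
    that event and their sum stays below [l] with probability at least one half, so the total still
    reaches [l]. This is the case [2 * l <= |y|]; otherwise one more coordinate is revealed. *)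
Lemma ottaviani mu (Hmu : forall i, is_mean (mu i)) (l : R) r y w :
  (forall j, (j <= r)%N ->
    avgs mu j (fun w => (l <= `|\sum_(k < j) w k|)%R%:R) w <= 2^-1) ->
  avgs mu r (fun w => (hit (2 * l) r y w)%:R) w <=
  2 * avgs mu r (fun w => (l <= `|y + \sum_(k < r) w k|)%R%:R) w.
Proof.
have E (j : nat) z (v : nat -> R) := avgs_sum Hmu j (fun x => (l <= `|x|)%R%:R) z v.
move=> H0; have {H0} H j : (j <= r)%N -> convs mu j (fun x => (l <= `|x|)%R%:R) 0 <= 2^-1.
  move=> jr; rewrite -(E j 0 w); have := H0 j jr; congr (avgs _ _ _ _ <= _).
  by apply/funext => v; rewrite add0r.
elim: r y w H => [|r IH] y w H; have := E; move=> {}E.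
  rewrite /= orbF big_ord0 addr0; case: (leP (2 * l) `|y|) => [h|]; last by rewrite mulr_ge0.
  have := H 0%N isT; rewrite /= normr0; case: (leP l 0) => l0; first by rewrite /=; lra.
  have -> : l <= `|y| by lra.
  by rewrite mulr1 ler1n.
have [h|h] := leP (2 * l) `|y|.
  apply: (@le_trans _ _ 1).
    rewrite -[leRHS](mean_cst (avgs_mean Hmu r.+1 w)); apply: (mean_le (avgs_mean Hmu r.+1 w)) => v.
    by case: hit.
  have h2 : avgs mu r.+1 (fun w => 1 - (l <= `|0 + \sum_(k < r.+1) w k|)%R%:R) w <=
       avgs mu r.+1 (fun w => (l <= `|y + \sum_(k < r.+1) w k|)%R%:R) w.
    apply: (mean_le (avgs_mean Hmu r.+1 w)) => v; rewrite add0r.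
    case: (leP l `|\sum_(k < r.+1) v k|) => h2; first by rewrite subrr.
    have -> : l <= `|y + \sum_(k < r.+1) v k|.
      have := lerB_normD y (\sum_(k < r.+1) v k); lra.
    by rewrite subr0.
  move: h2; rewrite (meanB (avgs_mean Hmu r.+1 w)) (mean_cst (avgs_mean Hmu r.+1 w)) E.
  have := H r.+1 (leqnn _); lra.
rewrite /= /avg -(meanZ (Hmu r)); apply: (mean_le (Hmu r)) => a.
have -> : (2 * l <= `|y|) = false by apply/negbTE; rewrite -ltNge.
rewrite -[X in avgs mu r X _ <= _]/(fun w0 : nat -> R => (hit (2 * l) r (y + w0 r) w0)%:R).
have -> : avgs mu r (fun w0 => (l <= `|y + \sum_(k < r.+1) w0 k|)%R%:R) (upd w r a) =
   avgs mu r (fun w0 => (l <= `|y + a + \sum_(k < r) w0 k|)%R%:R) (upd w r a).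
  apply: avgs_local => v Hv; rewrite big_ord_recr/= Hv// /upd eqxx.
  by rewrite addrAC addrA.
have -> : avgs mu r (fun w1 => (hit (2 * l) r (y + w1 r) w1)%:R) (upd w r a) =
   avgs mu r (fun w1 => (hit (2 * l) r (y + a) w1)%:R) (upd w r a).
  by apply: avgs_local => v Hv; rewrite Hv// /upd eqxx.
by apply: IH => j jr; apply: H; exact: leqW.
Qed.

End Swap.

(** * Smoothing of Lipschitz test functions *)

Section Smoothing.
Context {R : realType}.
Notation leb := (@lebesgue_measure R).

Lemma antiderivative (f : R -> R) : continuous f ->
  exists F : R -> R, forall x : R, is_derive x 1 F (f x).
Proof.
move=> cf.
have intf (a b : R) : leb.-integrable `[a, b] (EFin \o f).
  apply: continuous_compact_integrable; first exact: segment_compact.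
  exact: continuous_subspaceT.
pose F (y : R) : R := if 0 <= y then \int[leb]_(t in `]0, y]) f t
                  else - \int[leb]_(t in `]y, 0]) f t.
pose G (A y : R) : R := \int[leb]_(t in `[- A, y]) f t.
have FG A y : 0 < A -> - A < y -> F y = G A y - G A 0.
  move=> A0 Ay; rewrite /F /G; case: (leP 0 y) => y0.
    by rewrite Rintegral_itvB ?bnd_simp//; lra.
  by rewrite -opprB Rintegral_itvB ?bnd_simp//; lra.
exists F => x; pose A := `|x| + 1.
have xA : - A < x by rewrite /A; have := ler_norm (- x); rewrite normrN; lra.
have A0 : 0 < A by rewrite /A; have := normr_ge0 x; lra.
have x1 : x < x + 1 by lra.
have [dG GE] := continuous_FTC1_closed x1 (intf _ _) xA (cf x).
apply: (near_eq_is_derive (f := fun y => G A y - G A 0)).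
  near=> y; rewrite -FG//; near: y.
  exact: lt_nbhsr.
rewrite derive1E in GE; have dG' := DeriveDef dG GE.
by rewrite -[f x]subr0; apply: is_deriveB.
Unshelve. all: by end_near.
Qed.

Lemma mean_value (f df : R -> R) (a b : R) : (forall x : R, is_derive x 1 f (df x)) ->
  exists2 c, `|c - a| <= `|b - a| & f b - f a = df c * (b - a).
Proof.
move=> fdf; have cf : continuous f.
  by move=> x; apply: differentiable_continuous; apply/derivable1_diffP; case: (fdf x).
have [ab|/ltW ba] := leP a b.
  have [c ci e] := MVT_segment ab (fun x _ => fdf x) (continuous_subspaceT cf).
  exists c => //; move: ci; rewrite in_itv/= => /andP[c1 c2].
  by rewrite !ger0_norm ?subr_ge0// lerB.
have [c ci e] := MVT_segment ba (fun x _ => fdf x) (continuous_subspaceT cf).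
exists c; last by rewrite -[LHS]opprB e -mulrN opprB.
move: ci; rewrite in_itv/= => /andP[c1 c2].
by rewrite !ler0_norm ?subr_le0// lerN2 lerB.
Qed.

(** The remainder of [FF] has derivative [F (y + z) - F y - phi y * z] in [z], so the mean value
    theorem reduces both bounds to first-order estimates for [F]. The [m3] bound feeds the Lindeberg
    swap; the cubic bound compares the smoothed function with [phi]. *)
Lemma double_antiderivative (phi : R -> R) (M L : R) : 0 <= L ->
  (forall x, `|phi x| <= M) -> (forall x y, `|phi x - phi y| <= L * `|x - y|) ->
  exists F FF : R -> R, (forall x y, `|F x - F y| <= M * `|x - y|) /\
   (forall y x, `|FF (y + x) - FF y - F y * x - phi y / 2 * x ^+ 2| <= (2 * M + L) * m3 x) /\
   (forall y x, `|FF (y + x) - FF y - F y * x - phi y / 2 * x ^+ 2| <= L * `|x| ^+ 3).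
Proof.
move=> L0 phiM phiL.
have M0 : 0 <= M by apply: le_trans (phiM 0).
have cphi : continuous phi.
  move=> x; apply/cvgrPdist_lt => e e0; near=> y.
  apply: (le_lt_trans (phiL _ _)).
  apply: (@le_lt_trans _ _ ((L + 1) * `|x - y|)); first by rewrite ler_wpM2r//; lra.
  rewrite mulrC -ltr_pdivlMr; last by lra.
  near: y; apply: (@cvgr_dist_lt _ _ _ (nbhs x)) => //.
  by rewrite divr_gt0//; lra.
have [F dF] := antiderivative cphi.
have cF : continuous F.
  by move=> x; apply: differentiable_continuous; apply/derivable1_diffP; case: (dF x).
have [FF dFF] := antiderivative cF.
exists F, FF.
have FL y x : `|F (y + x) - F y - phi y * x| <= L * `|x| ^+ 2.
  have [c cx ->] := mean_value y (y + x) dF.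
  rewrite addrAC subrr add0r in cx *; rewrite -mulrBl normrM expr2 mulrA.
  by rewrite ler_wpM2r// (le_trans (phiL _ _))// ler_wpM2l.
have FM x y : `|F x - F y| <= M * `|x - y|.
  have [c _ ->] := mean_value y x dF; by rewrite normrM ler_wpM2r.
have key y x : exists2 c, `|c| <= `|x| &
   FF (y + x) - FF y - F y * x - phi y / 2 * x ^+ 2 = (F (y + c) - F y - phi y * c) * x.
  pose g z := FF (y + z) - F y * z - phi y / 2 * z ^+ 2.
  have dg (z : R) : is_derive z (1 : R) g (F (y + z) - F y - phi y * z).
    rewrite /g.
    have d1 : is_derive z 1 (fun z => FF (y + z)) (F (y + z)).
      have := @is_derive1_comp R FF (fun z => y + z) z (F (y + z)) 1 (dFF _).
      by rewrite mulr1; apply; rewrite -[X in is_derive _ _ _ X]add0r; apply: is_deriveD.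
    have d2 : is_derive z 1 (fun z => F y * z) (F y).
      by rewrite -[X in is_derive _ _ _ X]mulr1; apply: is_deriveZ.
    have d3 : is_derive z 1 (fun z => phi y / 2 * z ^+ 2) (phi y * z).
      apply: is_derive_eq; rewrite /GRing.scale/=; by field.
    exact: is_deriveB.
  have [c cx e] := mean_value 0 x dg; exists c; first by move: cx; rewrite !subr0.
  move: e; rewrite /g addr0 !mulr0 expr0n mulr0 !subr0 => <-; ring.
split => //.
have b1 y x : `|FF (y + x) - FF y - F y * x - phi y / 2 * x ^+ 2| <= L * `|x| ^+ 3.
  have [c cx ->] := key y x; rewrite normrM exprSr mulrA ler_wpM2r//.
  by rewrite (le_trans (FL _ _))// ler_wpM2l// ler_pXn2r// nnegrE.
split => // y x.
have b2 : `|FF (y + x) - FF y - F y * x - phi y / 2 * x ^+ 2| <= (2 * M) * x ^+ 2.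
  have [c cx ->] := key y x; rewrite normrM -[x ^+ 2]real_normK ?num_real// expr2 mulrA ler_wpM2r//.
  rewrite (le_trans (ler_normB _ _))// normrM.
  have h1 := FM (y + c) y; rewrite addrAC subrr add0r in h1.
  have h2 := phiM y; have := normr_ge0 c; have := normr_ge0 (phi y); nra.
rewrite /m3; case: (leP (x ^+ 2) (`|x| ^+ 3)) => _.
  by apply: (le_trans b2); rewrite ler_wpM2r ?sqr_ge0// lerDl.
apply: (le_trans (b1 y x)); rewrite ler_wpM2r ?exprn_ge0// lerDr.
by rewrite mulr_ge0.
Unshelve. all: by end_near.
Qed.

Definition smooth_const (M L h : R) : R :=
  2 * M / h + 2 * M / h ^+ 2 + 4 * (2 * M + L) / h ^+ 2.

(** The smoothed function is the normalized second difference of a second antiderivative, that is,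
    [phi] averaged against a triangular kernel on [[y, y + 2 * h]]. A second difference is a linear
    combination of translates, so it inherits the Taylor expansion of [FF], with the same second
    difference of [F] and half that of [phi] as coefficients. *)
Lemma smoothing (phi : R -> R) (M L h : R) : 0 <= L -> 0 < h ->
  (forall x, `|phi x| <= M) -> (forall x y, `|phi x - phi y| <= L * `|x - y|) ->
  exists2 Phi, taylor_cls (smooth_const M L h) Phi & forall y, `|Phi y - phi y| <= 3 * L * h.
Proof.
move=> L0 h0 phiM phiL.
have M0 : 0 <= M by apply: le_trans (phiM 0).
have [F [FF [FM [T1 T2]]]] := double_antiderivative L0 phiM phiL.
pose D (f : R -> R) y := (f (y + h + h) - 2 * f (y + h) + f y) / h ^+ 2.
have hn : h != 0 by rewrite gt_eqF.
have c1 : 0 <= 2 * M / h by rewrite divr_ge0 ?mulr_ge0// ltW.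
have h2 : 0 <= h ^+ 2 by exact: sqr_ge0.
have M2 : 0 <= 2 * M by rewrite mulr_ge0.
have c2 : 0 <= 2 * M / h ^+ 2 by apply: divr_ge0.
have c3 : 0 <= 4 * (2 * M + L) / h ^+ 2.
  by apply: divr_ge0 => //; rewrite mulr_ge0// addr_ge0.
have hh : `|h ^+ 2| = h ^+ 2 by rewrite ger0_norm ?sqr_ge0.
exists (D FF).
  exists (D F), (fun y => D phi y / 2) => y; split.
  - apply: (@le_trans _ _ (2 * M / h)); last by rewrite /smooth_const; lra.
    rewrite /D normrM normfV hh ler_pdivrMr ?exprn_gt0//.
    have -> : 2 * M / h * h ^+ 2 = M * h + M * h by field.
    rewrite (_ : _ + _ = (F (y + h + h) - F (y + h)) - (F (y + h) - F y)); last by ring.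
    rewrite (le_trans (ler_normB _ _))// lerD// (le_trans (FM _ _))//.
      by rewrite addrAC subrr add0r gtr0_norm.
    by rewrite addrAC subrr add0r gtr0_norm.
  - apply: (@le_trans _ _ (2 * M / h ^+ 2)); last by rewrite /smooth_const; lra.
    rewrite /D 2!normrM normfV hh mulrAC ler_wpM2r ?invr_ge0 ?sqr_ge0//.
    rewrite [`|2^-1|]ger0_norm ?invr_ge0// ler_pdivrMr//.
    have := ler_normD (phi (y + h + h) - 2 * phi (y + h)) (phi y).
    have := ler_normB (phi (y + h + h)) (2 * phi (y + h)).
    rewrite normrM (ger0_norm (_ : 0 <= 2))//.
    have := phiM (y + h + h); have := phiM (y + h); have := phiM y; lra.
  - move=> x.
    pose r z := FF (z + x) - FF z - F z * x - phi z / 2 * x ^+ 2.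
    have -> : D FF (y + x) - D FF y - D F y * x - D phi y / 2 * x ^+ 2 =
       (r (y + h + h) - 2 * r (y + h) + r y) / h ^+ 2.
      rewrite /D /r (_ : y + h + h + x = y + x + h + h); last by ring.
      rewrite (_ : y + h + x = y + x + h); last by ring.
      by field.
    apply: (@le_trans _ _ (4 * (2 * M + L) / h ^+ 2 * m3 x)); last first.
      rewrite ler_wpM2r; [by []| |by rewrite /smooth_const; lra].
      by rewrite /m3 le_min sqr_ge0 exprn_ge0.
    rewrite normrM normfV hh [leRHS]mulrAC ler_wpM2r ?invr_ge0 ?sqr_ge0//.
    have := ler_normD (r (y + h + h) - 2 * r (y + h)) (r y).
    have := ler_normB (r (y + h + h)) (2 * r (y + h)).
    rewrite normrM (ger0_norm (_ : 0 <= 2))//.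
    have := T1 (y + h + h) x; have := T1 (y + h) x; have := T1 y x.
    rewrite -/(r _) -/(r _) -/(r _); lra.
move=> y.
pose r x := FF (y + h + x) - FF (y + h) - F (y + h) * x - phi (y + h) / 2 * x ^+ 2.
(* Expanding around the midpoint [y + h] cancels the first-order terms, and the two halves of the
   quadratic term add up to [phi (y + h)]. *)
have e : D FF y - phi y = (r h + r (- h)) / h ^+ 2 + (phi (y + h) - phi y).
  by rewrite /D /r addrK; field.
rewrite e (le_trans (ler_normD _ _))//.
have -> : 3 * L * h = 2 * L * h + L * h by ring.
apply: lerD; last by rewrite (le_trans (phiL _ _))// addrAC subrr add0r gtr0_norm.
rewrite normrM normfV hh ler_pdivrMr ?exprn_gt0//.
have := T2 (y + h) h; have := T2 (y + h) (- h); rewrite -/(r h) -/(r (- h)) normrN (gtr0_norm h0).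
have := ler_normD (r h) (r (- h)).
have -> : 2 * L * h * h ^+ 2 = L * h ^+ 3 + L * h ^+ 3 by ring.
lra.
Qed.

End Smoothing.

(** * Square-integrable random variables *)

Lemma cs_bound {R : realType} (a b A B z : R) : 0 <= a -> 0 <= b -> A <= a ^+ 2 -> B <= b ^+ 2 ->
  (forall p q, 0 < p -> 0 < q -> z <= q / (2 * p) * A + p / (2 * q) * B) -> z <= a * b.
Proof.
move=> a0 b0 fa gb H.
have key (e : R) : 0 < e -> z <= (a + e) * (b + e).
  move=> e0; set p := a + e; set q := b + e.
  have p0 : 0 < p by rewrite /p; lra.
  have q0 : 0 < q by rewrite /q; lra.
  have h1 : q / (2 * p) * A <= q / (2 * p) * p ^+ 2.
    apply: ler_wpM2l; first by rewrite divr_ge0 ?mulr_ge0// ltW.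
    by apply: (le_trans fa); rewrite ler_pXn2r// ?nnegrE /p; lra.
  have h2 : p / (2 * q) * B <= p / (2 * q) * q ^+ 2.
    apply: ler_wpM2l; first by rewrite divr_ge0 ?mulr_ge0// ltW.
    by apply: (le_trans gb); rewrite ler_pXn2r// ?nnegrE /q; lra.
  apply: (le_trans (H _ _ p0 q0)).
  apply: (le_trans (lerD h1 h2)); rewrite le_eqVlt; apply/orP; left; apply/eqP.
  by field; rewrite !gt_eqF.
apply/ler_addgt0Pr => e e0.
pose d := Num.min 1 (e / (a + b + 1)).
have ab : 0 < a + b + 1 by lra.
have d0 : 0 < d by rewrite lt_min ltr01 divr_gt0.
apply: (le_trans (key d d0)).
have d1 : d <= 1 by rewrite ge_min lexx.
have d2 : d * (a + b + 1) <= e by rewrite -ler_pdivlMr// ge_min lexx orbT.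
nra.
Qed.

Lemma amgm_bound {R : realType} (x y p q : R) : 0 < p -> 0 < q ->
  `|x * y| <= q / (2 * p) * x ^+ 2 + p / (2 * q) * y ^+ 2.
Proof.
move=> p0 q0; rewrite normrM -[x ^+ 2]real_normK ?num_real// -[y ^+ 2]real_normK ?num_real//.
rewrite -subr_ge0.
have -> : q / (2 * p) * `|x| ^+ 2 + p / (2 * q) * `|y| ^+ 2 - `|x| * `|y| =
   (2 * p * q)^-1 * (q * `|x| - p * `|y|) ^+ 2.
  field; by rewrite !gt_eqF.
by rewrite mulr_ge0 ?sqr_ge0// invr_ge0 !mulr_ge0// ltW.
Qed.

Section Expect.
Context {R : realType} {d : measure_display} {T : measurableType d} (P : probability T R).
Implicit Types X Y : T -> R.

Definition Er X : R := fine 'E_P[X]%E.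
Definition int1 X := P.-integrable setT (EFin \o X).
Definition sqint X := measurable_fun setT X /\ int1 (fun w => X w ^+ 2).

Lemma ErE X : Er X = \int[P]_(x in setT) X x.
Proof. by rewrite /Er unlock. Qed.

Lemma eq_Er X Y : X =1 Y -> Er X = Er Y.
Proof. by move=> /funext ->. Qed.

Lemma int1_meas X : int1 X -> measurable_fun setT X.
Proof. by move=> /integrableP[/measurable_EFinP]. Qed.

Lemma int1_le X Y : measurable_fun setT X -> (forall w, `|X w| <= Y w) -> int1 Y -> int1 X.
Proof.
move=> mX XY; apply: le_integrable => //; first exact/measurable_EFinP.
by move=> w _ /=; rewrite lee_fin (le_trans (XY w))// ler_norm.
Qed.

Lemma int1_cst c : int1 (fun=> c).
Proof.
exact: finite_measure_integrable_cst.
Qed.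

Lemma int1_bnd X (M : R) : measurable_fun setT X -> (forall w, `|X w| <= M) -> int1 X.
Proof. by move=> mX XM; exact: int1_le mX XM (int1_cst M). Qed.

Lemma int1D X Y : int1 X -> int1 Y -> int1 (fun w => X w + Y w).
Proof. by move=> iX iY; have := integrableD measurableT iX iY. Qed.

Lemma int1Z a X : int1 X -> int1 (fun w => a * X w).
Proof. by move=> iX; have := integrableZl measurableT a iX. Qed.

Lemma int1N X : int1 X -> int1 (fun w => - X w).
Proof.
move=> /(int1Z (-1)); rewrite /int1; congr (_.-integrable _ _).
by apply/funext => w /=; rewrite mulN1r.
Qed.

Lemma int1B X Y : int1 X -> int1 Y -> int1 (fun w => X w - Y w).
Proof. by move=> iX /int1N; exact: int1D. Qed.

Lemma int1_norm X : int1 X -> int1 (fun w => `|X w|).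
Proof. by move=> /integrable_norm. Qed.

Lemma int1_sum I (r : seq I) (Q : pred I) (F : I -> T -> R) : (forall i, Q i -> int1 (F i)) ->
  int1 (fun w => \sum_(i <- r | Q i) F i w).
Proof.
move=> iF; rewrite /int1.
have := @integrable_sum _ _ _ P _ measurableT I r Q (fun i w => (F i w)%:E) iF.
by congr (_.-integrable _ _); apply/funext => w /=; rewrite sumEFin.
Qed.

Lemma ErD X Y : int1 X -> int1 Y -> Er (fun w => X w + Y w) = Er X + Er Y.
Proof. by move=> iX iY; rewrite !ErE RintegralD. Qed.

Lemma ErZ a X : int1 X -> Er (fun w => a * X w) = a * Er X.
Proof. by move=> iX; rewrite !ErE RintegralZl. Qed.

Lemma ErB X Y : int1 X -> int1 Y -> Er (fun w => X w - Y w) = Er X - Er Y.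
Proof. by move=> iX iY; rewrite !ErE RintegralB. Qed.

Lemma Er_cst c : Er (fun=> c) = c.
Proof. by rewrite /Er expectation_cst. Qed.

Lemma ErN X : int1 X -> Er (fun w => - X w) = - Er X.
Proof. by move=> iX; rewrite -[LHS](eq_Er (fun w => mulN1r (X w))) ErZ// mulN1r. Qed.

Lemma Er_le X Y : int1 X -> int1 Y -> (forall w, X w <= Y w) -> Er X <= Er Y.
Proof. by move=> iX iY XY; rewrite !ErE; apply: le_Rintegral => // w _. Qed.

Lemma Er_ge0 X : (forall w, 0 <= X w) -> 0 <= Er X.
Proof. by move=> X0; rewrite ErE; apply: Rintegral_ge0 => w _. Qed.

Lemma Er_norm X : int1 X -> `|Er X| <= Er (fun w => `|X w|).
Proof. by move=> iX; rewrite !ErE; exact: le_normr_Rintegral. Qed.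

Lemma Er_dist X Y : int1 X -> int1 Y -> `|Er X - Er Y| <= Er (fun w => `|X w - Y w|).
Proof. by move=> iX iY; rewrite -ErB//; apply: Er_norm; exact: int1B. Qed.

Lemma Er_sum I (r : seq I) (Q : pred I) (F : I -> T -> R) : (forall i, Q i -> int1 (F i)) ->
  Er (fun w => \sum_(i <- r | Q i) F i w) = \sum_(i <- r | Q i) Er (F i).
Proof.
move=> iF; elim: r => [|i r IH].
  by rewrite big_nil -[RHS](Er_cst 0); apply: eq_Er => w; rewrite big_nil.
rewrite big_cons -IH; case: ifP => Qi.
  rewrite -ErD; [|exact: iF|exact: int1_sum].
  by apply: eq_Er => w; rewrite big_cons Qi.
by apply: eq_Er => w; rewrite big_cons Qi.
Qed.

Lemma sqint_mul X Y : sqint X -> sqint Y -> int1 (fun w => X w * Y w).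
Proof.
move=> [mX iX] [mY iY].
apply: (@int1_le _ (fun w => X w ^+ 2 + Y w ^+ 2)); last exact: int1D.
  exact: measurable_funM.
move=> w; have := amgm_bound (X w) (Y w) (@ltr01 R) (@ltr01 R).
have := sqr_ge0 (X w); have := sqr_ge0 (Y w); lra.
Qed.

Lemma sqint_cst c : sqint (fun=> c).
Proof. by split; [exact: measurable_cst|exact: int1_cst]. Qed.

Lemma sqint_int1 X : sqint X -> int1 X.
Proof.
move=> sX; have := sqint_mul sX (sqint_cst 1).
by rewrite /int1; congr (_.-integrable _ _); apply/funext => w /=; rewrite mulr1.
Qed.

Lemma sqintD X Y : sqint X -> sqint Y -> sqint (fun w => X w + Y w).
Proof.
move=> sX sY; split; first by apply: measurable_funD; [case: sX|case: sY].
have := int1D (int1D (proj2 sX) (proj2 sY)) (int1Z 2 (sqint_mul sX sY)).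
by rewrite /int1; congr (_.-integrable _ _); apply/funext => w /=; congr EFin; ring.
Qed.

Lemma sqintZ a X : sqint X -> sqint (fun w => a * X w).
Proof.
move=> [mX iX]; split; first exact: measurable_funM.
have := int1Z (a ^+ 2) iX.
by rewrite /int1; congr (_.-integrable _ _); apply/funext => w /=; rewrite exprMn.
Qed.

Lemma sqintN X : sqint X -> sqint (fun w => - X w).
Proof.
move=> /(sqintZ (-1)); rewrite (_ : (fun w => -1 * X w) = (fun w => - X w))//.
by apply/funext => w; rewrite mulN1r.
Qed.

Lemma sqintB X Y : sqint X -> sqint Y -> sqint (fun w => X w - Y w).
Proof. by move=> sX /sqintN; exact: sqintD. Qed.

Lemma sqint_sum I (r : seq I) (Q : pred I) (F : I -> T -> R) : (forall i, Q i -> sqint (F i)) ->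
  sqint (fun w => \sum_(i <- r | Q i) F i w).
Proof.
move=> sF; elim: r => [|i r IH].
  rewrite (_ : (fun w => _) = fun=> 0); first exact: sqint_cst.
  by apply/funext => w; rewrite big_nil.
case Qi : (Q i).
  rewrite (_ : (fun w => _) = fun w => F i w + \sum_(i <- r | Q i) F i w).
    by apply: sqintD => //; exact: sF.
  by apply/funext => w; rewrite big_cons Qi.
rewrite (_ : (fun w => _) = fun w => \sum_(i <- r | Q i) F i w)//.
by apply/funext => w; rewrite big_cons Qi.
Qed.

Lemma sqint_le X Y : measurable_fun setT X -> (forall w, `|X w| <= `|Y w|) -> sqint Y -> sqint X.
Proof.
move=> mX XY [mY iY]; split => //; apply: int1_le iY; first exact: measurable_funX.
move=> w; rewrite ger0_norm ?sqr_ge0// -[X w ^+ 2]real_normK ?num_real//.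
by rewrite -[Y w ^+ 2]real_normK ?num_real// ler_pXn2r ?nnegrE.
Qed.

Lemma sqint_bnd X (M : R) : measurable_fun setT X -> (forall w, `|X w| <= M) -> sqint X.
Proof.
move=> mX XM; apply: sqint_le (sqint_cst M) => // w.
by rewrite (le_trans (XM w))// ler_norm.
Qed.

Lemma Er_CS X Y (a b : R) : sqint X -> sqint Y -> 0 <= a -> 0 <= b ->
  Er (fun w => X w ^+ 2) <= a ^+ 2 -> Er (fun w => Y w ^+ 2) <= b ^+ 2 ->
  Er (fun w => `|X w * Y w|) <= a * b.
Proof.
move=> sX sY a0 b0 Xa Yb; apply: (cs_bound a0 b0 Xa Yb) => p q p0 q0.
have [[_ iX] [_ iY]] := (sX, sY).
rewrite -!ErZ// -ErD; [|exact: int1Z|exact: int1Z].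
apply: Er_le; first by apply: int1_norm; exact: sqint_mul.
  by apply: int1D; exact: int1Z.
by move=> w; exact: amgm_bound.
Qed.

Lemma Er_L1 X (a : R) : sqint X -> 0 <= a -> Er (fun w => X w ^+ 2) <= a ^+ 2 ->
  Er (fun w => `|X w|) <= a.
Proof.
move=> sX a0 Xa; have := Er_CS sX (sqint_cst 1) a0 ler01 Xa.
rewrite Er_cst expr1n lexx mulr1 => /(_ isT); congr (_ <= _).
by apply: eq_Er => w; rewrite mulr1.
Qed.

Lemma Er_mink X Y (a b : R) : sqint X -> sqint Y -> 0 <= a -> 0 <= b ->
  Er (fun w => X w ^+ 2) <= a ^+ 2 -> Er (fun w => Y w ^+ 2) <= b ^+ 2 ->
  Er (fun w => (X w + Y w) ^+ 2) <= (a + b) ^+ 2.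
Proof.
move=> sX sY a0 b0 Xa Yb; have H := Er_CS sX sY a0 b0 Xa Yb.
have [[_ iX] [_ iY]] := (sX, sY).
have iXY := int1_norm (sqint_mul sX sY).
have : Er (fun w => (X w + Y w) ^+ 2) <= Er (fun w => (X w ^+ 2 + Y w ^+ 2) + 2 * `|X w * Y w|).
  apply: Er_le; first by case: (sqintD sX sY).
    by apply: int1D; [exact: int1D|exact: int1Z].
  by move=> w; have := ler_norm (X w * Y w); nra.
rewrite (ErD (int1D iX iY) (int1Z 2 iXY)) ErD// ErZ//; nra.
Qed.

Lemma Er_mink_sum I (r : seq I) (Q : pred I) (F : I -> T -> R) (a : I -> R) :
  (forall i, Q i -> sqint (F i)) -> (forall i, Q i -> 0 <= a i) ->
  (forall i, Q i -> Er (fun w => F i w ^+ 2) <= a i ^+ 2) ->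
  Er (fun w => (\sum_(i <- r | Q i) F i w) ^+ 2) <= (\sum_(i <- r | Q i) a i) ^+ 2.
Proof.
move=> sF a0 Fa; elim: r => [|i r IH].
  rewrite (eq_Er (Y := fun=> 0)) ?Er_cst ?sqr_ge0// => w.
  by rewrite big_nil expr0n.
rewrite big_cons; case Qi : (Q i); last first.
  rewrite (eq_Er (Y := fun w => (\sum_(i <- r | Q i) F i w) ^+ 2))// => w.
  by rewrite big_cons Qi.
rewrite (eq_Er (Y := fun w => (F i w + \sum_(i <- r | Q i) F i w) ^+ 2)); last first.
  by move=> w; rewrite big_cons Qi.
apply: Er_mink => //; [exact: sF|exact: sqint_sum|exact: a0|exact: sumr_ge0|exact: Fa].
Qed.

Lemma Er_dct (X : nat -> T -> R) (Y Z : T -> R) : (forall n, measurable_fun setT (X n)) ->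
  (forall n w, `|X n w| <= Z w) -> int1 Z -> (forall w, X ^~ w @ \oo --> Y w) ->
  measurable_fun setT Y /\ (fun n => Er (X n)) @ \oo --> Er Y.
Proof.
move=> mX XZ iZ XY.
have mY : measurable_fun setT Y.
  by apply: (measurable_fun_cvg mX) => w _; exact: XY.
split => //.
have YZ w : `|Y w| <= Z w.
  have h : (fun n => `|X n w|) @ \oo --> `|Y w| by apply: cvg_norm; exact: XY.
  rewrite -(cvg_lim (@Rhausdorff R) h).
  apply: limr_le; first by apply/cvg_ex; exists `|Y w|.
  by apply: nearW => n; exact: XZ.
have iY := int1_le mY YZ iZ.
have H : (fun n => \int[P]_x (X n x)%:E)%E @ \oo --> (\int[P]_x (Y x)%:E)%E.
  apply: (@dominated_cvg _ _ _ P setT measurableT (fun n w => (X n w)%:E)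
     (fun w => (Y w)%:E) (fun w => (Z w)%:E)) => //.
  - by move=> n; exact/measurable_EFinP.
  - by move=> w _; apply: cvg_EFin; [exact: nearW|exact: XY].
  - by move=> n w _; rewrite /= lee_fin.
rewrite -(fineK (integrable_fin_num measurableT iY)) in H.
rewrite ErE (_ : (fun n => Er (X n)) = fine \o (fun n => \int[P]_x (X n x)%:E)%E).
  exact: (fine_cvg H).
by apply/funext => n; rewrite ErE.
Qed.

Definition pos (x c : R) : R := Num.max 0 (`|x| - c).

Lemma powR2_le (y c q : R) : 2 < q -> 0 < c -> c < `|y| -> y ^+ 2 <= `|y| `^ q * c `^ (2 - q).
Proof.
move=> q2 c0 cy; have y0 : 0 < `|y| by exact: lt_trans cy.
have -> : y ^+ 2 = `|y| `^ q * `|y| `^ (2 - q).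
  rewrite -powRD; last by apply/implyP => _; rewrite gt_eqF.
  by rewrite (_ : q + (2 - q) = 2%:R) ?powR_mulrn ?real_normK ?num_real//; ring.
rewrite ler_wpM2l ?powR_ge0// -opprB !powRN lef_pV2 ?posrE ?powR_gt0//.
by rewrite ge0_ler_powR ?nnegrE ?ltW//; lra.
Qed.

(** The exponent [q > 2] is converted once and for all into a second-moment bound and a rate of
    uniform integrability. The factor 2 comes from splitting at the level [a]: below it the square
    is at most [a ^+ 2], above it [powR2_le] applies. Later only the order of magnitude matters. *)
Lemma LqN_sqint (q a : R) Y : 2 < q -> 0 < a -> measurable_fun setT Y ->
  (LqN P q Y <= a%:E)%E ->
  [/\ sqint Y, Er (fun w => Y w ^+ 2) <= 2 * a ^+ 2 &
      forall c, 0 < c -> Er (fun w => pos (Y w) c ^+ 2) <= a `^ q * c `^ (2 - q)].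
Proof.
move=> q2 a0 mY Ya.
have q0 : q != 0 by rewrite gt_eqF//; lra.
have mYq : measurable_fun setT (fun w => `|Y w| `^ q).
  by apply: (measurableT_comp (measurable_powR q)); exact: measurableT_comp.
have I : (\int[P]_w (`|Y w| `^ q)%:E <= (a `^ q)%:E)%E.
  have := powR_Lnorm P (EFin \o Y) q0.
  rewrite (_ : (\int[P]_x _)%E = \int[P]_w (`|Y w| `^ q)%:E)%E; last first.
    by apply: eq_integral.
  move=> <-; rewrite -poweR_EFin; apply: gt0_ler_poweR => //; first by lra.
    by rewrite in_itv/= leey andbT Lnorm_ge0.
  by rewrite in_itv/= leey andbT lee_fin ltW.
have iYq : int1 (fun w => `|Y w| `^ q).
  apply/integrableP; split; first exact/measurable_EFinP.
  apply: (@le_lt_trans _ _ (a `^ q)%:E); last by rewrite ltry.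
  apply: le_trans I; apply: ge0_le_integral => //.
  - by apply: measurableT_comp => //; exact/measurable_EFinP.
  - exact/measurable_EFinP.
  - by move=> w _; rewrite /= lee_fin ger0_norm ?powR_ge0.
have EYq : Er (fun w => `|Y w| `^ q) <= a `^ q.
  by rewrite ErE /Rintegral -[leRHS]/(fine (a `^ q)%:E); apply: fine_le => //; exact: integrable_fin_num.
have key c w : 0 < c -> Y w ^+ 2 <= c ^+ 2 + c `^ (2 - q) * `|Y w| `^ q.
  move=> c0; have [h|h] := leP `|Y w| c.
    rewrite -[leLHS]addr0 lerD// ?mulr_ge0 ?powR_ge0//.
    by rewrite -[leLHS]real_normK ?num_real// ler_pXn2r ?nnegrE// ltW.
  rewrite mulrC; apply: (le_trans (powR2_le q2 c0 h)).
  by rewrite -[leLHS]add0r lerD// sqr_ge0.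
have iK c := int1D (int1_cst (c ^+ 2)) (int1Z (c `^ (2 - q)) iYq).
have mY2 : measurable_fun setT (fun w => Y w ^+ 2) by exact: measurable_funX.
have iY2 : int1 (fun w => Y w ^+ 2).
  by apply: (int1_le mY2 _ (iK a)) => w; rewrite ger0_norm ?sqr_ge0// key.
split => //.
  apply: (le_trans (Er_le iY2 (iK a) (fun w => key a w a0))).
  rewrite (ErD (int1_cst _) (int1Z _ iYq)) (ErZ _ iYq) Er_cst.
  have h : a `^ (2 - q) * Er (fun w => `|Y w| `^ q) <= a `^ (2 - q) * a `^ q.
    by rewrite ler_wpM2l ?powR_ge0.
  have e : a `^ (2 - q) * a `^ q = a ^+ 2.
    rewrite -powRD; last by apply/implyP => _; rewrite gt_eqF.
    by rewrite subrK (powR_mulrn 2 (ltW a0)).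
  lra.
move=> c c0.
apply: (@le_trans _ _ (Er (fun w => c `^ (2 - q) * `|Y w| `^ q))); last first.
  by rewrite ErZ// mulrC ler_wpM2r ?powR_ge0.
have key2 w : pos (Y w) c ^+ 2 <= c `^ (2 - q) * `|Y w| `^ q.
  rewrite /pos; have [h|h] := leP `|Y w| c.
    have -> : Num.max 0 (`|Y w| - c) = 0 by apply/max_idPl; lra.
    by rewrite expr0n/= mulr_ge0 ?powR_ge0.
  rewrite mulrC; apply: le_trans (powR2_le q2 c0 h).
  have -> : Num.max 0 (`|Y w| - c) = `|Y w| - c by apply/max_idPr; lra.
  rewrite -[leRHS]real_normK ?num_real// ler_pXn2r ?nnegrE//; lra.
apply: Er_le => //; last exact: int1Z.
apply: (int1_le _ _ (int1Z (c `^ (2 - q)) iYq)) => [|w]; last by rewrite ger0_norm ?sqr_ge0.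
apply: measurable_funX; apply: measurable_maxr => //.
by apply: measurable_funB => //; exact: measurableT_comp.
Qed.

End Expect.

(** * Independent letters with finitely many values *)

Section Letters.
Context {R : realType} {d : measure_display} {T : measurableType d} (P : probability T R).
Variables (l : nat -> T -> nat) (N : nat -> nat).
Hypothesis lN : forall i w, (l i w < N i)%N.
Hypothesis ml : forall i a, measurable [set w | l i w = a].

Let ind i a w : R := (l i w == a)%:R.

Definition lmean i (phi : nat -> R) := \sum_(a < N i) Er P (fun w => (l i w == a)%:R) * phi a.

Let ind_indic i a : ind i a = \1_[set w | l i w = a].
Proof.
apply/funext => w; rewrite /ind indicE; congr (nat_of_bool _)%:R.
by apply/eqP/idP => [?|]; [rewrite inE|rewrite inE].
Qed.

Let mind i a : measurable_fun setT (ind i a).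
Proof. by rewrite ind_indic; exact: measurable_indic. Qed.

Let ind_bnd i a w : `|ind i a w| <= 1.
Proof. by rewrite /ind; case: eqP; rewrite ?normr1 ?normr0. Qed.

Lemma sum_ind i w (phi : nat -> R) : \sum_(a < N i) ind i a w * phi a = phi (l i w).
Proof.
rewrite (bigD1 (Ordinal (lN i w)))//= /ind eqxx mul1r big1 ?addr0// => a /eqP aw.
case: eqP => [h|]; last by rewrite mul0r.
by case: aw; apply: val_inj.
Qed.

Lemma lmean_mean i : is_mean (lmean i).
Proof.
have p0 a : 0 <= Er P (ind i a) by apply: Er_ge0 => w; rewrite /ind ler0n.
split.
- move=> c f g; rewrite /lmean mulr_sumr -big_split/=; apply: eq_bigr => a _; ring.
- by move=> f g fg; apply: ler_sum => a _; apply: ler_wpM2l; [exact: p0|exact: fg].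
- move=> c; rewrite /lmean -mulr_suml.
  rewrite -(Er_sum (index_enum 'I_(N i)) (F := fun a : 'I_(N i) => ind i a)); last first.
    by move=> a _; exact: int1_bnd (@mind i a) (@ind_bnd i a).
  rewrite (eq_Er P (Y := fun=> 1)) ?Er_cst ?mul1r// => w.
  rewrite -[RHS](sum_ind i w (fun=> 1)); apply: eq_bigr => a _; by rewrite mulr1.
Qed.

Lemma letters_meas m (F : (nat -> nat) -> R) : dep_on (fun k => (k < m)%N) F ->
  measurable_fun setT (fun w => F (l ^~ w)) /\ exists M, forall w, `|F (l ^~ w)| <= M.
Proof.
elim: m F => [|m IH] F dF.
  have E w : F (l^~ w) = F (fun=> 0%N) by apply: dF.
  split; last by exists `|F (fun=> 0%N)| => w; rewrite E.
  by rewrite (_ : (fun w => _) = fun=> F (fun=> 0%N)); [exact: measurable_cst|exact/funext].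
have dG a : dep_on (fun k => (k < m)%N) (fun w => F (upd w m a)).
  move=> w w' H; apply: dF => k km; rewrite /upd; case: eqP => // /eqP h.
  by apply: H; rewrite ltn_neqAle h -ltnS.
have E w : F (l^~ w) = \sum_(a < N m) ind m a w * F (upd (l^~ w) m a).
  rewrite (sum_ind m w (fun a => F (upd (l^~ w) m a))); apply: dF => k _.
  by rewrite /upd; case: eqP => // ->.
split.
  rewrite (_ : (fun w => _) = fun w => \sum_(a < N m) ind m a w * F (upd (l^~ w) m a)); last exact/funext.
  apply: measurable_sum => a; apply: measurable_funM; first exact: mind.
  by have [] := IH _ (dG a).
have bG a : exists M, forall w, `|F (upd (l^~ w) m a)| <= M by have [] := IH _ (dG a).
have [M HM] := choice bG.
exists (\sum_(a < N m) M a) => w; rewrite E (le_trans (ler_norm_sum _ _ _))//.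
by apply: ler_sum => a _; rewrite normrM -[leRHS]mul1r ler_pM.
Qed.

Hypothesis indep_l : forall m (a : nat -> nat),
  Er P (fun w => \prod_(0 <= i < m) (l i w == a i)%:R) = \prod_(0 <= i < m) Er P (fun w => (l i w == a i)%:R).

(** The product law enters only through probabilities of finite words. The auxiliary claim fixes the
    letters from [k] on by an indicator and averages those below [k]; summing over the value of
    letter [k] moves it from one side to the other. *)
Lemma letters_bridge m (F : (nat -> nat) -> R) w0 : dep_on (fun k => (k < m)%N) F ->
  Er P (fun w => F (l ^~ w)) = avgs lmean m F w0.
Proof.
move=> dF.
pose I k (a : nat -> nat) w : R := \prod_(k <= i < m) (l i w == a i)%:R.
have mI k a : measurable_fun setT (I k a).
  by apply: measurable_prod => i _; exact: mind.
have I1 k a w : `|I k a w| <= 1.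
  rewrite /I normr_prod; apply: prodr_ile1 => i _; rewrite normr_ge0/=; exact: ind_bnd.
have [mF [M FM]] := letters_meas dF.
have iIF k a : int1 P (fun w => I k a w * F (l^~ w)).
  apply: (@int1_bnd _ _ _ P _ M); first exact: measurable_funM.
  by move=> w; rewrite normrM -[leRHS]mul1r ler_pM.
have key k a : (k <= m)%N -> Er P (fun w => I k a w * F (l^~ w)) =
    (\prod_(k <= i < m) Er P (fun w => (l i w == a i)%:R)) * avgs lmean k F a.
  elim: k a => [|k IH] a km.
    rewrite /= -indep_l mulrC -ErZ; last exact: int1_bnd (@mI 0%N a) (@I1 0%N a).
    apply: eq_Er => w; rewrite mulrC.
    have [h|h] := boolP [forall i : 'I_m, l i w == a i].
      congr (_ * _); apply: dF => i im; apply/eqP.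
      by have /forallP/(_ (Ordinal im)) := h.
    rewrite /I (_ : \prod_(0 <= i < m) _ = 0) ?mulr0 ?mul0r//.
    move: h; rewrite negb_forall => /existsP[i /negbTE h].
    by rewrite big_mkord (bigD1 i)//= h mul0r.
  have E w : I k.+1 a w = \sum_(b < N k) I k (upd a k b) w.
    rewrite [RHS](eq_bigr (fun b : 'I_(N k) => ind k b w * \prod_(k.+1 <= i < m) (l i w == a i)%:R)).
      by rewrite (sum_ind k w (fun=> _)).
    move=> b _; rewrite /I (big_ltn km) {1}/upd eqxx; congr (_ * _); apply: eq_big_nat => i /andP[ki _].
    by rewrite /upd (gtn_eqF ki).
  rewrite (eq_Er P (Y := fun w => \sum_(b < N k) I k (upd a k b) w * F (l^~ w))); last first.
    by move=> w; rewrite E mulr_suml.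
  rewrite Er_sum// -[avgs lmean k.+1 F a]/(\sum_(b < N k) Er P (fun w => (l k w == b)%:R) * avgs lmean k F (upd a k b)).
  rewrite mulr_sumr; apply: eq_bigr => b _.
  rewrite (IH _ (ltnW km)) (big_ltn km) {1}/upd eqxx.
  rewrite (eq_big_nat _ _ (F2 := fun i => Er P (fun w => (l i w == a i)%:R))); first by ring.
  by move=> i /andP[ki _]; rewrite /upd (gtn_eqF ki).
have := key m w0 (leqnn m); rewrite big_geq// mul1r => <-.
by apply: eq_Er => w; rewrite /I big_geq// mul1r.
Qed.

End Letters.

(** * Quantization of real variables *)

Section Quantize.
Context {R : realType}.

Definition quant (kap : R -> nat) (N : nat) :=
  (forall x, (kap x < N)%N) /\ (forall a, measurable [set x | kap x = a]).

Lemma quant_pair k1 N1 k2 N2 : quant k1 N1 -> quant k2 N2 ->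
  exists k N, quant k N /\ (forall x y, k x = k y -> k1 x = k1 y /\ k2 x = k2 y).
Proof.
move=> [b1 m1] [b2 m2]; exists (fun x => k2 x * N1 + k1 x)%N, (N2 * N1)%N.
have N10 : (0 < N1)%N by apply: leq_ltn_trans (b1 0).
have d1 x : ((k2 x * N1 + k1 x) %% N1 = k1 x)%N by rewrite modnMDl modn_small.
have d2 x : ((k2 x * N1 + k1 x) %/ N1 = k2 x)%N by rewrite divnMDl// divn_small// addn0.
split; last first.
  by move=> x y h; split; [rewrite -(d1 x) h d1|rewrite -(d2 x) h d2].
split=> [x|a].
  apply: (@leq_trans ((k2 x).+1 * N1)); first by rewrite mulSn addnC ltn_add2r.
  by rewrite leq_mul2r b2 orbT.
rewrite (_ : [set x | _] = [set x | k1 x = (a %% N1)%N] `&` [set x | k2 x = (a %/ N1)%N]).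
  exact: measurableI.
apply/seteqP; split => x /=; first by move=> <-; rewrite d1 d2.
by move=> [-> ->]; rewrite -divn_eq.
Qed.

(** A common refinement of finitely many partitions of the line, so that one alphabet serves all
    time indices at once. *)
Lemma quant_seq (k : nat -> R -> nat) (N : nat -> nat) n : (forall i, (i < n)%N -> quant (k i) (N i)) ->
  exists k' N', quant k' N' /\ (forall i x y, (i < n)%N -> k' x = k' y -> k i x = k i y).
Proof.
elim: n => [|n IH] H.
  exists (fun=> 0%N), 1%N; split => //; split => // a.
  have [->|a0] := eqVneq a 0%N.
    by rewrite (_ : [set x | _] = setT)//; apply/seteqP; split.
  by rewrite (_ : [set x | _] = set0)//; apply/seteqP; split => // x /= h; rewrite h eqxx in a0.
have [|k1 [N1 [q1 h1]]] := IH; first by move=> i ni; apply: H; exact: ltnW.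
have [k2 [N2 [q2 h2]]] := quant_pair q1 (H n (ltnSn n)).
exists k2, N2; split => // i x y; rewrite ltnS leq_eqVlt => /orP[/eqP ->|ni] /h2[] // e _.
exact: h1.
Qed.

Variable m : nat.
Hypothesis m0 : (0 < m)%N.
Let mr : R := m%:R.

(** Rounding towards zero with mesh [1 / m] on []-m, m[], everything else being sent to the cell of
    zero. Negative values use the codes from [m * m] on. Rounding towards zero gives [gridv_le],
    which supplies the domination needed for convergence in L2. *)
Definition gridk (x : R) : nat :=
  if `|x| < mr then (if 0 <= x then Num.truncn (`|x| * mr)%R else (m * m + Num.truncn (`|x| * mr)%R)%N)
  else 0%N.
Definition gridv (a : nat) : R :=
  if (a < m * m)%N then a%:R / mr else - ((a - m * m)%N%:R / mr).

Let mr0 : 0 < mr. Proof. by rewrite ltr0n. Qed.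

Let trunc_lt (x : R) : `|x| < mr -> (Num.truncn (`|x| * mr)%R < m * m)%N.
Proof.
move=> h; rewrite truncn_lt_nat ?mulr_ge0 ?(ltW mr0)// natrM ltr_pM2r//.
Qed.

Lemma gridv_gridk x : `|x| < mr -> `|x - gridv (gridk x)| <= mr^-1 /\ `|gridv (gridk x)| <= `|x|.
Proof.
move=> h; rewrite /gridk h.
have := trunc_lt h; set t := Num.truncn _ => tm.
have xm0 : 0 <= `|x| * mr by rewrite mulr_ge0// ltW.
have /andP[t1 t2] := truncn_itv xm0; rewrite -/t in t1 t2.
have a1 : t%:R / mr <= `|x| by rewrite ler_pdivrMr.
have a2 : `|x| <= t%:R / mr + mr^-1.
  by rewrite -[X in _ + X]mul1r -mulrDl natr1 ler_pdivlMr// ltW.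
have a0 : 0 <= t%:R / mr by rewrite divr_ge0// ltW.
case: (leP 0 x) => x0; rewrite /gridv.
  rewrite tm (ger0_norm x0) in a1 a2 *; rewrite (ger0_norm a0); split => //.
  by rewrite ger0_norm; lra.
rewrite ltnNge leq_addr/= addKn normrN (ger0_norm a0); split => //.
by rewrite (ltr0_norm x0) in a1 a2; rewrite opprK ler0_norm; lra.
Qed.

Lemma gridv_le x : `|gridv (gridk x)| <= `|x|.
Proof.
have [h|h] := ltP `|x| mr; first by case: (gridv_gridk h).
by rewrite /gridk ltNge h /= /gridv muln_gt0 m0 mul0r normr0.
Qed.

Lemma gridk_quant : quant gridk (2 * (m * m)).
Proof.
split=> [x|a].
  rewrite /gridk; case: ltP => h; last by rewrite !muln_gt0 m0.
  have := trunc_lt h; case: ifP => _; lia.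
have mn : measurable_fun setT (fun x : R => `|x|) by exact: normr_measurable.
have m1 : measurable [set x : R | `|x| < mr].
  rewrite -[X in measurable X]setTI; have := mn measurableT _ (measurable_itv `]-oo, mr[).
  by congr (measurable (_ `&` _)); apply/seteqP; split => x /=; rewrite in_itv.
have m2 : measurable [set x : R | 0 <= x].
  rewrite (_ : [set x | _] = `[0, +oo[%classic); first exact: measurable_itv.
  by apply/seteqP; split => x /=; rewrite in_itv/= andbT.
have m3 (b : nat) : measurable [set x : R | Num.truncn (`|x| * mr)%R = b].
  have mf : measurable_fun setT (fun x : R => `|x| * mr) by exact: measurable_funM.
  rewrite -[X in measurable X]setTI; have := mf measurableT _ (measurable_itv `[b%:R, b.+1%:R[).
  congr (measurable (_ `&` _)); apply/seteqP; split => x /=; rewrite in_itv/=.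
    by move=> h; apply: truncn_def.
  by move=> <-; apply: truncn_itv; rewrite mulr_ge0// ltW.
rewrite (_ : [set x | _] =
  ([set x | `|x| < mr] `&` ([set x | 0 <= x] `&` [set x | Num.truncn (`|x| * mr)%R = a] `|`
     ~` [set x | 0 <= x] `&` [set x | (m * m + Num.truncn (`|x| * mr)%R)%N = a])) `|`
  (~` [set x | `|x| < mr] `&` [set x | 0%N = a])); last first.
  apply/seteqP; split => x /=; rewrite /gridk.
    by case: (`|x| < mr) => h; [left; split => //; move: h; case: (0 <= x) => h; [left|right]|right].
  by move=> [[-> [[-> //]|[/negP/negbTE -> //]]]|[/negP/negbTE -> //]].
apply: measurableU; first apply: measurableI => //; first apply: measurableU.
- exact: measurableI.
- apply: measurableI; first exact: measurableC.
  have [ma|ma] := leqP (m * m) a.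
    rewrite (_ : [set x | _] = [set x | Num.truncn (`|x| * mr)%R = (a - m * m)%N])//.
    by apply/seteqP; split => x /=; lia.
  by rewrite (_ : [set x | _] = set0)//; apply/seteqP; split => // x /=; lia.
- apply: measurableI; first exact: measurableC.
  have [<-|a0] := eqVneq 0%N a.
    by rewrite (_ : [set x | _] = setT)//; apply/seteqP; split.
  by rewrite (_ : [set x | _] = set0)//; apply/seteqP; split => // x /= h; rewrite h eqxx in a0.
Qed.

End Quantize.

Lemma quant_meas {R : realType} (kap : R -> nat) N (v : nat -> R) : quant kap N ->
  measurable_fun setT (fun x => v (kap x)).
Proof.
move=> [b mk].
have [] := @letters_meas R _ R (fun=> kap) (fun=> N) (fun=> b) (fun=> mk) 1 (fun w => v (w 0%N)) _ => //.
by move=> w w' H; rewrite H.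
Qed.

Lemma quantize {R : realType} {d : measure_display} {T : measurableType d} (P : probability T R)
    (X : T -> R) (e : R) : sqint P X -> 0 < e ->
  exists kap N v, [/\ quant kap N, forall x, `|v (kap x)| <= `|x| &
     Er P (fun w => (X w - v (kap (X w))) ^+ 2) <= e].
Proof.
move=> [mX iX] e0.
pose D m w := (X w - gridv m.+1 (gridk m.+1 (X w))) ^+ 2.
have mD m : measurable_fun setT (D m).
  apply: measurable_funX; apply: measurable_funB => //.
  have H := @quant_meas R _ _ (gridv m.+1) (gridk_quant (ltn0Sn m)).
  exact: (measurableT_comp H mX).
have bD m w : `|D m w| <= 4 * X w ^+ 2.
  rewrite ger0_norm ?sqr_ge0// /D -[X w ^+ 2]real_normK ?num_real//.
  rewrite -[leLHS]real_normK ?num_real//.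
  have := gridv_le (ltn0Sn m) (X w); have := ler_normB (X w) (gridv m.+1 (gridk m.+1 (X w))).
  have := normr_ge0 (X w - gridv m.+1 (gridk m.+1 (X w))); nra.
have cD w : D ^~ w @ \oo --> 0.
  apply/cvgrPdist_lt => r r0; near=> m; rewrite sub0r normrN ger0_norm ?sqr_ge0// /D.
  have h1 : `|X w| < m.+1%:R.
    apply: (@lt_trans _ _ m%:R); last by rewrite ltr_nat.
    by near: m; exact: nbhs_infty_gtr.
  have [h2 _] := gridv_gridk (ltn0Sn m) h1.
  rewrite -real_normK ?num_real//.
  have h3 : m.+1%:R^-1 < Num.min 1 r.
    rewrite invf_plt ?posrE ?lt_min ?ltr01//.
    apply: (@lt_trans _ _ m%:R); last by rewrite ltr_nat.
    by near: m; exact: nbhs_infty_gtr.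
  rewrite lt_min in h3; case/andP: h3 => h3 h4.
  apply: le_lt_trans h4; apply: le_trans (h2).
  by rewrite expr2 ler_piMr// (le_trans h2)// ltW.
have [_ /cvgrPdist_lt/(_ e e0)[m _ /(_ m (leqnn m))]] :=
  Er_dct mD bD (int1Z 4 iX) cD.
rewrite Er_cst sub0r normrN => h.
exists (gridk m.+1), (2 * (m.+1 * m.+1))%N, (gridv m.+1); split.
- exact: gridk_quant.
- exact: gridv_le.
- by apply/ltW; apply: le_lt_trans h; exact: ler_norm.
Unshelve. all: by end_near.
Qed.

(** * The innovation sequence and approximation by finite alphabets *)

Lemma preimage_gen {d} {T : measurableType d} {S : Type} (G : set (set S)) (f : T -> S) :
  (forall A, G A -> measurable (f @^-1` A)) ->
  forall A, <<s G >> A -> measurable (f @^-1` A).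
Proof.
move=> H; apply: smallest_sub => //.
split=> [|A mA|A mA].
- by rewrite preimage_set0; exact: measurable0.
- by rewrite setTD preimage_setC; exact: measurableC.
- by rewrite preimage_bigcup; exact: bigcup_measurable.
Qed.

Section SeqSpace.
Context {R : realType}.

(* [nat -> R] with the sigma-algebra of finite-dimensional rectangles, which form a pi-system. *)
Definition cylS : set (set (nat -> R)) :=
  [set A | exists K (B : nat -> set R), (forall i, measurable (B i)) /\
     A = [set x | forall k, (k < K)%N -> B k (x k)]].
Definition seqR := g_sigma_algebraType cylS.

Lemma cylS_coord k (B : set R) : measurable B -> measurable ([set x | B (x k)] : set seqR).
Proof.
move=> mB; apply: sub_sigma_algebra; exists k.+1, (fun i => if i == k then B else setT); split.
  by move=> i; case: ifP => _; [exact: mB|exact: measurableT].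
apply/seteqP; split => x /= H.
  by move=> i _; case: eqP => [->|].
by have := H k (ltnSn k); rewrite eqxx.
Qed.

Lemma meas_seq {d} {T : measurableType d} (y : T -> seqR) :
  (forall k, measurable_fun setT (fun w => y w k)) -> measurable_fun setT y.
Proof.
move=> my _ A mA; rewrite setTI; move: A mA; apply: preimage_gen => _ [K [B [mB ->]]].
rewrite (_ : _ @^-1` _ = \bigcap_(k in `I_K) ((fun w => y w k) @^-1` B k)); last first.
  by apply/seteqP; split => w /= H k; apply: H.
apply: bigcap_measurableType => k _.
by rewrite -[X in measurable X]setTI; apply: my.
Qed.

Lemma meas_cyl_gen {d} {T : measurableType d} (f : T -> R * (nat -> R)) :
  measurable_fun setT (fun w => (f w).1) -> (forall k, measurable_fun setT (fun w => (f w).2 k)) ->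
  forall A, <<s cyl_gen >> A -> measurable (f @^-1` A).
Proof.
move=> m1 m2; apply: preimage_gen.
move=> A [[B mB ->]|[k [B mB ->]]].
  by have := m1 measurableT B mB; rewrite setTI.
by have := m2 k measurableT B mB; rewrite setTI.
Qed.

Lemma kernel_section (G : R -> (nat -> R) -> R) u : kernel_measurable G ->
  measurable_fun setT (G u : seqR -> R).
Proof.
move=> mG _ B mB; rewrite setTI.
apply: (@meas_cyl_gen _ seqR (fun x => (u, x : nat -> R)) _ _ _ (mG B mB)) => [|k] /=.
  exact: measurable_cst.
by move=> _ C mC; rewrite setTI; exact: cylS_coord.
Qed.

Lemma kernel_joint (G : R -> (nat -> R) -> R) {d} {T : measurableType d} (y : T -> nat -> R) :
  (forall k, measurable_fun setT (fun w => y w k)) -> kernel_measurable G ->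
  measurable_fun setT (fun z : R * T => G z.1 (y z.2)).
Proof.
move=> my mG _ B mB; rewrite setTI.
apply: (@meas_cyl_gen _ _ (fun z : R * T => (z.1, y z.2)) _ _ _ (mG B mB)) => [|k] /=.
  exact: measurable_fst.
exact: (measurableT_comp (my k) measurable_snd).
Qed.

Section Law.
Context {d : measure_display} {T : measurableType d} (P : probability T R).

Definition iidseq (pi : set R -> \bar R) (y : T -> nat -> R) :=
  (forall k, measurable_fun setT (fun w => y w k)) /\
  forall K (B : nat -> set R), (forall i, measurable (B i)) ->
    P [set w | forall k, (k < K)%N -> B k (y w k)] = (\prod_(k < K) pi (B k))%E.

Lemma iidseq_law pi y1 y2 (A : set seqR) : iidseq pi y1 -> iidseq pi y2 -> measurable A ->
  P (y1 @^-1` A) = P (y2 @^-1` A).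
Proof.
move=> [m1 i1] [m2 i2] mA.
have M1 : measurable_fun setT (y1 : T -> seqR) by exact: meas_seq.
have M2 : measurable_fun setT (y2 : T -> seqR) by exact: meas_seq.
pose Y1 : {mfun T >-> seqR} := mfun_Sub (mem_set M1).
pose Y2 : {mfun T >-> seqR} := mfun_Sub (mem_set M2).
apply: (@measure_unique _ R seqR cylS (fun=> setT) erefl _ _ _ (distribution P Y1) (distribution P Y2)) => //.
- move=> _ _ [K [B [mB ->]]] [K' [B' [mB' ->]]].
  exists (maxn K K'), (fun i => (if (i < K)%N then B i else setT) `&` (if (i < K')%N then B' i else setT)).
  split; first by move=> i; apply: measurableI; case: ifP => _ //; exact: measurableT.
  apply/seteqP; split => x /=.
    by move=> [h1 h2] k _; split; case: ifP => // kK; [exact: h1|exact: h2].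
  move=> H; split=> k kK; have := H k; rewrite leq_max kK ?orbT => /(_ isT) [].
    by [].
  by [].
- by move=> _; exists 0%N, (fun=> setT); split => //; apply/seteqP; split.
- by apply/seteqP; split => // x _; exists 0%N.
- by move=> _ [K [B [mB ->]]]; exact: (etrans (i1 K B mB) (esym (i2 K B mB))).
- by move=> _; apply: (@le_lt_trans _ _ 1%E); [exact: (@probability_le1 _ _ _ P setT measurableT)|exact: ltry].
Qed.

(** Equality of laws is transported only for squares, whose integrals are defined without an
    integrability condition; means and covariances are recovered from second moments by
    polarization. *)
Lemma iidseq_sqint pi y1 y2 (h : (nat -> R) -> R) : iidseq pi y1 -> iidseq pi y2 ->
  measurable_fun setT (h : seqR -> R) -> sqint P (fun w => h (y1 w)) ->
  sqint P (fun w => h (y2 w)) /\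
  Er P (fun w => h (y2 w) ^+ 2) = Er P (fun w => h (y1 w) ^+ 2).
Proof.
move=> l1 l2 mh [mh1 ih1].
have M1 : measurable_fun setT (y1 : T -> seqR) by apply: meas_seq; case: l1.
have M2 : measurable_fun setT (y2 : T -> seqR) by apply: meas_seq; case: l2.
pose Y1 : {mfun T >-> seqR} := mfun_Sub (mem_set M1).
pose Y2 : {mfun T >-> seqR} := mfun_Sub (mem_set M2).
have mh2 : measurable_fun setT (fun x : seqR => (h x ^+ 2)%:E).
  by apply/measurable_EFinP; exact: measurable_funX.
have h0 (x : seqR) : (0 <= (h x ^+ 2)%:E)%E by rewrite lee_fin sqr_ge0.
have e1 := @ge0_integral_distribution _ _ T seqR R P Y1 (fun x : seqR => (h x ^+ 2)%:E) mh2 h0.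
have e2 := @ge0_integral_distribution _ _ T seqR R P Y2 (fun x : seqR => (h x ^+ 2)%:E) mh2 h0.
have e3 : (\int[distribution P Y1]_x (h x ^+ 2)%:E = \int[distribution P Y2]_x (h x ^+ 2)%:E)%E.
  by apply: eq_measure_integral => A mA _; exact: (iidseq_law l1 l2).
rewrite e1 e2 in e3.
have mhy2 : measurable_fun setT (fun w => h (y2 w)) := measurableT_comp mh M2.
split; last by rewrite !ErE /Rintegral; congr fine.
split => //; apply/integrableP; split; first by apply/measurable_EFinP; exact: measurable_funX.
have /integrableP[_] := ih1.
rewrite (_ : (\int[P]_x _ = \int[P]_x (h (y1 x) ^+ 2)%:E)%E); last first.
  by apply: eq_integral => w _ /=; rewrite ger0_norm ?sqr_ge0.
rewrite (_ : (\int[P]_x `|_| = \int[P]_x (h (y2 x) ^+ 2)%:E)%E); last first.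
  by apply: eq_integral => w _ /=; rewrite ger0_norm ?sqr_ge0.
have e4 : (\int[P]_x (h (y1 x) ^+ 2)%:E = \int[P]_x (h (y2 x) ^+ 2)%:E)%E := e3.
by rewrite e4.
Qed.

End Law.
End SeqSpace.

(** * Density of functions of finitely many quantized coordinates *)

Section Density.
Context {R : realType}.
Local Notation seqR := (@seqR R).

Definition cyl (kap : R -> nat) K (Phi : (nat -> R) -> R) :=
  forall x x', (forall k, (k < K)%N -> kap (x k) = kap (x' k)) -> Phi x = Phi x'.

Lemma cyl_word kap K Phi : cyl kap K Phi ->
  exists2 F : (nat -> nat) -> R, dep_on (fun k => (k < K)%N) F &
    forall x, Phi x = F (fun k => kap (x k)).
Proof.
(* Each code in the image of [kap] gets a representative real number, so [Phi] can be evaluated on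
   words; codes outside the image receive the default 0 and never arise. *)
move=> cPhi; pose rep a := xget 0 [set x : R | kap x = a].
have kr x : kap (rep (kap x)) = kap x.
  by rewrite /rep; case: xgetP => [y _ //|/(_ x)]; case.
exists (fun w => Phi (fun k => rep (w k))) => [w w' H|x].
  by apply: cPhi => k kK; rewrite H.
by apply: cPhi => k _; rewrite kr.
Qed.

Lemma cyl_meas kap N K Phi : quant kap N -> cyl kap K Phi ->
  measurable_fun setT (Phi : seqR -> R) /\ exists M, forall x, `|Phi x| <= M.
Proof.
move=> [b mk] /cyl_word[F dF E].
have := @letters_meas R _ seqR (fun k x => kap (x k)) (fun=> N) (fun k x => b (x k)) _ K F dF.
rewrite (_ : (fun w : seqR => _) = Phi); last by apply/funext => x; rewrite E.
case => [i a|mPhi [M HM]]; last by split => //; exists M => x; rewrite E.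
exact: (cylS_coord i (mk a)).
Qed.

Lemma cyl_sub kap kap' K K' Phi : (forall x y, kap' x = kap' y -> kap x = kap y) ->
  (K <= K')%N -> cyl kap K Phi -> cyl kap' K' Phi.
Proof.
by move=> kk KK c x x' H; apply: c => k kK; apply: kk; apply: H; exact: leq_trans KK.
Qed.

Context {d : measure_display} {T : measurableType d} (P : probability T R).
Variable y : T -> nat -> R.
Hypothesis my : forall k, measurable_fun setT (fun w => y w k).

Let My : measurable_fun setT (y : T -> seqR) := meas_seq my.

Let meas_comp (h : (nat -> R) -> R) : measurable_fun setT (h : seqR -> R) ->
  measurable_fun setT (fun w => h (y w)) := fun mh => measurableT_comp mh My.

(** These sets form a sigma-algebra containing the coordinate events, hence contain every measurable
    set. Keeping values in [[0, 1]] makes products stable in L1. *)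
Definition approx_set (A : set seqR) := measurable A /\ forall e : R, 0 < e ->
  exists kap N K Phi, [/\ quant kap N, cyl kap K Phi, forall x, 0 <= Phi x <= 1 &
    Er P (fun w => `|\1_A (y w) - Phi (y w)|) <= e].

Let ind_int (A B : (nat -> R) -> R) : measurable_fun setT (A : seqR -> R) -> measurable_fun setT (B : seqR -> R) ->
  (forall x, 0 <= A x <= 1) -> (forall x, 0 <= B x <= 1) ->
  int1 P (fun w => `|A (y w) - B (y w)|).
Proof.
move=> mA mB A1 B1; apply: (@int1_bnd _ _ _ P _ 1).
  by apply: measurableT_comp => //; apply: measurable_funB; exact: meas_comp.
move=> w; rewrite normr_id ler_norml; have := A1 (y w); have := B1 (y w); lra.
Qed.

Let ind01 (A : set seqR) x : 0 <= (\1_A x : R) <= 1.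
Proof. by rewrite indicE; case: (x \in A); rewrite /= ?lexx ?ler01. Qed.

Let mind (A : set seqR) : measurable A -> measurable_fun setT (\1_A : seqR -> R).
Proof. by move=> mA; exact: measurable_indic. Qed.

Lemma approx_setC A : approx_set A -> approx_set (~` A).
Proof.
move=> [mA H]; split; first exact: measurableC.
move=> e e0; have [kap [N [K [Phi [q c P1 E]]]]] := H e e0.
exists kap, N, K, (fun x => 1 - Phi x); split => //.
- by move=> x x' h; rewrite (c x x').
- by move=> x; have := P1 x; lra.
apply: le_trans E; rewrite (eq_Er P (Y := fun w => `|\1_A (y w) - Phi (y w)|))// => w.
rewrite !indicE in_setC; case: (_ \in A) => /=; rewrite -normrN; congr `|_|; ring.
Qed.

Lemma approx_setI A B : approx_set A -> approx_set B -> approx_set (A `&` B).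
Proof.
move=> [mA HA] [mB HB]; split; first exact: measurableI.
move=> e e0; have e2 : 0 < e / 2 by lra.
have [k1 [N1 [K1 [F1 [q1 c1 P1 E1]]]]] := HA _ e2.
have [k2 [N2 [K2 [F2 [q2 c2 P2 E2]]]]] := HB _ e2.
have [k [N [q kk]]] := quant_pair q1 q2.
have d1 := cyl_sub (fun x y h => proj1 (kk x y h)) (leq_maxl K1 K2) c1.
have d2 := cyl_sub (fun x y h => proj2 (kk x y h)) (leq_maxr K1 K2) c2.
have cF : cyl k (maxn K1 K2) (fun x => F1 x * F2 x).
  by move=> x x' h; rewrite (d1 x x')// (d2 x x').
have F01 x : 0 <= F1 x * F2 x <= 1.
  have := P1 x; have := P2 x => /andP[a b] /andP[a' b'].
  by rewrite mulr_ge0//= mulr_ile1.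
exists k, N, (maxn K1 K2), (fun x => F1 x * F2 x); split => //.
have [m1 _] := cyl_meas q1 c1; have [m2 _] := cyl_meas q2 c2; have [m3 _] := cyl_meas q cF.
have i1 := ind_int (mind mA) m1 (ind01 A) P1.
have i2 := ind_int (mind mB) m2 (ind01 B) P2.
have i3 := ind_int (mind (measurableI _ _ mA mB)) m3 (ind01 _) F01.
apply: (@le_trans _ _ (Er P (fun w => `|\1_A (y w) - F1 (y w)| + `|\1_B (y w) - F2 (y w)|))); last first.
  by rewrite ErD//; lra.
apply: Er_le => //; first exact: int1D.
move=> w; rewrite indicI/=.
have -> : \1_A (y w) * \1_B (y w) - F1 (y w) * F2 (y w) =
  (\1_A (y w) - F1 (y w)) * \1_B (y w) + F1 (y w) * (\1_B (y w) - F2 (y w)) :> R by ring.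
rewrite (le_trans (ler_normD _ _))// !normrM lerD// ?ler_piMr// ?ler_piMl//.
  by have /andP[h0 h1] := ind01 B (y w); rewrite ger0_norm.
by have /andP[h0 h1] := P1 (y w); rewrite ger0_norm.
Qed.

Lemma approx_setU A B : approx_set A -> approx_set B -> approx_set (A `|` B).
Proof.
move=> hA hB; rewrite -(setCK (A `|` B)) setCU.
by apply: approx_setC; apply: approx_setI; exact: approx_setC.
Qed.

Lemma approx_set_cst (b : bool) : approx_set [set _ | b].
Proof.
have mS : measurable ([set _ | b] : set seqR).
  case: b; first by rewrite (_ : [set _ | _] = setT)//; apply/seteqP; split.
  by rewrite (_ : [set _ | _] = set0)//; apply/seteqP; split.
split => // e e0.
have [k [N [q _]]] := @quant_seq R (fun=> fun=> 0%N) (fun=> 1%N) 0 (fun i (h : (i < 0)%N) => False_ind _ (notF h)).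
exists k, N, 0%N, (fun=> b%:R); split => //; first by move=> x; case: b {mS}; rewrite /= ?lexx ?ler01.
rewrite (eq_Er P (Y := fun=> 0)); first by rewrite Er_cst ltW.
move=> w; rewrite indicE (_ : (y w \in _) = b) ?subrr ?normr0//.
by apply/idP/idP; rewrite inE.
Qed.

Lemma approx_set_bigcup (A : (set seqR)^nat) : (forall i, approx_set (A i)) -> approx_set (\bigcup_i A i).
Proof.
move=> hA; have mA : measurable (\bigcup_i A i) by apply: bigcup_measurable => i _; case: (hA i).
pose B m := [set x | exists2 i, (i < m)%N & A i x].
have hB m : approx_set (B m).
  elim: m => [|m IH].
    rewrite (_ : B 0%N = [set _ | false]); first exact: approx_set_cst.
    by apply/seteqP; split => // x [].
  rewrite (_ : B m.+1 = B m `|` A m); first exact: approx_setU.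
  apply/seteqP; split => x.
    move=> [i]; rewrite ltnS leq_eqVlt => /orP[/eqP ->|im] Ai; [by right|by left; exists i].
  by move=> [[i im Ai]|Am]; [exists i => //; exact: ltnW|exists m].
split => // e e0; have e2 : 0 < e / 2 by lra.
pose D m w : R := `|\1_(\bigcup_i A i) (y w) - \1_(B m) (y w)|.
have iD m : int1 P (D m).
  by apply: ind_int; [exact: mind|apply: mind; case: (hB m)|exact: ind01|exact: ind01].
have HD : measurable_fun [set: T] ((fun=> 0) : T -> R) /\
    (fun m => Er P (D m)) @ \oo --> Er P (fun=> 0).
  apply: (Er_dct (Z := fun=> 1)) => [m|m w||w]; [exact: int1_meas| |exact: int1_cst|].
    rewrite normr_id ler_norml.
    have := ind01 (\bigcup_i A i) (y w); have := ind01 (B m) (y w); lra.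
  apply: cvg_near_cst; have [[i _ Ai]|nA] := pselect ((\bigcup_i A i) (y w)).
    near=> m; rewrite /D !indicE mem_set; last by exists i.
    rewrite mem_set ?subrr ?normr0//; exists i => //.
    by near: m; exact: nbhs_infty_gt.
  apply: nearW => m; rewrite /D !indicE memNset// memNset ?subrr ?normr0//.
  by move=> [i _ Ai]; apply: nA; exists i.
have [_ /cvgrPdist_lt/(_ (e / 2) e2)[m _ /(_ m (leqnn m))]] := HD.
rewrite Er_cst sub0r normrN => h.
have [mB /(_ _ e2)[k [N [K [F [q c F01 E]]]]]] := hB m.
exists k, N, K, F; split => //.
have [mF _] := cyl_meas q c.
have i1 := ind_int (mind mB) mF (ind01 _) F01.
apply: (@le_trans _ _ (Er P (fun w => D m w + `|\1_(B m) (y w) - F (y w)|))).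
  apply: Er_le; [exact: ind_int (mind mA) mF (ind01 _) F01|exact: int1D|move=> w].
  by rewrite /D (le_trans _ (ler_normD _ _))// addrA subrK.
rewrite ErD//; have := ler_norm (Er P (D m)); lra.
Unshelve. all: by end_near.
Qed.

Lemma approx_set_coord k (B : set R) : measurable B -> approx_set [set x | B (x k)].
Proof.
move=> mB; split; first exact: cylS_coord.
pose kap x := nat_of_bool (x \in B).
have q : quant kap 2.
  split=> [x|a]; first by rewrite /kap; case: (x \in B).
  case: a => [|[|a]].
  - rewrite (_ : [set x | _] = ~` B); first exact: measurableC.
    apply/seteqP; split => x; rewrite /kap /=; last by move=> h; rewrite memNset.
    by case: (boolP (x \in B)) => // /negP h _ Bx; apply: h; rewrite inE.
  - rewrite (_ : [set x | _] = B)//.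
    apply/seteqP; split => x; rewrite /kap /=; last by move=> h; rewrite mem_set.
    by case: (boolP (x \in B)) => //; rewrite inE.
  - rewrite (_ : [set x | _] = set0)//.
    by apply/seteqP; split => // x; rewrite /kap /=; case: (x \in B).
move=> e e0; exists kap, 2%N, k.+1, (fun x => (kap (x k))%:R); split => //.
- by move=> x x' H; rewrite H.
- by move=> x; rewrite /kap; case: (_ \in B); rewrite /= ?lexx ?ler01.
rewrite (eq_Er P (Y := fun=> 0)); first by rewrite Er_cst ltW.
move=> w; rewrite indicE /kap (_ : (y w \in _) = (y w k \in B)) ?subrr ?normr0//.
Qed.

Lemma approx_set_meas (A : set seqR) : measurable A -> approx_set A.
Proof.
move: A; rewrite -/((cylS.-sigma).-measurable `<=` approx_set); apply: smallest_sub.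
  split=> [|A hA|A hA].
  - rewrite (_ : set0 = [set _ | false]); first exact: approx_set_cst.
    by apply/seteqP; split.
  - by rewrite setTD; exact: approx_setC.
  - exact: approx_set_bigcup.
move=> _ [K [B [mB ->]]]; elim: K => [|K IH].
  rewrite (_ : [set x | _] = [set _ | true]); first exact: approx_set_cst.
  by apply/seteqP; split.
rewrite (_ : [set x | _] = [set x : seqR | forall k, (k < K)%N -> B k (x k)] `&` [set x | B K (x K)]).
  by apply: approx_setI => //; exact: approx_set_coord.
apply/seteqP; split => x /=.
  by move=> H; split; [move=> k kK; apply: H; exact: ltnW|exact: H].
by move=> [H1 H2] k; rewrite ltnS leq_eqVlt => /orP[/eqP ->|]; [exact: H2|exact: H1].
Qed.

Lemma approx_fun (h : (nat -> R) -> R) (e : R) : measurable_fun setT (h : seqR -> R) ->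
  sqint P (fun w => h (y w)) -> 0 < e ->
  exists kap N K Phi, [/\ quant kap N, cyl kap K Phi &
    Er P (fun w => (h (y w) - Phi (y w)) ^+ 2) <= e ^+ 2].
Proof.
move=> mh sh e0; have e2 : 0 < e / 2 by lra.
have [kh [Nh [v [[bh mk] vle Eq]]]] := quantize sh (exprn_gt0 2 e2).
pose V := \sum_(a < Nh) `|v a|; have V0 : 0 <= V by exact: sumr_ge0.
(* The level sets are approximated in L1 within [s ^+ 2]; the differences are bounded by 1, so the
   L2 error is at most [s], and the weights [|v a|] sum to [V]. *)
pose s := e / 2 / (V + 1).
have s0 : 0 < s by rewrite divr_gt0//; lra.
pose A a : set seqR := [set x | kh (h x) = a].
have mA a : measurable (A a).
  by have := mh measurableT _ (mk a); rewrite setTI.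
have HA a : exists z : (R -> nat) * nat * nat * ((nat -> R) -> R),
    [/\ quant z.1.1.1 z.1.1.2, cyl z.1.1.1 z.1.2 z.2, forall x, 0 <= z.2 x <= 1 &
    Er P (fun w => `|\1_(A a) (y w) - z.2 (y w)|) <= s ^+ 2].
  have [_ /(_ _ (exprn_gt0 2 s0))[k [N [K [F H]]]]] := approx_set_meas (mA a).
  by exists (k, N, K, F).
have [z Hz] := choice HA.
have [k [N [q kk]]] := @quant_seq R (fun a => (z a).1.1.1) (fun a => (z a).1.1.2) Nh
  (fun i _ => let: And4 p _ _ _ := Hz i in p).
pose K := \max_(a < Nh) (z a).1.2.
pose Phi x := \sum_(a < Nh) v a * (z a).2 x.
have ca (a : 'I_Nh) : cyl k K (z a).2.
  have [_ c _ _] := Hz a; apply: cyl_sub c; first by move=> x x'; exact: kk.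
  exact: (leq_bigmax (F := fun a : 'I_Nh => (z a).1.2)).
have cPhi : cyl k K Phi.
  by move=> x x' H; apply: eq_bigr => a _; rewrite (ca a x x').
exists k, N, K, Phi; split => //.
have mz a : measurable_fun setT ((z a).2 : seqR -> R).
  by have [q' c' _ _] := Hz a; have [] := cyl_meas q' c'.
have z01 a x : 0 <= (z a).2 x <= 1 by have [] := Hz a.
pose Da a w := v a * (\1_(A a) (y w) - (z a).2 (y w)).
have D1 a w : `|\1_(A a) (y w) - (z a).2 (y w)| <= 1.
  rewrite ler_norml; have := ind01 (A a) (y w); have := z01 a (y w); lra.
have sD a : sqint P (Da a).
  apply: (@sqint_bnd _ _ _ P _ `|v a|).
    apply: measurable_funM => //; apply: measurable_funB; apply: meas_comp => //.
  by move=> w; rewrite normrM ler_piMr.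
have E w : h (y w) - Phi (y w) = (h (y w) - v (kh (h (y w)))) + \sum_(a < Nh) Da a w.
  have -> : v (kh (h (y w))) = \sum_(a < Nh) v a * \1_(A a) (y w).
    rewrite (bigD1 (Ordinal (bh (h (y w)))))//= indicE mem_set// mulr1 big1 ?addr0// => a /eqP ne.
    rewrite indicE memNset ?mulr0// => hA; apply: ne; apply: val_inj; exact: esym hA.
  have -> : \sum_(a < Nh) Da a w = \sum_(a < Nh) v a * \1_(A a) (y w) - Phi (y w).
    by rewrite /Phi -sumrB; apply: eq_bigr => a _; rewrite /Da mulrBr.
  ring.
rewrite (eq_Er P (Y := fun w => ((h (y w) - v (kh (h (y w)))) + \sum_(a < Nh) Da a w) ^+ 2)); last first.
  by move=> w; rewrite E.
have -> : e = e / 2 + e / 2 by lra.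
apply: Er_mink; [| |exact: ltW|exact: ltW|exact: Eq|].
- have qh : quant kh Nh by split.
  have mhy := measurableT_comp (quant_meas v qh) (proj1 sh).
  by apply: sqintB => //; apply: sqint_le sh => // w; exact: vle.
- by apply: sqint_sum => a _.
apply: (@le_trans _ _ ((\sum_(a < Nh) `|v a| * s) ^+ 2)).
  apply: Er_mink_sum => [a _|a _|a _]; [exact: sD|by rewrite mulr_ge0// ltW|].
  rewrite (eq_Er P (Y := fun w => v a ^+ 2 * (\1_(A a) (y w) - (z a).2 (y w)) ^+ 2)); last first.
    by move=> w; rewrite exprMn.
  have i2 : int1 P (fun w => (\1_(A a) (y w) - (z a).2 (y w)) ^+ 2).
    apply: (@int1_bnd _ _ _ P _ 1).
      by apply: measurable_funX; apply: measurable_funB; apply: meas_comp.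
    by move=> w; rewrite normrX exprn_ile1.
  rewrite ErZ// exprMn real_normK ?num_real// ler_wpM2l ?sqr_ge0//.
  have [_ _ _ Ea] := Hz a; apply: le_trans Ea; apply: Er_le => //.
    by apply: ind_int => //; exact: mind.
  move=> w; rewrite -real_normK ?num_real// expr2 ler_piMr//.
have Vs : V * s <= e / 2.
  have es : s * (V + 1) = e / 2 by rewrite /s mulrVK// unitfE gt_eqF//; lra.
  lra.
have Vs0 : 0 <= V * s by apply: mulr_ge0 => //; exact: ltW.
by rewrite -mulr_suml -/V; apply: lerXn2r; rewrite ?nnegrE//; lra.
Qed.

End Density.

(** * The innovations as letters *)

Section Model.
Context {R : realType} {d : measure_display} {T : measurableType d} (P : probability T R).
Variables eps epss : int -> T -> R.
Hypothesis Heps_meas : forall i, measurable_fun setT (eps i) /\ measurable_fun setT (epss i).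
Hypothesis Hindep : mutual_indep P (joint_family eps epss).
Hypothesis Hident : ident_distr P (joint_family eps epss).
Let fam := joint_family eps epss.
Let mfam s : measurable_fun setT (fam s).
Proof. by case: s => i; case: (Heps_meas i). Qed.

Definition marg (B : set R) := P (eps 0 @^-1` B).

Lemma family_indep (idx : nat -> int + int) m (B : nat -> set R) : injective idx ->
  (forall i, measurable (B i)) ->
  P (\bigcap_(i in `I_m) (fam (idx i) @^-1` B i)) = (\prod_(i < m) marg (B i))%E.
Proof.
move=> inj mB; rewrite (Hindep (m := m) (idx := idx)) //; last by move=> i j _ _; exact: inj.
by apply: eq_bigr => i _; rewrite /marg (Hident (idx i) (inl 0)).
Qed.

Lemma family_iid (idx : nat -> int + int) : injective idx ->
  iidseq P marg (fun w k => fam (idx k) w).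
Proof.
move=> inj; split=> [k|m B mB]; first exact: mfam.
by rewrite -(family_indep m inj mB); congr (P _); apply/seteqP; split => w /= H k; apply: H.
Qed.

Lemma eps_seq_iid t : iidseq P marg (eps_seq eps t).
Proof.
have H : injective (fun k : nat => (inl (t - k%:Z) : int + int)).
  by move=> i j [] /(congr1 (fun x => t - x)); rewrite !subKr => -[].
exact: (family_iid H).
Qed.

Lemma eps_tilde_iid t j : iidseq P marg (eps_tilde eps epss t j).
Proof.
have H : injective (fun k : nat => if k == j then (inr (t - j%:Z) : int + int) else inl (t - k%:Z)).
  move=> i k; case: eqP => [->|_]; case: eqP => [->|_] //.
  by move=> [] /(congr1 (fun x => t - x)); rewrite !subKr => -[].
have := family_iid H; rewrite (_ : (fun w k => _) = eps_tilde eps epss t j)//.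
by apply/funext => w; apply/funext => k; rewrite /eps_tilde; case: eqP.
Qed.

Section Kap.
Variables (kap : R -> nat) (N : nat).
Hypothesis q : quant kap N.

Definition letter_law (phi : nat -> R) :=
  \sum_(a < N) fine (marg [set x | kap x = a]) * phi a.

Variable idx : nat -> int + int.
Hypothesis inj : injective idx.
Let l c w := kap (fam (idx c) w).

Let ml i a : measurable [set w | l i w = a].
Proof. by have := mfam (idx i) measurableT (proj2 q a); rewrite setTI. Qed.

Let Er_ind i a : Er P (fun w => (l i w == a)%:R) = fine (marg [set x | kap x = a]).
Proof.
rewrite /marg (Hident (inl 0) (idx i) (proj2 q a)) -/fam.
rewrite (eq_Er P (Y := \1_[set w | l i w = a])).
  by rewrite /Er expectation_indic.
move=> w; rewrite indicE; congr (nat_of_bool _)%:R.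
by apply/eqP/idP => [?|]; rewrite inE.
Qed.

(** Any injective choice of innovations and copies may serve as the source of the word. A copy can
    therefore be appended as one additional letter, which turns resampling into coupling. *)
Lemma word_bridge m (F : (nat -> nat) -> R) w0 : dep_on (fun k => (k < m)%N) F ->
  Er P (fun w => F (fun c => kap (fam (idx c) w))) = avgs (fun=> letter_law) m F w0.
Proof.
move=> dF.
have lmE : lmean P l (fun=> N) = fun=> letter_law.
  apply/funext => i; apply/funext => phi; rewrite /lmean /letter_law.
  by apply: eq_bigr => a _; rewrite Er_ind.
have := @letters_bridge R d T P l (fun=> N) (fun i w => proj1 q _) ml _ m F w0 dF.
rewrite lmE; apply => {F w0 dF} {}m a.
under [RHS]eq_bigr do rewrite Er_ind.
have key : P (\bigcap_(i in `I_m) (fam (idx i) @^-1` [set x | kap x = a i])) =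
    (\prod_(0 <= i < m) fine (marg [set x | kap x = a i]))%:E.
  rewrite (family_indep m (B := fun i => [set x | kap x = a i]) inj); last by move=> i; exact: (proj2 q).
  rewrite -(big_mkord xpredT (fun i => marg [set x | kap x = a i])).
  elim: (m) => [|k IH]; first by rewrite !big_geq.
  rewrite !big_nat_recr//= IH EFinM; congr (_ * _)%E.
  rewrite fineK// /marg fin_num_measure//.
  by have := mfam (inl 0) measurableT (proj2 q (a k)); rewrite setTI.
rewrite (eq_Er P (Y := \1_(\bigcap_(i in `I_m) (fam (idx i) @^-1` [set x | kap x = a i])))).
  rewrite /Er expectation_indic ?key//.
  apply: bigcap_measurableType => i _.
  by have := mfam (idx i) measurableT (proj2 q (a i)); rewrite setTI.
move=> w; rewrite indicE; case: (boolP (_ \in _)) => [|/negP] h.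
  rewrite big_nat big1// => i /andP[_ im].
  by move: h; rewrite inE => /(_ i im) /= h; rewrite /l h eqxx.
apply/eqP; rewrite prodf_seq_eq0/=; apply/hasP.
have : ~ forall i, (i < m)%N -> kap (fam (idx i) w) = a i.
  by move=> h'; apply: h; rewrite inE.
move=> /existsNP[i /not_implyP[im /eqP ne]]; exists i; first by rewrite mem_index_iota.
by rewrite /l (negbTE ne).
Qed.

Lemma word_sqint m (F : (nat -> nat) -> R) : dep_on (fun k => (k < m)%N) F ->
  sqint P (fun w => F (fun c => kap (fam (idx c) w))).
Proof.
move=> dF.
have [mF [M HM]] := @letters_meas R d T l (fun=> N) (fun i w => proj1 q _) ml m F dF.
exact: (@sqint_bnd _ _ _ P _ M mF HM).
Qed.

Lemma letter_law_mean : is_mean letter_law.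
Proof.
have lmE : lmean P l (fun=> N) 0%N = letter_law.
  apply/funext => phi; rewrite /lmean /letter_law.
  by apply: eq_bigr => a _; rewrite Er_ind.
rewrite -lmE; apply: lmean_mean; [by move=> *; exact: (proj1 q)|exact: ml].
Qed.

End Kap.

(** A martingale difference is the average of [F] minus [F] with letter [c] replaced by an
    independent value; Jensen's inequality moves the square inside. This links orthogonal increments
    to the coupling assumption. *)
Lemma mdiff_resample (A : Type) (mu : nat -> (A -> R) -> R) (Hmu : forall i, is_mean (mu i)) (N : nat)
    (p : nat -> R) (v : nat -> A) c M (F : (nat -> A) -> R) w :
  (forall phi, mu c phi = \sum_(a < N) p a * phi (v a)) -> (c < M)%N ->
  avgs mu M (fun w => mdiff mu c F w ^+ 2) w <=
  mu c (fun b => avgs mu M (fun w => (F w - F (upd w c b)) ^+ 2) w).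
Proof.
move=> muE cM; have HM := avgs_mean Hmu M w.
rewrite muE.
apply: (@le_trans _ _ (avgs mu M (fun w => \sum_(a < N) p a * avgs mu c (fun w => (F w - F (upd w c (v a))) ^+ 2) w) w)).
  apply: (mean_le HM) => w'.
  have -> : mdiff mu c F w' = mu c (fun b => avgs mu c (fun w => F w - F (upd w c b)) w').
    rewrite /mdiff /= /avg -[X in X - _](mean_cst (Hmu c)) -(meanB (Hmu c)); apply: eq_mean => b.
    by rewrite (meanB (avgs_mean Hmu c w')) avgs_upd.
  rewrite -[leRHS](muE (fun b => avgs mu c (fun w => (F w - F (upd w c b)) ^+ 2) w')).
  apply: (le_trans (mean_sqr (Hmu c) _)); apply: (mean_le (Hmu c)) => b.
  exact: (mean_sqr (avgs_mean Hmu c w')).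
rewrite (mean_sum HM (index_enum 'I_N) xpredT (fun (a : 'I_N) w => p a * avgs mu c (fun w => (F w - F (upd w c (v a))) ^+ 2) w)).
by apply: ler_sum => a _; rewrite (meanZ HM) (avgs_avgs Hmu _ (ltnW cM)).
Qed.

Variables (n : nat) (g : nat -> (nat -> R) -> R) (C rho : R).
Hypotheses (C0 : 0 < C) (rho01 : 0 < rho < 1).
Hypothesis mg : forall i, measurable_fun setT (g i : seqR -> R).
Let Y i : T -> nat -> R := eps_seq eps i.+1%:Z.
Let Yt i j : T -> nat -> R := eps_tilde eps epss i.+1%:Z j.
Hypothesis sg : forall i, sqint P (fun w => g i (Y i w)).
Hypothesis Eg : forall i, Er P (fun w => g i (Y i w)) = 0.
Hypothesis Dg : forall i j, Er P (fun w => (g i (Y i w) - g i (Yt i j w)) ^+ 2) <= (C * rho ^+ j) ^+ 2.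

(** A rough approximation fixes a memory length [K1]. A finer one has an error below the coupling
    bound at all lags less than [K1], so it keeps that bound up to a factor 2. Averaging out the
    lags from [K1] on kills the remaining increments, and costs little because the rough
    approximation does not depend on those letters. *)
Lemma letter_model (eta : R) : 0 < eta ->
  exists (mu : (nat -> R) -> R) K (word : T -> nat -> nat) (Z : nat -> (nat -> nat) -> R),
  [/\ is_mean mu,
   forall F, dep_on (fun k => (k < n + K)%N) F -> sqint P (fun w => F (word w)) /\
       Er P (fun w => F (word w)) = avgs (fun=> mu) (n + K) F (fun=> 0%N),
   forall i, dep_on (fun k => (k < (i + K).+1)%N) (Z i) /\ forall w, avgs (fun=> mu) (i + K).+1 (Z i) w = 0,
   forall i c, (i < n)%N -> (c <= i + K)%N ->
     avgs (fun=> mu) (n + K) (fun w => mdiff (fun=> mu) c (Z i) w ^+ 2) (fun=> 0%N) <= (2 * C * rho ^+ (i + K - c)) ^+ 2 &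
   forall i, (i < n)%N -> Er P (fun w => (g i (Y i w) - Z i (word w)) ^+ 2) <= eta ^+ 2].
Proof.
move=> eta0; have r0 : 0 < rho by case/andP: rho01.
have r1 : rho <= 1 by case/andP: rho01 => _ /ltW.
have mY i k : measurable_fun setT (fun w => Y i w k) by have [h _] := eps_seq_iid i.+1%:Z; exact: h.
have H1 i : exists z : (R -> nat) * nat * nat * ((nat -> R) -> R),
   [/\ quant z.1.1.1 z.1.1.2, cyl z.1.1.1 z.1.2 z.2 &
    Er P (fun w => (g i (Y i w) - z.2 (Y i w)) ^+ 2) <= (eta / 4) ^+ 2].
  have e4 : 0 < eta / 4 by rewrite divr_gt0.
  by have [k [N [K [F H]]]] := approx_fun (mY i) (mg i) (sg i) e4; exists (k, N, K, F).
have [z1 Hz1] := choice H1.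
pose K1 := \max_(i < n) (z1 i).1.2.
(* The second entry is half the coupling bound at lag [K1]: two approximation errors plus
   [C * rho ^+ j] then stay within [2 * C * rho ^+ j] for every [j < K1]. *)
pose e2 := Num.min (eta / 8) (C * rho ^+ K1 / 2).
have e20 : 0 < e2 by rewrite lt_min !divr_gt0// mulr_gt0// exprn_gt0.
have H2 i : exists z : (R -> nat) * nat * nat * ((nat -> R) -> R),
   [/\ quant z.1.1.1 z.1.1.2, cyl z.1.1.1 z.1.2 z.2 &
    Er P (fun w => (g i (Y i w) - z.2 (Y i w)) ^+ 2) <= e2 ^+ 2].
  by have [k [N [K [F H]]]] := approx_fun (mY i) (mg i) (sg i) e20; exists (k, N, K, F).
have [z2 Hz2] := choice H2.
pose K := maxn K1 (\max_(i < n) (z2 i).1.2).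
have [k1 [N1 [q1 kk1]]] := @quant_seq R (fun i => (z1 i).1.1.1) (fun i => (z1 i).1.1.2) n
  (fun i _ => let: And3 p _ _ := Hz1 i in p).
have [k2 [N2 [q2 kk2]]] := @quant_seq R (fun i => (z2 i).1.1.1) (fun i => (z2 i).1.1.2) n
  (fun i _ => let: And3 p _ _ := Hz2 i in p).
have [kap [N [q kk]]] := quant_pair q1 q2.
have c1 i : (i < n)%N -> cyl kap K1 (z1 i).2.
  move=> ni; have [_ c _] := Hz1 i; apply: cyl_sub c.
    by move=> x y /kk[h _]; exact: kk1 h.
  exact: (leq_bigmax (F := fun i : 'I_n => (z1 i).1.2) (Ordinal ni)).
have c2 i : (i < n)%N -> cyl kap K (z2 i).2.
  move=> ni; have [_ c _] := Hz2 i; apply: cyl_sub c.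
    by move=> x y /kk[_ h]; exact: kk2 h.
  rewrite leq_max; apply/orP; right.
  exact: (leq_bigmax (F := fun i : 'I_n => (z2 i).1.2) (Ordinal ni)).
have HF1 i : exists F : (nat -> nat) -> R, (i < n)%N ->
   dep_on (fun k => (k < K1)%N) F /\ forall x, (z1 i).2 x = F (fun k => kap (x k)).
  have [ni|_] := boolP (i < n)%N; last by exists (fun=> 0).
  by have [F dF E] := cyl_word (c1 i ni); exists F.
have HF2 i : exists F : (nat -> nat) -> R, (i < n)%N ->
   dep_on (fun k => (k < K)%N) F /\ forall x, (z2 i).2 x = F (fun k => kap (x k)).
  have [ni|_] := boolP (i < n)%N; last by exists (fun=> 0).
  by have [F dF E] := cyl_word (c2 i ni); exists F.
have [F1 HF1'] := choice HF1; have [F2 HF2'] := choice HF2.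
pose lag i (w : nat -> nat) k := w (i + K - k)%N.
pose Y1 i w := F1 i (lag i w); pose Y2 i w := F2 i (lag i w).
have K1K : (K1 <= K)%N by exact: leq_maxl.
have dY1 i : (i < n)%N -> dep_on (fun k => ((i + K).+1 - K1 <= k < (i + K).+1)%N) (Y1 i).
  move=> ni w w' H; have [dF _] := HF1' i ni; apply: dF => k kK; apply: H; lia.
have dY2 i : (i < n)%N -> dep_on (fun k => (k < (i + K).+1)%N) (Y2 i).
  move=> ni w w' H; have [dF _] := HF2' i ni; apply: dF => k kK; apply: H; lia.
(* Index [i] stands for time [i + 1], and position [i + K] of the word carries the innovation of
   that time. *)
pose time (c : nat) : int := c%:Z - K%:Z + 1.
have time_inj : injective time by move=> x y; rewrite /time; lia.
pose idx0 c : int + int := inl (time c).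
have inj0 : injective idx0 by move=> x y [] /time_inj.
pose word w c := kap (fam (idx0 c) w).
pose mu := letter_law kap N.
have Hmu : is_mean mu := letter_law_mean q idx0.
pose mus (_ : nat) := mu; have Hmus i : is_mean (mus i) by [].
pose M := (n + K)%N; pose w0 (_ : nat) := 0%N.
pose E F := avgs mus M F w0; have HE : is_mean E := avgs_mean Hmus M w0.
have bridge F : dep_on (fun k => (k < M)%N) F -> sqint P (fun w => F (word w)) /\
       Er P (fun w => F (word w)) = E F.
  by move=> dF; split; [exact: (word_sqint q idx0 dF)|exact: (word_bridge q inj0 w0 dF)].
have iKM i : (i < n)%N -> ((i + K).+1 <= M)%N by move=> ni; rewrite /M -addSn leq_add2r.
have depM i (F : (nat -> nat) -> R) : (i < n)%N -> dep_on (fun k => (k < (i + K).+1)%N) F -> dep_on (fun k => (k < M)%N) F.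
  by move=> ni dF w w' H; apply: dF => k kk'; apply: H; exact: leq_trans (iKM i ni).
have Y1word i w : (i < n)%N -> Y1 i (word w) = (z1 i).2 (Y i w).
  move=> ni; have [dF ->] := HF1' i ni; apply: dF => k kK.
  rewrite /lag /word /Y /eps_seq /=; congr (kap (eps _ w)); rewrite /time; lia.
have Y2word i w : (i < n)%N -> Y2 i (word w) = (z2 i).2 (Y i w).
  move=> ni; have [dF ->] := HF2' i ni; apply: dF => k kK.
  rewrite /lag /word /Y /eps_seq /=; congr (kap (eps _ w)); rewrite /time; lia.
pose ci i := ((i + K).+1 - K1)%N.
pose m i := E (Y2 i).
(* Positions below [ci i] are those of lag at least [K1]. Subtracting the mean [m i] restores the
   exact centring that the approximation has lost. *)
pose Z i w := if (i < n)%N then avgs mus (ci i) (Y2 i) w - m i else 0.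
have ciM i : (i < n)%N -> (ci i <= M)%N.
  by move=> ni; apply: leq_trans (iKM i ni); exact: leq_subr.
have dZ i : dep_on (fun k => (k < (i + K).+1)%N) (Z i).
  move=> w w' H; rewrite /Z; case: (boolP (i < n)%N) => // ni; congr (_ - _).
  by apply: (dep_avgs mus (dY2 i ni)) => k /andP[h _]; exact: H.
have mZ c i w : (i < n)%N -> mdiff mus c (Z i) w = if (ci i <= c)%N then mdiff mus c (Y2 i) w else 0.
  move=> ni.
  have e b v : avgs mus b (Z i) v = avgs mus b (avgs mus (ci i) (Y2 i)) v - m i.
    rewrite -[X in _ - X](mean_cst (avgs_mean Hmus b v)) -(meanB (avgs_mean Hmus b v)).
    by congr (avgs _ _ _ _); apply/funext => v'; rewrite /Z ni.
  rewrite /mdiff !e; case: leqP => h.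
    by rewrite !(avgs_avgs Hmus)// 1?leqW//; ring.
  by rewrite !(avgs_avgs_le Hmus) ?(ltnW h)//; ring.
have law2 i j : (i < n)%N -> sqint P (fun w => g i (Yt i j w) - (z2 i).2 (Yt i j w)) /\
    Er P (fun w => (g i (Yt i j w) - (z2 i).2 (Yt i j w)) ^+ 2) <= e2 ^+ 2.
  move=> ni; have [qz cz Ez] := Hz2 i.
  have [mz [B HB]] := cyl_meas qz cz.
  have sz : sqint P (fun w => g i (Y i w) - (z2 i).2 (Y i w)).
    by apply: sqintB => //; apply: (@sqint_bnd _ _ _ P _ B) => //; exact: (measurableT_comp mz (meas_seq (mY i))).
  have mh : measurable_fun setT ((fun x => g i x - (z2 i).2 x) : seqR -> R) by exact: measurable_funB.
  have [s e] := iidseq_sqint (eps_seq_iid i.+1%:Z) (eps_tilde_iid i.+1%:Z j) mh sz.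
  by split => //; rewrite e.
have sz2 i : sqint P (fun w => (z2 i).2 (Y i w)).
  have [qz cz _] := Hz2 i; have [mz [B HB]] := cyl_meas qz cz.
  by apply: (@sqint_bnd _ _ _ P _ B) => //; exact: (measurableT_comp mz (meas_seq (mY i))).
have sz1 i : sqint P (fun w => (z1 i).2 (Y i w)).
  have [qz cz _] := Hz1 i; have [mz [B HB]] := cyl_meas qz cz.
  by apply: (@sqint_bnd _ _ _ P _ B) => //; exact: (measurableT_comp mz (meas_seq (mY i))).
exists mu, K, word, Z; split => //.
- move=> i; split; [exact: dZ|move=> w; rewrite /Z].
  case: (boolP (i < n)%N) => ni; last by rewrite (mean_cst (avgs_mean Hmus _ w)).
  rewrite (meanB (avgs_mean Hmus _ w)) (mean_cst (avgs_mean Hmus _ w)).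
  rewrite (avgs_avgs Hmus _ (leq_subr _ _)) /m /E.
  by rewrite (avgs_const Hmus w0 w (iKM i ni) (dY2 i ni)) subrr.
- move=> i c ni ciK; rewrite -/mus -/(E _).
  rewrite (eq_mean E (g := fun w => (if (ci i <= c)%N then mdiff mus c (Y2 i) w else 0) ^+ 2)); last first.
    by move=> w; rewrite mZ.
  case: leqP => [h|_]; last by rewrite (mean_cst HE) expr0n sqr_ge0.
  pose j := (i + K - c)%N.
  have jK1 : (j < K1)%N by rewrite /j; move: h; rewrite /ci; lia.
  have cM : (c < M)%N by apply: leq_ltn_trans ciK _; exact: iKM.
  have HR := mdiff_resample Hmus (N := N) (p := fun a => fine (marg [set x | kap x = a])) (v := id) (Y2 i) w0 (fun phi => erefl) cM.
  apply: (le_trans HR).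
  pose G w := (Y2 i w - Y2 i (upd w c (w M))) ^+ 2.
  have dG : dep_on (fun k => (k < M.+1)%N) G.
    move=> w w' H; rewrite /G (H M)// (_ : Y2 i w = Y2 i w'); last first.
      by apply: (dY2 i ni) => k kk'; apply: H; apply: ltnW; apply: leq_ltn_trans kk' _; exact: iKM.
    congr ((_ - _) ^+ 2); apply: (dY2 i ni) => k kk'; rewrite /upd; case: ifP => // _.
    by apply: H; apply: ltnW; apply: leq_ltn_trans kk' _; exact: iKM.
  (* The additional position [M] carries the copy of the innovation at position [c], so substituting
     it there evaluates the function along [eps_tilde] at lag [j]. *)
  pose idx1 b : int + int := if b == M then inr (time c) else inl (time b).
  have inj1 : injective idx1.
    move=> x y; rewrite /idx1; case: eqP => [->|_]; case: eqP => [->|_] //.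
    by move=> [] /time_inj.
  have := word_bridge q inj1 w0 dG.
  have -> : avgs (fun=> letter_law kap N) M.+1 G w0 = mus c (fun b => avgs mus M (fun w => (Y2 i w - Y2 i (upd w c b)) ^+ 2) w0).
    rewrite /= /avg /mus; apply: eq_mean => b.
    rewrite avgs_upd//; congr (avgs _ _ _ _); apply/funext => w; rewrite /G.
    have e w' : Y2 i (upd w' M b) = Y2 i w'.
      by apply: (dY2 i ni) => k kk'; rewrite /upd ltn_eqF// (leq_trans kk')// iKM.
    have -> : upd w M b M = b by rewrite /upd eqxx.
    rewrite e -(e (upd w c b)); congr ((_ - Y2 i _) ^+ 2); apply/funext => k.
    by rewrite /upd; case: (k == c); case: (k == M).
  move=> <-.
  have wd w k : (k < M)%N -> kap (fam (idx1 k) w) = word w k.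
    by move=> kM; rewrite /idx1 ltn_eqF.
  rewrite (eq_Er P (Y := fun w => (((z2 i).2 (Y i w) - g i (Y i w)) + (g i (Y i w) - g i (Yt i j w)) +
     (g i (Yt i j w) - (z2 i).2 (Yt i j w))) ^+ 2)); last first.
    move=> w; rewrite /G.
    have -> : Y2 i (fun k => kap (fam (idx1 k) w)) = (z2 i).2 (Y i w).
      rewrite -Y2word//; apply: (dY2 i ni) => k kk'; rewrite wd//.
      by apply: leq_trans kk' _; exact: iKM.
    have -> : Y2 i (upd (fun k => kap (fam (idx1 k) w)) c (kap (fam (idx1 M) w))) = (z2 i).2 (Yt i j w).
      have [dF ->] := HF2' i ni; apply: dF => k kK.
      rewrite /lag /upd /Yt /eps_tilde; have [jk|jk] := eqVneq k j.
        have -> : (i + K - k)%N == c by rewrite jk /j; lia.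
        rewrite /idx1 eqxx /=; congr (kap (epss _ w)); rewrite /time /j; lia.
      have -> : ((i + K - k)%N == c) = false.
        by apply/eqP => hc; move/eqP: jk; apply; rewrite /j -hc; lia.
      have ikM : (i + K - k < M)%N by apply: leq_ltn_trans (leq_subr _ _) _; exact: iKM.
      rewrite wd// /word /idx0 /=; congr (kap (eps _ w)); rewrite /time; lia.
    congr (_ ^+ 2); ring.
  have [st Et] := law2 i j ni.
  have mh : measurable_fun setT (g i : seqR -> R) by exact: mg.
  have [sgt _] := iidseq_sqint (eps_seq_iid i.+1%:Z) (eps_tilde_iid i.+1%:Z j) mh (sg i).
  have rj : 0 < rho ^+ j by rewrite exprn_gt0.
  have Crj : 0 < C * rho ^+ j by rewrite mulr_gt0.
  have [_ _ Ez] := Hz2 i.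
  apply: (@le_trans _ _ ((e2 + C * rho ^+ j + e2) ^+ 2)).
    apply: Er_mink; [| exact: st | by rewrite addr_ge0// ltW | exact: ltW | | exact: Et].
      by apply: sqintD; apply: sqintB => //; exact: sgt.
    apply: Er_mink; [by apply: sqintB|by apply: sqintB => //; exact: sgt|exact: ltW|exact: ltW| |exact: Dg].
    apply: le_trans Ez; rewrite (eq_Er P (Y := fun w => (g i (Y i w) - (z2 i).2 (Y i w)) ^+ 2))// => w.
    by rewrite -sqrrN opprB.
  have e2j : e2 <= C * rho ^+ j / 2.
    apply: (@le_trans _ _ (C * rho ^+ K1 / 2)); first by rewrite ge_min lexx orbT.
    rewrite ler_wpM2r ?invr_ge0// ler_wpM2l ?(ltW C0)//.
    by apply: ler_wiXn2l; rewrite ?(ltW r0)// ltnW.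
  by rewrite -/j; apply: lerXn2r; rewrite ?nnegrE; lra.
move=> i ni.
have [_ _ Ez1] := Hz1 i; have [_ _ Ez2] := Hz2 i.
(* Averaging leaves [Y1 i] unchanged, so the loss [Y2 i - avgs (Y2 i)] equals [D - avgs D], and both
   of its terms are as small as the two approximation errors together. *)
pose D w := Y2 i w - Y1 i w.
have Dword w : D (word w) = ((z2 i).2 (Y i w) - g i (Y i w)) + (g i (Y i w) - (z1 i).2 (Y i w)).
  by rewrite /D Y1word// Y2word//; ring.
have dY1' : dep_on (fun k => (k < (i + K).+1)%N) (Y1 i).
  by move=> w w' H; apply: (dY1 i ni) => k /andP[_ h]; exact: H.
have dD : dep_on (fun k => (k < (i + K).+1)%N) D.
  by move=> w w' H; rewrite /D (dY2 i ni w w' H) (dY1' w w' H).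
have dDa : dep_on (fun k => (k < (i + K).+1)%N) (avgs mus (ci i) D).
  by move=> w w' H; apply: (dep_avgs mus dD) => k /andP[h _]; exact: H.
have s20 : 0 <= e2 + eta / 4 by lra.
have ED : E (fun w => D w ^+ 2) <= (e2 + eta / 4) ^+ 2.
  have [_ <-] := bridge (fun w => D w ^+ 2) (depM i _ ni (fun w w' H => congr1 (fun x : R => x ^+ 2) (dD w w' H))).
  rewrite (eq_Er P (Y := fun w => (((z2 i).2 (Y i w) - g i (Y i w)) + (g i (Y i w) - (z1 i).2 (Y i w))) ^+ 2)); last first.
    by move=> w; rewrite Dword.
  apply: Er_mink; [by apply: sqintB|by apply: sqintB|exact: ltW|lra| |exact: Ez1].
  apply: le_trans Ez2; rewrite (eq_Er P (Y := fun w => (g i (Y i w) - (z2 i).2 (Y i w)) ^+ 2))// => w.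
  by rewrite -sqrrN opprB.
have mi : `|m i| <= e2.
  rewrite /m; have [_ <-] := bridge (Y2 i) (depM i _ ni (dY2 i ni)).
  rewrite (eq_Er P (Y := fun w => - (g i (Y i w) - (z2 i).2 (Y i w)) + g i (Y i w))); last first.
    by move=> w; rewrite Y2word//; ring.
  have sd : sqint P (fun w => g i (Y i w) - (z2 i).2 (Y i w)) by exact: sqintB.
  rewrite ErD ?Eg ?addr0 ?ErN ?normrN; [|exact: sqint_int1|apply: int1N|]; try exact: sqint_int1.
  by apply: (le_trans (Er_norm (sqint_int1 sd))); apply: Er_L1 => //; exact: ltW.
have [sDD EDD] := bridge (fun w => D w - avgs mus (ci i) D w)
  (depM i _ ni (fun w w' H => f_equal2 (fun x y : R => x - y) (dD w w' H) (dDa w w' H))).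
rewrite (eq_Er P (Y := fun w => ((g i (Y i w) - (z2 i).2 (Y i w)) + (D (word w) - avgs mus (ci i) D (word w)) + m i) ^+ 2)); last first.
  move=> w; rewrite /Z ni.
  have -> : avgs mus (ci i) D (word w) = avgs mus (ci i) (Y2 i) (word w) - Y1 i (word w).
    rewrite (meanB (avgs_mean Hmus _ (word w))); congr (_ - _).
    apply: (avgs_ge Hmus) => w' H; apply: (dY1 i ni) => k /andP[h _]; exact: H.
  by rewrite /D Y2word//; congr (_ ^+ 2); ring.
have e28 : e2 <= eta / 8 by rewrite ge_min lexx.
apply: (@le_trans _ _ ((e2 + ((e2 + eta / 4) + (e2 + eta / 4)) + e2) ^+ 2)); last first.
  by apply: lerXn2r; rewrite ?nnegrE; lra.
apply: Er_mink; [| exact: sqint_cst | lra | lra | |].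
- by apply: sqintD => //; exact: sqintB.
- apply: Er_mink; [by apply: sqintB| exact: sDD | lra | lra | exact: Ez2 |].
  have [_ ->] := bridge (fun w => (D w - avgs mus (ci i) D w) ^+ 2)
    (depM i _ ni (fun w w' H => f_equal2 (fun x y : R => (x - y) ^+ 2) (dD w w' H) (dDa w w' H))).
  apply: (mean_minkowski HE (g := fun w => - avgs mus (ci i) D w)) => //.
  rewrite (eq_mean E (g := fun w => avgs mus (ci i) D w ^+ 2)); last by move=> w; rewrite sqrrN.
  by apply: le_trans ED; apply: (avgs_sqr Hmus); exact: ciM.
- by rewrite Er_cst -real_normK ?num_real//; apply: lerXn2r; rewrite ?nnegrE// ltW.
Qed.

End Model.

(** * Gaussian increments and the one-dimensional limit theorem *)

Lemma integral_eq_law {R : realType} {d1 d2 d3} {T1 : measurableType d1} {T2 : measurableType d2}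
    {S : measurableType d3} (P1 : probability T1 R) (P2 : probability T2 R)
    (X1 : T1 -> S) (X2 : T2 -> S) (f : S -> \bar R) :
  measurable_fun setT X1 -> measurable_fun setT X2 ->
  (forall A, measurable A -> P1 (X1 @^-1` A) = P2 (X2 @^-1` A)) ->
  (forall x, 0 <= f x)%E -> measurable_fun setT f ->
  (\int[P1]_w f (X1 w) = \int[P2]_w f (X2 w))%E.
Proof.
move=> m1 m2 H f0 mf.
pose Y1 : {mfun T1 >-> S} := mfun_Sub (mem_set m1).
pose Y2 : {mfun T2 >-> S} := mfun_Sub (mem_set m2).
have <- := @ge0_integral_distribution _ _ T1 S R P1 Y1 f mf f0.
have <- := @ge0_integral_distribution _ _ T2 S R P2 Y2 f mf f0.
by apply: eq_measure_integral => A mA _; exact: H.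
Qed.

Section Gauss.
Context {R : realType} {d : measure_display} {T : measurableType d} (P : probability T R).
Implicit Types s m : R.
Local Notation mu := (@lebesgue_measure R).

Lemma integral_normal_prob s (f : R -> \bar R) : (forall x, 0 <= f x)%E -> measurable_fun setT f ->
  (\int[normal_prob (0 : R) s]_x f x = \int[mu]_x (f x * (normal_pdf 0 s x)%:E))%E.
Proof.
move=> f0 mf.
have dom := @normal_prob_dominates R 0 s.
have mpdf : measurable_fun setT (fun x : R => (normal_pdf 0 s x)%:E).
  by apply/measurable_EFinP; exact: measurable_normal_pdf.
rewrite -(Radon_Nikodym_SigmaFinite.change_of_variables dom f0 measurableT mf).
have iRN := Radon_Nikodym_SigmaFinite.f_integrable dom.
apply: ae_eq_integral => //.
- by apply: emeasurable_funM => //; apply: measurable_int iRN.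
- exact: emeasurable_funM.
apply: ae_eqe_mul2l; apply: integral_ae_eq => // E _ mE.
by rewrite -Radon_Nikodym_SigmaFinite.f_integral.
Qed.

Definition gaussian s (X : T -> R) := measurable_fun setT X /\
  forall A, measurable A -> P (X @^-1` A) = normal_prob 0 s A.

Lemma gaussian_integral s X (f : R -> \bar R) : gaussian s X -> (forall x, 0 <= f x)%E ->
  measurable_fun setT f ->
  (\int[P]_w f (X w) = \int[mu]_x (f x * (normal_pdf 0 s x)%:E))%E.
Proof.
move=> [mX lX] f0 mf; rewrite -integral_normal_prob//.
exact: (@integral_eq_law _ _ _ _ T (measurableTypeR R) R P (normal_prob 0 s) X idfun f mX
  (@measurable_id _ (measurableTypeR R) setT) lX f0 mf).
Qed.

(* Tilting: a function that turns one normal density into a multiple of another has a known mean. *)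
Lemma gaussian_tilt s X (g : R -> R) c m s' : gaussian s X -> 0 < s -> 0 < s' ->
  measurable_fun setT g -> (forall x, 0 <= g x) ->
  (forall x, g x * normal_fun 0 s x = c * normal_fun m s' x) ->
  int1 P (fun w => g (X w)) /\ Er P (fun w => g (X w)) = c * (s' / s).
Proof.
move=> gX s0 s'0 mg g0 E.
have pk (x : R) : 0 < x -> normal_peak x = x^-1 * normal_peak 1.
  move=> x0; rewrite /normal_peak -!mulrnAr sqrtrM ?sqr_ge0// sqrtr_sqr gtr0_norm// invfM.
  by rewrite expr1n mul1r.
have p0 : 0 < @normal_peak R 1 by apply: normal_peak_gt0; exact: oner_neq0.
have K : (\int[P]_w (g (X w))%:E = (c * (s' / s))%:E)%E.
  rewrite (gaussian_integral gX (f := fun x => (g x)%:E)).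
  - rewrite (_ : (fun x => _) = (fun x => (c * (s' / s))%:E * (normal_pdf m s' x)%:E)%E).
      rewrite integralZl//; last exact: integrable_normal_pdf.
      by rewrite integral_normal_pdf mule1.
    apply/funext => x; rewrite -!EFinM !normal_pdfE ?gt_eqF//; congr EFin.
    rewrite mulrCA E (pk s s0) (pk s' s'0); field.
    by rewrite gt_eqF//= gt_eqF.
  - by move=> x; rewrite lee_fin.
  - exact/measurable_EFinP.
have mgX : measurable_fun setT (fun w => g (X w)) by apply: measurableT_comp => //; case: gX.
split; last by rewrite ErE /Rintegral K.
apply/integrableP; split; first exact/measurable_EFinP.
rewrite (eq_integral (fun w => (g (X w))%:E)) ?K ?ltry// => w _ /=.
by rewrite ger0_norm.
Qed.

Lemma gaussian_exp_sqr s X h : gaussian s X -> 0 < s -> 0 < 1 + 2 * h * s ^+ 2 ->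
  int1 P (fun w => expR (- h * X w ^+ 2)) /\
  Er P (fun w => expR (- h * X w ^+ 2)) = (Num.sqrt (1 + 2 * h * s ^+ 2))^-1.
Proof.
move=> gX s0 v0; set v := 1 + _ in v0 *.
have rv : 0 < Num.sqrt v by rewrite sqrtr_gt0.
have [] := @gaussian_tilt s X (fun x => expR (- h * x ^+ 2)) 1 0 (s / Num.sqrt v) gX s0.
- by rewrite divr_gt0.
- apply: measurableT_comp => //; apply: measurable_funM => //; exact: measurable_funX.
- by move=> x; exact: expR_ge0.
- move=> x; rewrite /normal_fun mul1r !subr0 -expRD exprMn exprVn sqr_sqrtr ?ltW//; congr expR.
  have -> : h = (v - 1) / (2 * s ^+ 2) by rewrite /v; field; rewrite gt_eqF.
  move: v0; clearbody v => v0; rewrite -[s ^+ 2 *+ 2]mulr_natr -[s ^+ 2 / v *+ 2]mulr_natr; field.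
  by rewrite !gt_eqF.
- move=> h1 h2; split => //; rewrite h2 mul1r; field.
  by rewrite gt_eqF//= gt_eqF.
Qed.

Lemma gaussian_exp s X u : gaussian s X -> 0 < s ->
  int1 P (fun w => expR (u * X w)) /\
  Er P (fun w => expR (u * X w)) = expR (u ^+ 2 * s ^+ 2 / 2).
Proof.
move=> gX s0.
have [] := @gaussian_tilt s X (fun x => expR (u * x)) (expR (u ^+ 2 * s ^+ 2 / 2)) (u * s ^+ 2) s gX s0 s0.
- apply: measurableT_comp => //; exact: measurable_funM.
- by move=> x; exact: expR_ge0.
- move=> x; rewrite /normal_fun -!expRD; congr expR; rewrite -[s ^+ 2 *+ 2]mulr_natr; field.
  by rewrite gt_eqF.
- by move=> h1 h2; split => //; rewrite h2 divff ?mulr1// gt_eqF.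
Qed.

(** From [y ^+ 2 / 2 <= expR y] with [y = X ^+ 2 / (4 * s ^+ 2)], whose exponential mean is the
    square root of 2 and is bounded by 2. The constant is crude, but only the order [s ^+ 4]
    matters. *)
Lemma gaussian_moment4 s X : gaussian s X -> 0 < s ->
  int1 P (fun w => X w ^+ 4) /\ Er P (fun w => X w ^+ 4) <= 64 * s ^+ 4.
Proof.
move=> gX s0; have [mX _] := gX.
have s2 : 0 < s ^+ 2 by rewrite exprn_gt0.
have [||i1 e1] := @gaussian_exp_sqr s X (- (4 * s ^+ 2)^-1) gX => //.
  rewrite (_ : 1 + _ = 2^-1 :> R); last by field; rewrite gt_eqF.
  by rewrite invr_gt0.
have le w : `|X w ^+ 4| <= 32 * s ^+ 4 * expR (- - (4 * s ^+ 2)^-1 * X w ^+ 2).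
  rewrite opprK ger0_norm; last by rewrite -[4%N]/(2 * 2)%N exprM sqr_ge0.
  set y := _ * X w ^+ 2.
  have y0 : 0 <= y by rewrite /y mulr_ge0 ?sqr_ge0// invr_ge0 mulr_ge0// ltW.
  have H : 1 + y ^+ 2 / 2 <= expR y := expR_ge1Dxn 1 y0.
  have -> : X w ^+ 4 = 32 * s ^+ 4 * (y ^+ 2 / 2).
    by rewrite /y; field; rewrite gt_eqF.
  apply: ler_wpM2l; first by rewrite mulr_ge0// -[4%N]/(2 * 2)%N exprM sqr_ge0.
  apply: le_trans H; lra.
have i2 := int1Z (32 * s ^+ 4) i1.
have i4 : int1 P (fun w => X w ^+ 4) by apply: int1_le le i2; exact: measurable_funX.
split => //.
apply: le_trans (Er_le i4 i2 (fun w => le_trans (ler_norm _) (le w))) _.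
rewrite ErZ// e1 (_ : 1 + _ = 2^-1 :> R); last by field; rewrite gt_eqF.
have : (Num.sqrt (2^-1 : R))^-1 <= 2.
  rewrite -[leRHS]invrK lef_pV2 ?posrE ?invr_gt0 ?sqrtr_gt0 ?invr_gt0//.
  rewrite -[leLHS](@ger0_norm _ (2^-1 : R)) ?invr_ge0// -sqrtr_sqr ler_wsqrtr//.
  by rewrite expr2; lra.
have : 0 <= s ^+ 4 by rewrite -[4%N]/(2 * 2)%N exprM sqr_ge0.
by move=> h1 h2; nra.
Qed.

Lemma gaussian_sqint s X : gaussian s X -> 0 < s -> sqint P X.
Proof.
move=> gX s0; have [mX _] := gX; have [i4 _] := gaussian_moment4 gX s0.
split => //; apply: (@int1_le _ _ _ _ _ (fun w => 1 + X w ^+ 4)).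
- exact: measurable_funX.
- move=> w; rewrite ger0_norm ?sqr_ge0//.
  have := sqr_ge0 (X w ^+ 2 - 1); have : 0 <= X w ^+ 4 by rewrite -[4%N]/(2 * 2)%N exprM sqr_ge0.
  have -> : X w ^+ 4 = (X w ^+ 2) ^+ 2 by rewrite -exprM.
  have := sqr_ge0 (X w); set z := X w ^+ 2; nra.
- by apply: int1D => //; exact: int1_cst.
Qed.

(** The exponential moment is [1 + O(u ^+ 2)] but at least [1 + u * Er P X]. Taking [u = t * m] with
    a small positive [t] would give a linear gain [t * m ^+ 2] beating the quadratic term if the
    mean [m] were not zero. *)
Lemma gaussian_mean s X : gaussian s X -> 0 < s -> Er P X = 0.
Proof.
move=> gX s0; have iX := sqint_int1 (gaussian_sqint gX s0).
have H (u : R) : 1 + u * Er P X <= expR (u ^+ 2 * s ^+ 2 / 2).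
  have [i1 <-] := gaussian_exp u gX s0.
  rewrite -ErZ// -[X in X + _](Er_cst P) -ErD//; [|exact: int1_cst|exact: int1Z].
  apply: Er_le => //; first by apply: int1D; [exact: int1_cst|exact: int1Z].
  by move=> w; exact: expR_ge1Dx.
have S0 : 0 < s ^+ 2 by rewrite exprn_gt0.
apply/eqP; apply: contraT => m0.
set m := Er P X in H m0.
have m2 : 0 < m ^+ 2 by rewrite exprn_even_gt0.
set S := s ^+ 2 in H S0; pose t := (1 + S + m ^+ 2 * S)^-1.
have mS : 0 < m ^+ 2 * S by rewrite mulr_gt0.
have D0 : 0 < 1 + S + m ^+ 2 * S by rewrite !addr_gt0.
have t0 : 0 < t by rewrite invr_gt0.
have tD : t * (1 + S + m ^+ 2 * S) = 1 by rewrite mulVf// gt_eqF.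
have := H (t * m); set z := _ / 2 => h2.
have zE : z = t * (t * (m ^+ 2 * S)) / 2 by rewrite /z; ring.
have h1 := expR_ge1Dx (- z); rewrite expRN in h1.
have ez : 0 < expR z := expR_gt0 _.
have h3 : (1 - z) * expR z <= 1.
  by rewrite -ler_pdivlMr// div1r.
have tm1 : t * (m ^+ 2 * S) <= 1 by have := mulr_gt0 t0 S0; lra.
have tS1 : t * S + t * (m ^+ 2 * S) <= 1 by lra.
have t1 : t <= 1 by have := mulr_gt0 t0 S0; have := mulr_gt0 t0 mS; lra.
have z1 : z <= 2^-1.
  have := ler_pM (ltW t0) (ltW (mulr_gt0 t0 mS)) t1 tm1; rewrite zE; lra.
have h4 : (1 - z) * (1 + t * m * m) <= 1 by apply: le_trans h3; apply: ler_wpM2l => //; lra.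
have E : (1 - z) * (1 + t * m * m) = 1 + t * m ^+ 2 * (1 - (t * S + t * (m ^+ 2 * (t * S))) / 2).
  by rewrite zE; ring.
rewrite E gerDl (pmulr_rle0 _ (mulr_gt0 t0 m2)) in h4.
have := ler_wpM2r (ltW (mulr_gt0 t0 mS)) t1.
lra.
Qed.

(** The exact mean of [expR (- h * X ^+ 2)] is compared with its tangent bound for small [h] of
    either sign. Writing [r] for the ratio of the second moment to [s ^+ 2], this gives
    [v * (1 - r) = O(v ^+ 2)]; choosing [v] proportional to [1 - r] forces [r = 1]. *)
Lemma gaussian_variance s X : gaussian s X -> 0 < s -> Er P (fun w => X w ^+ 2) = s ^+ 2.
Proof.
move=> gX s0; have [mX iX2] := gaussian_sqint gX s0.
have S0 : 0 < s ^+ 2 by rewrite exprn_gt0.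
set m := Er P _; pose r := m / s ^+ 2.
have mE : m = r * s ^+ 2 by rewrite /r divfK// gt_eqF.
have r0 : 0 <= r by rewrite divr_ge0 ?(ltW S0)// Er_ge0// => w; exact: sqr_ge0.
have H (v : R) : 0 < 1 + v -> (1 - r * v / 2) <= (Num.sqrt (1 + v))^-1.
  move=> v0; have vE : v = 2 * (v / (2 * s ^+ 2)) * s ^+ 2 by field; rewrite gt_eqF.
  have [|i1] := @gaussian_exp_sqr s X (v / (2 * s ^+ 2)) gX s0; first by rewrite -vE.
  rewrite -vE => <-.
  have -> : 1 - r * v / 2 = 1 + - (v / (2 * s ^+ 2)) * m.
    by rewrite mE; field; rewrite gt_eqF.
  rewrite /m -ErZ// -[X in X + _](Er_cst P) -ErD//; [|exact: int1_cst|exact: int1Z].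
  apply: Er_le => //; first by apply: int1D; [exact: int1_cst|exact: int1Z].
  by move=> w; exact: expR_ge1Dx.
have H2 (v : R) : 0 < 1 + v -> 0 <= 1 - r * v / 2 -> (1 - r * v / 2) ^+ 2 * (1 + v) <= 1.
  move=> v0 r1; have := H v v0; set q := Num.sqrt _ => h.
  have q0 : 0 < q by rewrite sqrtr_gt0.
  have -> : 1 + v = q ^+ 2 by rewrite sqr_sqrtr// ltW.
  rewrite -exprMn expr_le1 ?mulr_ge0 ?(ltW q0)//.
  by rewrite -ler_pdivlMr// div1r.
suff : r = 1 by move=> r1; rewrite mE r1 mul1r.
have hB (v : R) : `|v| <= (2 * (1 + r))^-1 -> v * (1 - r) <= 2 * (1 + r) ^+ 2 * v ^+ 2.
  move=> hv; have D0 : 0 < 2 * (1 + r) by lra.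
  have hv' : `|v| * (1 + r) <= 2^-1.
    by move: hv; rewrite invfM ler_pdivlMr//; lra.
  have := ler_norm v; have := ler_normr v v; have nv := normr_ge0 v.
  have [n1 n2] : - `|v| <= v /\ v <= `|v| by split; [rewrite lerNl -normrN ler_norm|rewrite ler_norm].
  move=> _ _; have k1 := mulr_ge0 nv r0.
  have k2 : - (`|v| * r) <= v * r <= `|v| * r by rewrite -mulNr !ler_wpM2r.
  have /andP[k3 k4] := k2.
  have a1 : 0 < 1 + v by lra.
  have a2 : 0 <= 1 - r * v / 2 by lra.
  have := H2 v a1 a2.
  have -> : (1 - r * v / 2) ^+ 2 * (1 + v) = 1 + v * (1 - r) + v ^+ 2 * (- r + r ^+ 2 / 4 + v * r * r / 4) by field.
  have := sqr_ge0 v; set y := v ^+ 2 => y0 h.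
  have c1 : - (2 * (1 + r) ^+ 2) <= - r + r ^+ 2 / 4 + v * r * r / 4.
    have := ler_wpM2r r0 k3; nra.
  have := ler_wpM2l y0 c1; lra.
apply/eqP; apply: contraT => r1.
have D0 : 0 < 1 + r by lra.
pose t := (4 * (1 + r) ^+ 2)^-1.
have t0 : 0 < t by rewrite invr_gt0 mulr_gt0 ?exprn_gt0.
have tD : t * (1 + r) = (4 * (1 + r))^-1 by rewrite /t; field; rewrite gt_eqF.
have := hB (t * (1 - r)).
have -> : 2 * (1 + r) ^+ 2 * (t * (1 - r)) ^+ 2 = t * (1 - r) ^+ 2 / 2.
  by rewrite /t; field; rewrite gt_eqF.
have -> : t * (1 - r) * (1 - r) = t * (1 - r) ^+ 2 by rewrite expr2 mulrA.
have : 0 < t * (1 - r) ^+ 2 by rewrite mulr_gt0// exprn_even_gt0//= subr_eq0 eq_sym.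
move=> h hb; suff /hb : `|t * (1 - r)| <= (2 * (1 + r))^-1 by lra.
rewrite normrM gtr0_norm//; apply: (@le_trans _ _ (t * (1 + r))).
  by rewrite ler_pM2l// ler_norml; apply/andP; split; lra.
by rewrite tD lef_pV2 ?posrE ?mulr_gt0//; lra.
Qed.
End Gauss.

Lemma lip_measurable {R : realType} (phi : R -> R) (L : R) : 
  (forall x y, `|phi x - phi y| <= L * `|x - y|) -> measurable_fun setT phi.
Proof.
move=> phiL; apply: continuous_measurable_fun => x; apply/cvgrPdist_lt => e e0.
have L0 : 0 < `|L| + 1 by rewrite ltr_wpDl.
near=> y; have xy : `|x - y| < e / (`|L| + 1).
  by near: y; apply: (@cvgr_dist_lt _ _ _ (nbhs x)) => //; exact: divr_gt0.
rewrite ltr_pdivlMr// mulrC in xy; apply: le_lt_trans xy; apply: le_trans (phiL x y) _.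
by apply: ler_wpM2r => //; have := ler_norm L; lra.
Unshelve. all: by end_near.
Qed.

Section SwapArith.
Context {R : realFieldType}.

Lemma le_two_one (a b d : R) : a <= 2 * d -> b <= d -> a + b <= 3 * d.
Proof. lra. Qed.

Lemma swap_error (c x d y z e : R) : c * x <= e / 64 -> c * d <= e / 64 -> c * y <= e / 16 -> c * z <= e / 16 ->
  c * (5 * x + 3 * d + d + (y + z)) <= 5 * (e / 64) + 4 * (e / 64) + e / 16 + e / 16.
Proof. lra. Qed.

Lemma swap_chain (p q s t e : R) : 0 < e -> `|p| <= e / 8 -> `|q| <= 5 * (e / 64) + 4 * (e / 64) + e / 16 + e / 16 ->
  `|s| <= e / 8 -> `|t| <= e / 64 -> `|p + q - s + t| <= e.
Proof.
rewrite !ler_norml => ? /andP[? ?] /andP[? ?] /andP[? ?] /andP[? ?].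
by apply/andP; split; lra.
Qed.
End SwapArith.

(** * Brownian increments and the Lindeberg theorem *)

Section Brownian.
Context {R : realType} {d : measure_display} {T : measurableType d} (Q : probability T R).
Variable B : R -> T -> R.
Hypothesis BM : std_brownian Q B.

Definition incr (t : nat -> R) i w := B (t i.+1) w - B (t i) w.

Lemma bm_incr s t : 0 <= s -> s < t -> gaussian Q (Num.sqrt (t - s)) (fun w => B t w - B s w).
Proof.
move=> s0 st; case: BM => mB _ _ H _; split; last exact: H.
exact: measurable_funB.
Qed.

Lemma bm_incr_sqint s t : 0 <= s -> s <= t ->
  sqint Q (fun w => B t w - B s w) /\ Er Q (fun w => (B t w - B s w) ^+ 2) = t - s.
Proof.
move=> s0; rewrite le_eqVlt => /orP[/eqP <-|st].
  rewrite (_ : (fun w => B s w - B s w) = fun=> 0); last by apply/funext => w; rewrite subrr.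
  split; first exact: sqint_cst.
  by rewrite (eq_Er Q (Y := fun=> 0)) ?Er_cst ?subrr// => w; rewrite subrr expr0n.
have g := bm_incr s0 st; have q0 : 0 < Num.sqrt (t - s) by rewrite sqrtr_gt0 subr_gt0.
split; first exact: gaussian_sqint g q0.
by rewrite (gaussian_variance g q0) sqr_sqrtr// subr_ge0 ltW.
Qed.

Lemma bm_eq_law (s t s' t' : R) (phi : R -> R) : 0 <= s -> 0 <= s' -> s < t -> t - s = t' - s' ->
  measurable_fun setT phi -> (forall x, 0 <= phi x) ->
  Er Q (fun w => phi (B t w - B s w)) = Er Q (fun w => phi (B t' w - B s' w)).
Proof.
move=> s0 s'0 st E mphi phi0.
have st' : s' < t' by rewrite -subr_gt0 -E subr_gt0.
have [m1 l1] := bm_incr s0 st; have [m2 l2] := bm_incr s'0 st'.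
rewrite !ErE /Rintegral; congr fine.
apply: (integral_eq_law (X1 := fun w => B t w - B s w) (X2 := fun w => B t' w - B s' w)
  (f := fun x => (phi x)%:E)) => //.
- by move=> A mA; apply: etrans (l1 A mA) (esym _); rewrite E; exact: l2.
- exact/measurable_EFinP.
Qed.

Section Quant.
Variable t : nat -> R.
Hypotheses (t0 : t 0%N = 0) (tS : forall i, t i < t i.+1).

Lemma incr_ge0 i : 0 <= t i.
Proof. by elim: i => [|i IH]; rewrite ?t0// (le_trans IH)// ltW. Qed.

Let path_t m : path <%R 0 (mkseq (fun i => t i.+1) m).
Proof.
apply/(pathP 0) => i; rewrite size_mkseq => im.
by case: i im => [|i] im; rewrite /= !nth_mkseq// -?t0 ?tS// ltnW.
Qed.

Lemma incr_indep m : indep_fam Q m (incr t).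
Proof.
case: BM => _ _ _ _ H A mA; have := H _ (path_t m); rewrite size_mkseq => /(_ A mA).
have E i : (i < m)%N -> (fun w : T => B (nth 0 (mkseq (fun i => t i.+1) m) i) w -
    B (nth 0 (0 :: mkseq (fun i => t i.+1) m) i) w) = incr t i.
  move=> im; apply/funext => w; rewrite /incr.
  by case: i im => [|i] im; rewrite /= !nth_mkseq// ?t0// ltnW.
move=> H'; transitivity (Q (\bigcap_(i in `I_m)
    (fun w : T => B (nth 0 (mkseq (fun i => t i.+1) m) i) w -
    B (nth 0 (0 :: mkseq (fun i => t i.+1) m) i) w) @^-1` A i)).
  by congr (Q _); apply: eq_bigcapr => i im; rewrite E.
rewrite H'; apply: eq_bigr => i _; by rewrite E.
Qed.

(* Brownian increments are replaced by finitely valued independent variables, so that their laws act on arbitrary functions. *)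
Lemma bm_quant e : 0 < e -> exists (nu : nat -> (R -> R) -> R) (D : nat -> T -> R),
  [/\ forall k, is_mean (nu k),
      forall k phi, nu k phi = Er Q (fun w => phi (D k w)) /\ measurable_fun setT (fun w => phi (D k w)),
      forall k w, `|D k w| <= `|incr t k w|,
      forall k, Er Q (fun w => (incr t k w - D k w) ^+ 2) <= e &
      forall m g w0, dep_on (fun k => (k < m)%N) g ->
        measurable_fun setT (fun w => g (D ^~ w)) /\ Er Q (fun w => g (D ^~ w)) = avgs nu m g w0].
Proof.
move=> e0.
have qi k : exists q : (R -> nat) * nat * (nat -> R), [/\ quant q.1.1 q.1.2,
    forall x, `|q.2 (q.1.1 x)| <= `|x| &
    Er Q (fun w => (incr t k w - q.2 (q.1.1 (incr t k w))) ^+ 2) <= e].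
  have [sq _] := bm_incr_sqint (incr_ge0 k) (ltW (tS k)).
  have [kap [N [v [h1 h2 h3]]]] := quantize sq e0.
  by exists (kap, N, v).
have [q qP] := choice qi.
pose kap i := (q i).1.1; pose N i := (q i).1.2; pose v i := (q i).2.
pose l i w := kap i (incr t i w).
have lN i w : (l i w < N i)%N by have [[h _] _ _] := qP i; exact: h.
have mi i : measurable_fun setT (incr t i).
  by case: BM => mB _ _ _ _; exact: measurable_funB.
have mk i a : measurable [set x | kap i x = a] by have [[_ h] _ _] := qP i; exact: h.
have ml i a : measurable [set w | l i w = a].
  by rewrite -[X in measurable X]setTI; exact: (mi i measurableT _ (mk i a)).
have il m (a : nat -> nat) : Er Q (fun w => \prod_(0 <= i < m) (l i w == a i)%:R) =
    \prod_(0 <= i < m) Er Q (fun w => (l i w == a i)%:R).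
  have E1 i : Er Q (fun w => (l i w == a i)%:R) = fine (Q (incr t i @^-1` [set x | kap i x = a i])).
    rewrite (eq_Er Q (Y := \1_[set w | l i w = a i])); first by rewrite /Er expectation_indic.
    by move=> w; rewrite indicE; congr (nat_of_bool _)%:R; apply/eqP/idP => [?|]; rewrite inE.
  under [RHS]eq_bigr do rewrite E1.
  rewrite (eq_Er Q (Y := \1_(\bigcap_(i in `I_m) (incr t i @^-1` [set x | kap i x = a i])))).
    rewrite /Er expectation_indic; last first.
      by apply: bigcap_measurableType => i _; exact: ml.
    rewrite (@incr_indep m (fun i => [set x | kap i x = a i]) (fun i => mk i (a i))).
    rewrite -(big_mkord xpredT (fun i => Q (incr t i @^-1` [set x | kap i x = a i]))).
    elim: (m) => [|k IH]; first by rewrite !big_geq.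
    rewrite !big_nat_recr//= fineM ?IH//; last exact/fin_num_measure/ml.
    by rewrite big_mkord; apply: prode_fin_num => i _; exact/fin_num_measure/ml.
  move=> w; rewrite indicE; case: (boolP (_ \in _)) => [|/negP] h.
    rewrite big_nat big1// => i /andP[_ im].
    by move: h; rewrite inE => /(_ i im) /= h; rewrite /l h eqxx.
  apply/eqP; rewrite prodf_seq_eq0/=; apply/hasP.
  have : ~ forall i, (i < m)%N -> l i w = a i by move=> h'; apply: h; rewrite inE.
  move=> /existsNP[i /not_implyP[im /eqP/negbTE ia]].
  by exists i; [rewrite mem_index_iota|rewrite ia].
have mI k a : measurable_fun setT (fun w => (l k w == a)%:R : R).
  have [|//] := @letters_meas R _ T l N lN ml k.+1 (fun u => (u k == a)%:R).
  by move=> u u' H; rewrite H.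
have lE k (f : nat -> R) : lmean Q l N k f = Er Q (fun w => f (l k w)).
  rewrite (eq_Er Q (fun w => esym (@sum_ind R _ T l N lN k w f))) Er_sum.
    apply: eq_bigr => a _; rewrite mulrC -ErZ; last first.
      apply: (@int1_bnd _ _ _ Q _ 1) => // w; first by case: eqP; rewrite ?normr0 ?normr1.
    by apply: eq_Er => w; rewrite mulrC.
  move=> a _; apply: (@int1_bnd _ _ _ Q _ `|f a|); first exact: measurable_funM.
  by move=> w; case: eqP; rewrite ?mul1r ?mul0r ?normr0.
pose nu i (phi : R -> R) := lmean Q l N i (fun a => phi (v i a)).
have mean_nu k : is_mean (nu k).
  have H := lmean_mean Q lN ml k; split => *.
  - exact: (mean_lin H).
  - by apply: (mean_le H) => a.
  - exact: (mean_cst H).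
pose D i w := v i (l i w).
have DE i w : D i w = v i (kap i (incr t i w)) by [].
exists nu, D; split => //.
- move=> k phi; split; first by rewrite /nu lE.
  have [|//] := @letters_meas R _ T l N lN ml k.+1 (fun u => phi (v k (u k))).
  by move=> u u' H; rewrite H.
- by move=> k w; have [_ h _] := qP k; exact: h.
- by move=> k; have [_ _ h] := qP k.
move=> m g w0 dg.
have dF : dep_on (fun k => (k < m)%N) (fun a : nat -> nat => g (fun i => v i (a i))).
  by move=> a a' H; apply: dg => k km; rewrite H.
split.
  by have [] := letters_meas lN ml dF.
rewrite (letters_bridge lN ml il (fun=> 0%N) dF).
have cm i : (i <= i.+1)%N by [].
have dz i : dep_on (fun k => (i <= k < i.+1)%N) (fun a : nat -> nat => v i (a i)).
  by move=> a a' H; rewrite H// leqnn ltnSn.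
rewrite (@avgs_blocks _ _ _ _ (lmean_mean Q lN ml) id (fun i a => v i (a i)) (fun=> 0%N) cm dz m g).
have -> : block_law (lmean Q l N) id (fun i a => v i (a i)) (fun=> 0%N) = nu.
  apply/funext => k; apply/funext => phi; rewrite /block_law /nu /= /avg.
  apply: eq_mean => a; rewrite (avgs_ge (lmean_mean Q lN ml)); first by rewrite /upd eqxx.
  by move=> w' H; rewrite H.
exact: (avgs_const mean_nu _ _ (leqnn m) dg).
Qed.

Lemma bm_sum m w : \sum_(k < m) incr t k w = B (t m) w - B 0 w.
Proof.
rewrite -(big_mkord xpredT (fun k => incr t k w)) /incr.
by have := @telescope_sumr R 0 m (fun k => B (t k) w) isT; rewrite t0.
Qed.
End Quant.

Lemma m3_split (a x : R) : 0 < a -> m3 x <= a * x ^+ 2 + x ^+ 4 / a.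
Proof.
move=> a0; apply: (@le_trans _ _ (`|x| ^+ 3)); first by rewrite /m3 ge_min lexx orbT.
have y0 := normr_ge0 x.
rewrite -[x ^+ 2]real_normK ?num_real// (_ : x ^+ 4 = `|x| ^+ 4); last first.
  by rewrite -[4%N]/(2 * 2)%N !exprM real_normK ?num_real.
set y := `|x| in y0 *.
have -> : a * y ^+ 2 + y ^+ 4 / a = y ^+ 3 + (a * y ^+ 2 + y ^+ 4 / a - y ^+ 3) by ring.
rewrite lerDl.
have -> : a * y ^+ 2 + y ^+ 4 / a - y ^+ 3 = ((a - y) ^+ 2 + y ^+ 2 + a ^+ 2) * y ^+ 2 / (2 * a).
  by field; rewrite gt_eqF.
by rewrite divr_ge0 ?mulr_ge0 ?addr_ge0 ?sqr_ge0// ltW.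
Qed.

Lemma m3_mono (x y : R) : `|x| <= `|y| -> m3 x <= m3 y.
Proof.
move=> h; rewrite /m3 le_min !ge_min -[x ^+ 2]real_normK ?num_real// -[y ^+ 2]real_normK ?num_real//.
by rewrite !lerXn2r ?nnegrE ?orbT.
Qed.

(* One-dimensional Lindeberg theorem, uniform over bounded Lipschitz test functions. *)
Lemma clt (M L lo hi e : R) : 0 < M -> 0 < L -> 0 < lo -> lo <= hi -> 0 < e ->
  exists2 del : R, 0 < del & forall tau (mu : nat -> (R -> R) -> R) r w, lo <= tau -> tau <= hi ->
    (forall k, is_mean (mu k)) -> (forall k, mu k id = 0) ->
    (forall k, (k < r)%N -> mu k (fun x => x ^+ 2) <= del) ->
    `|\sum_(k < r) mu k (fun x => x ^+ 2) - tau| <= del ->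
    \sum_(k < r) mu k m3 <= del ->
  forall phi : R -> R, (forall x, `|phi x| <= M) -> (forall x y, `|phi x - phi y| <= L * `|x - y|) ->
    `|avgs mu r (fun w => phi (\sum_(k < r) w k)) w - Er Q (fun w => phi (B tau w - B 0 w))| <= e.
Proof.
move=> M0 L0 lo0 lohi e0; have hi0 : 0 < hi by exact: lt_le_trans lohi.
pose h := e / (24 * L); have h0 : 0 < h by rewrite divr_gt0 ?mulr_gt0.
have hE : 3 * L * h = e / 8 by rewrite /h; field; rewrite gt_eqF.
pose c := Num.max 1 (smooth_const M L h).
have c0 : 0 < c by rewrite lt_max ltr01.
pose a := e / (16 * c * hi); have a0 : 0 < a by rewrite divr_gt0 ?mulr_gt0.
have aE : c * (a * hi) = e / 16 by rewrite /a; field; rewrite !gt_eqF.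
clearbody a h.
pose del := Num.min (Num.min 1 (lo / 4)) (Num.min (e / (64 * c)) (a * e / (64 * (64 * (c * hi))))).
have q1 : 0 < e / (64 * c) by rewrite divr_gt0// mulr_gt0.
have q2 : 0 < a * e / (64 * (64 * (c * hi))).
  by apply: divr_gt0; [exact: mulr_gt0|do 3!apply: mulr_gt0 => //].
have del0 : 0 < del by rewrite /del !lt_min ltr01 q1 q2 !andbT/= divr_gt0.
have d1 : del <= 1 by rewrite !ge_min lexx.
have d2 : del <= lo / 4 by rewrite !ge_min lexx ?orbT.
have d3 : c * del <= e / 64.
  rewrite mulrC -ler_pdivlMr// -mulrA -invfM !ge_min lexx ?orbT//.
have d4 : c * (64 * (4 * del) * hi / a) <= e / 16.
  have : del <= a * e / (64 * (64 * (c * hi))) by rewrite !ge_min lexx ?orbT.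
  rewrite ler_pdivlMr; last by rewrite !mulr_gt0.
  move=> h4.
  have -> : c * (64 * (4 * del) * hi / a) = del * (64 * (64 * (c * hi))) / a / 16.
    by field; rewrite gt_eqF.
  by rewrite ler_pM2r// ler_pdivrMr// [e * a]mulrC.
exists del => // tau mu r w0 lot thi mean_mu mu0 mu2 mus mu3 phi phiM phiL.
have {}aE : c * (a * tau) <= e / 16 by rewrite -aE ler_pM2l// ler_pM2l.
have {}d4 : c * (64 * (4 * del) * tau / a) <= e / 16.
  apply: le_trans d4; rewrite ler_pM2l// ler_pM2r ?invr_gt0// ler_pM2l// !mulr_gt0//.
have tau0 : 0 < tau by exact: lt_le_trans lot.
pose s k := mu k (fun x => x ^+ 2).
have s0 k : 0 <= s k by apply: (mean_ge0 (mean_mu k)) => x; exact: sqr_ge0.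
(* Each variance is raised slightly so that all Brownian times are strictly increasing, even where a
   block has variance zero; the total increase stays below [del]. *)
pose kap := del / r.+1%:R; have kap0 : 0 < kap by rewrite divr_gt0// ltr0n.
have rkap : r%:R * kap <= del.
  by rewrite /kap mulrCA ler_piMr ?(ltW del0)// ler_pdivrMr ?ltr0n// mul1r ler_nat.
have rkap0 : 0 <= r%:R * kap by rewrite mulr_ge0// ltW.
pose V := \sum_(k < r) (s k + kap).
have VE : V = \sum_(k < r) s k + r%:R * kap.
  by rewrite /V big_split/= sumr_const card_ord mulr_natl.
have [V1 V2] : V - tau <= 2 * del /\ tau - V <= 2 * del.
  by move: mus; rewrite VE ler_norml -/(s _) => /andP[]; rewrite -/(s _); lra.
have V0 : 0 < V by lra.
(* Rescaling makes the comparison variances add up to exactly [tau], so that the Brownian sum is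
   [B tau - B 0] without a remainder. *)
pose cc := tau / V.
have cc0 : 0 < cc by rewrite divr_gt0.
have cc2 : cc <= 2 by rewrite ler_pdivrMr//; lra.
have ccV : cc * V = tau by rewrite divfK// gt_eqF.
pose p k := cc * (s k + kap).
have p0 k : 0 < p k by rewrite mulr_gt0// ltr_wpDl.
have p4 k : (k < r)%N -> p k <= 4 * del.
  move=> kr; have := mu2 k kr; rewrite -/(s k) => h1.
  have kd : kap <= del by rewrite /kap ler_pdivrMr ?ltr0n// ler_peMr ?(ltW del0)// ler1n.
  have : cc * (s k + kap) <= 2 * (s k + kap) by rewrite ler_pM2r// ltr_wpDl.
  by rewrite -/(p k); lra.
have sp : \sum_(k < r) p k = tau by rewrite -mulr_sumr.
pose t k := \sum_(j < k) p j.
have t0 : t 0%N = 0 by rewrite /t big_ord0.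
have tS k : t k.+1 - t k = p k by rewrite /t big_ord_recr/= addrAC subrr add0r.
have tlt k : t k < t k.+1 by rewrite -subr_gt0 tS.
(* The quantization error may depend on the number [r] of terms, whereas [del] may not: the
   quantized increments are chosen only after [r]. *)
pose ee := e / (64 * r.+1%:R * (c + L)).
have cL : 0 < c + L by rewrite addr_gt0.
have ee0 : 0 < ee by rewrite divr_gt0// !mulr_gt0// ltr0n.
have eer : r%:R * ee * (c + L) <= e / 64.
  have -> : r%:R * ee * (c + L) = e / 64 * (r%:R / r.+1%:R).
    have H (N x : R) : N != 0 -> x * (e / (64 * N * (c + L))) * (c + L) = e / 64 * (x / N).
      by move=> N0; field; rewrite N0 gt_eqF.
    by apply: H; rewrite pnatr_eq0.
  by rewrite ler_piMr ?divr_ge0 ?(ltW e0)// ler_pdivrMr ?ltr0n// mul1r ler_nat.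
have ree : 0 <= r%:R * ee by rewrite mulr_ge0// ltW.
have [eec eeL] : c * (r%:R * ee) <= e / 64 /\ L * (r%:R * ee) <= e / 64.
  by split; apply: le_trans eer; rewrite [leRHS]mulrC ler_wpM2r// ?lerDl ?lerDr ltW.
have [nu [D [mean_nu nuE Dle De Dbr]]] := bm_quant t0 tlt (exprn_gt0 2 ee0).
have sqI k : sqint Q (incr t k) /\ Er Q (fun w => incr t k w ^+ 2) = p k.
  by have := bm_incr_sqint (incr_ge0 t0 tlt k) (ltW (tlt k)); rewrite tS.
have gI k : gaussian Q (Num.sqrt (p k)) (incr t k).
  by have := bm_incr (incr_ge0 t0 tlt k) (tlt k); rewrite tS.
have mD k : measurable_fun setT (D k) by have [] := nuE k id.
have sqD k : sqint Q (D k) by exact: sqint_le (mD k) (Dle k) (proj1 (sqI k)).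
have sqID k : sqint Q (fun w => incr t k w - D k w) by exact: sqintB (proj1 (sqI k)) (sqD k).
have E1 k : Er Q (fun w => `|incr t k w - D k w|) <= ee by apply: Er_L1 => //; exact: ltW.
have rp k : 0 < Num.sqrt (p k) by rewrite sqrtr_gt0.
have n1 k : `|mu k id - nu k id| <= ee.
  rewrite mu0 sub0r normrN (proj1 (nuE k id)).
  have <- : Er Q (fun w => D k w) - Er Q (incr t k) = Er Q (fun w => D k w).
    by rewrite (gaussian_mean (gI k) (rp k)) subr0.
  apply: le_trans (Er_dist (sqint_int1 (sqD k)) (sqint_int1 (proj1 (sqI k)))) _.
  by apply: le_trans (E1 k); rewrite le_eqVlt; apply/orP; left; apply/eqP/eq_Er => w; rewrite distrC.
have n2 k : (k < r)%N -> `|mu k (fun x => x ^+ 2) - nu k (fun x => x ^+ 2)| <= `|s k - p k| + 4 * ee.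
  move=> kr; rewrite -/(s k) (proj1 (nuE k _)).
  set z := Er _ _; have -> : s k - z = (s k - p k) + (p k - z) by rewrite addrA subrK.
  apply: le_trans (ler_normD _ _) _; rewrite lerD2l -(proj2 (sqI k)) /z.
  apply: le_trans (Er_dist (proj2 (proj1 (sqI k))) (proj2 (sqD k))) _.
  have CS : Er Q (fun w => `|(incr t k w - D k w) * incr t k w|) <= ee * 2.
    apply: Er_CS => //; [exact: (proj1 (sqI k))|exact: ltW|].
    by rewrite (proj2 (sqI k)); have := p4 k kr; rewrite expr2; lra.
  have i1 : int1 Q (fun w => `|(incr t k w - D k w) * incr t k w|).
    by apply/int1_norm/sqint_mul => //; exact: (proj1 (sqI k)).
  have : Er Q (fun w => `|incr t k w ^+ 2 - D k w ^+ 2|) <=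
      Er Q (fun w => 2 * `|(incr t k w - D k w) * incr t k w|).
    apply: Er_le.
    - by apply/int1_norm/int1B; [exact: (proj2 (proj1 (sqI k)))|exact: (proj2 (sqD k))].
    - exact: int1Z.
    - move=> w; rewrite subr_sqr !normrM mulrCA ler_wpM2l//.
      by apply: le_trans (ler_normD _ _) _; have := Dle k w; lra.
  by rewrite ErZ//; lra.
(* The Gaussian third moment is avoided: [m3_split] bounds it by the second and fourth moments, and
   the fourth is at most a small multiple of the variance because every [p k] is at most
   [4 * del]. *)
have n3 k : (k < r)%N -> nu k m3 <= a * p k + 64 * (4 * del) * p k / a.
  move=> kr; rewrite (proj1 (nuE k _)).
  have [i4 e4] := gaussian_moment4 (gI k) (rp k).
  have iB := int1D (int1Z a (proj2 (proj1 (sqI k)))) (int1Z a^-1 i4).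
  have m30 (x : R) : 0 <= m3 x by rewrite /m3 le_min sqr_ge0 exprn_ge0.
  have le1 w : m3 (D k w) <= a * incr t k w ^+ 2 + a^-1 * incr t k w ^+ 4.
    by apply: le_trans (m3_mono (Dle k w)) _; rewrite [a^-1 * _]mulrC; exact: m3_split.
  have i3 : int1 Q (fun w => m3 (D k w)).
    apply: (int1_le _ _ iB); first exact: (proj2 (nuE k m3)).
    by move=> w; rewrite ger0_norm.
  have := Er_le i3 iB le1.
  rewrite ErD; [|exact: int1Z (proj2 (proj1 (sqI k)))|exact: int1Z].
  rewrite ErZ ?(proj2 (sqI k)); last exact: (proj2 (proj1 (sqI k))).
  rewrite ErZ// => h1; apply: le_trans h1 _; rewrite lerD2l [leRHS]mulrC ler_pM2l ?invr_gt0//.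
  apply: le_trans e4 _; rewrite -[4%N]/(2 * 2)%N exprM sqr_sqrtr ?(ltW (p0 k))//.
  have := ler_wpM2r (ltW (p0 k)) (p4 k kr); rewrite expr2; lra.
have [Phi tP PhiE] := smoothing (ltW L0) h0 phiM phiL; rewrite hE in PhiE.
have tP' : taylor_cls c Phi.
  have [P1 [P2 H]] := tP; exists P1, P2 => y; have [H1 H2 H3] := H y.
  have cc' : smooth_const M L h <= c by rewrite le_max lexx orbT.
  split; [exact: le_trans cc'|exact: le_trans cc'|move=> x; apply: le_trans (H3 x) _].
  by rewrite ler_wpM2r// /m3 le_min sqr_ge0 exprn_ge0.
have key := lindeberg_swap mean_mu mean_nu r 0 tP'.
have av (xi : nat -> (R -> R) -> R) v : (forall k, is_mean (xi k)) ->
    `|avgs xi r (fun w => phi (\sum_(k < r) w k)) v - convs xi r Phi 0| <= e / 8.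
  move=> mxi; rewrite -(avgs_sum mxi r Phi 0 v); apply: (mean_dist (avgs_mean mxi r v)) => u.
  by rewrite add0r distrC.
have S1 : \sum_(k < r) (`|mu k id - nu k id| + `|mu k (fun x => x ^+ 2) - nu k (fun x => x ^+ 2)|
    + mu k m3 + nu k m3) <= 5 * (r%:R * ee) + 3 * del + del + (a * tau + 64 * (4 * del) * tau / a).
  have S2 : \sum_(k < r) `|s k - p k| <= 3 * del.
    apply: (@le_trans _ _ (\sum_(k < r) (`|1 - cc| * (s k + kap) + kap))).
      apply: ler_sum => k _; have -> : s k - p k = (1 - cc) * (s k + kap) - kap by rewrite /p; ring.
      apply: le_trans (ler_normB _ _) _; rewrite normrM (gtr0_norm kap0).
      by rewrite (ger0_norm (addr_ge0 (s0 k) (ltW kap0))).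
    rewrite big_split/= -mulr_sumr -/V sumr_const card_ord -[kap *+ r]mulr_natl.
    have -> : `|1 - cc| * V = `|V - tau|.
      by rewrite -[in LHS](gtr0_norm V0) -normrM mulrBl mul1r ccV.
    have : `|V - tau| <= 2 * del by rewrite ler_norml V1 andbT lerNl opprB.
    by move=> Vt; exact: le_two_one.
  have S3 : \sum_(k < r) (a * p k + 64 * (4 * del) * p k / a) = a * tau + 64 * (4 * del) * tau / a.
    by rewrite -sp !mulr_sumr mulr_suml -big_split.
  apply: (@le_trans _ _ (\sum_(k < r) (5 * ee + `|s k - p k| + mu k m3 + (a * p k + 64 * (4 * del) * p k / a)))).
    apply: ler_sum => k _; have := n1 k; have := n2 k (ltn_ord k); have := n3 k (ltn_ord k); lra.
  rewrite 3!big_split/= S3 sumr_const card_ord -[_ *+ r]mulr_natl.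
  have -> : r%:R * (5 * ee) = 5 * (r%:R * ee) by ring.
  lra.
have E2 := Dbr r (fun u => phi (\sum_(k < r) u k)) w0 _.
have {E2}[mphi E2] : measurable_fun setT (fun w => phi (\sum_(k < r) D k w)) /\
    Er Q (fun w => phi (\sum_(k < r) D k w)) = avgs nu r (fun u => phi (\sum_(k < r) u k)) w0.
  by apply: E2 => u u' H; congr phi; apply: eq_bigr => k _; exact: H.
have sum_incr w : \sum_(k < r) incr t k w = B tau w - B 0 w by rewrite bm_sum// -sp.
have cphi : measurable_fun setT phi.
  exact: lip_measurable phiL.
have mB k : measurable_fun setT (incr t k) by have [] := proj1 (sqI k).
have E3 : `|Er Q (fun w => phi (\sum_(k < r) D k w)) - Er Q (fun w => phi (B tau w - B 0 w))| <= L * (r%:R * ee).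
  have i1 : int1 Q (fun w => phi (\sum_(k < r) D k w)) by apply: (@int1_bnd _ _ _ Q _ M).
  have i2 : int1 Q (fun w => phi (B tau w - B 0 w)).
    apply: (@int1_bnd _ _ _ Q _ M) => //.
    rewrite (_ : (fun w => _) = fun w => phi (\sum_(k < r) incr t k w)).
      by apply: measurableT_comp => //; exact: measurable_sum.
    by apply/funext => w; rewrite sum_incr.
  apply: le_trans (Er_dist i1 i2) _.
  have i3 k : int1 Q (fun w => `|incr t k w - D k w|) by exact/int1_norm/sqint_int1.
  apply: (@le_trans _ _ (Er Q (fun w => L * \sum_(k < r) `|incr t k w - D k w|))).
    apply: Er_le => [||w]; [exact/int1_norm/int1B|by apply/int1Z/int1_sum => k _|].
    rewrite -sum_incr; apply: le_trans (phiL _ _) _; apply: ler_wpM2l; first exact: ltW.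
    rewrite distrC -sumrB; exact: ler_norm_sum.
  rewrite ErZ; last by apply: int1_sum => k _.
  rewrite ler_pM2l// Er_sum; last by move=> k _.
  apply: (@le_trans _ _ (\sum_(k < r) ee)); first by apply: ler_sum => k _; exact: E1.
  by rewrite sumr_const card_ord mulr_natl.
have A1 := av mu w0 mean_mu; have A2 := av nu w0 mean_nu.
have K2 := le_trans key (ler_wpM2l (ltW c0) S1).
move: E3; rewrite E2.
set x1 := avgs mu r _ _ in A1 *; set x2 := avgs nu r _ _ in A2 *.
set c1 := convs mu _ _ _ in A1 K2 *; set c2 := convs nu _ _ _ in A2 K2 *; set y := Er _ _ => E3.
have -> : x1 - y = (x1 - c1) + (c1 - c2) - (x2 - c2) + (x2 - y) by ring.
have {K2} K3 : `|c1 - c2| <= 5 * (e / 64) + 4 * (e / 64) + e / 16 + e / 16.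
  by apply: le_trans K2 _; exact: swap_error.
exact: (swap_chain e0 A1 K3 A2 (le_trans E3 eeL)).
Qed.
End Brownian.

(** * Lipschitz functionals on the Skorokhod space *)

Section Paths.
Context {R : realType}.
Implicit Types (x y : R -> R) (f F : (R -> R) -> R).

Definition supclose (r : R) x y := forall v, I01 v -> `|x v - y v| <= r.
Definition sup_cont F := forall x, cadlag x -> forall e, 0 < e ->
  exists2 del, 0 < del & forall y, cadlag y -> supclose del x y -> `|F x - F y| < e.
(** Both conditions concern cadlag paths only, and the uniform distance enters through arbitrary
    upper bounds [r], so no supremum over the interval has to be formed. *)
Definition lipD (M L : R) F := (forall x, cadlag x -> `|F x| <= M) /\
  forall x y r, cadlag x -> cadlag y -> supclose r x y -> `|F x - F y| <= L * r.
(** On [[0, 1]] the value [x i] is taken on the cell starting at [i / m], and [x m] only at the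
    endpoint 1; the rescaled partial-sum process has exactly this form. *)
Definition stepf (m : nat) (x : nat -> R) : R -> R := fun v => x (Num.truncn (m%:R * v)).

Lemma supclose_sym r x y : supclose r x y -> supclose r y x.
Proof. by move=> H v /H; rewrite distrC. Qed.

Lemma skor_dist_le r x y : supclose r x y -> (skor_dist x y <= r%:E)%E.
Proof.
move=> H; have r0 : 0 <= r by apply: le_trans (H 0 _) => //; rewrite /I01/= lexx ler01.
apply: ereal_inf_le; exists (maxe (ereal_sup [set `|id t - t|%:E | t in I01])
    (ereal_sup [set `|x t - y (id t)|%:E | t in I01])).
  exists id => //; split; last by [].
  by apply: continuous_subspaceT => t; exact: cvg_id.
rewrite ge_max; apply/andP; split; apply: ub_ereal_sup => _ [t It <-]; rewrite lee_fin.
  by rewrite subrr normr0.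
exact: H.
Qed.

(** The identity is an admissible time change, so the Skorokhod distance is at most the uniform one.
    Continuity for the coarser topology implies the continuity used from here on. *)
Lemma skor_sup_cont f : skor_continuous f -> sup_cont f.
Proof.
move=> H x cx e e0; have [del del0 D] := H x cx e e0.
exists (del / 2); first by rewrite divr_gt0.
move=> y cy xy; apply: D => //; apply: le_lt_trans (skor_dist_le xy) _.
by rewrite lte_fin; lra.
Qed.

Lemma lip_sup_cont M L F : 0 < L -> lipD M L F -> sup_cont F.
Proof.
move=> L0 [_ H] x cx e e0; exists (e / (2 * L)); first by rewrite divr_gt0 ?mulr_gt0.
move=> y cy xy; apply: le_lt_trans (H _ _ _ cx cy xy) _.
have -> : L * (e / (2 * L)) = e / 2 by field; rewrite gt_eqF.
lra.
Qed.

Lemma sup_cont_eq F x y : sup_cont F -> cadlag x -> cadlag y -> (forall v, I01 v -> x v = y v) ->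
  F x = F y.
Proof.
move=> cF cx cy xy; apply/eqP; rewrite -subr_eq0 -normr_eq0; apply/eqP/le_anti; rewrite normr_ge0 andbT.
apply/ler_addgt0Pr => e e0; rewrite add0r ltW//.
have [del del0] := cF x cx e e0; apply => // v Iv; by rewrite xy// subrr normr0 ltW.
Qed.

Lemma cadlag_step m (x : nat -> R) : cadlag (stepf m x).
Proof.
have [m0|m0] := posnP m.
  have E : stepf m x = fun=> x 0%N.
    by apply/funext => v; rewrite /stepf m0 mul0r truncn0.
  rewrite E; split=> t _; first exact: cvg_cst.
  by exists (x 0%N); exact: cvg_cst.
have m0' : 0 < m%:R :> R by rewrite ltr0n.
split=> t /andP[t0 t1].
  have mt0 : 0 <= m%:R * t by rewrite mulr_ge0// ltW.
  have /andP[k1 k2] := truncn_itv mt0.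
  apply: cvg_near_cst; near=> v.
  have tv : t < v by near: v; exact: nbhs_right_gt.
  have vk : v < (Num.truncn (m%:R * t)).+1%:R / m%:R.
    by near: v; apply: nbhs_right_lt; rewrite ltr_pdivlMr// [t * _]mulrC.
  rewrite /stepf; congr x; apply: truncn_def; apply/andP; split.
    by apply: le_trans k1 _; rewrite ler_pM2l// ltW.
  by rewrite [_ * v]mulrC -ltr_pdivlMr.
pose k := (Num.truncn (m%:R * t)); pose k' := if k%:R == m%:R * t then k.-1 else k.
have mt0 : 0 < m%:R * t by rewrite mulr_gt0.
have /andP[k1 k2] := truncn_itv (ltW mt0); rewrite -/k in k1 k2.
have [h1 h2] : k'%:R < m%:R * t /\ m%:R * t <= k'.+1%:R.
  rewrite /k'; case: eqP => [E|/eqP E]; last by split; [rewrite lt_neqAle E|exact: ltW].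
  have kp : (0 < k)%N by rewrite -(ltr_nat R) E.
  by rewrite -E prednK// ltr_nat ltn_predL.
exists (x k'); apply: cvg_near_cst; near=> v.
have vt : v < t by near: v; exact: nbhs_left_lt.
have vk : k'%:R / m%:R < v.
  by near: v; apply: nbhs_left_gt; rewrite ltr_pdivrMr// [t * _]mulrC.
rewrite /stepf; congr x; apply: truncn_def; apply/andP; split.
  by rewrite [_ * v]mulrC -ler_pdivrMr// ltW.
by apply: lt_le_trans h2; rewrite ltr_pM2l.
Unshelve. all: by end_near.
Qed.

Definition cont01 x := forall t, I01 t -> forall e, 0 < e ->
  exists2 del, 0 < del & forall s, I01 s -> `|s - t| < del -> `|x s - x t| < e.

Lemma cadlag_cont x : cont01 x -> cadlag x.
Proof.
move=> cx; split=> t /andP[t0 t1].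
  apply/cvgrPdist_lt => e e0; have It : I01 t by rewrite /I01/= t0 ltW.
  have [del del0 H] := cx t It e e0; near=> s.
  have ts : t < s by near: s; exact: nbhs_right_gt.
  rewrite distrC; apply: H.
    rewrite /I01/= (ltW (le_lt_trans t0 ts))/=; near: s; exact: nbhs_right_le.
  rewrite gtr0_norm ?subr_gt0// ltrBlDl; near: s; apply: nbhs_right_lt; lra.
exists (x t); apply/cvgrPdist_lt => e e0; have It : I01 t by rewrite /I01/= t1 ltW.
have [del del0 H] := cx t It e e0; near=> s.
have ts : s < t by near: s; exact: nbhs_left_lt.
rewrite distrC; apply: H.
  rewrite /I01/= (ltW (lt_le_trans ts t1)) andbT; near: s; exact: nbhs_left_ge.
rewrite ltr0_norm ?subr_lt0// opprB ltrBlDl -ltrBlDr; near: s; apply: nbhs_left_gt; lra.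
Unshelve. all: by end_near.
Qed.

Lemma unif_cont01 x e : cont01 x -> 0 < e ->
  exists2 del, 0 < del & forall s t, I01 s -> I01 t -> `|s - t| < del -> `|x s - x t| < e.
Proof.
move=> cx e0.
have cK := @segment_compact R 0 1.
have /compact_near_coveringP := cK.
move=> /(_ R (0 : R)^'+ (fun del t => I01 t -> forall s, I01 s -> `|s - t| < del -> `|x s - x t| < e)).
move=> /(_ _ _) H; have {}H := H _.
have : \forall del \near (0 : R)^'+, `[0, 1]%classic `<=`
    (fun t => I01 t -> forall s, I01 s -> `|s - t| < del -> `|x s - x t| < e).
  apply: H => t It; have {}It : I01 t by move: It; rewrite /= in_itv.
  have e2 : 0 < e / 2 by rewrite divr_gt0.
  have [del del0 D] := cx t It _ e2.
  have d2 : 0 < del / 2 by rewrite divr_gt0.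
  exists (ball t (del / 2), [set r : R | r < del / 2]).
    by split; [exact: nbhsx_ballx|exact: nbhs_right_lt].
  move=> [t' r] [/= tt rd] It' s Is sr.
  have tt' : `|t' - t| < del / 2 by rewrite distrC.
  have st : `|s - t| < del.
    have -> : s - t = (s - t') + (t' - t) by ring.
    by apply: le_lt_trans (ler_normD _ _) _; lra.
  have h1 := D _ Is st; have h2 := D _ It' (lt_le_trans tt' (ltW _)).
  have -> : x s - x t' = (x s - x t) - (x t' - x t) by ring.
  apply: le_lt_trans (ler_normB _ _) _; have := h2 (ltac:(lra)); lra.
move=> h; near (0 : R)^'+ => del.
exists del; first by near: del; exact: nbhs_right_gt.
move=> s t Is It; have hd : `[0, 1]%classic `<=`
    (fun t => I01 t -> forall s, I01 s -> `|s - t| < del -> `|x s - x t| < e).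
  by near: del.
by apply: hd => //; rewrite /= in_itv.
Unshelve. all: by end_near.
Qed.

Lemma truncn_grid m (v : R) : 0 <= v -> 0 <= v - (Num.truncn (m.+1%:R * v))%:R / m.+1%:R < m.+1%:R^-1.
Proof.
move=> v0; have mv0 : 0 <= m.+1%:R * v by rewrite mulr_ge0.
have m0 : 0 < m.+1%:R :> R by rewrite ltr0n.
have /andP[k1 k2] := truncn_itv mv0.
rewrite subr_ge0 ler_pdivrMr// [v * _]mulrC k1/= ltrBlDr -[X in X + _]mul1r -mulrDl.
by rewrite ltr_pdivlMr// [v * _]mulrC [1 + _]addrC natr1.
Qed.

Lemma truncn_le_grid m (v : R) : I01 v -> (Num.truncn (m%:R * v) <= m)%N.
Proof.
move=> /andP[v0 v1]; have /andP[k1 _] := @truncn_itv R (m%:R * v) (mulr_ge0 (ler0n _ _) v0).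
by rewrite -(ler_nat R); apply: le_trans k1 _; rewrite ler_piMr.
Qed.

Definition gridpt (m i : nat) : R := Num.min (i%:R / m%:R) 1.

Lemma gridpt_I01 m i : I01 (gridpt m i).
Proof. by rewrite /I01 /gridpt/= le_min ler01 ge_min lexx orbT andbT divr_ge0. Qed.

Lemma unif_grid x e : cont01 x -> 0 < e -> \forall m \near \oo, 
  supclose e x (stepf m (fun i => x (gridpt m i))).
Proof.
move=> cx e0; have [del del0 D] := unif_cont01 cx e0; near=> m => v /andP[v0 v1].
have m0 : (0 < m)%N by near: m; exact: nbhs_infty_gt.
have mdel : m%:R^-1 < del.
  rewrite invf_plt ?posrE ?ltr0n//; near: m; exact: nbhs_infty_gtr.
move: m0 mdel; case: (m) => // m' _ mdel; rewrite /stepf /gridpt min_l; last first.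
  rewrite ler_pdivrMr ?ltr0n// mul1r ler_nat; apply: truncn_le_grid; exact/andP.
have /andP[g1 g2] := truncn_grid m' v0.
have k0 : 0 <= (Num.truncn (m'.+1%:R * v))%:R / m'.+1%:R :> R by rewrite divr_ge0.
apply/ltW/D; rewrite /I01/= ?v0// ?k0/=; first by apply: le_trans v1; rewrite -subr_ge0.
by rewrite ger0_norm//; exact: lt_trans mdel.
Unshelve. all: by end_near.
Qed.

Section Supconv.
Variables (f : (R -> R) -> R) (M : R).
Hypothesis fM : forall x, `|f x| <= M.

(** The sup-convolution of [f]: a [k]-Lipschitz majorant for the uniform distance that tends to [f]
    at every cadlag path where [f] is continuous. *)
Definition supconv (k : R) x := sup [set z | exists y r, [/\ cadlag y, 0 <= r, supclose r x y & z = f y - k * r]].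

Let M0 : 0 <= M. Proof. exact: le_trans (fM (fun=> 0)). Qed.

Let hs (k : R) x : 0 <= k -> cadlag x ->
  has_sup [set z | exists y r, [/\ cadlag y, 0 <= r, supclose r x y & z = f y - k * r]].
Proof.
move=> k0 cx; split.
  exists (f x), x, 0; split => //; last by rewrite mulr0 subr0.
  by move=> v _; rewrite subrr normr0.
exists M => z [y [r [_ r0 _ ->]]].
have := ler_norm (f y); have := fM y; have := mulr_ge0 k0 r0; lra.
Qed.

Lemma supconv_ge k x y r : 0 <= k -> cadlag x -> cadlag y -> 0 <= r -> supclose r x y ->
  f y - k * r <= supconv k x.
Proof.
by move=> k0 cx cy r0 xy; apply: (sup_upper_bound (hs k0 cx)); exists y, r.
Qed.

Lemma supconv_le k x B : 0 <= k -> cadlag x ->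
  (forall y r, cadlag y -> 0 <= r -> supclose r x y -> f y - k * r <= B) -> supconv k x <= B.
Proof.
move=> k0 cx H; apply: ge_sup; first by case: (hs k0 cx).
by move=> z [y [r [cy r0 xy ->]]]; exact: H.
Qed.

Lemma supconv_self k x : 0 <= k -> cadlag x -> f x <= supconv k x.
Proof.
move=> k0 cx; have := @supconv_ge k x x 0 k0 cx cx (lexx _).
by rewrite mulr0 subr0; apply=> v _; rewrite subrr normr0.
Qed.

Lemma supconv_lip k : 0 <= k -> lipD M k (supconv k).
Proof.
move=> k0; split=> [x cx|].
  rewrite ler_norml; apply/andP; split.
    by apply: le_trans (supconv_self k0 cx); have := fM x; rewrite ler_norml => /andP[].
  apply: supconv_le => // y r cy r0 _.
  have := ler_norm (f y); have := fM y; have := mulr_ge0 k0 r0; lra.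
have half x y r : cadlag x -> cadlag y -> supclose r x y -> supconv k x <= supconv k y + k * r.
  move=> cx cy xy; apply: supconv_le => // z r' cz r'0 xz.
  have r0 : 0 <= r by apply: le_trans (xy 0 _) => //; rewrite /I01/= lexx ler01.
  have : f z - k * (r + r') <= supconv k y.
    apply: supconv_ge => //; first exact: addr_ge0.
    move=> v Iv; have -> : y v - z v = - (x v - y v) + (x v - z v) by ring.
    by apply: le_trans (ler_normD _ _) _; rewrite normrN lerD//; [exact: xy|exact: xz].
  by rewrite mulrDr; lra.
move=> x y r cx cy xy; have h1 := half x y r cx cy xy.
have h2 := half y x r cy cx (supclose_sym xy).
by rewrite ler_norml; apply/andP; split; lra.
Qed.

Lemma supconv_cvg x : sup_cont f -> cadlag x -> (fun k : nat => supconv k%:R x) @ \oo --> f x.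
Proof.
move=> cf cx; apply/cvgrPdist_le => e e0.
have [del del0 D] := cf x cx e e0.
near=> k; have k0 : 0 <= k%:R :> R by [].
have kd : 2 * M <= k%:R * del.
  rewrite -ler_pdivrMr//; near: k; exact: nbhs_infty_ger.
rewrite distrC ger0_norm ?subr_ge0 ?supconv_self// lerBlDl.
apply: supconv_le => // y r cy r0 xy.
have [rd|rd] := lerP r del.
  have : `|f x - f y| < e by apply: D => // v Iv; apply: le_trans rd; exact: xy.
  rewrite distrC => h; have := ler_norm (f y - f x); have := mulr_ge0 k0 r0; lra.
have := ler_wpM2l k0 (ltW rd); have := fM x; have := fM y; rewrite !ler_norml => /andP[_ a1] /andP[a2 _] a3.
lra.
Unshelve. all: by end_near.
Qed.
End Supconv.
End Paths.

(** * Measurability of path functionals and reduction to Lipschitz tests *)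

Section Transfer.
Context {R : realType} {d : measure_display} {T : measurableType d}.
Implicit Types F f : (R -> R) -> R.

(** A functional that is only continuous for the uniform distance has no evident measurability.
    Along step paths with quantized values it is a function of finitely many letters, hence
    measurable, and continuity lets the mesh tend to zero. *)
Lemma meas_step F m (xi : nat -> T -> R) : sup_cont F -> (forall i, measurable_fun setT (xi i)) ->
  measurable_fun setT (fun w => F (stepf m (xi ^~ w))).
Proof.
move=> cF mxi.
pose xiN N i w := gridv N.+1 (gridk N.+1 (xi i w)) : R.
apply: (@measurable_fun_cvg _ _ _ setT (fun N w => F (stepf m (xiN N ^~ w)))).
  move=> N.
  have [] := @letters_meas R _ T (fun i w => gridk N.+1 (xi i w)) (fun=> (2 * (N.+1 * N.+1))%N) _ _ m.+1
    (fun a => F (stepf m (fun i => gridv N.+1 (a i)))) => //.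
  - by move=> i w; have [h _] := @gridk_quant R _ (ltn0Sn N).
  - move=> i a; rewrite -[X in measurable X]setTI.
    by have [_ h] := @gridk_quant R _ (ltn0Sn N); exact: (mxi i measurableT _ (h a)).
  move=> a a' H; apply: sup_cont_eq => //; try exact: cadlag_step.
  by move=> v Iv; rewrite /stepf H// ltnS truncn_le_grid.
move=> w _; apply/cvgrPdist_lt => e e0.
have [del del0 D] := cF _ (cadlag_step m (xi ^~ w)) e e0.
near=> N; apply: D; first exact: cadlag_step.
move=> v Iv; rewrite /stepf; have := truncn_le_grid m Iv; set k := Num.truncn _ => km.
have kS : `|xi k w| < N.+1%:R.
  apply: (@le_lt_trans _ _ (\sum_(i < m.+1) `|xi i w|)).
    rewrite -ltnS in km; rewrite (bigD1 (Ordinal km))//= lerDl; exact: sumr_ge0.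
  apply: (@lt_trans _ _ N%:R); last by rewrite ltr_nat.
  by near: N; exact: nbhs_infty_gtr.
have [h _] := gridv_gridk (ltn0Sn N) kS; apply: le_trans h _.
rewrite invf_ple ?posrE//; apply: (@le_trans _ _ N%:R); last by rewrite ler_nat.
by near: N; exact: nbhs_infty_ger.
Unshelve. all: by end_near.
Qed.

Section ContPath.
Variables (P : probability T R) (Y : T -> R -> R) (F : (R -> R) -> R).
Hypotheses (cY : forall w, cont01 (Y w)) (mY : forall u, I01 u -> measurable_fun setT (fun w => Y w u)).
Hypothesis cF : sup_cont F.

Let stepY m w := F (stepf m (fun i => Y w (gridpt m i))).

Lemma meas_stepY m : measurable_fun setT (stepY m).
Proof.
have := @meas_step F m (fun i w => Y w (gridpt m i)) cF; apply => i.
exact/mY/gridpt_I01.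
Qed.

Lemma cvg_stepY w : stepY ^~ w @ \oo --> F (Y w).
Proof.
apply/cvgrPdist_lt => e e0; have [del del0 D] := cF (cadlag_cont (cY w)) e0.
near=> m; apply: D; first exact: cadlag_step.
by near: m; exact: unif_grid.
Unshelve. all: by end_near.
Qed.

Lemma meas_path : measurable_fun setT (fun w => F (Y w)).
Proof.
apply: (measurable_fun_cvg meas_stepY) => w _; exact: cvg_stepY.
Qed.

Lemma Er_stepY M : (forall x, cadlag x -> `|F x| <= M) ->
  (fun m => Er P (stepY m)) @ \oo --> Er P (fun w => F (Y w)).
Proof.
move=> FM; have [|_] := Er_dct meas_stepY _ (int1_cst P M) cvg_stepY => // m w.
by apply: FM; exact: cadlag_step.
Qed.

End ContPath.
End Transfer.

(** An upper bound for the limit superior is enough, since it is applied to [f] and to [- f]. It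
    follows by comparing [f] with a sup-convolution, whose mean under the limit law approaches that
    of [f] by dominated convergence. *)
Lemma skorokhod_reduction {R : realType} {d d'} {T : measurableType d} {T' : measurableType d'}
    (P : probability T R) (Q : probability T' R) (S : nat -> T -> R -> R) (Y : T' -> R -> R) :
  (forall n w, cadlag (S n w)) -> (forall w, cadlag (Y w)) ->
  (forall F, sup_cont F -> (forall n, measurable_fun setT (fun w => F (S n w))) /\
     measurable_fun setT (fun w => F (Y w))) ->
  (forall F M L, 0 < M -> 0 < L -> lipD M L F ->
     (fun n => Er P (fun w => F (S n w))) @ \oo --> Er Q (fun w => F (Y w))) ->
  weak_conv_D P S Q Y.
Proof.
move=> cS cY mF H f [M0 fM0] /skor_sup_cont cf.
pose M := M0 + 1; have fM x : `|f x| <= M by apply: le_trans (fM0 x) _; rewrite lerDl.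
have Mp : 0 < M by rewrite ltr_wpDl// (le_trans _ (fM0 (fun=> 0))).
have iS F n : sup_cont F -> (forall x, cadlag x -> `|F x| <= M) -> int1 P (fun w => F (S n w)).
  by move=> cF FM; apply: (@int1_bnd _ _ _ P _ M); [case: (mF F cF)|move=> w; exact: FM].
have iY F : sup_cont F -> (forall x, cadlag x -> `|F x| <= M) -> int1 Q (fun w => F (Y w)).
  by move=> cF FM; apply: (@int1_bnd _ _ _ Q _ M); [case: (mF F cF)|move=> w; exact: FM].
have half g e : (forall x, `|g x| <= M) -> sup_cont g -> 0 < e ->
    \forall n \near \oo, Er P (fun w => g (S n w)) < Er Q (fun w => g (Y w)) + e.
  move=> gM cg e0.
  have lk (k : nat) : lipD M k.+1%:R (supconv g k.+1%:R) by apply: supconv_lip.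
  have ck k : sup_cont (supconv g k.+1%:R) by apply: (lip_sup_cont _ (lk k)).
  have [||||_] := @Er_dct _ _ _ Q (fun k w => supconv g k.+1%:R (Y w)) (fun w => g (Y w)) (fun=> M).
  - by move=> k; case: (mF _ (ck k)).
  - by move=> k w; case: (lk k) => h _; exact: h.
  - exact: int1_cst.
  - by move=> w; have := supconv_cvg gM cg (cY w); rewrite -cvg_shiftS.
  have e2 : 0 < e / 2 by rewrite divr_gt0.
  move=> /cvgrPdist_lt/(_ _ e2)[k _ /(_ k (leqnn k))] hk.
  have /cvgrPdist_lt/(_ _ e2) := H _ _ _ Mp (ltr0Sn R k) (lk k).
  apply: filterS => n hn.
  have : Er P (fun w => g (S n w)) <= Er P (fun w => supconv g k.+1%:R (S n w)).
    apply: Er_le => [||w]; [exact: iS|by apply: iS => //; case: (lk k)|exact: supconv_self].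
  move: hk hn; rewrite !ltr_norml => /andP[? ?] /andP[? ?]; lra.
rewrite -/(Er Q _); apply/cvgrPdist_lt => e e0.
have cN : sup_cont (fun x => - f x).
  move=> x cx r r0; have [del del0 D] := cf x cx r r0; exists del => // y cy xy.
  by rewrite -normrN opprB opprK addrC; exact: D.
near=> n; rewrite ltr_norml; apply/andP; split.
  have : Er P (fun w => f (S n w)) < Er Q (fun w => f (Y w)) + e.
    by near: n; exact: half.
  by rewrite /Er; lra.
have : Er P (fun w => - f (S n w)) < Er Q (fun w => - f (Y w)) + e.
  by near: n; apply: (half (fun x => - f x)) => // x; rewrite normrN.
rewrite (ErN (iS f n cf (fun x _ => fM x))) (ErN (iY f cf (fun x _ => fM x))) /Er; lra.
Unshelve. all: by end_near.
Qed.

(** * Covariances of the kernels *)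

Section Kernels.
Context {R : realType} {d : measure_display} {T : measurableType d} (P : probability T R).
Variables eps epss : int -> T -> R.
Hypothesis Heps_meas : forall i, measurable_fun setT (eps i) /\ measurable_fun setT (epss i).
Hypothesis Hindep : mutual_indep P (joint_family eps epss).
Hypothesis Hident : ident_distr P (joint_family eps epss).
Implicit Types a b : (nat -> R) -> R.

Let E a := Er P (fun w => a (eps_seq eps 0 w)).
Let iid t := eps_seq_iid Heps_meas Hindep Hident t.

(* Square-integrable functions of the past, tested at time 0. *)
Definition L2k a := measurable_fun setT (a : seqR -> R) /\ sqint P (fun w => a (eps_seq eps 0 w)).
Definition nsq a := Er P (fun w => a (eps_seq eps 0 w) ^+ 2).
Definition cv (h : nat) a b := Er P (fun w => a (eps_seq eps 0 w) * b (eps_seq eps h%:Z w)).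
Definition ctr a : (nat -> R) -> R := fun y => a y - Er P (fun w => a (eps_seq eps 0 w)).

Lemma L2k_at t a : L2k a -> sqint P (fun w => a (eps_seq eps t w)) /\
  Er P (fun w => a (eps_seq eps t w) ^+ 2) = nsq a.
Proof. by move=> [ma sa]; have := iidseq_sqint (iid 0) (iid t) ma sa. Qed.

Lemma L2kB a b : L2k a -> L2k b -> L2k (fun y => a y - b y).
Proof. by move=> [ma sa] [mb sb]; split; [exact: measurable_funB|exact: sqintB]. Qed.

Lemma L2kD a b : L2k a -> L2k b -> L2k (fun y => a y + b y).
Proof. by move=> [ma sa] [mb sb]; split; [exact: measurable_funD|exact: sqintD]. Qed.

Lemma L2k_cst c : L2k (fun=> c).
Proof. by split; [exact: measurable_cst|exact: sqint_cst]. Qed.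

Lemma L2k_ctr a : L2k a -> L2k (ctr a).
Proof. by move=> La; apply: L2kB => //; exact: L2k_cst. Qed.

Lemma nsq_ge0 a : 0 <= nsq a.
Proof. by apply: Er_ge0 => w; exact: sqr_ge0. Qed.

Lemma shift_meas h : measurable_fun setT ((fun y k => y (k + h)%N) : @seqR R -> @seqR R).
Proof.
apply: meas_seq => k _ B mB.
rewrite setTI; exact: (@cylS_coord R (k + h)%N _ mB).
Qed.

Lemma L2k_shift h a : L2k a -> L2k (fun y => a (fun k => y (k + h)%N)) /\
  forall t w, a (fun k => eps_seq eps t w (k + h)%N) = a (eps_seq eps (t - h%:Z) w).
Proof.
move=> La.
have E1 t w : a (fun k => eps_seq eps t w (k + h)%N) = a (eps_seq eps (t - h%:Z) w).
  by congr a; apply/funext => k; rewrite /eps_seq PoszD; congr (eps _ w); ring.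
split => //; split; first exact: (measurableT_comp (proj1 La) (shift_meas h)).
rewrite (_ : (fun w => _) = fun w => a (eps_seq eps (0 - h%:Z) w)); last by apply/funext => w; exact: E1.
by have [] := L2k_at (0 - h%:Z) La.
Qed.

(** Stationarity is available for second moments; the mean is extracted by comparing the squares of
    [X + 1] and [X]. *)
Lemma Er_at t a : L2k a -> Er P (fun w => a (eps_seq eps t w)) = E a.
Proof.
move=> La; have [s1 e1] := L2k_at t (L2kD La (L2k_cst 1)).
have [s2 e2] := L2k_at t La.
have [s3 e3] := L2k_at 0 (L2kD La (L2k_cst 1)).
have [s4 e4] := L2k_at 0 La.
have H (X : T -> R) : sqint P X -> Er P X = (Er P (fun w => (X w + 1) ^+ 2) - Er P (fun w => X w ^+ 2) - 1) / 2.
  move=> sX; rewrite (eq_Er P (X := fun w => (X w + 1) ^+ 2) (Y := fun w => (X w ^+ 2 + 2 * X w) + 1)); last by move=> w; ring.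
  have iX := sqint_int1 sX; have [_ iX2] := sX.
  rewrite !ErD//; [|exact: int1Z|apply: int1D => //; exact: int1Z|exact: int1_cst].
  by rewrite ErZ// Er_cst; lra.
by rewrite /E (H _ s2) (H _ s4) e1 e2 e3 e4.
Qed.

(* Polarization reduces the stationarity of covariances to that of second moments. *)
Lemma cv_at s h a b : L2k a -> L2k b ->
  Er P (fun w => a (eps_seq eps s w) * b (eps_seq eps (s + h%:Z) w)) = cv h a b.
Proof.
move=> La Lb; have [Lh Eh] := L2k_shift h La.
have pol t : Er P (fun w => a (eps_seq eps (t - h%:Z) w) * b (eps_seq eps t w)) =
    (nsq (fun y => a (fun k => y (k + h)%N) + b y) - nsq (fun y => a (fun k => y (k + h)%N) - b y)) / 4.
  have [s1 e1] := L2k_at t (L2kD Lh Lb); have [s2 e2] := L2k_at t (L2kB Lh Lb).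
  rewrite -e1 -e2 -ErB; [|by case: s1|by case: s2].
  rewrite mulrC -ErZ; last by apply: int1B; [case: s1|case: s2].
  by apply: eq_Er => w; rewrite Eh; field.
by rewrite -[X in eps_seq eps X](addrK h%:Z) pol /cv -[0 : int](subrr h%:Z) pol.
Qed.

Lemma cv_int h a b : L2k a -> L2k b ->
  int1 P (fun w => a (eps_seq eps 0 w) * b (eps_seq eps h%:Z w)).
Proof. by move=> La Lb; apply: sqint_mul; [case: La|case: (L2k_at h%:Z Lb)]. Qed.

Lemma cv_CS h a b A B : L2k a -> L2k b -> 0 <= A -> 0 <= B -> nsq a <= A ^+ 2 -> nsq b <= B ^+ 2 ->
  `|cv h a b| <= A * B.
Proof.
move=> La Lb A0 B0 nA nB; have [s1 e1] := L2k_at h%:Z Lb.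
apply: le_trans (Er_norm (cv_int h La Lb)) _.
by apply: Er_CS => //; [case: La|rewrite e1].
Qed.

Lemma cv_diff h a b a' b' A B D D' : L2k a -> L2k b -> L2k a' -> L2k b' ->
  0 <= A -> 0 <= B -> 0 <= D -> 0 <= D' -> nsq a' <= A ^+ 2 -> nsq b <= B ^+ 2 ->
  nsq (fun y => a y - a' y) <= D ^+ 2 -> nsq (fun y => b y - b' y) <= D' ^+ 2 ->
  `|cv h a b - cv h a' b'| <= D * B + A * D'.
Proof.
move=> La Lb La' Lb' A0 B0 D0 D'0 nA nB nD nD'.
have -> : cv h a b - cv h a' b' = cv h (fun y => a y - a' y) b + cv h a' (fun y => b y - b' y).
  rewrite /cv -ErB; [|exact: cv_int|exact: cv_int].
  rewrite -ErD; [|exact: (cv_int h (L2kB La La') Lb)|exact: (cv_int h La' (L2kB Lb Lb'))].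
  by apply: eq_Er => w; ring.
apply: le_trans (ler_normD _ _) _.
by apply: lerD; apply: cv_CS => //; exact: L2kB.
Qed.

Lemma ctr_mean a : L2k a -> E (ctr a) = 0.
Proof.
move=> [_ sa]; rewrite /E /ctr ErB; [|exact: sqint_int1|exact: int1_cst].
by rewrite Er_cst subrr.
Qed.

Lemma ctr_nsq a : L2k a -> nsq (ctr a) <= nsq a.
Proof.
move=> La; have [_ sa] := La; have i1 := sqint_int1 sa; have [_ i2] := sa.
rewrite /nsq /ctr -/(E a) (eq_Er P (Y := fun w => (a (eps_seq eps 0 w) ^+ 2 + (- 2 * E a) * a (eps_seq eps 0 w)) + E a ^+ 2)).
  have i3 := int1Z (- 2 * E a) i1.
  rewrite (ErD (int1D i2 i3) (int1_cst P (E a ^+ 2))) (ErD i2 i3) (ErZ _ i1) Er_cst.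
  rewrite -/(E a); have := sqr_ge0 (E a); rewrite expr2; lra.
by move=> w; ring.
Qed.

Lemma ctrB a b : L2k a -> L2k b -> (fun y => ctr a y - ctr b y) = ctr (fun y => a y - b y).
Proof.
move=> [_ sa] [_ sb]; apply/funext => y; rewrite /ctr ErB; [ring|exact: sqint_int1|exact: sqint_int1].
Qed.

Definition coupled C rho a := forall (t : int) (j : nat),
  Er P (fun w => (a (eps_seq eps t w) - a (eps_tilde eps epss t j w)) ^+ 2) <= (C * rho ^+ j) ^+ 2.

(** One factor [2 * C] bounds the norm of a letter approximation and the other its coupling
    constant; the last factor is the geometric sum in [cov_decay]. *)
Definition ckap (C rho : R) := 2 * C * (2 * C) * (1 - rho)^-1.

(** The covariance bound for letters is independent of the approximation error [eta], so it passes
    to the kernels as the error tends to zero. *)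
Lemma cv_decay h a b C rho : 0 < C -> 0 < rho < 1 -> L2k a -> L2k b -> E a = 0 -> E b = 0 ->
  nsq a <= C ^+ 2 -> nsq b <= C ^+ 2 -> coupled C rho a -> coupled C rho b ->
  `|cv h a b| <= ckap C rho * rho ^+ h.
Proof.
move=> C0 rho01 La Lb Ea Eb na nb ca cb.
have r1 : 0 < 1 - rho by case/andP: rho01 => _; rewrite subr_gt0.
have r0 : 0 < rho by case/andP: rho01.
have [->|h0] := posnP h.
  rewrite expr0 mulr1; apply: le_trans (cv_CS 0 La Lb (ltW C0) (ltW C0) na nb) _.
  rewrite /ckap ler_pdivlMr//; have := mulr_gt0 C0 C0; nra.
apply/ler_addgt0Pr => e e0.
pose eta := Num.min C (e / (3 * C)).
have eta0 : 0 < eta by rewrite lt_min C0 divr_gt0// mulr_gt0.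
have etaC : eta <= C by rewrite ge_min lexx.
have etae : 3 * C * eta <= e by rewrite mulrC -ler_pdivlMr ?mulr_gt0// ge_min lexx orbT.
(* Only the indices 0 and [h] carry the two kernels; all others are zero, which trivially satisfies
   the coupling bound required of the whole family. *)
pose g i : (nat -> R) -> R := if i == 0%N then a else if i == h then b else fun=> 0.
have Lg i : L2k (g i) by rewrite /g; case: eqP => // _; case: eqP => // _; exact: L2k_cst.
have Eg i : E (g i) = 0.
  by rewrite /g; case: eqP => // _; case: eqP => // _; rewrite /E Er_cst.
have ng i : nsq (g i) <= C ^+ 2.
  rewrite /g; case: eqP => // _; case: eqP => // _; rewrite /nsq (eq_Er P (Y := fun=> 0)) ?Er_cst ?sqr_ge0// => w.
  by rewrite expr0n.
have Dg i j : Er P (fun w => (g i (eps_seq eps i.+1%:Z w) - g i (eps_tilde eps epss i.+1%:Z j w)) ^+ 2) <= (C * rho ^+ j) ^+ 2.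
  rewrite /g; case: eqP => [_|_]; first exact: ca.
  case: eqP => [_|_]; first exact: cb.
  rewrite (eq_Er P (Y := fun=> 0)) ?Er_cst ?sqr_ge0// => w.
  by rewrite subrr expr0n.
have [mu [K [word [Z [mmu br dZ hZ cZ]]]]] := letter_model Heps_meas Hindep Hident h.+1 C0 rho01
  (fun i => proj1 (Lg i)) (fun i => proj1 (L2k_at i.+1%:Z (Lg i)))
  (fun i => etrans (Er_at i.+1%:Z (Lg i)) (Eg i)) Dg eta0.
pose G i w := g i (eps_seq eps i.+1%:Z w).
have sG i : sqint P (G i) /\ Er P (fun w => G i w ^+ 2) <= C ^+ 2.
  by have [s1 e1] := L2k_at i.+1%:Z (Lg i); split => //; rewrite e1.
have bZ i : (i < h.+1)%N -> sqint P (fun w => Z i (word w)).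
  move=> ih; have [|//] := br (Z i) _; move=> w w' H; apply: (dZ i).1 => k ki; apply: H.
  by apply: leq_trans ki _; rewrite -addSn leq_add2r.
have sGZ i : (i < h.+1)%N -> sqint P (fun w => G i w - Z i (word w)).
  by move=> ih; apply: sqintB; [exact: (sG i).1|exact: bZ].
have Z2 i : (i < h.+1)%N -> Er P (fun w => Z i (word w) ^+ 2) <= (2 * C) ^+ 2.
  move=> ih; have sN : sqint P (fun w => - (G i w - Z i (word w))) by exact/sqintN/sGZ.
  have eN : Er P (fun w => (- (G i w - Z i (word w))) ^+ 2) <= C ^+ 2.
    rewrite (eq_Er P (Y := fun w => (G i w - Z i (word w)) ^+ 2)); last by move=> w; rewrite sqrrN.
    by apply: le_trans (cZ i ih) _; rewrite lerXn2r// nnegrE ltW.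
  have := Er_mink (sG i).1 sN (ltW C0) (ltW C0) (sG i).2 eN.
  rewrite (eq_Er P (Y := fun w => Z i (word w) ^+ 2)) => [|w]; last by rewrite opprB addrC subrK.
  by rewrite (_ : C + C = 2 * C)//; ring.
have dZ2 i j : (i < h.+1)%N -> (j < h.+1)%N -> dep_on (fun k => (k < h.+1 + K)%N) (fun w => Z i w * Z j w).
  move=> ih jh w w' H; congr (_ * _).
    by apply: (dZ i).1 => k ki; apply: H; apply: leq_trans ki _; rewrite -addSn leq_add2r.
  by apply: (dZ j).1 => k ki; apply: H; apply: leq_trans ki _; rewrite -addSn leq_add2r.
have C2 : 0 <= 2 * C by rewrite mulr_ge0// ltW.
have hX2 i : (i < h.+1)%N -> avgs (fun=> mu) (h.+1 + K) (fun w => Z i w ^+ 2) (fun=> 0%N) <= (2 * C) ^+ 2.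
  by move=> ih; rewrite -(br _ (dZ2 i i ih ih)).2; exact: Z2.
have := cov_decay (fun=> mmu) (ltn0Sn 0) (leqnn (h.+1 + K)) C2 rho01 (fun i => (dZ i).1)
  (fun i => (dZ i).2) hZ C2 (lexx 0) hX2 (p := 0%N) (t := h).
rewrite h0 ltnSn subn0 => /(_ isT) cd.
rewrite -(br _ (dZ2 0%N h (ltn0Sn h) (ltnSn h))).2 in cd.
have hh : (h < h.+1)%N by [].
have -> : cv h a b = Er P (fun w => (G 0%N w - Z 0%N (word w)) * G h w) +
    Er P (fun w => Z 0%N (word w) * (G h w - Z h (word w))) + Er P (fun w => Z 0%N (word w) * Z h (word w)).
  have j1 := sqint_mul (sGZ 0%N (ltn0Sn h)) (sG h).1.
  have j2 := sqint_mul (bZ 0%N (ltn0Sn h)) (sGZ h hh).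
  have j3 := sqint_mul (bZ 0%N (ltn0Sn h)) (bZ h hh).
  rewrite -(ErD j1 j2) -(ErD (int1D j1 j2) j3).
  rewrite -(cv_at 1 h La Lb); apply: eq_Er => w.
  have -> : a (eps_seq eps 1 w) = G 0%N w by [].
  have -> : b (eps_seq eps (1 + h%:Z) w) = G h w.
    by rewrite /G /g eqxx gtn_eqF.
  ring.
have e1 := Er_CS (sGZ 0%N (ltn0Sn h)) (sG h).1 (ltW eta0) (ltW C0) (cZ 0%N (ltn0Sn h)) (sG h).2.
have e2 := Er_CS (bZ 0%N (ltn0Sn h)) (sGZ h hh) C2 (ltW eta0) (Z2 0%N (ltn0Sn h)) (cZ h hh).
have n1 := Er_norm (sqint_mul (sGZ 0%N (ltn0Sn h)) (sG h).1).
have n2 := Er_norm (sqint_mul (bZ 0%N (ltn0Sn h)) (sGZ h hh)).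
apply: le_trans (ler_normD _ _) _; rewrite addrC; apply: lerD; first exact: cd.
apply: le_trans (ler_normD _ _) _; apply: le_trans etae.
apply: le_trans (lerD (le_trans n1 e1) (le_trans n2 e2)) _.
by rewrite le_eqVlt; apply/orP; left; apply/eqP; ring.
Qed.

End Kernels.

(** * Primitives of bounded measurable functions *)

Section BoundedPrimitive.
Context {R : realType}.
Variables (f : R -> R) (M : R).
Hypotheses (mf : measurable_fun (I01 : set R) f) (fM : forall u, I01 u -> `|f u| <= M).

Definition primitive (v : R) : R :=
  fine (\int[lebesgue_measure]_(u in [set u : R | (0 <= u <= v)%R]) (f u)%:E)%E.

Let itvE (v : R) : [set u : R | (0 <= u <= v)%R] = `[0, v]%classic.
Proof. by apply/seteqP; split => x /=; rewrite in_itv. Qed.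

Let intf (a b : itv_bound R) (v : R) : v <= 1 -> [set` Interval a b] `<=` `[0, v]%classic ->
  (@lebesgue_measure R).-integrable [set` Interval a b] (EFin \o f).
Proof.
move=> v1 ab; apply: (@integrableS _ _ _ (@lebesgue_measure R) `[0, 1]%classic) => //.
  by apply: subset_trans ab _; apply: subset_itvl; rewrite bnd_simp.
apply: measurable_bounded_integrable => //.
- by rewrite /= lebesgue_measure_itv/= lte01 sube0 ltry.
- exists M; split; first exact: num_real.
  move=> x Mx u uI; apply: le_trans (ltW Mx); apply: fM.
  by move: uI; rewrite /= in_itv.
Qed.

Lemma primitive_incr (s t c b : R) : 0 <= s -> s <= t -> t <= 1 ->
  (forall u, s < u -> u <= t -> `|f u - c| <= b) ->
  `|primitive t - primitive s - (t - s) * c| <= (t - s) * b.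
Proof.
move=> s0 st t1 H; rewrite /primitive !itvE.
have i0 : (@lebesgue_measure R).-integrable `[0, t]%classic (EFin \o f).
  by apply: (intf (v := t)).
have := Rintegral_itvB i0 (x := s) _ _; rewrite /Rintegral => ->; rewrite ?bnd_simp//.
rewrite -/(Rintegral lebesgue_measure `]s, t]%classic f).
have sub : `]s, t]%classic `<=` `[0, t]%classic by apply: subset_itvr; rewrite bnd_simp.
have i1 : (@lebesgue_measure R).-integrable `]s, t]%classic (EFin \o f) by apply: (intf t1).
have Lst : fine (@lebesgue_measure R `]s, t]%classic) = t - s.
  move: st; rewrite le_eqVlt => /orP[/eqP ->|st].
    by rewrite set_itvoc0 measure0 subrr.
  by rewrite /= lebesgue_measure_itv/= lte_fin st -EFinD.
have ic r : (@lebesgue_measure R).-integrable `]s, t]%classic (EFin \o (fun=> r)).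
  apply: measurable_bounded_integrable => //.
    by rewrite /= lebesgue_measure_itv/=; case: ifP => _; rewrite ?ltry// -EFinD ltry.
  exists `|r|; split; first exact: num_real.
  by move=> x rx u _; exact: ltW.
have E r : \int[lebesgue_measure]_(x in `]s, t]) r = (t - s) * r.
  by rewrite Rintegral_cst// Lst mulrC.
rewrite -(E c) -(E b) -RintegralB//.
have iB : (@lebesgue_measure R).-integrable `]s, t]%classic (EFin \o (fun u => f u - c)).
  suff : (@lebesgue_measure R).-integrable `]s, t]%classic ((EFin \o f) \- (EFin \o (fun=> c)))%E by [].
  by apply: integrableB => //; exact: ic.
apply: le_trans (le_normr_Rintegral _ iB) _ => //.
apply: le_Rintegral => //.
- exact: (integrable_norm iB).
- by move=> u /=; rewrite in_itv/= => /andP[su ut]; exact: H.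
Qed.

Lemma primitive_lip (s t : R) : 0 <= s -> s <= t -> t <= 1 -> `|primitive t - primitive s| <= (t - s) * M.
Proof.
move=> s0 st t1; have := @primitive_incr s t 0 M s0 st t1; rewrite mulr0 subr0; apply => u su ut.
by rewrite subr0; apply: fM; rewrite /I01/= (ltW (le_lt_trans s0 su)) (le_trans ut).
Qed.

Lemma primitive0 : primitive 0 = 0.
Proof.
by rewrite /primitive itvE set_itv1 integral_set1.
Qed.
End BoundedPrimitive.

(** * Variances of partial sums and the integrated long-run variance *)

Section Sigma.
Context {R : realType} {d : measure_display} {T : measurableType d} (P : probability T R).
Variables eps epss : int -> T -> R.
Hypothesis Heps_meas : forall i, measurable_fun setT (eps i) /\ measurable_fun setT (epss i).
Hypothesis Hindep : mutual_indep P (joint_family eps epss).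
Hypothesis Hident : ident_distr P (joint_family eps epss).
Variables (C rho : R) (gn : nat -> R -> (nat -> R) -> R) (g : R -> (nat -> R) -> R).
Hypotheses (C0 : 0 < C) (rho01 : 0 < rho < 1).
Local Notation nsqr := (nsq P eps).
Local Notation cv := (cv P eps).
Local Notation L2k := (L2k P eps).
Hypothesis K1 : forall n u, (0 < n)%N -> I01 u -> [/\ L2k (gn n u),
  Er P (fun w => gn n u (eps_seq eps 0 w)) = 0, nsqr (gn n u) <= C ^+ 2 & coupled P eps epss C rho (gn n u)].
Hypothesis K2 : forall u, I01 u -> L2k (g u).
Hypothesis K3 : forall e, 0 < e -> exists N, forall n u, (N <= n)%N -> I01 u ->
  nsqr (fun y => gn n u y - g u y) <= e ^+ 2.
Hypothesis K5 : forall h, measurable_fun I01 (fun u => cv h (g u) (g u)).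

Definition gam h u := cv h (g u) (g u).
Definition psum N u := gam 0 u + 2 * \sum_(h < N) gam h.+1 u.
Definition sig u := limn (fun N => psum N u).
Let kap := ckap C rho.
Let tl N := 2 * kap * (1 - rho)^-1 * rho ^+ N.

Let rr0 : 0 < rho. Proof. by case/andP: rho01. Qed.
Let r1 : 0 < 1 - rho. Proof. by case/andP: rho01 => _; rewrite subr_gt0. Qed.
Let kap0 : 0 < kap.
Proof. by rewrite /kap /ckap !mulr_gt0// invr_gt0. Qed.

Lemma nsq_g u : I01 u -> nsqr (g u) <= (2 * C) ^+ 2.
Proof.
move=> Iu; have [N H] := K3 C0; have h := H N.+1 u (leqnSn N) Iu.
have [[mn sn] _ nn _] := K1 (ltn0Sn N) Iu; have [mg sg] := K2 Iu.
have sD : sqint P (fun w => - (gn N.+1 u (eps_seq eps 0 w) - g u (eps_seq eps 0 w))) by exact/sqintN/sqintB.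
have eD : Er P (fun w => (- (gn N.+1 u (eps_seq eps 0 w) - g u (eps_seq eps 0 w))) ^+ 2) <= C ^+ 2.
  by rewrite (eq_Er P (Y := fun w => (gn N.+1 u (eps_seq eps 0 w) - g u (eps_seq eps 0 w)) ^+ 2)) // => w; rewrite sqrrN.
have := Er_mink sn sD (ltW C0) (ltW C0) nn eD.
rewrite (_ : C + C = 2 * C); last by ring.
by rewrite /nsq (eq_Er P (Y := fun w => g u (eps_seq eps 0 w) ^+ 2)) // => w; rewrite opprB addrC subrK.
Qed.

Lemma cv_gn_g n h u e : (0 < n)%N -> I01 u -> 0 <= e -> nsqr (fun y => gn n u y - g u y) <= e ^+ 2 ->
  `|cv h (gn n u) (gn n u) - gam h u| <= 3 * C * e.
Proof.
move=> n0 Iu e0 he; have [Ln _ nn _] := K1 n0 Iu; have Lg := K2 Iu.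
have C2 : 0 <= 2 * C by rewrite mulr_ge0// ltW.
apply: le_trans (cv_diff Heps_meas Hindep Hident h Ln Ln Lg Lg C2 (ltW C0) e0 e0 (nsq_g Iu) nn he he) _.
by rewrite le_eqVlt; apply/orP; left; apply/eqP; ring.
Qed.

(** The limiting kernel carries no coupling assumption of its own; the decay is inherited from the
    prelimit kernels, whose bound is uniform in [n]. *)
Lemma gam_decay h u : I01 u -> `|gam h u| <= kap * rho ^+ h.
Proof.
move=> Iu; apply/ler_addgt0Pr => e e0.
have e1 : 0 < e / (3 * C) by rewrite divr_gt0// mulr_gt0.
have [N H] := K3 e1; have {}H := H N.+1 u (leqnSn N) Iu.
have := cv_gn_g h (ltn0Sn N) Iu (ltW e1) H.
have -> : 3 * C * (e / (3 * C)) = e by field; rewrite gt_eqF.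
have [Ln mn nn cn] := K1 (ltn0Sn N) Iu.
have := cv_decay Heps_meas Hindep Hident h C0 rho01 Ln Ln mn mn nn nn cn cn.
rewrite -/kap distrC; set x := cv _ _ _ => h1 h2.
have := ler_normD (gam h u - x) x; rewrite subrK; lra.
Qed.

Lemma psum_diff N m u : I01 u -> `|psum (N + m) u - psum N u| <= tl N.
Proof.
move=> Iu; have -> : psum (N + m) u - psum N u = 2 * \sum_(h < m) gam (N + h).+1 u.
  rewrite /psum big_split_ord/=; ring.
have -> : tl N = 2 * (kap * rho ^+ N * (1 - rho)^-1) by rewrite /tl; ring.
rewrite normrM ger0_norm// ler_pM2l//.
apply: le_trans (ler_norm_sum _ _ _) _.
apply: (@le_trans _ _ (\sum_(h < m) kap * rho ^+ N * rho ^+ h)).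
  apply: ler_sum => h _; apply: le_trans (gam_decay _ Iu) _.
  rewrite -mulrA -exprD ler_pM2l// exprS ler_piMl ?exprn_ge0 ?ltW//.
  by case/andP: rho01.
have := sum_geom_le m rho01; set G := \sum_(j < m) _ => hG.
by rewrite -mulr_sumr -/G ler_pM2l// mulr_gt0// exprn_gt0.
Qed.

Let tl_small e : 0 < e -> exists N0, forall N, (N0 <= N)%N -> tl N <= e.
Proof.
move=> e0; have K0 : 0 < 2 * kap * (1 - rho)^-1 by rewrite !mulr_gt0// invr_gt0.
have : (fun N => tl N) @ \oo --> (0 : R).
  have h : `|rho| < 1 by rewrite gtr0_norm//; case/andP: rho01.
  exact: cvg_geometric.
move=> /cvgrPdist_le/(_ e e0)[N0 _ H]; exists N0 => N NN.
by have := H N NN; rewrite sub0r normrN; apply: le_trans; exact: ler_norm.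
Qed.

Lemma psum_cvg u : I01 u -> psum ^~ u @ \oo --> sig u.
Proof.
move=> Iu; apply: cauchy_cvg; apply: cauchy_exP => e e0.
have e2 : 0 < e / 2 by rewrite divr_gt0.
have [N0 H] := tl_small e2; exists (psum N0 u).
exists N0 => // N /= NN; rewrite -ball_normE/= distrC -(subnKC NN).
apply: le_lt_trans (psum_diff _ _ Iu) _; have := H N0 (leqnn _); lra.
Qed.

Lemma sig_tail N u : I01 u -> `|sig u - psum N u| <= tl N.
Proof.
move=> Iu; apply/ler_addgt0Pr => e e0.
have /cvgrPdist_lt/(_ e e0)[N0 _ H] := psum_cvg Iu.
have := H (N + N0)%N (leq_addl _ _); have := psum_diff N N0 Iu.
have := ler_normD (sig u - psum (N + N0) u) (psum (N + N0) u - psum N u).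
rewrite addrA subrK; lra.
Qed.

Lemma sig_bound u : I01 u -> `|sig u| <= kap + tl 0.
Proof.
move=> Iu; have := sig_tail 0 Iu; rewrite {1}/psum big_ord0 mulr0 addr0.
have := gam_decay 0 Iu; rewrite expr0 mulr1.
have := ler_normD (sig u - gam 0 u) (gam 0 u); rewrite subrK; lra.
Qed.

Lemma sig_meas : measurable_fun I01 sig.
Proof.
apply: (measurable_fun_cvg (h := psum)) => [N|u Iu].
  apply: measurable_funD; first exact: K5.
  by apply: measurable_funM => //; apply: measurable_sum => h; exact: K5.
exact: psum_cvg.
Qed.

Definition nrm a := Num.sqrt (nsqr a).
Lemma nrm_ge0 a : 0 <= nrm a. Proof. exact: sqrtr_ge0. Qed.
Lemma nrmE a : nrm a ^+ 2 = nsqr a.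
Proof. by rewrite sqr_sqrtr// nsq_ge0. Qed.

Lemma nrm_le a (r : R) : 0 <= r -> nsqr a <= r ^+ 2 -> nrm a <= r.
Proof. by move=> r0 H; rewrite -(@ler_pXn2r _ 2)// ?nnegrE ?nrm_ge0// nrmE. Qed.

Lemma nrm_tri a b c : L2k a -> L2k b -> L2k c ->
  nrm (fun y => a y - c y) <= nrm (fun y => a y - b y) + nrm (fun y => b y - c y).
Proof.
move=> La Lb Lc; apply: nrm_le; first by rewrite addr_ge0// nrm_ge0.
have [_ s1] := L2kB La Lb; have [_ s2] := L2kB Lb Lc.
have := Er_mink s1 s2 (nrm_ge0 (fun y => a y - b y)) (nrm_ge0 (fun y => b y - c y)).
rewrite !nrmE => /(_ (lexx _) (lexx _)).
by rewrite /nsq (eq_Er P (Y := fun w => (a (eps_seq eps 0 w) - c (eps_seq eps 0 w)) ^+ 2)) // => w; rewrite addrA subrK.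
Qed.

Hypothesis K4 : forall a, 0 < a -> exists2 D, 0 <= D & forall n x, (0 < n)%N ->
  (forall r, (r < n)%N -> r%:R / n%:R <= x r < r.+1%:R / n%:R) ->
  \sum_(r < n) nrm (fun y => gn n (r.+1%:R / n%:R) y - gn n (x r) y) <= n%:R * a + D.

Section FixedN.
Variable n : nat.
Hypothesis n0 : (0 < n)%N.
Let ak r := gn n (r.+1%:R / n%:R).
Let V r := nrm (fun y => ak r y - gn n (r%:R / n%:R) y).
Let Xk r w := ak r (eps_seq eps r.+1%:Z w).

Let gI r : (r <= n)%N -> I01 (r%:R / n%:R : R).
Proof.
by move=> rn; rewrite /I01/= divr_ge0//= ler_pdivrMr ?ltr0n// mul1r ler_nat.
Qed.

Let kL r : (r < n)%N -> [/\ L2k (ak r), Er P (fun w => ak r (eps_seq eps 0 w)) = 0, nsqr (ak r) <= C ^+ 2 & coupled P eps epss C rho (ak r)].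
Proof. by move=> rn; apply: K1 => //; exact: gI. Qed.

(** The long-run variance truncated at [H] lags with the kernel frozen at the right end of cell [r].
    The companion [stepD] is the exact increase of the variance when term [r] joins a sum started at
    [l]. *)
Let qH H r := cv 0 (ak r) (ak r) + 2 * \sum_(h < H) cv h.+1 (ak r) (ak r).
Let stepD l r := cv 0 (ak r) (ak r) + 2 * \sum_(l <= i < r) cv (r - i) (ak i) (ak r).

Lemma var_expand l r : (r <= n)%N -> (l <= r)%N ->
  Er P (fun w => (\sum_(l <= i < r) Xk i w) ^+ 2) = \sum_(l <= i < r) stepD l i.
Proof.
move=> rn lr; elim: r lr rn => [|r IH].
  rewrite leqn0 => /eqP -> _; rewrite !big_geq//.
  by rewrite (eq_Er P (Y := fun=> 0)) ?Er_cst// => w; rewrite big_geq// expr0n.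
rewrite leq_eqVlt => /orP[/eqP <- _|].
  rewrite !big_geq// (eq_Er P (Y := fun=> 0)) ?Er_cst// => w.
  by rewrite big_geq// expr0n.
rewrite ltnS => lr rn; rewrite big_nat_recr//= -IH ?(ltnW rn)//.
have sX i : (i < n)%N -> sqint P (Xk i).
  by move=> ii; have [Li _ _ _] := kL ii; have [] := L2k_at Heps_meas Hindep Hident i.+1%:Z Li.
have sS : sqint P (fun w => \sum_(l <= i < r) Xk i w).
  rewrite (_ : (fun w => _) = fun w => \sum_(i <- index_iota l r | (i < n)%N) Xk i w); last first.
    apply/funext => w; rewrite big_nat_cond [RHS]big_seq_cond; apply: eq_bigl => i.
    rewrite mem_index_iota andbT; case: (boolP (l <= i < r)%N) => //= /andP[_ ir].
    by rewrite (ltn_trans ir rn).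
  by apply: sqint_sum => i; exact: sX.
have iP i : (i < n)%N -> int1 P (fun w => Xk i w * Xk r w) by move=> ii; apply: sqint_mul; exact: sX.
have -> : stepD l r = Er P (fun w => Xk r w ^+ 2) + 2 * Er P (fun w => (\sum_(l <= i < r) Xk i w) * Xk r w).
  have [Lr _ _ _] := kL rn; congr (_ + 2 * _).
    have := cv_at Heps_meas Hindep Hident r.+1%:Z 0 Lr Lr; rewrite addr0 => <-.
    by apply: eq_Er => w; rewrite expr2.
  rewrite (eq_Er P (Y := fun w => \sum_(i <- index_iota l r | (i < n)%N) Xk i w * Xk r w)).
    rewrite Er_sum//; rewrite [LHS]big_nat_cond [RHS]big_seq_cond; apply: eq_big => i.
      rewrite mem_index_iota andbT; case: (boolP (l <= i < r)%N) => //= /andP[_ ir].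
      by rewrite (ltn_trans ir rn).
    rewrite andbT => /andP[_ ir]; have [Li _ _ _] := kL (ltn_trans ir rn).
    rewrite -(cv_at Heps_meas Hindep Hident i.+1%:Z (r - i) Li Lr).
    by rewrite -PoszD addSn subnKC// ltnW.
  move=> w; rewrite mulr_suml big_nat_cond [RHS]big_seq_cond; apply: eq_bigl => i.
  rewrite mem_index_iota andbT; case: (boolP (l <= i < r)%N) => //= /andP[_ ir].
  by rewrite (ltn_trans ir rn).
have i1 : int1 P (fun w => (\sum_(l <= i < r) Xk i w) * Xk r w) by apply: sqint_mul => //; exact: sX.
rewrite -ErZ// -ErD; [|by case: (sX r rn)|exact: int1Z].
rewrite -ErD; [|by case: sS|by apply: int1D; [case: (sX r rn)|exact: int1Z]].
by apply: eq_Er => w; rewrite big_nat_recr//=; ring.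
Qed.

Lemma nrm_sym a b : nrm (fun y => a y - b y) = nrm (fun y => b y - a y).
Proof. by congr Num.sqrt; apply: eq_Er => w; rewrite -sqrrN opprB. Qed.

Let V0 r : 0 <= V r. Proof. exact: nrm_ge0. Qed.

Lemma lag_dist r h : (h <= r)%N -> (r < n)%N ->
  nrm (fun y => ak (r - h)%N y - ak r y) <= \sum_(j < h) V (r - j).
Proof.
move=> hr rn; elim: h hr => [|h IH] hr.
  rewrite big_ord0 subn0; apply: nrm_le => //.
  rewrite /nsq (eq_Er P (Y := fun=> 0)) ?Er_cst ?expr0n// => w; by rewrite subrr expr0n.
have L i : (i <= r)%N -> L2k (ak i) by move=> ir; case: (kL (leq_ltn_trans ir rn)).
apply: le_trans (nrm_tri (L _ (leq_subr h.+1 r)) (L _ (leq_subr h r)) (L _ (leqnn r))) _.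
rewrite big_ord_recr/= [leRHS]addrC; apply: lerD; last exact/IH/ltnW.
by rewrite nrm_sym /V {2}/ak subnSK.
Qed.

(** Three errors: freezing the earlier kernel, paid by the variation over the preceding cells; lags
    cut off by the start [l], which concerns only the first [H] indices; and lags beyond [H], which
    decay geometrically. *)
Lemma step_approx H l r : (l <= r)%N -> (r < n)%N ->
  `|stepD l r - qH H r| <=
    2 * (H%:R * (C * (\sum_(j < H | (j <= r)%N) V (r - j)) + C ^+ 2 * (r - l < H)%N%:R)
       + kap * (1 - rho)^-1 * rho ^+ H).
Proof.
move=> lr rn; have [Lr mr nr cr] := kL rn.
set W := \sum_(j < H | _) _.
have W0 : 0 <= W by apply: sumr_ge0 => j _.
pose m := (r - l)%N.
pose A h := if (h < m)%N then cv h.+1 (ak (r - h.+1)) (ak r) else 0.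
pose B h := cv h.+1 (ak r) (ak r).
have EA : \sum_(l <= i < r) cv (r - i) (ak i) (ak r) = \sum_(h < m) A h.
  rewrite big_nat_rev/= -{1}[l]add0n big_addn big_mkord; apply: eq_bigr => h _.
  rewrite /A ltn_ord; have hm : (h < r - l)%N := ltn_ord h.
  have -> : (l + r - (h + l).+1)%N = (r - h.+1)%N by lia.
  by have -> : (r - (r - h.+1))%N = h.+1 by lia.
have EA2 : \sum_(h < m) A h = \sum_(h < H) A h + \sum_(h < m) A (H + h)%N.
  have S x y : \sum_(h < x + y) A h = \sum_(h < x) A h + \sum_(h < y) A (x + h)%N by rewrite big_split_ord.
  rewrite -S addnC S [X in _ = _ + X]big1 ?addr0// => h _.
  by rewrite /A ltnNge leq_addr.
have -> : stepD l r - qH H r = 2 * (\sum_(h < H) (A h - B h) + \sum_(h < m) A (H + h)%N).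
  by rewrite /stepD /qH EA EA2 sumrB; ring.
rewrite normrM ger0_norm// ler_pM2l//.
apply: le_trans (ler_normD _ _) _; apply: lerD.
  apply: le_trans (ler_norm_sum _ _ _) _.
  apply: (@le_trans _ _ (\sum_(h < H) (C * W + C ^+ 2 * (r - l < H)%N%:R))); last first.
    by rewrite sumr_const card_ord -[leLHS]mulr_natl.
  apply: ler_sum => h _; rewrite /A; case: ltnP => hm.
    apply: (@le_trans _ _ (C * W)); last by rewrite lerDl mulr_ge0// exprn_ge0 ?ltW.
    have hr : (h.+1 <= r)%N by apply: leq_trans hm _; rewrite leq_subr.
    have [Lh mh nh ch] := kL (leq_ltn_trans (leq_subr h.+1 r) rn).
    have D0 : nsqr (fun y => ak r y - ak r y) <= 0 ^+ 2.
      by rewrite /nsq (eq_Er P (Y := fun=> 0)) ?Er_cst ?expr0n// => w; rewrite subrr expr0n.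
    have D1 : nsqr (fun y => ak (r - h.+1)%N y - ak r y) <= nrm (fun y => ak (r - h.+1)%N y - ak r y) ^+ 2 by rewrite nrmE.
    apply: le_trans (cv_diff Heps_meas Hindep Hident h.+1 Lh Lr Lr Lr (ltW C0) (ltW C0) (nrm_ge0 _) (lexx 0) nr nr D1 D0) _.
    rewrite mulr0 addr0 mulrC ler_pM2l//.
    apply: le_trans (lag_dist hr rn) _.
    have hH : (h.+1 <= H)%N := ltn_ord h.
    rewrite (big_ord_widen H (fun j => V (r - j)) hH) [leLHS]big_mkcond [leRHS]big_mkcond/=.
    apply: ler_sum => j _; case: ifP => jh; last by case: ifP.
    by rewrite (leq_trans _ hr)// ltnW.
  rewrite sub0r normrN.
  have -> : (r - l < H)%N by apply: leq_ltn_trans hm _.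
  apply: (@le_trans _ _ (C ^+ 2)); last by rewrite mulr1 lerDr mulr_ge0// ltW.
  by rewrite expr2; exact: (cv_CS Heps_meas Hindep Hident h.+1 Lr Lr (ltW C0) (ltW C0) nr nr).
apply: le_trans (ler_norm_sum _ _ _) _.
apply: (@le_trans _ _ (\sum_(h < m) kap * rho ^+ H * rho ^+ h)).
  apply: ler_sum => h _; rewrite /A; case: ifP => hm; last first.
    rewrite normr0; apply: mulr_ge0; last by rewrite exprn_ge0// ltW.
    by apply: mulr_ge0; [exact: ltW|rewrite exprn_ge0// ltW].
  have [Lh mh nh ch] := kL (leq_ltn_trans (leq_subr (H + h).+1 r) rn).
  apply: le_trans (cv_decay Heps_meas Hindep Hident _ C0 rho01 Lh Lr mh mr nh nr ch cr) _.
  rewrite -/kap -mulrA -exprD ler_pM2l// exprS ler_piMl ?exprn_ge0 ?ltW//.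
  by case/andP: rho01.
have := sum_geom_le m rho01; set G := \sum_(j < m) _ => hG.
rewrite -mulr_sumr -/G [leRHS]mulrAC ler_pM2l// mulr_gt0// exprn_gt0//.
Qed.

Lemma sum_V_shift j k : (k <= n)%N -> \sum_(r < k | (j <= r)%N) V (r - j) <= \sum_(r < n) V r.
Proof.
move=> kn; have [kj|jk] := leqP k j.
  rewrite big1 ?sumr_ge0// => r; rewrite leqNgt; by rewrite (leq_trans (ltn_ord r) kj).
rewrite -(big_mkord (fun r => (j <= r)%N) (fun r => V (r - j))).
rewrite (big_cat_nat (n := j))//= ?(ltnW jk)//.
rewrite big1_seq ?add0r; last first.
  by move=> i /andP[ji]; rewrite mem_index_iota => /andP[_]; rewrite ltnNge ji.
rewrite -{1}[j]add0n big_addn big_mkord.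
rewrite (eq_bigr (fun r : 'I_(k - j) => V r)); last by move=> i _; rewrite addnK.
rewrite (eq_bigl xpredT) => [|i]; last by rewrite leq_addl.
have kjn : (k - j <= n)%N by rewrite (leq_trans (leq_subr _ _)).
rewrite (big_ord_widen n V kjn) [leLHS]big_mkcond/=; apply: ler_sum => i _; by case: ifP.
Qed.

Lemma var_qH H l l' : (l <= l')%N -> (l' <= n)%N ->
  `|Er P (fun w => (\sum_(l <= i < l') Xk i w) ^+ 2) - \sum_(l <= i < l') qH H i| <=
  2 * (H%:R * (C * (H%:R * \sum_(r < n) V r) + C ^+ 2 * H%:R) + n%:R * (kap * (1 - rho)^-1 * rho ^+ H)).
Proof.
move=> ll ln; rewrite var_expand// -sumrB.
apply: le_trans (ler_norm_sum _ _ _) _.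
set c := kap * _ * _; have c0 : 0 <= c.
  apply: mulr_ge0; last by rewrite exprn_ge0// ltW.
  by apply: mulr_ge0; [exact: ltW|rewrite invr_ge0 ltW].
apply: (@le_trans _ _ (\sum_(l <= r < l') 2 * (H%:R * (C * (\sum_(j < H | (j <= r)%N) V (r - j)) + C ^+ 2 * (r - l < H)%N%:R) + c))).
  rewrite big_nat_cond [leRHS]big_nat_cond; apply: ler_sum => i; rewrite andbT => /andP[li il].
  by apply: step_approx => //; exact: leq_trans ln.
rewrite -mulr_sumr ler_pM2l// big_split/= -mulr_sumr; apply: lerD; last first.
  rewrite big_const_nat iter_addr_0 -[leLHS]mulr_natl ler_wpM2r// ler_nat.
  by rewrite (leq_trans (leq_subr _ _)).
rewrite ler_wpM2l// big_split/= -!mulr_sumr; apply: lerD; last first.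
  rewrite ler_pM2l ?exprn_gt0// -natr_sum ler_nat.
  rewrite -{1}[l]add0n big_addn big_mkord.
  rewrite (eq_bigr (fun i : 'I_(l' - l) => (i < H)%N : nat)); last by move=> i _; rewrite addnK.
  suff : (\sum_(i < l' - l) (i < H) <= minn (l' - l) H)%N by rewrite leq_min => /andP[].
  elim: (l' - l)%N => [|k IH]; first by rewrite big_ord0.
  rewrite big_ord_recr/=; move: IH; set S := (\sum_(i < k) _)%N.
  by case: (ltnP k H) => kH /=; rewrite ?addn1 ?addn0; lia.
rewrite ler_pM2l// (exchange_big_dep xpredT)//=.
apply: (@le_trans _ _ (\sum_(j < H) \sum_(r < n) V r)); last first.
  by rewrite sumr_const card_ord mulr_natl.
apply: ler_sum => j _; apply: le_trans (sum_V_shift j ln).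
rewrite -(big_mkord (fun r => (j <= r)%N) (fun r => V (r - j))).
rewrite [leRHS](big_cat_nat (n := l))//= lerDr; by apply: sumr_ge0.
Qed.

Let nrm_ak r u : (r < n)%N -> I01 u -> nrm (fun y => ak r y - gn n u y) <= 2 * C.
Proof.
move=> rn Iu; have [Lr _ nr _] := kL rn; have [Lu _ nu _] := K1 n0 Iu.
apply: le_trans (nrm_tri Lr (L2k_cst P eps 0) Lu) _.
rewrite [X in _ + X]nrm_sym.
have z b : (fun y => b y - (fun=> 0) y) = b :> ((nat -> R) -> R) by apply/funext => y; rewrite subr0.
rewrite !z; have := nrm_le (ltW C0) nr; have := nrm_le (ltW C0) nu; lra.
Qed.

Let cell (r : nat) (u : R) := r%:R / n%:R <= u < r.+1%:R / n%:R.

(** The kernel need not be continuous in time, so the oscillation in a cell is replaced by a nearly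
    maximizing point. Cells are half-open, so every chosen point lies strictly before the right end
    of its cell and the points can be inserted in a partition. *)
Lemma cell_sup a : 0 < a -> exists x : nat -> R, forall r, (r < n)%N -> cell r (x r) /\
  forall u, cell r u -> nrm (fun y => ak r y - gn n u y) <= nrm (fun y => ak r y - gn n (x r) y) + a.
Proof.
move=> a0; have nn : 0 < n%:R :> R by rewrite ltr0n.
suff H r : exists x, (r < n)%N -> cell r x /\
    forall u, cell r u -> nrm (fun y => ak r y - gn n u y) <= nrm (fun y => ak r y - gn n x y) + a.
  by have [x hx] := choice H; exists x.
have [rn|] := ltnP r n; last by exists 0.
pose E := [set nrm (fun y => ak r y - gn n u y) | u in [set u | cell r u]].
have cI u : cell r u -> I01 u.
  move=> /andP[h1 h2]; apply/andP; split; first by apply: le_trans h1; rewrite divr_ge0.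
  by apply: le_trans (ltW h2) _; rewrite ler_pdivrMr// mul1r ler_nat.
have hE : has_sup E.
  split; last by exists (2 * C) => z [u cu <-]; exact: (nrm_ak rn (cI u cu)).
  exists (nrm (fun y => ak r y - gn n (r%:R / n%:R) y)); exists (r%:R / n%:R) => //.
  by rewrite /cell /= lexx /= ltr_pM2r ?invr_gt0// ltr_nat.
have [z [x cx <-] hx] := sup_adherent a0 hE.
exists x => _; split => // u cu.
have : nrm (fun y => ak r y - gn n u y) <= sup E by apply: sup_upper_bound => //; exists u.
lra.
Qed.

(** On each cell the integrand is compared with [qH]: the tail of the covariance series, the passage
    from the limiting to the prelimit kernel, and the oscillation within the cell. Only the sum of
    the oscillations over the cells is controlled, and that is enough. *)
Lemma riemann H (del a D : R) l l' : 0 <= del -> (forall u, I01 u -> nsqr (fun y => gn n u y - g u y) <= del ^+ 2) ->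
  0 < a -> (forall x, (forall r, (r < n)%N -> r%:R / n%:R <= x r < r.+1%:R / n%:R) ->
    \sum_(r < n) nrm (fun y => gn n (r.+1%:R / n%:R) y - gn n (x r) y) <= n%:R * a + D) ->
  (l <= l')%N -> (l' <= n)%N ->
  `|n%:R * (primitive sig (l'%:R / n%:R) - primitive sig (l%:R / n%:R)) - \sum_(l <= i < l') qH H i| <=
  n%:R * tl H + (1 + 2 * H%:R) * (n%:R * (3 * C * del) + 2 * C * (n%:R * a + (n%:R * a + D))).
Proof.
move=> del0 hdel a0 hD ll ln; have nn : 0 < n%:R :> R by rewrite ltr0n.
have [x hx] := cell_sup a0.
pose dd r := nrm (fun y => ak r y - gn n (x r) y).
have dd0 r : 0 <= dd r by exact: nrm_ge0.
pose b r := tl H + (1 + 2 * H%:R) * (3 * C * del + 2 * C * (a + dd r)).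
have tl0 : 0 <= tl H.
  apply: mulr_ge0; last by rewrite exprn_ge0// ltW.
  by rewrite -mulrA mulr_ge0// ltW// divr_gt0.
have H20 : 0 <= 1 + 2 * H%:R :> R by rewrite addr_ge0// mulr_ge0.
have b0 r : 0 <= b r.
  by rewrite addr_ge0// mulr_ge0// addr_ge0// !mulr_ge0 ?(ltW C0)// addr_ge0// ltW.
have step r : (r < n)%N ->
    `|n%:R * (primitive sig (r.+1%:R / n%:R) - primitive sig (r%:R / n%:R)) - qH H r| <= b r.
  move=> rn; have [Lr _ nr _] := kL rn.
  have pt u : r%:R / n%:R < u -> u <= r.+1%:R / n%:R -> `|sig u - qH H r| <= b r.
    move=> u1 u2; have Iu : I01 u.
      apply/andP; split; first by apply: le_trans (ltW u1); rewrite divr_ge0.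
      by apply: le_trans u2 _; rewrite ler_pdivrMr// mul1r ler_nat.
    have [Lu _ nu _] := K1 n0 Iu.
    have du : nrm (fun y => ak r y - gn n u y) <= a + dd r.
      rewrite addrC; move: u2; rewrite le_eqVlt => /orP[/eqP ->|u2].
        apply: nrm_le; first by rewrite addr_ge0// ltW.
        rewrite /nsq (eq_Er P (Y := fun=> 0)) ?Er_cst ?sqr_ge0// => w.
        by rewrite subrr expr0n.
      by have [_] := hx r rn; apply; rewrite /cell (ltW u1).
    have t h : `|gam h u - cv h (ak r) (ak r)| <= 3 * C * del + 2 * C * (a + dd r).
      have := cv_gn_g h n0 Iu del0 (hdel u Iu).
      have nsD : nsqr (fun y => gn n u y - ak r y) <= (a + dd r) ^+ 2.
        by rewrite -nrmE lerXn2r ?nnegrE ?nrm_ge0 ?addr_ge0 ?(ltW a0)// nrm_sym.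
      have := cv_diff Heps_meas Hindep Hident h Lu Lu Lr Lr (ltW C0) (ltW C0) (addr_ge0 (ltW a0) (dd0 r))
        (addr_ge0 (ltW a0) (dd0 r)) nr nu nsD nsD.
      rewrite [X in _ -> X <= _ -> _]distrC.
      set p := cv _ _ _; set q := cv _ _ _; set m := gam h u => h1 h2.
      have := ler_normD (m - p) (p - q); rewrite addrA subrK; lra.
    have S : `|psum H u - qH H r| <= (1 + 2 * H%:R) * (3 * C * del + 2 * C * (a + dd r)).
      have -> : psum H u - qH H r = (gam 0 u - cv 0 (ak r) (ak r)) +
          2 * \sum_(h < H) (gam h.+1 u - cv h.+1 (ak r) (ak r)).
        by rewrite /psum /qH sumrB; ring.
      apply: le_trans (ler_normD _ _) _; rewrite [leRHS]mulrDl mul1r; apply: lerD; first exact: t.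
      rewrite normrM ger0_norm// -mulrA ler_pM2l//; apply: le_trans (ler_norm_sum _ _ _) _.
      apply: (@le_trans _ _ (\sum_(h < H) (3 * C * del + 2 * C * (a + dd r)))); first by apply: ler_sum => h _.
      by rewrite sumr_const card_ord -[leLHS]mulr_natl.
    have := sig_tail H Iu; have := ler_normD (sig u - psum H u) (psum H u - qH H r).
    by rewrite addrA subrK /b; lra.
  have st : r%:R / n%:R <= r.+1%:R / n%:R :> R by rewrite ler_pM2r ?invr_gt0// ler_nat.
  have := primitive_incr sig_meas sig_bound _ st _ pt.
  have := gI (ltnW rn); have := gI rn; rewrite /I01/= => /andP[_ g1] /andP[g2 _] => /(_ g2 g1).
  have -> : r.+1%:R / n%:R - r%:R / n%:R = n%:R^-1 :> R.
    by rewrite -mulrBl -natr1 addrAC subrr add0r mul1r.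
  set Dp := primitive sig _ - primitive sig _ => h1.
  have -> : n%:R * Dp - qH H r = n%:R * (Dp - n%:R^-1 * qH H r) by field; rewrite gt_eqF.
  by rewrite normrM gtr0_norm// -ler_pdivlMl.
have -> : primitive sig (l'%:R / n%:R) - primitive sig (l%:R / n%:R) =
    \sum_(l <= i < l') (primitive sig (i.+1%:R / n%:R) - primitive sig (i%:R / n%:R)).
  by rewrite (telescope_sumr (fun i => primitive sig (i%:R / n%:R))).
rewrite mulr_sumr -sumrB; apply: le_trans (ler_norm_sum _ _ _) _.
apply: (@le_trans _ _ (\sum_(l <= i < l') b i)).
  rewrite big_nat_cond [leRHS]big_nat_cond; apply: ler_sum => i; rewrite andbT => /andP[_ il].
  by apply: step; exact: leq_trans ln.
apply: (@le_trans _ _ (\sum_(i < n) b i)).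
  rewrite -(big_mkord xpredT b) [leRHS](big_cat_nat (n := l'))//=.
  rewrite [X in _ <= X + _](big_cat_nat (n := l))//=.
  have s1 : 0 <= \sum_(0 <= i < l) b i by apply: sumr_ge0.
  have s2 : 0 <= \sum_(l' <= i < n) b i by apply: sumr_ge0.
  by lra.
rewrite /b big_split/= sumr_const card_ord -[tl H *+ n]mulr_natl lerD2l -mulr_sumr ler_wpM2l//.
rewrite big_split/= sumr_const card_ord -[_ *+ n]mulr_natl lerD2l -mulr_sumr ler_wpM2l ?mulr_ge0 ?(ltW C0)//.
rewrite big_split/= sumr_const card_ord -[_ *+ n]mulr_natl lerD2l.
by apply: hD => r rn; have [] := hx r rn.
Qed.
End FixedN.

Lemma sigma_limit e : 0 < e -> exists N, forall n l l', (N <= n)%N -> (l <= l')%N -> (l' <= n)%N ->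
  `|n%:R^-1 * Er P (fun w => (\sum_(l <= i < l') gn n (i.+1%:R / n%:R) (eps_seq eps i.+1%:Z w)) ^+ 2)
    - (primitive sig (l'%:R / n%:R) - primitive sig (l%:R / n%:R))| <= e.
Proof.
move=> e0; have e4 : 0 < e / 4 by rewrite divr_gt0.
have [H0 hH] := tl_small e4; pose H := H0.
have tH : tl H <= e / 4 := hH H0 (leqnn _).
(* This collects the coefficients of [n * a] in both comparisons. The truncation [H] is already
   fixed, so [a] can be taken small after it and [n] large after both; the final 1 keeps [c2]
   positive. *)
pose c2 := 2 * (H%:R * (C * H%:R)) + 2 * (H%:R * (C ^+ 2 * H%:R)) + (1 + 2 * H%:R) * (6 * C) + 1.
have h0 : 0 <= H%:R :> R by [].
have c20 : 1 <= c2.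
  rewrite /c2 lerDr !addr_ge0 ?mulr_ge0 ?exprn_ge0 ?(ltW C0)//.
have c2p : 0 < c2 by lra.
pose a := e / (16 * c2).
have a0 : 0 < a by rewrite divr_gt0// mulr_gt0.
have ca : c2 * a = e / 16 by rewrite /a; field; rewrite gt_eqF.
have [D D0 hD] := K4 a0.
have [N1 hN1] := K3 a0.
have ND : 0 <= (D + 1) / a by rewrite divr_ge0 ?(ltW a0)// addr_ge0.
have [N2 hN2] : exists N2 : nat, (D + 1) / a < N2%:R.
  by exists (Num.truncn ((D + 1) / a)).+1; have /andP[] := truncn_itv ND.
exists (maxn N1 N2.+1) => n l l'; rewrite geq_max => /andP[n1 n2] ll ln.
have n0 : (0 < n)%N by apply: leq_trans n2.
have nn : 0 < n%:R :> R by rewrite ltr0n.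
have Dn : D + 1 <= n%:R * a.
  rewrite -ler_pdivrMr//; apply: le_trans (ltW hN2) _; rewrite ler_nat; exact: ltnW.
have h1 := var_qH n0 H ll ln.
have h2 := riemann n0 H (ltW a0) (fun u => hN1 n u n1) a0 (fun x => hD n x n0) ll ln.
have hV := hD n (fun r => r%:R / n%:R) n0 _.
have {}hV : \sum_(r < n) nrm (fun y => gn n (r.+1%:R / n%:R) y - gn n (r%:R / n%:R) y) <= n%:R * a + D.
  by apply: hV => r rn; rewrite lexx/= ltr_pM2r ?invr_gt0// ltr_nat.
move: h1 h2; set EV := Er P _; set Q := \sum_(l <= i < l') _; set DS := primitive sig _ - _ => h1 h2.
set VV := \sum_(r < n) _ in hV h1.
have -> : n%:R^-1 * EV - DS = n%:R^-1 * (EV - n%:R * DS) by field; rewrite gt_eqF.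
rewrite normrM gtr0_norm ?invr_gt0// ler_pdivrMl//.
have : `|EV - n%:R * DS| <= `|EV - Q| + `|n%:R * DS - Q|.
  have -> : EV - n%:R * DS = (EV - Q) - (n%:R * DS - Q) by ring.
  exact: ler_normB.
move=> h3; apply: le_trans h3 _; apply: le_trans (lerD h1 h2) _.
have hV2 : VV <= 2 * (n%:R * a) by lra.
have H1 : 2 * (H%:R * (C * (H%:R * VV) + C ^+ 2 * H%:R)) <=
   2 * (H%:R * (C * H%:R)) * (2 * (n%:R * a)) + 2 * (H%:R * (C ^+ 2 * H%:R)) * (n%:R * a).
  have -> : 2 * (H%:R * (C * (H%:R * VV) + C ^+ 2 * H%:R)) =
    2 * (H%:R * (C * H%:R)) * VV + 2 * (H%:R * (C ^+ 2 * H%:R)) * 1 by ring.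
  apply: lerD; apply: ler_wpM2l => //; last by lra.
    by rewrite !mulr_ge0// ltW.
  by rewrite !mulr_ge0// ltW.
have H2 : n%:R * (3 * C * a) + 2 * C * (n%:R * a + (n%:R * a + D)) <= 6 * C * (2 * (n%:R * a)).
  have -> : n%:R * (3 * C * a) + 2 * C * (n%:R * a + (n%:R * a + D)) = C * (7 * (n%:R * a) + 2 * D) by ring.
  have -> : 6 * C * (2 * (n%:R * a)) = C * (12 * (n%:R * a)) by ring.
  by rewrite ler_pM2l//; lra.
have H2' : 0 <= 1 + 2 * H%:R :> R by rewrite addr_ge0// mulr_ge0.
have H3 := ler_wpM2l H2' H2.
have tE : 2 * (n%:R * (kap * (1 - rho)^-1 * rho ^+ H)) = n%:R * tl H by rewrite /tl; ring.
have na0 : 0 <= n%:R * a by rewrite mulr_ge0// ltW.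
have K : 2 * (H%:R * (C * H%:R)) * (2 * (n%:R * a)) + 2 * (H%:R * (C ^+ 2 * H%:R)) * (n%:R * a) +
    (1 + 2 * H%:R) * (6 * C * (2 * (n%:R * a))) <= 2 * (c2 * (n%:R * a)).
  have u1 : 0 <= H%:R * (C ^+ 2 * H%:R) * (n%:R * a) by apply: mulr_ge0 => //; rewrite !mulr_ge0// ltW.
  rewrite /c2; lra.
have nt : n%:R * tl H <= n%:R * (e / 4) by rewrite ler_pM2l.
have cna : c2 * (n%:R * a) = n%:R * (e / 16) by rewrite mulrCA ca.
rewrite [2 * (_ + _)]mulrDr tE; rewrite cna in K.
have ne : 0 <= n%:R * e by rewrite mulr_ge0// ltW.
lra.
Qed.
End Sigma.

(** * Consequences of the assumptions for the centred kernels *)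

Section Assumptions.
Context {R : realType} {d : measure_display} {T : measurableType d} (P : probability T R).
Variables eps epss : int -> T -> R.
Hypothesis Heps_meas : forall i, measurable_fun setT (eps i) /\ measurable_fun setT (epss i).
Hypothesis Hindep : mutual_indep P (joint_family eps epss).
Hypothesis Hident : ident_distr P (joint_family eps epss).
Variables (q p CG rho : R).
Hypotheses (Hq : 2 < q) (Hp : 1 <= p) (Hrho : 0 < rho < 1).
Variables (Gn : nat -> R -> (nat -> R) -> R) (G : R -> (nat -> R) -> R).
Hypotheses (HGn_meas : forall n, kernel_measurable (Gn n)) (HG_meas : kernel_measurable G).
Hypothesis A1 : forall e : R, 0 < e -> exists N : nat, forall n : nat, (N <= n)%N ->
  forall u, 0 <= u <= 1 ->
  (LqN P q (fun w => (Gn n u (eps_seq eps 0 w) - G u (eps_seq eps 0 w))%R) <= e%:E)%E.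
Hypothesis A2 : (ereal_sup [set LqN P q (fun w => Gn nu.1 nu.2 (eps_seq eps 0 w))
                     | nu in [set nu : nat * R | (0 < nu.1)%N /\ (0 <= nu.2 <= 1)%R]]
           + ereal_sup [set pvar P q p (Gn n) (eps_seq eps 0)
                       | n in [set n : nat | (0 < n)%N]] <= CG%:E)%E.
Hypothesis A3 : forall (j n : nat) (t : int) (u : R), (0 < n)%N -> 0 <= u <= 1 ->
  (LqN P q (fun w => (Gn n u (eps_seq eps t w) - Gn n u (eps_tilde eps epss t j w))%R)
    <= (CG * rho ^+ j)%R%:E)%E.

Let LqN0 X : (0 <= LqN P q X)%E. Proof. exact: Lnorm_ge0. Qed.

Lemma LqN_pvar_bound : 0 <= CG /\ (forall n u, (0 < n)%N -> I01 u ->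
    (LqN P q (fun w => Gn n u (eps_seq eps 0 w)) <= CG%:E)%E) /\
  forall n, (0 < n)%N -> (pvar P q p (Gn n) (eps_seq eps 0) <= CG%:E)%E.
Proof.
move: A2; set s1 := ereal_sup _; set s2 := ereal_sup _ => A.
have s10 : (0 <= s1)%E.
  apply: (@le_trans _ _ (LqN P q (fun w => Gn 1 0 (eps_seq eps 0 w)))); first exact: LqN0.
  by apply: ereal_sup_ubound; exists (1%N, 0) => //=; rewrite lexx ler01.
have pv0 n : (0 <= pvar P q p (Gn n) (eps_seq eps 0))%E.
  apply: le_trans; last first.
    by apply: ereal_sup_ubound; exists [:: 1] => //; split => //=; rewrite ltr01.
  exact: poweR_ge0.
have s20 : (0 <= s2)%E.
  apply: (@le_trans _ _ (pvar P q p (Gn 1) (eps_seq eps 0))); first exact: pv0.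
  by apply: ereal_sup_ubound; exists 1%N.
split; first by rewrite -lee_fin; apply: le_trans A; exact: adde_ge0.
split=> [n u n0 Iu|n n0].
  apply: le_trans A; apply: (@le_trans _ _ s1); last exact: leeDl.
  by apply: ereal_sup_ubound; exists (n, u).
apply: le_trans A; apply: (@le_trans _ _ s2); last exact: leeDr.
by apply: ereal_sup_ubound; exists n.
Qed.

(** Adding 1 makes the constant positive. Doubling it absorbs the factor 2 of [LqN_sqint], since
    [2 * a ^+ 2 <= (2 * a) ^+ 2]. *)
Definition Cst := 2 * (CG + 1).
Let CG0 : 0 <= CG := LqN_pvar_bound.1.
Let C10 : 0 < CG + 1. Proof. by rewrite ltr_wpDl. Qed.
Lemma Cst_gt0 : 0 < Cst. Proof. by rewrite mulr_gt0. Qed.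

Let mseq t : measurable_fun setT (eps_seq eps t : T -> seqR).
Proof. by apply: meas_seq => k; case: (Heps_meas (t - k%:Z)). Qed.

Let mtil t j : measurable_fun setT (eps_tilde eps epss t j : T -> seqR).
Proof.
apply: meas_seq => k; rewrite /eps_tilde; case: eqP => _.
  by case: (Heps_meas (t - j%:Z)).
by case: (Heps_meas (t - k%:Z)).
Qed.

Let mGn n u t : measurable_fun setT (fun w => Gn n u (eps_seq eps t w)).
Proof. exact: (measurableT_comp (kernel_section u (HGn_meas n)) (mseq t)). Qed.
Let mG u t : measurable_fun setT (fun w => G u (eps_seq eps t w)).
Proof. exact: (measurableT_comp (kernel_section u HG_meas) (mseq t)). Qed.

Lemma Gn_L2k n u : (0 < n)%N -> I01 u -> [/\ L2k P eps (Gn n u), nsq P eps (Gn n u) <= Cst ^+ 2 &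
  forall c, 0 < c -> Er P (fun w => pos (Gn n u (eps_seq eps 0 w)) c ^+ 2) <= (CG + 1) `^ q * c `^ (2 - q)].
Proof.
move=> n0 Iu; have [_ [H _]] := LqN_pvar_bound.
have h : (LqN P q (fun w => Gn n u (eps_seq eps 0 w)) <= (CG + 1)%:E)%E.
  by apply: le_trans (H n u n0 Iu) _; rewrite lee_fin lerDl.
have [s1 s2 s3] := LqN_sqint Hq C10 (mGn n u 0) h.
split => //; first by split => //; exact: kernel_section.
apply: le_trans s2 _; rewrite /Cst exprMn ler_wpM2r ?sqr_ge0//; rewrite expr2; lra.
Qed.

Lemma Gn_G e : 0 < e -> exists N, forall n u, (N <= n)%N -> I01 u ->
  sqint P (fun w => Gn n u (eps_seq eps 0 w) - G u (eps_seq eps 0 w)) /\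
  Er P (fun w => (Gn n u (eps_seq eps 0 w) - G u (eps_seq eps 0 w)) ^+ 2) <= e ^+ 2.
Proof.
move=> e0; have e2 : 0 < e / 2 by rewrite divr_gt0.
have [N H] := A1 e2; exists N => n u Nn Iu.
have [||s1 s2 _] := @LqN_sqint _ _ _ P q (e / 2) (fun w => Gn n u (eps_seq eps 0 w) - G u (eps_seq eps 0 w)) Hq e2.
- exact: measurable_funB.
- exact: H.
split => //; apply: le_trans s2 _; have := sqr_ge0 e; rewrite exprMn; lra.
Qed.

Lemma G_L2k u : I01 u -> L2k P eps (G u).
Proof.
move=> Iu; split; first exact: kernel_section.
have [N H] := Gn_G ltr01; have [s1 _] := H N.+1 u (leqnSn N) Iu.
have [[_ s2] _ _] := Gn_L2k (ltn0Sn N) Iu.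
have := sqintB s2 s1; rewrite (_ : (fun w => _) = fun w => G u (eps_seq eps 0 w))//.
by apply/funext => w; rewrite opprB addrC subrK.
Qed.

Definition cGn n u := ctr P eps (Gn n u).
Definition cG u := ctr P eps (G u).

Lemma centered_coupled n u : (0 < n)%N -> I01 u -> [/\ L2k P eps (cGn n u),
  Er P (fun w => cGn n u (eps_seq eps 0 w)) = 0, nsq P eps (cGn n u) <= Cst ^+ 2 & coupled P eps epss Cst rho (cGn n u)].
Proof.
move=> n0 Iu; have [L nn _] := Gn_L2k n0 Iu; split.
- exact: L2k_ctr.
- exact: ctr_mean.
- exact: le_trans (ctr_nsq L) nn.
move=> t j; have rj : 0 < rho ^+ j by rewrite exprn_gt0//; case/andP: Hrho.
have a0 : 0 < (CG + 1) * rho ^+ j by rewrite mulr_gt0.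
have [||_ s2 _] := @LqN_sqint _ _ _ P q ((CG + 1) * rho ^+ j)
    (fun w => Gn n u (eps_seq eps t w) - Gn n u (eps_tilde eps epss t j w)) Hq a0.
- apply: measurable_funB => //.
  exact: (measurableT_comp (kernel_section u (HGn_meas n)) (mtil t j)).
- by apply: le_trans (A3 j t n0 Iu) _; rewrite lee_fin ler_pM2r// lerDl.
rewrite (eq_Er P (Y := fun w => (Gn n u (eps_seq eps t w) - Gn n u (eps_tilde eps epss t j w)) ^+ 2)).
  apply: le_trans s2 _; rewrite /Cst -mulrA [leRHS]exprMn ler_wpM2r ?sqr_ge0//; rewrite expr2; lra.
by move=> w; rewrite /cGn /ctr; congr (_ ^+ 2); ring.
Qed.

Lemma centered_limit_L2k u : I01 u -> L2k P eps (cG u).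
Proof. by move=> Iu; apply: L2k_ctr; exact: G_L2k. Qed.

Lemma centered_kernel_cvg e : 0 < e -> exists N, forall n u, (N <= n)%N -> I01 u ->
  nsq P eps (fun y => cGn n u y - cG u y) <= e ^+ 2.
Proof.
move=> e0; have [N H] := Gn_G e0; exists N.+1 => n u Nn Iu.
have [s1 s2] := H n u (ltnW Nn) Iu.
have [L1 _ _] := Gn_L2k (leq_trans (ltn0Sn N) Nn) Iu; have L2 := G_L2k Iu.
by rewrite (ctrB L1 L2); apply: le_trans (ctr_nsq (L2kB L1 L2)) _.
Qed.

Lemma meas_Er2 (A : R * T -> R) : measurable_fun setT A ->
  measurable_fun setT (fun u => Er P (fun w => A (u, w) ^+ 2)).
Proof.
move=> mA.
have m1 : measurable_fun setT (fun z => (A z ^+ 2)%:E) by apply/measurable_EFinP; exact: measurable_funX.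
have H := @measurable_fun_fubini_tonelli_F _ _ R T R P (fun z => (A z ^+ 2)%:E) m1
  (fun z => ltac:(by rewrite lee_fin sqr_ge0)).
rewrite (_ : (fun u => _) = fine \o fubini_F P (fun z => (A z ^+ 2)%:E)).
  by apply: measurableT_comp => //.
by apply/funext => u; rewrite ErE /Rintegral.
Qed.

Let G01 u y : R := \1_I01 u * G u y.
Let mI01 : measurable (I01 : set R).
Proof.
rewrite (_ : I01 = `[0, 1]%classic); first exact: measurable_itv.
by apply/seteqP; split => x /=; rewrite in_itv.
Qed.

Let mG01 t : measurable_fun setT (fun z : R * T => G01 z.1 (eps_seq eps t z.2)).
Proof.
apply: measurable_funM.
  by apply: (measurableT_comp _ (measurable_fst)) => //; exact: measurable_indic.
apply: (kernel_joint (y := eps_seq eps t)) => //.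
by move=> k; case: (Heps_meas (t - k%:Z)).
Qed.

(** Polarization writes the covariance through integrals of squares, whose dependence on [u] is
    measurable by Tonelli's theorem without any integrability in the product space. *)
Lemma centered_cov_meas h : measurable_fun I01 (fun u => cv P eps h (cG u) (cG u)).
Proof.
pose S2 (A : R * T -> R) u := Er P (fun w => A (u, w) ^+ 2).
pose Z0 (z : R * T) := G01 z.1 (eps_seq eps 0 z.2); pose Zh (z : R * T) := G01 z.1 (eps_seq eps h%:Z z.2).
pose mean u := (S2 (fun z => Z0 z + 1) u - S2 Z0 u - 1) / 2.
pose corr u := (S2 (fun z => Z0 z + Zh z) u - S2 (fun z => Z0 z - Zh z) u) / 4.
have mS A : measurable_fun setT A -> measurable_fun setT (S2 A) by exact: meas_Er2.
have mm : measurable_fun setT mean.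
  apply: measurable_funM => //; apply: measurable_funB => //; apply: measurable_funB; apply: mS; last exact: mG01.
  by apply: measurable_funD => //; exact: mG01.
have mc : measurable_fun setT corr.
  apply: measurable_funM => //; apply: measurable_funB; apply: mS.
    by apply: measurable_funD; exact: mG01.
  by apply: measurable_funB; exact: mG01.
apply: (eq_measurable_fun (fun u => corr u - mean u ^+ 2)); last first.
  apply: measurable_funTS; apply: measurable_funB => //; exact: measurable_funX.
move=> u; rewrite inE => Iu.
have LG := G_L2k Iu; have [s0 e0] := L2k_at Heps_meas Hindep Hident 0 LG; have [sh eh] := L2k_at Heps_meas Hindep Hident h%:Z LG.
have Z0E w : Z0 (u, w) = G u (eps_seq eps 0 w) by rewrite /Z0 /G01/= indicE mem_set// mul1r.
have ZhE w : Zh (u, w) = G u (eps_seq eps h%:Z w) by rewrite /Zh /G01/= indicE mem_set// mul1r.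
set m := Er P (fun w => G u (eps_seq eps 0 w)).
have mh : Er P (fun w => G u (eps_seq eps h%:Z w)) = m by rewrite (Er_at Heps_meas Hindep Hident).
have i0 := sqint_int1 s0; have ih := sqint_int1 sh.
have meanE : mean u = m.
  rewrite /mean /S2 (eq_Er P (Y := fun w => G u (eps_seq eps 0 w) ^+ 2 + (2 * G u (eps_seq eps 0 w) + 1))); last first.
    by move=> w; rewrite Z0E; ring.
  rewrite (eq_Er P (X := fun w => Z0 (u, w) ^+ 2) (Y := fun w => G u (eps_seq eps 0 w) ^+ 2)); last by move=> w; rewrite Z0E.
  rewrite (ErD (proj2 s0) (int1D (int1Z 2 i0) (int1_cst P 1))) (ErD (int1Z 2 i0) (int1_cst P 1)) (ErZ 2 i0) Er_cst -/m.
  by field.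
have corrE : corr u = Er P (fun w => G u (eps_seq eps 0 w) * G u (eps_seq eps h%:Z w)).
  have p1 := (sqintD s0 sh).2; have p2 := (sqintB s0 sh).2.
  rewrite /corr /S2 (eq_Er P (Y := fun w => (G u (eps_seq eps 0 w) + G u (eps_seq eps h%:Z w)) ^+ 2)); last first.
    by move=> w; rewrite Z0E ZhE.
  rewrite (eq_Er P (X := fun w => (Z0 (u, w) - Zh (u, w)) ^+ 2) (Y := fun w => (G u (eps_seq eps 0 w) - G u (eps_seq eps h%:Z w)) ^+ 2)); last first.
    by move=> w; rewrite Z0E ZhE.
  rewrite -ErB// mulrC -ErZ; last exact: int1B.
  by apply: eq_Er => w; field.
have iP := sqint_mul s0 sh.
rewrite corrE meanE /cv /cG /ctr -/m.
rewrite (eq_Er P (X := fun w => (G u (eps_seq eps 0 w) - m) * (G u (eps_seq eps h%:Z w) - m))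
  (Y := fun w => (G u (eps_seq eps 0 w) * G u (eps_seq eps h%:Z w) + (- m * G u (eps_seq eps 0 w))) +
     ((- m) * G u (eps_seq eps h%:Z w) + m ^+ 2))); last by move=> w; ring.
have j1 := int1Z (- m) i0; have j2 := int1Z (- m) ih.
rewrite (ErD (int1D iP j1) (int1D j2 (int1_cst P _))) (ErD iP j1) (ErD j2 (int1_cst P _)).
rewrite (ErZ _ i0) (ErZ _ ih) Er_cst mh -/m; ring.
Qed.

(** The points [x r] are inserted between consecutive grid points and only the leg from [x r] to the
    next grid point is kept. A point equal to the left grid point is not inserted, because
    partitions must be strictly increasing. *)
Lemma part_sum n (k : nat) (x : nat -> R) : (0 < n)%N -> 
  (forall r, (r < k)%N -> r%:R / n%:R <= x r < r.+1%:R / n%:R) ->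
  exists s : seq R, [/\ path <%R 0 s, last 0 s = k%:R / n%:R &
   (\sum_(r < k) (LqN P q (fun w => (Gn n (r.+1%:R / n%:R) (eps_seq eps 0 w) - Gn n (x r) (eps_seq eps 0 w))%R)) `^ p
    <= \sum_(i < size s) (LqN P q (fun w => (Gn n (part_pt s i.+1) (eps_seq eps 0 w)
                                       - Gn n (part_pt s i) (eps_seq eps 0 w))%R)) `^ p)%E].
Proof.
move=> n0; pose e u v := ((LqN P q (fun w => (Gn n u (eps_seq eps 0 w) - Gn n v (eps_seq eps 0 w))%R)) `^ p)%E.
have e0 u v : (0 <= e u v)%E by exact: poweR_ge0.
pose Tot s := (\sum_(i < size s) e (part_pt s i.+1) (part_pt s i))%E.
have Tr s y : Tot (rcons s y) = (Tot s + e y (last 0%R s))%E.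
  rewrite /Tot size_rcons big_ord_recr/=; congr (_ + e _ _)%E.
  - apply: eq_bigr => i _; rewrite /part_pt/= !nth_rcons ltn_ord; congr (e _ _).
    by case: (nat_of_ord i) (ltn_ord i) => //= j js; rewrite nth_rcons (ltnW js).
  - by rewrite /part_pt/= nth_rcons ltnn eqxx.
  - by rewrite /part_pt (last_nth 0) -rcons_cons nth_rcons/= ltnSn.
elim: k => [|k IH] hx.
  exists [::]; split => //=; first by rewrite mul0r.
  by rewrite !big_ord0.
have [s [ps ls hs]] := IH (fun r rk => hx r (ltnW rk)).
have /andP[x1 x2] := hx k (ltnSn k).
have prc (z : seq R) y : path <%R 0 z -> last 0 z < y -> path <%R 0 (rcons z y).
  by move=> pz ly; rewrite rcons_path pz.
rewrite big_ord_recr/=.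
move: x1; rewrite le_eqVlt => /orP[/eqP xk|xk].
  exists (rcons s (k.+1%:R / n%:R)); rewrite last_rcons; split => //.
    by apply: prc => //; rewrite ls xk.
  by rewrite -/(Tot _) Tr; apply: leeD => //; rewrite ls xk.
exists (rcons (rcons s (x k)) (k.+1%:R / n%:R)); rewrite last_rcons; split => //.
  by apply: (prc (rcons s (x k))); [apply: (prc s) => //; rewrite ls|rewrite last_rcons].
rewrite -/(Tot _) !Tr last_rcons; apply: leeD => //.
by apply: le_trans hs _; exact: leeDl.
Qed.

(** Increments below the threshold [a] are charged [a] each; larger ones are dominated by their
    [p]-th power times [a ^ (1 - p)]. *)
Lemma le_split_powR (a l : R) : 0 < a -> a < l -> l <= l `^ p * a `^ (1 - p).
Proof.
move=> a0 al; have l0 := lt_trans a0 al.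
have h : a `^ (p - 1) <= l `^ (p - 1).
  by apply: ge0_ler_powR; rewrite ?nnegrE ?subr_ge0//; exact: ltW.
have pE : l `^ p = l * l `^ (p - 1).
  rewrite -[X in X * _]powRr1 ?ltW// -powRD; first by congr (_ `^ _); ring.
  by apply/implyP => _; rewrite gt_eqF.
have aE : a `^ (1 - p) = (a `^ (p - 1))^-1 by rewrite -powRN opprB.
have ap : 0 < a `^ (p - 1) by rewrite powR_gt0.
rewrite pE aE -mulrA; apply: ler_peMr; first exact: ltW.
by rewrite ler_pdivlMr// mul1r.
Qed.

Lemma nrm_LqN n u v a : (0 < n)%N -> I01 u -> I01 v -> 0 < a ->
  ((nrm P eps (fun y => cGn n u y - cGn n v y))%:E <= (2 * a)%:E + (2 * a `^ (1 - p))%:E *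
     (LqN P q (fun w => (Gn n u (eps_seq eps 0 w) - Gn n v (eps_seq eps 0 w))%R)) `^ p)%E.
Proof.
move=> n0 Iu Iv a0; set L := LqN P q _.
have [Lu _ _] := Gn_L2k n0 Iu; have [Lv _ _] := Gn_L2k n0 Iv.
have bnd l : 0 < l -> (L <= l%:E)%E -> nrm P eps (fun y => cGn n u y - cGn n v y) <= 2 * l.
  move=> l0 Ll; apply: nrm_le; first by rewrite mulr_ge0// ltW.
  rewrite (ctrB Lu Lv); apply: le_trans (ctr_nsq (L2kB Lu Lv)) _.
  have [|_ s2 _] := LqN_sqint Hq l0 _ Ll; first exact: measurable_funB.
  by apply: le_trans s2 _; have := sqr_ge0 l; rewrite exprMn; lra.
have p1 : 0 < p := lt_le_trans ltr01 Hp.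
have c0 : 0 <= 2 * a `^ (1 - p) by rewrite mulr_ge0 ?powR_ge0.
have [La|La] := leP L a%:E.
  apply: (@le_trans _ _ (2 * a)%:E); first by rewrite lee_fin; exact: bnd.
  by rewrite leeDl// mule_ge0// poweR_ge0.
have L0 : (0 <= L)%E by exact: LqN0.
case: L bnd La L0 => [l||]// bnd La L0.
  rewrite poweR_EFin -EFinM -EFinD lee_fin; rewrite lte_fin in La.
  have := bnd l (lt_trans a0 La) (lexx _).
  have := le_split_powR a0 La; have := ltW a0; lra.
rewrite poweRyr; last by rewrite gt_eqF.
rewrite gt0_muley ?lte_fin ?mulr_gt0 ?powR_gt0// addey ?leey//.
Qed.

Lemma centered_variation a : 0 < a -> exists2 D, 0 <= D & forall n x, (0 < n)%N ->
  (forall r, (r < n)%N -> r%:R / n%:R <= x r < r.+1%:R / n%:R) ->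
  \sum_(r < n) nrm P eps (fun y => cGn n (r.+1%:R / n%:R) y - cGn n (x r) y) <= n%:R * a + D.
Proof.
move=> a0; have a2 : 0 < a / 2 by rewrite divr_gt0.
have p0 : 0 < p := lt_le_trans ltr01 Hp.
exists (2 * (a / 2) `^ (1 - p) * CG `^ p); first by rewrite !mulr_ge0 ?powR_ge0.
move=> n x n0 hx; have nn : 0 < n%:R :> R by rewrite ltr0n.
have [s [ps ls hs]] := part_sum n0 hx.
have cE : 0 <= 2 * (a / 2) `^ (1 - p) by rewrite mulr_ge0 ?powR_ge0.
rewrite divff ?gt_eqF// in ls.
set S1 := (\sum_(r < n) _)%E in hs; set S2 := (\sum_(i < size s) _)%E in hs.
have S20 : (0 <= S2)%E by apply: sume_ge0 => i _; exact: poweR_ge0.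
have [_ [_ H]] := LqN_pvar_bound.
have hS2 : (S2 <= (CG `^ p)%:E)%E.
  have h : (S2 `^ p^-1 <= CG%:E)%E.
    apply: le_trans (H n n0); apply: ereal_sup_ubound; exists s => //.
  have := gt0_ler_poweR (ltW p0) _ _ h.
  rewrite -poweRrM mulVf ?gt_eqF// poweRe1// poweR_EFin; apply.
    by rewrite in_itv/= poweR_ge0 leey.
  by rewrite in_itv/= lee_fin CG0 leey.
rewrite -lee_fin -sumEFin EFinD.
apply: (@le_trans _ _ (\sum_(r < n) ((2 * (a / 2))%:E + (2 * (a / 2) `^ (1 - p))%:E *
     (LqN P q (fun w => (Gn n (r.+1%:R / n%:R) (eps_seq eps 0 w) - Gn n (x r) (eps_seq eps 0 w))%R)) `^ p))%E).
  apply: lee_sum => r _; have /andP[h1 h2] := hx r (ltn_ord r).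
  have I1 : r.+1%:R / n%:R <= 1 :> R by rewrite ler_pdivrMr// mul1r ler_nat.
  apply: nrm_LqN => //; rewrite /I01/=; first by rewrite divr_ge0//.
  by rewrite (le_trans (ltW h2))// (le_trans _ h1)// divr_ge0.
rewrite big_split/= -ge0_sume_distrr; last by move=> r _; exact: poweR_ge0.
apply: leeD.
  rewrite sumEFin sumr_const card_ord lee_fin -[leLHS]mulr_natl; rewrite ler_pM2l//; lra.
by rewrite [in leRHS]EFinM lee_wpmul2l ?lee_fin// (le_trans hs).
Qed.

Lemma sum_sym (c : nat -> R) N : \sum_(i < (2 * N).+1) c `|i%:Z - N%:Z|%N = c 0%N + 2 * \sum_(h < N) c h.+1.
Proof.
have -> : (2 * N).+1 = (N + N.+1)%N by lia.
rewrite -(big_mkord xpredT (fun i => c `|i%:Z - N%:Z|%N)) (big_cat_nat (n := N))//= ?leq_addr//.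
have -> : \sum_(0 <= i < N) c `|i%:Z - N%:Z|%N = \sum_(h < N) c h.+1.
  by rewrite big_nat_rev/= big_mkord; apply: eq_bigr => i _; congr c; have := ltn_ord i; lia.
have -> : \sum_(N <= i < N + N.+1) c `|i%:Z - N%:Z|%N = \sum_(h < N.+1) c `|(h + N)%N%:Z - N%:Z|%N.
  by rewrite -{1}[N]add0n big_addn addKn big_mkord.
rewrite (eq_bigr (fun h : 'I_N.+1 => c h)); last by move=> i _; congr c; lia.
rewrite big_ord_recl/=; ring.
Qed.

Lemma cov_gam u (N i : nat) : I01 u ->
  fine (covariance P (fun w => G u (eps_seq eps (i%:Z - N%:Z) w)) (fun w => G u (eps_seq eps 0 w))) =
  gam P eps cG `|i%:Z - N%:Z|%N u.
Proof.
move=> Iu; have LG := G_L2k Iu; have Lg := centered_limit_L2k Iu.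
rewrite covariance.unlock -/(Er P _).
have -> : fine ('E_P[(fun w => G u (eps_seq eps (i%:Z - N%:Z) w))])%E = Er P (fun w => G u (eps_seq eps 0 w)).
  exact: (Er_at Heps_meas Hindep Hident (i%:Z - N%:Z) LG).
set m := Er P _.
transitivity (Er P (fun w => cG u (eps_seq eps (i%:Z - N%:Z) w) * cG u (eps_seq eps 0 w))); first exact: eq_Er.
rewrite /gam; case: (leqP N i) => h.
  have -> : i%:Z - N%:Z = (i - N)%N%:Z by lia.
  by rewrite absz_nat /cv; apply: eq_Er => w; rewrite mulrC.
have -> : i%:Z - N%:Z = - (N - i)%N%:Z by lia.
rewrite abszN absz_nat -(cv_at Heps_meas Hindep Hident (- (N - i)%N%:Z) (N - i) Lg Lg).
by rewrite addNr.
Qed.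

Lemma sigma2E u : I01 u ->
  limn (fun N : nat => \sum_(i < (2 * N).+1)
      fine (covariance P (fun w => G u (eps_seq eps (i%:Z - N%:Z) w))
                         (fun w => G u (eps_seq eps 0 w)))) = sig P eps cG u.
Proof.
move=> Iu; rewrite /sig; set F := (F in limn F).
suff -> : F = psum P eps cG ^~ u by [].
apply/funext => N; rewrite /F.
rewrite (eq_bigr (fun i : 'I_(2 * N).+1 => gam P eps cG `|i%:Z - N%:Z|%N u)); last by move=> i _; exact: cov_gam.
by rewrite (sum_sym (fun h => gam P eps cG h u)).
Qed.

End Assumptions.

(** * The block model *)

Lemma avgs_sum_sqr {R : realType} (bl : nat -> (R -> R) -> R) (Hbl : forall k, is_mean (bl k)) r r' y u :
  (forall k, (r <= k < r')%N -> bl k id = 0) ->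
  avgs bl r' (fun u => (y + \sum_(r <= k < r') u k) ^+ 2) u = y ^+ 2 + \sum_(r <= k < r') bl k (fun x => x ^+ 2).
Proof.
elim: r' y u => [|r' IH] y u H.
  by rewrite /= !big_geq// !addr0.
have [rr|rr] := leqP r r'; last first.
  rewrite [in RHS]big_geq// addr0 (avgs_ge Hbl) ?big_geq ?addr0// => w' _.
  by rewrite big_geq// addr0.
rewrite /= /avg [in RHS]big_nat_recr//=.
rewrite (eq_mean (bl r') (g := fun a => (y ^+ 2 + \sum_(r <= k < r') bl k (fun x => x ^+ 2)) + (2 * y * a + a ^+ 2))).
  rewrite (meanD (Hbl r')) (meanD (Hbl r') (fun a => 2 * y * a)) (mean_cst (Hbl r')) (meanZ (Hbl r') (2 * y) id).
  by rewrite H ?rr ?ltnSn// mulr0 add0r addrA.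
move=> a; rewrite (avgs_local bl (G := fun u => ((y + a) + \sum_(r <= k < r') u k) ^+ 2)).
  rewrite IH => [|k /andP[k1 k2]]; last by rewrite H// k1 ltnW.
  ring.
move=> w' Hw; rewrite big_nat_recr//= Hw// /upd eqxx; ring.
Qed.

Section WordBlocks.
Context {R : realType} {A : Type}.
Variable mu : nat -> (A -> R) -> R.
Hypothesis Hmu : forall i, is_mean (mu i).
Variables (n K b : nat) (X : nat -> (nat -> A) -> R) (w0 : nat -> A) (C rho V0 c delta : R).
Hypotheses (n0 : (0 < n)%N) (b0 : (0 < b)%N) (C0 : 0 <= C) (rho01 : 0 < rho < 1) (V00 : 0 <= V0) (c0 : 0 <= c).
Hypothesis depX : forall i, dep_on (fun k => (k < (i + K).+1)%N) (X i).
Hypothesis cX : forall i w, avgs mu (i + K).+1 (X i) w = 0.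
Let E F := avgs mu (n + K) F w0.
Hypothesis hD : forall i c, (i < n)%N -> (c <= i + K)%N ->
  E (fun w => mdiff mu c (X i) w ^+ 2) <= (C * rho ^+ (i + K - c)) ^+ 2.
Hypothesis hX2 : forall i, (i < n)%N -> E (fun w => X i w ^+ 2) <= V0 ^+ 2.
Hypothesis hUI : forall i, (i < n)%N -> E (fun w => Num.max 0 (`|X i w| - c) ^+ 2) <= delta.

Let HE : is_mean E := avgs_mean Hmu _ _.
Let sq : R := Num.sqrt n%:R.
Let sq0 : 0 < sq. Proof. by rewrite sqrtr_gt0 ltr0n. Qed.
Let sq2 : sq ^+ 2 = n%:R. Proof. by rewrite sqr_sqrtr// ler0n. Qed.
Let cuts k := (K + k * b)%N.
Let cutsS k : (cuts k <= cuts k.+1)%N. Proof. by rewrite leq_add2l leq_mul2r leqnSn orbT. Qed.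
Let xik := xi mu n K b X.
Definition zeta k w := sq^-1 * xi mu n K b X k w.
Let dz k : dep_on (fun j => (cuts k <= j < cuts k.+1)%N) (zeta k).
Proof. by move=> w w' H; congr (_ * _); apply: (dep_xi mu n b0 depX). Qed.
Definition bl := block_law mu (fun k => (K + k * b)%N) zeta w0.

Lemma bl_mean k : is_mean (bl k).
Proof. exact: block_law_mean. Qed.

Let cuts_le k : (k < n %/ b)%N -> (cuts k.+1 <= n + K)%N.
Proof. by move=> kn; rewrite /cuts addnC leq_add2r -leq_divRL. Qed.

Lemma bl_law k phi : (k < n %/ b)%N -> bl k phi = E (fun w => phi (zeta k w)).
Proof.
move=> kn; apply/esym; apply: (avgs_const Hmu w0 w0 (cuts_le kn)) => w w' H; congr phi; apply: dz => j /andP[_ jk].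
exact: H.
Qed.

Lemma bl_id k : (k < n %/ b)%N -> bl k id = 0.
Proof.
move=> kn; rewrite bl_law// /zeta (meanZ HE) (mean_sum HE) big1 ?mulr0// => i _.
have iK : (bstart K b i <= n + K)%N.
  rewrite /bstart addnC leq_add2r (leq_trans (leq_trunc_div _ _))// ltnW//.
have iK' : ((i + K).+1 <= n + K)%N by rewrite -addSn leq_add2r.
rewrite /Xb /E (avgs_avgs Hmu _ iK) -(avgs_avgs Hmu _ iK') (_ : avgs mu (i + K).+1 (X i) = fun=> 0).
  exact: (mean_cst HE).
exact/funext/cX.
Qed.

Lemma bl_sq k : (k < n %/ b)%N -> bl k (fun x => x ^+ 2) <= (b%:R * V0) ^+ 2 / n%:R.
Proof.
move=> kn; rewrite bl_law// (eq_mean E (g := fun w => n%:R^-1 * xi mu n K b X k w ^+ 2)); last first.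
  by move=> w; rewrite /zeta exprMn exprVn sq2.
rewrite (meanZ HE) mulrC ler_pM2r ?invr_gt0 ?ltr0n//.
exact: (block_sum_sqr Hmu b0 (leqnn (n + K)) V00 hX2 xpredT k).
Qed.

Lemma bl_sq_sum : \sum_(k < n %/ b) bl k (fun x => x ^+ 2) <= b%:R * V0 ^+ 2.
Proof.
apply: (@le_trans _ _ (\sum_(k < n %/ b) (b%:R * V0) ^+ 2 / n%:R)); first by apply: ler_sum => k _; exact: bl_sq.
rewrite sumr_const card_ord -[leLHS]mulr_natl exprMn.
have -> : (n %/ b)%:R * (b%:R ^+ 2 * V0 ^+ 2 / n%:R) = b%:R * V0 ^+ 2 * ((n %/ b * b)%:R / n%:R) :> R by rewrite natrM; ring.
rewrite ler_piMr ?mulr_ge0 ?exprn_ge0// ler_pdivrMr ?ltr0n// mul1r ler_nat; exact: leq_trunc_div.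
Qed.

Lemma bl_m3 : \sum_(k < n %/ b) bl k m3 <= 2 * b%:R * c / sq * (b%:R * V0 ^+ 2) + 4 * (b%:R * delta).
Proof.
have K0 : 0 <= 2 * b%:R * c / sq by apply: divr_ge0; [rewrite !mulr_ge0|exact: ltW].
(* Up to [2 * b * c] the cubic term is used, as one factor is then at most [2 * b * c / sqrt n].
   Beyond it the excess over [b * c] is at least half of [|x|], whence the factor 4. *)
have pt (x : R) : m3 (sq^-1 * x) <= 2 * b%:R * c / sq * (sq^-1 * x) ^+ 2 + 4 / n%:R * Num.max 0 (`|x| - b%:R * c) ^+ 2.
  set y := sq^-1 * x; have bc0 : 0 <= b%:R * c by rewrite mulr_ge0.
  have yE : `|y| = sq^-1 * `|x| by rewrite /y normrM gtr0_norm ?invr_gt0.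
  have y2 : y ^+ 2 = n%:R^-1 * x ^+ 2 by rewrite /y exprMn exprVn sq2.
  have N0 : 0 < n%:R^-1 :> R by rewrite invr_gt0 ltr0n.
  have A0 : 0 <= 2 * b%:R * c / sq * y ^+ 2.
    by apply: mulr_ge0 => //; exact: sqr_ge0.
  have B0 : 0 <= 4 / n%:R * Num.max 0 (`|x| - b%:R * c) ^+ 2.
    by apply: mulr_ge0; [rewrite divr_ge0|exact: sqr_ge0].
  have [h|h] := lerP `|x| (2 * (b%:R * c)).
    apply: (@le_trans _ _ (2 * b%:R * c / sq * y ^+ 2)); last by rewrite lerDl.
    apply: (@le_trans _ _ (`|y| ^+ 3)); first by rewrite /m3 ge_min lexx orbT.
    rewrite exprS real_normK ?num_real//; apply: ler_wpM2r; first exact: sqr_ge0.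
    by rewrite yE mulrC ler_pM2r ?invr_gt0// -mulrA.
  apply: (@le_trans _ _ (4 / n%:R * Num.max 0 (`|x| - b%:R * c) ^+ 2)); last by rewrite lerDr.
  apply: (@le_trans _ _ (y ^+ 2)); first by rewrite /m3 ge_min lexx.
  rewrite max_r; last by lra.
  have -> : 4 / n%:R * (`|x| - b%:R * c) ^+ 2 = n%:R^-1 * (2 * (`|x| - b%:R * c)) ^+ 2 by ring.
  rewrite y2 ler_pM2l// -[x ^+ 2]real_normK ?num_real// lerXn2r ?nnegrE//; lra.
apply: (@le_trans _ _ (\sum_(k < n %/ b) (2 * b%:R * c / sq * bl k (fun x => x ^+ 2) +
    4 / n%:R * E (fun w => Num.max 0 (`|xi mu n K b X k w| - b%:R * c) ^+ 2)))).
  apply: ler_sum => k _; rewrite !bl_law// -!(meanZ HE) -(meanD HE); apply: (mean_le HE) => w.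
  exact: pt.
rewrite big_split/= -!mulr_sumr; apply: lerD.
  by apply: ler_wpM2l => //; exact: bl_sq_sum.
have H := xi_tail Hmu b0 (leqnn (n + K)) c0 hUI (n %/ b).
have H4 : 0 <= 4 / n%:R :> R by rewrite divr_ge0.
apply: le_trans (ler_wpM2l H4 H) _.
have -> : 4 / n%:R * (b%:R * (n%:R * delta)) = 4 * (b%:R * delta) * (n%:R / n%:R) by ring.
by rewrite divff ?mulr1// pnatr_eq0 -lt0n.
Qed.

Let D := 4 * C * Num.sqrt (n %/ b).+1%:R * (1 - rho)^-1 ^+ 2 + b%:R * V0.

Lemma bl_var l l' : (l <= l')%N -> (l' <= n)%N ->
  E (fun w => (sq^-1 * \sum_(l <= i < l') X i w - \sum_(l %/ b <= k < l' %/ b) zeta k w) ^+ 2) <= (2 * D / sq) ^+ 2 /\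
  E (fun w => (\sum_(l %/ b <= k < l' %/ b) zeta k w) ^+ 2) = \sum_(l %/ b <= k < l' %/ b) bl k (fun x => x ^+ 2).
Proof.
move=> ll ln; have D0 : 0 <= D.
  have r1 : 0 <= (1 - rho)^-1 by rewrite invr_ge0; case/andP: rho01 => _ /ltW; rewrite subr_ge0.
  by rewrite addr_ge0 ?mulr_ge0 ?sqrtr_ge0.
split.
  have t1 := tot_sqr Hmu b0 (leqnn (n + K)) C0 rho01 depX hD V00 hX2 ln.
  have t2 := tot_sqr Hmu b0 (leqnn (n + K)) C0 rho01 depX hD V00 hX2 (leq_trans ll ln).
  rewrite -/D in t1 t2.
  have t2' : E (fun w => (- (\sum_(i < l) X i w - \sum_(k < l %/ b) xi mu n K b X k w)) ^+ 2) <= D ^+ 2.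
    by rewrite (eq_mean E (g := fun w => (\sum_(i < l) X i w - \sum_(k < l %/ b) xi mu n K b X k w) ^+ 2)) // => w; rewrite sqrrN.
  have := mean_minkowski HE D0 D0 t1 t2'.
  rewrite (eq_mean E (g := fun w => n%:R * (sq^-1 * \sum_(l <= i < l') X i w - \sum_(l %/ b <= k < l' %/ b) zeta k w) ^+ 2)).
    rewrite (meanZ HE) => h; rewrite exprMn exprVn sq2 ler_pdivlMr ?ltr0n// mulrC.
    by apply: le_trans h _; rewrite le_eqVlt; apply/orP; left; apply/eqP; ring.
  move=> w; have S (f : nat -> R) x y : (x <= y)%N -> \sum_(x <= i < y) f i = \sum_(i < y) f i - \sum_(i < x) f i.
    move=> xy; rewrite -!(big_mkord xpredT f) [X in _ = X - _](big_cat_nat (n := x))//=; ring.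
  rewrite (S (fun i => X i w))// (S (fun k => zeta k w)) ?leq_div2r//.
  rewrite /zeta -!mulr_sumr -sq2; field.
  by rewrite gt_eqF.
have lb : (l' %/ b <= n %/ b)%N by rewrite leq_div2r.
have lK : (cuts (l' %/ b) <= n + K)%N.
  rewrite /cuts addnC leq_add2r; apply: leq_trans ln; exact: leq_trunc_div.
have H1 : E (fun w => (0 + \sum_(l %/ b <= k < l' %/ b) zeta k w) ^+ 2) =
    avgs mu (cuts (l' %/ b)) (fun w => (0 + \sum_(l %/ b <= k < l' %/ b) zeta k w) ^+ 2) w0.
  apply: (avgs_const Hmu w0 w0 lK) => w w' H; congr ((_ + _) ^+ 2).
  rewrite big_nat_cond [RHS]big_nat_cond; apply: eq_bigr => k; rewrite andbT => /andP[_ kl].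
  apply: dz => j /andP[_ jk]; apply: H; apply: leq_trans jk _.
  by rewrite leq_add2l leq_mul2r kl orbT.
rewrite (eq_mean E (g := fun w => (0 + \sum_(l %/ b <= k < l' %/ b) zeta k w) ^+ 2)); last by move=> w; rewrite add0r.
rewrite H1 (avgs_blocks Hmu w0 cutsS dz (l' %/ b) (fun u => (0 + \sum_(l %/ b <= k < l' %/ b) u k) ^+ 2)).
rewrite (avgs_sum_sqr bl_mean) ?expr0n ?add0r// => k /andP[_ kl].
by apply: bl_id; exact: leq_trans lb.
Qed.

Lemma bl_path F (Mf L a : R) : 0 < L -> lipD Mf L F -> 0 < a ->
  `|E (fun w => F (stepf n (fun l => sq^-1 * \sum_(i < minn l n) X i w))) -
    avgs bl (n %/ b) (fun u => F (stepf n (fun l => \sum_(k < minn l n %/ b) u k))) (zeta ^~ w0)| <=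
  L * (sq^-1 * (4 * C * Num.sqrt (n %/ b).+1%:R * (1 - rho)^-1 ^+ 2 + (b%:R * c + a + b%:R / a * (n%:R * delta)))).
Proof.
move=> L0 [FM FL] a0.
rewrite -(avgs_blocks Hmu w0 cutsS dz (n %/ b) (fun u => F (stepf n (fun l => \sum_(k < minn l n %/ b) u k)))).
have nK : (cuts (n %/ b) <= n + K)%N by rewrite /cuts addnC leq_add2r leq_trunc_div.
rewrite -(avgs_const Hmu w0 w0 nK); last first.
  move=> w w' H; congr (F (stepf n _)); apply/funext => l; apply: eq_bigr => k _.
  apply: dz => j /andP[_ jk]; apply: H; apply: leq_trans jk _.
  rewrite leq_add2l leq_mul2r; apply/orP; right; apply: (leq_trans (ltn_ord k)).
  by rewrite leq_div2r// geq_minr.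
rewrite -(meanB HE); apply: le_trans (mean_norm HE _) _.
have H := tot_dev_mean Hmu b0 (leqnn (n + K)) C0 rho01 depX hD hUI a0.
have Ls : 0 <= L / sq by rewrite divr_ge0 ?ltW.
rewrite mulrA; apply: le_trans (ler_wpM2l Ls H); rewrite -(meanZ HE); apply: (mean_le HE) => w.
rewrite -mulrA; apply: FL; try exact: cadlag_step.
move=> v Iv; rewrite /stepf; set l := minn _ n.
rewrite /zeta -mulr_sumr -mulrBr normrM gtr0_norm ?invr_gt0// ler_pM2l ?invr_gt0//.
by apply: (tot_dev_ge mu X b0 (leqnn (n + K)) C0 rho01 c0 w a0); rewrite geq_minr.
Qed.

End WordBlocks.

Section BlockArith.
Context {R : realFieldType}.

Lemma each_le_sum (a c d s : R) : 0 <= a -> 0 <= c -> 0 <= d -> a + 1 + c + d <= s ->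
  [/\ a <= s, 1 <= s, c <= s & d <= s].
Proof. by move=> ? ? ? ?; split; lra. Qed.

Lemma twice_sum_le (a b x : R) : a <= x -> b <= x -> 2 * (a + b) <= 4 * x.
Proof. lra. Qed.

Lemma sum_four_le (a b c d x : R) : a <= x -> b <= x -> c <= x -> d <= x -> a + (b + c + d) <= 4 * x.
Proof. lra. Qed.

Lemma five_eighths (x e : R) : 0 < e -> x <= e / 8 -> x + 4 * x <= e.
Proof. lra. Qed.
End BlockArith.

Lemma Er_sqr_close {R : realType} {d : measure_display} {T : measurableType d} (P : probability T R)
    (X Y : T -> R) (a k : R) : sqint P X -> sqint P Y -> 0 <= a -> 0 <= k ->
  Er P (fun w => X w ^+ 2) <= a ^+ 2 -> Er P (fun w => (X w - Y w) ^+ 2) <= k ^+ 2 ->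
  `|Er P (fun w => Y w ^+ 2) - Er P (fun w => X w ^+ 2)| <= k * (2 * a + k).
Proof.
move=> sX sY a0 k0 Xa Dk; have sD := sqintB sX sY.
have iXD := sqint_mul sX sD.
have h := Er_CS sX sD a0 k0 Xa Dk.
have h1 := le_trans (Er_norm iXD) h.
have h2 : 0 <= Er P (fun w => (X w - Y w) ^+ 2) by apply: Er_ge0 => w; exact: sqr_ge0.
have E : Er P (fun w => Y w ^+ 2) = Er P (fun w => X w ^+ 2) + (Er P (fun w => (X w - Y w) ^+ 2)
    + (- 2) * Er P (fun w => X w * (X w - Y w))).
  rewrite -ErZ// -ErD ?sX.2 ?sD.2//; last exact: int1Z.
  rewrite -ErD ?sX.2//; last by apply: int1D; [exact: sD.2|exact: int1Z].
  by apply: eq_Er => w; ring.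
rewrite E [X in `|X|]addrC addKr.
move: h1; rewrite ler_norml => /andP[h3 h4].
move: Dk; rewrite expr2 => Dk; rewrite mulrDr mulrCA ler_norml; apply/andP; split; lra.
Qed.

Lemma dep_zeta {R : realType} {A : Type} (mu : nat -> (A -> R) -> R) (n K b : nat) (X : nat -> (nat -> A) -> R) (k : nat) :
  (forall i, dep_on (fun k => (k < (i + K).+1)%N) (X i)) ->
  dep_on (fun j => (j < n + K)%N) (zeta mu n K b X k).
Proof.
move=> dX w w' H; congr (_ * _); apply: eq_bigr => i _.
by apply: (dep_avgs mu (dX i)) => j jj; apply: H; move: jj (ltn_ord i) => /andP[]; lia.
Qed.

Lemma Er_sum_sqr_le {R : realType} {d : measure_display} {T : measurableType d} (P : probability T R)
    (D : nat -> T -> R) (eta : R) (n l l' : nat) : 0 <= eta -> (l' <= n)%N ->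
  (forall i, (i < n)%N -> sqint P (D i) /\ Er P (fun w => D i w ^+ 2) <= eta ^+ 2) ->
  sqint P (fun w => \sum_(l <= i < l') D i w) /\
  Er P (fun w => (\sum_(l <= i < l') D i w) ^+ 2) <= (n%:R * eta) ^+ 2.
Proof.
move=> e0 ln H.
have E w : \sum_(l <= i < l') D i w = \sum_(l <= i < l' | (i < n)%N) D i w.
  rewrite big_nat_cond [RHS]big_nat_cond; apply: eq_bigl => i.
  by case: (boolP (l <= i < l')%N) => //= /andP[_ ii]; rewrite (leq_trans ii ln).
rewrite (_ : (fun w => \sum_(l <= i < l') D i w) = fun w => \sum_(l <= i < l' | (i < n)%N) D i w); last exact/funext.
split; first by apply: sqint_sum => i /H[].
rewrite (eq_Er P (Y := fun w => (\sum_(l <= i < l' | (i < n)%N) D i w) ^+ 2)); last by move=> w; rewrite E.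
have h1 i : (i < n)%N -> sqint P (D i) by move=> /H[].
have h2 i : (i < n)%N -> Er P (fun w => D i w ^+ 2) <= eta ^+ 2 by move=> /H[].
have := @Er_mink_sum _ _ _ P nat (index_iota l l') (fun i => (i < n)%N) D (fun=> eta) h1 (fun _ _ => e0) h2.
move=> h; apply: le_trans h _; rewrite lerXn2r ?nnegrE ?mulr_ge0 ?sumr_ge0//.
rewrite big_mkcond /=; apply: (@le_trans _ _ (\sum_(l <= i < l') eta)).
  by apply: ler_sum => i _; case: ifP.
rewrite sumr_const_nat -[leLHS]mulr_natl ler_wpM2r// ler_nat.
by apply: leq_trans (leq_subr _ _) ln.
Qed.

Section BlockModel.
Context {R : realType} {d : measure_display} {T : measurableType d} (P : probability T R).
Variables eps epss : int -> T -> R.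
Hypothesis Heps_meas : forall i, measurable_fun setT (eps i) /\ measurable_fun setT (epss i).
Hypothesis Hindep : mutual_indep P (joint_family eps epss).
Hypothesis Hident : ident_distr P (joint_family eps epss).
Variables (C rho : R) (gn : nat -> R -> (nat -> R) -> R).
Hypotheses (C0 : 0 < C) (rho01 : 0 < rho < 1).
Hypothesis K1 : forall n u, (0 < n)%N -> I01 u -> [/\ L2k P eps (gn n u),
  Er P (fun w => gn n u (eps_seq eps 0 w)) = 0, nsq P eps (gn n u) <= C ^+ 2 & coupled P eps epss C rho (gn n u)].
Hypothesis KUI : forall del, 0 < del -> exists2 c, 0 <= c & forall n u, (0 < n)%N -> I01 u ->
  Er P (fun w => pos (gn n u (eps_seq eps 0 w)) c ^+ 2) <= del.
Let Gw n i w := gn n (i.+1%:R / n%:R) (eps_seq eps i.+1%:Z w).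
Variables (B : R) (NB : nat).
Hypothesis B0 : 0 <= B.
Hypothesis KB : forall n l l', (NB <= n)%N -> (l <= l')%N -> (l' <= n)%N ->
  n%:R^-1 * Er P (fun w => (\sum_(l <= i < l') Gw n i w) ^+ 2) <= B ^+ 2.

Let r1 : 0 < 1 - rho. Proof. by case/andP: rho01 => _; rewrite subr_gt0. Qed.

Lemma pos_approx (x z c : R) : 0 <= c -> pos z c ^+ 2 <= 2 * pos x c ^+ 2 + 2 * (x - z) ^+ 2.
Proof.
move=> c0; have h0 (y : R) : 0 <= pos y c by rewrite /pos le_max lexx.
have h : pos z c <= pos x c + `|x - z|.
  rewrite {1}/pos ge_max addr_ge0//=.
  have : `|x| - c <= pos x c by rewrite /pos le_max lexx orbT.
  have := ler_normB x (x - z); rewrite opprB addrC subrK; lra.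
have := h0 z; have := h0 x; have := normr_ge0 (x - z); rewrite -[(x - z) ^+ 2]real_normK ?num_real//.
set a := pos z c; set b := pos x c; set y := `|x - z| => y0 b0 a0.
have : a ^+ 2 <= (b + y) ^+ 2 by rewrite lerXn2r ?nnegrE ?addr_ge0.
have := sqr_ge0 (b - y); lra.
Qed.

(** The length [b] makes the Doob error small relative to [sqrt n]; the truncation level [c] then
    makes the excesses small against [1 / b]; finally [n] makes a single block negligible and the
    letter approximation accurate to [1 / n]. *)
Lemma block_model e : 0 < e -> exists (b N : nat), (0 < b)%N /\ forall n, (N <= n)%N -> (0 < n)%N /\
  exists (bl : nat -> (R -> R) -> R) (u0 : nat -> R),
  [/\ forall k, is_mean (bl k),
      forall k, (k < n %/ b)%N -> bl k id = 0 /\ bl k (fun x => x ^+ 2) <= e,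
      \sum_(k < n %/ b) bl k m3 <= e,
      forall l l', (l <= l')%N -> (l' <= n)%N ->
        `|\sum_(l %/ b <= k < l' %/ b) bl k (fun x => x ^+ 2) -
          n%:R^-1 * Er P (fun w => (\sum_(l <= i < l') Gw n i w) ^+ 2)| <= e &
      forall F M L, 0 < L -> lipD M L F ->
        `|Er P (fun w => F (stepf n (fun l => (Num.sqrt n%:R)^-1 * \sum_(i < minn l n) Gw n i w))) -
          avgs bl (n %/ b) (fun u => F (stepf n (fun l => \sum_(k < minn l n %/ b) u k))) u0| <= L * e].
Proof.
move=> e0.
move: (B0) (C0) => B0' C0'.
have B1 : 0 < 2 * B + 1 by lra.
(* The entry with [2 * B + 1] handles variances: an L2 error [5 * e1] changes a second moment
   bounded by [B ^+ 2] by at most [5 * e1 * (2 * B + 5 * e1)]. *)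
pose e1 := Num.min 1 (Num.min e (e / (2 * B + 1))) / 8.
have m0 : 0 < Num.min 1 (Num.min e (e / (2 * B + 1))) by rewrite !lt_min ltr01 e0 divr_gt0.
have e10 : 0 < e1 by rewrite divr_gt0.
have e1_1 : e1 <= 1 / 8 by rewrite ler_pM2r ?invr_gt0// ge_min lexx.
have e1_e : e1 <= e / 8 by rewrite ler_pM2r ?invr_gt0// !ge_min lexx orbT.
have e1_B : e1 * (2 * B + 1) <= e / 8.
  have : e1 <= e / (2 * B + 1) / 8 by rewrite ler_pM2r ?invr_gt0// !ge_min lexx !orbT.
  rewrite -mulrA [_^-1 / 8]mulrC mulrA ler_pdivlMr//.
clearbody e1.
pose A := 4 * (2 * C) * (1 - rho)^-1 ^+ 2.
have A0 : 0 < A by rewrite !mulr_gt0// ?exprn_gt0// invr_gt0.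
pose s := e1 / A; have s0 : 0 < s by rewrite divr_gt0.
have s20 : 0 < s ^+ 2 by rewrite exprn_gt0.
have [b' hb'] : exists b' : nat, 2 / s ^+ 2 < b'%:R.
  exists (Num.truncn (2 / s ^+ 2)).+1; have h : 0 <= 2 / s ^+ 2 by rewrite divr_ge0// ltW.
  by have /andP[] := truncn_itv h.
pose b := b'.+1.
have hb : 2 <= s ^+ 2 * b%:R.
  rewrite mulrC -ler_pdivrMr//; apply: le_trans (ltW hb') _; by rewrite ler_nat.
have bp : 0 < b%:R :> R by rewrite ltr0n.
(* With [a = e1 * sqrt n] in [bl_path], the excess term [b / a * (n * del)] is then a quarter of
   [e1 * sqrt n]. *)
pose del := e1 ^+ 2 / (4 * b%:R).
have del0 : 0 < del by rewrite divr_gt0 ?exprn_gt0// mulr_gt0.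
have del1 : del <= 1.
  rewrite ler_pdivrMr ?mulr_gt0// mul1r; have : 1 <= b%:R :> R by rewrite ler1n.
  have : e1 ^+ 2 <= 1 by rewrite expr_le1 ?(ltW e10)//; lra.
  lra.
have d4 : 0 < del / 4 by rewrite divr_gt0.
have [c c0 hc] := KUI d4.
pose V0 := 2 * C; have V00 : 0 <= V0 by rewrite mulr_ge0// ltW.
(* All terms that must be at most [e1 * sqrt n] but do not grow with [n]; the 1 pays for the letter
   approximation, whose [n] errors of size at most [1 / n] add up to at most 1. *)
pose Y := (b%:R * V0 + 1 + b%:R * c + 2 * b%:R * c * (b%:R * V0 ^+ 2)) / e1.
have [p1 p2 p3] : [/\ 0 <= b%:R * V0, 0 <= b%:R * c & 0 <= 2 * b%:R * c * (b%:R * V0 ^+ 2)].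
  by split; rewrite ?mulr_ge0// ?exprn_ge0// ?mulr_ge0// ltW.
have Y0 : 0 <= Y.
  by rewrite /Y; apply: divr_ge0; [do 3?apply: addr_ge0 => //|exact: ltW].
have [N1 hN1] : exists N1 : nat, Y ^+ 2 + 2 / s ^+ 2 < N1%:R.
  exists (Num.truncn (Y ^+ 2 + 2 / s ^+ 2)).+1.
  have h : 0 <= Y ^+ 2 + 2 / s ^+ 2 by rewrite addr_ge0 ?exprn_ge0// divr_ge0// ltW.
  by have /andP[] := truncn_itv h.
exists b, (maxn NB N1.+1); split => // n; rewrite geq_max => /andP[nB n1].
have n0 : (0 < n)%N by apply: leq_trans n1.
split => //; have nn : 0 < n%:R :> R by rewrite ltr0n.
pose sq := Num.sqrt (n%:R : R); have sq0 : 0 < sq by rewrite sqrtr_gt0.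
have sq2 : sq ^+ 2 = n%:R by rewrite sqr_sqrtr// ltW.
have nY : Y ^+ 2 + 2 / s ^+ 2 <= n%:R by apply: le_trans (ltW hN1) _; rewrite ler_nat ltnW.
have s2i : 0 < 2 / s ^+ 2 by rewrite divr_gt0.
have Ysq : Y <= sq.
  rewrite -(@ler_pXn2r _ 2)// ?nnegrE ?(ltW sq0)// sq2; lra.
have hY : b%:R * V0 + 1 + b%:R * c + 2 * b%:R * c * (b%:R * V0 ^+ 2) <= e1 * sq.
  by rewrite [leRHS]mulrC -ler_pdivrMr.
have [y1 y2 y3 y4] := each_le_sum p1 p2 p3 hY.
have hA : A * Num.sqrt (n %/ b).+1%:R <= e1 * sq.
  have -> : e1 = A * s by rewrite /s mulrCA divff ?mulr1// gt_eqF.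
  rewrite -[A * s * sq]mulrA ler_pM2l// -(@ler_pXn2r _ 2)// ?nnegrE ?sqrtr_ge0 ?(mulr_ge0 (ltW s0) (ltW sq0))//.
  rewrite sqr_sqrtr// exprMn sq2 -natr1.
  have h1 : (n %/ b)%:R <= s ^+ 2 * n%:R / 2.
    rewrite ler_pdivlMr// -(ler_pM2r bp).
    have : (n %/ b * b)%:R <= n%:R :> R by rewrite ler_nat leq_trunc_div.
    rewrite natrM => h; have := ler_wpM2r (ler0n R n) hb; lra.
  have : 2 <= s ^+ 2 * n%:R by rewrite mulrC -ler_pdivrMr//; have := sqr_ge0 Y; lra.
  lra.
pose eta := Num.min n%:R^-1 (Num.min C (del / 4)).
have eta0 : 0 < eta by rewrite !lt_min invr_gt0 nn C0.
have [eta1 eta2 eta3] : [/\ eta <= n%:R^-1, eta <= C & eta <= del / 4].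
  by split; rewrite !ge_min lexx ?orbT.
clearbody eta.
have grid i : (i < n)%N -> I01 (i.+1%:R / n%:R : R).
  by move=> ii; rewrite /I01/= divr_ge0//= ler_pdivrMr// mul1r ler_nat.
pose g' i : (nat -> R) -> R := if (i < n)%N then gn n (i.+1%:R / n%:R) else fun=> 0.
have z0 : nsq P eps (fun=> 0) = 0 by rewrite /nsq (eq_Er P (Y := fun=> 0)) ?Er_cst// => w; rewrite expr0n.
have Lg i : L2k P eps (g' i).
  by rewrite /g'; case: ifP => ii; [case: (K1 n0 (grid i ii))|exact: L2k_cst].
have Eg i : Er P (fun w => g' i (eps_seq eps 0 w)) = 0.
  by rewrite /g'; case: ifP => ii; [case: (K1 n0 (grid i ii))|rewrite Er_cst].
have ng i : nsq P eps (g' i) <= C ^+ 2.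
  by rewrite /g'; case: ifP => ii; [case: (K1 n0 (grid i ii))|rewrite z0 sqr_ge0].
have Dg i j : Er P (fun w => (g' i (eps_seq eps i.+1%:Z w) - g' i (eps_tilde eps epss i.+1%:Z j w)) ^+ 2) <= (C * rho ^+ j) ^+ 2.
  rewrite /g'; case: ifP => ii; first by case: (K1 n0 (grid i ii)) => _ _ _; exact.
  by rewrite (eq_Er P (Y := fun=> 0)) ?Er_cst ?sqr_ge0// => w; rewrite subrr expr0n.
have [mu [K [word [Z [mmu br dZ hD cZ]]]]] := letter_model Heps_meas Hindep Hident n C0 rho01
  (fun i => proj1 (Lg i)) (fun i => proj1 (L2k_at Heps_meas Hindep Hident i.+1%:Z (Lg i)))
  (fun i => etrans (Er_at Heps_meas Hindep Hident i.+1%:Z (Lg i)) (Eg i)) Dg eta0.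
pose G i w := g' i (eps_seq eps i.+1%:Z w).
have GE i w : (i < n)%N -> Gw n i w = G i w by move=> ii; rewrite /Gw /G /g' ii.
have sG i : sqint P (G i) /\ Er P (fun w => G i w ^+ 2) <= C ^+ 2.
  by have [t1 t2] := L2k_at Heps_meas Hindep Hident i.+1%:Z (Lg i); split => //; rewrite t2.
have dZi i : (i < n)%N -> dep_on (fun k => (k < n + K)%N) (Z i).
  move=> ii w w' H; apply: (dZ i).1 => k ki; apply: H; apply: leq_trans ki _.
  by rewrite -addSn leq_add2r.
have bZ i : (i < n)%N -> sqint P (fun w => Z i (word w)) by move=> ii; have [] := br _ (dZi i ii).
have sGZ i : (i < n)%N -> sqint P (fun w => G i w - Z i (word w)).
  by move=> ii; apply: sqintB; [exact: (sG i).1|exact: bZ].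
pose w0 : nat -> nat := fun=> 0%N.
have hX2 i : (i < n)%N -> avgs (fun=> mu) (n + K) (fun w => Z i w ^+ 2) w0 <= V0 ^+ 2.
  move=> ii; have dd : dep_on (fun k => (k < n + K)%N) (fun w => Z i w ^+ 2).
    by move=> w w' H; rewrite (dZi i ii _ _ H).
  rewrite -(br _ dd).2; have sN : sqint P (fun w => - (G i w - Z i (word w))) by exact/sqintN/sGZ.
  have eN : Er P (fun w => (- (G i w - Z i (word w))) ^+ 2) <= C ^+ 2.
    rewrite (eq_Er P (Y := fun w => (G i w - Z i (word w)) ^+ 2)); last by move=> w; rewrite sqrrN.
    by apply: le_trans (cZ i ii) _; rewrite lerXn2r// nnegrE ltW.
  have := Er_mink (sG i).1 sN (ltW C0) (ltW C0) (sG i).2 eN.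
  rewrite (eq_Er P (Y := fun w => Z i (word w) ^+ 2)) => [|w]; last by rewrite opprB addrC subrK.
  by rewrite (_ : C + C = V0)//; rewrite /V0; ring.
have hUI i : (i < n)%N -> avgs (fun=> mu) (n + K) (fun w => Num.max 0 (`|Z i w| - c) ^+ 2) w0 <= del.
  move=> ii; have dd : dep_on (fun k => (k < n + K)%N) (fun w => pos (Z i w) c ^+ 2).
    by move=> w w' H; rewrite (dZi i ii _ _ H).
  rewrite -[X in avgs _ _ X]/(fun w => pos (Z i w) c ^+ 2) -(br _ dd).2.
  have Lp : L2k P eps (fun y => pos (g' i y) c).
    have mp (S : Type) d' (S' : measurableType d') (f : S' -> R) : measurable_fun setT f -> measurable_fun setT (fun y => pos (f y) c).
      move=> mf; apply: measurable_maxr => //; apply: measurable_funB => //.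
      exact: (measurableT_comp (@normr_measurable R setT) mf).
    split; first exact: (mp nat _ _ _ (Lg i).1).
    apply: (@sqint_le _ _ _ P _ _ (mp nat _ _ _ (Lg i).2.1) _ (Lg i).2) => w.
    rewrite ger0_norm /pos ?le_max ?lexx// ge_max normr_ge0/=; lra.
  have [sp ep] := L2k_at Heps_meas Hindep Hident i.+1%:Z Lp.
  have pg : nsq P eps (fun y => pos (g' i y) c) <= del / 4.
    by rewrite /nsq /g' ii; apply: hc => //; exact: grid.
  have i1 := int1D (int1Z 2 sp.2) (int1Z 2 (sGZ i ii).2).
  have dd' : dep_on (fun k => (k < n + K)%N) (fun w => pos (Z i w) c).
    by move=> w w' H; rewrite (dZi i ii _ _ H).
  have := Er_le (br _ dd').1.2 (int1D (int1Z 2 sp.2) (int1Z 2 (sGZ i ii).2)) (fun w => pos_approx (G i w) (Z i (word w)) c0).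
  rewrite (ErD (int1Z 2 sp.2) (int1Z 2 (sGZ i ii).2)) !ErZ//; [|exact: (sGZ i ii).2|exact: sp.2].
  have := cZ i ii; rewrite -/(G i _) => t1 t2; apply: le_trans t2 _.
  have t3 : eta ^+ 2 <= del / 4.
    rewrite expr2; apply: le_trans (ler_wpM2r (ltW eta0) eta3) _; rewrite -[leRHS]mulr1 ler_pM2l//.
    by apply: le_trans eta3 _; lra.
  move: pg; rewrite -ep /G => pg; lra.
have CC : 0 <= 2 * C := V00.
pose blk := bl (fun=> mu) n K b Z w0.
exists blk, (zeta (fun=> mu) n K b Z ^~ w0); split.
- by move=> k; exact: bl_mean.
- move=> k kn; split; first exact: (bl_id (fun=> mmu) w0 (ltn0Sn b') (fun i => (dZ i).1) (fun i => (dZ i).2) kn).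
  apply: le_trans (bl_sq (fun=> mmu) n0 (ltn0Sn b') V00 (fun i => (dZ i).1) hX2 kn) _.
  rewrite -sq2 -expr_div_n; have h : b%:R * V0 / sq <= e1 by rewrite ler_pdivrMr.
  have h' : 0 <= b%:R * V0 / sq by rewrite divr_ge0// ltW.
  apply: le_trans (lerXn2r 2 _ _ h) _; rewrite ?nnegrE ?(ltW e10)//.
  have := ler_wpM2r (ltW e10) e1_1; rewrite expr2; lra.
- apply: le_trans (bl_m3 (fun=> mmu) n0 (ltn0Sn b') V00 c0 (fun i => (dZ i).1) hX2 hUI) _.
  rewrite -/sq; have -> : 2 * b%:R * c / sq * (b%:R * V0 ^+ 2) = 2 * b%:R * c * (b%:R * V0 ^+ 2) / sq by ring.
  have -> : 4 * (b%:R * del) = e1 ^+ 2 by rewrite /del; field; rewrite gt_eqF.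
  have : 2 * b%:R * c * (b%:R * V0 ^+ 2) / sq <= e1 by rewrite ler_pdivrMr.
  have := ler_wpM2r (ltW e10) e1_1; rewrite expr2; lra.
- move=> l l' ll ln.
  have lk k : (l <= k < l')%N -> (k < n)%N by case/andP=> _ kl; exact: leq_trans kl ln.
  pose W1 w := sq^-1 * \sum_(l <= i < l') G i w.
  pose zs (w : nat -> nat) := \sum_(l %/ b <= k < l' %/ b) zeta (fun=> mu) n K b Z k w.
  pose Xs (w : nat -> nat) := sq^-1 * \sum_(l <= i < l') Z i w.
  have dX : dep_on (fun k => (k < n + K)%N) Xs.
    move=> w w' H; congr (_ * _); rewrite big_nat_cond [RHS]big_nat_cond; apply: eq_bigr => i /andP[ii _].
    by apply: (dZi i (lk i ii)).
  have dzs : dep_on (fun k => (k < n + K)%N) zs.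
    by move=> w w' H; apply: eq_bigr => k _; exact: (@dep_zeta R nat (fun=> mu) n K b Z k (fun i => (dZ i).1) w w' H).
  have dXz : dep_on (fun k => (k < n + K)%N) (fun w => Xs w - zs w).
    by move=> w w' H; rewrite (dX _ _ H) (dzs _ _ H).
  have sW1 : sqint P W1 by apply: sqintZ; apply: sqint_sum => i _; exact: (sG i).1.
  have sW2 : sqint P (fun w => zs (word w)) by exact: (br _ dzs).1.
  have EW1 : Er P (fun w => W1 w ^+ 2) = n%:R^-1 * Er P (fun w => (\sum_(l <= i < l') Gw n i w) ^+ 2).
    rewrite (eq_Er P (Y := fun w => n%:R^-1 * (\sum_(l <= i < l') G i w) ^+ 2)); last first.
      by move=> w; rewrite /W1 exprMn exprVn sq2.
    rewrite ErZ; last by apply: (proj2 (_ : sqint P _)); apply: sqint_sum => i _; exact: (sG i).1.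
    congr (_ * _); apply: eq_Er => w; congr (_ ^+ 2); rewrite big_nat_cond [RHS]big_nat_cond.
    by apply: eq_bigr => i /andP[/lk ii _]; rewrite GE.
  have W1B : Er P (fun w => W1 w ^+ 2) <= B ^+ 2 by rewrite EW1; exact: KB.
  have [v1 v2] := bl_var (fun=> mmu) n0 (ltn0Sn b') CC rho01 V00 (fun i => (dZ i).1) (fun i => (dZ i).2) hD hX2 ll ln.
  pose kp := 2 * (A * Num.sqrt (n %/ b).+1%:R + b%:R * V0) / sq.
  have kp0 : 0 <= kp by rewrite divr_ge0 ?(ltW sq0)// mulr_ge0// addr_ge0// mulr_ge0 ?sqrtr_ge0// ltW.
  have kp1 : kp <= 4 * e1 by rewrite ler_pdivrMr// -[leRHS]mulrA; exact: twice_sum_le.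
  have Dk : Er P (fun w => (W1 w - zs (word w)) ^+ 2) <= (5 * e1) ^+ 2.
    have [sd ed] := Er_sum_sqr_le (P := P) (D := fun i w => G i w - Z i (word w)) l (ltW eta0) ln (fun i ii => conj (sGZ i ii) (cZ i ii)).
    pose Dd w := sq^-1 * \sum_(l <= i < l') (G i w - Z i (word w)).
    have sDd : sqint P Dd by exact: sqintZ.
    have Dd1 : Er P (fun w => Dd w ^+ 2) <= e1 ^+ 2.
      rewrite (eq_Er P (Y := fun w => sq^-1 ^+ 2 * (\sum_(l <= i < l') (G i w - Z i (word w))) ^+ 2)); last by move=> w; rewrite exprMn.
      rewrite ErZ; last exact: sd.2.
      apply: le_trans (ler_wpM2l (sqr_ge0 _) ed) _; rewrite -exprMn lerXn2r ?nnegrE ?(ltW e10)//.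
        by rewrite mulr_ge0 ?invr_ge0 ?(ltW sq0)// mulr_ge0// ltW.
      rewrite ler_pdivrMl// [leRHS]mulrC; apply: le_trans y2.
      by rewrite mulrC -ler_pdivlMr// mul1r.
    have Ez : Er P (fun w => (Xs (word w) - zs (word w)) ^+ 2) <= (4 * e1) ^+ 2.
      have dd : dep_on (fun k => (k < n + K)%N) (fun w => (Xs w - zs w) ^+ 2).
        by move=> w w' H; rewrite (dXz _ _ H).
      rewrite (br _ dd).2; apply: le_trans v1 _; rewrite -/sq [X in X ^+ 2 <= _](_ : _ = kp) ?lerXn2r ?nnegrE//; last first.
        by rewrite /kp; congr (2 * (_ + _) / _); rewrite /A mulrAC.
      by rewrite mulr_ge0// ltW.
    have := Er_mink sDd (br _ dXz).1 (ltW e10) (mulr_ge0 (ler0n _ 4) (ltW e10)) Dd1 Ez.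
    rewrite (_ : e1 + 4 * e1 = 5 * e1); last by ring.
    congr (_ <= _); apply: eq_Er => w; congr (_ ^+ 2); rewrite /Dd /Xs /W1 addrA; congr (_ - _).
    by rewrite -mulrDr sumrB subrK.
  have := Er_sqr_close sW1 sW2 B0 (mulr_ge0 (ler0n _ 5) (ltW e10)) W1B Dk.
  rewrite EW1 -v2.
  have dd : dep_on (fun k => (k < n + K)%N) (fun w => zs w ^+ 2).
    by move=> w w' H; rewrite (dzs _ _ H).
  rewrite (br _ dd).2 => h; apply: le_trans h _.
  have := ler_wpM2r (ltW e10) e1_1; have := e1_B; rewrite !mulrDr !mulr1; set z1 := e1 * (2 * B).
  rewrite (_ : 5 * e1 * (2 * B) = 5 * z1); last by rewrite /z1; ring.
  rewrite (_ : 5 * e1 * (5 * e1) = 25 * (e1 * e1)); last by ring.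
  have z10 : 0 <= z1 by rewrite !mulr_ge0// ltW.
  lra.
- move=> F M L L0 FL.
  have cF := lip_sup_cont L0 FL.
  pose pG w := stepf n (fun l => sq^-1 * \sum_(i < minn l n) G i w).
  pose pZ (w : nat -> nat) := stepf n (fun l => sq^-1 * \sum_(i < minn l n) Z i w).
  have E1 : Er P (fun w => F (stepf n (fun l => sq^-1 * \sum_(i < minn l n) Gw n i w))) = Er P (fun w => F (pG w)).
    apply: eq_Er => w; congr (F (stepf _ _)); apply/funext => l; congr (_ * _); apply: eq_bigr => i _.
    by apply: GE; apply: leq_trans (ltn_ord i) (geq_minr _ _).
  rewrite -[X in `|X - _|]/(Er P (fun w => F (stepf n (fun l => sq^-1 * \sum_(i < minn l n) Gw n i w)))) E1.
  have dF : dep_on (fun k => (k < n + K)%N) (fun w => F (pZ w)).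
    move=> w w' H; congr (F (stepf _ _)); apply/funext => l; congr (_ * _); apply: eq_bigr => i _.
    by apply: dZi => //; apply: leq_trans (ltn_ord i) (geq_minr _ _).
  have iG : int1 P (fun w => F (pG w)).
    apply: (@int1_bnd _ _ _ P _ M); last by move=> w; apply: FL.1; exact: cadlag_step.
    apply: (meas_step (F := F) (xi := fun l w => sq^-1 * \sum_(i < minn l n) G i w) n cF) => l.
    by apply: measurable_funM => //; apply: measurable_sum => i; exact: (sG i).1.1.
  have iZ : int1 P (fun w => F (pZ (word w))) := sqint_int1 (br _ dF).1.
  have sN i : (i < n)%N -> sqint P (fun w => `|G i w - Z i (word w)|).
    move=> ii; have [s1 s2] := sGZ i ii; split; first exact: (measurableT_comp (@normr_measurable R setT) s1).
    by move: s2; congr (int1 P _); apply/funext => w; rewrite real_normK ?num_real.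
  have iD : int1 P (fun w => L * (sq^-1 * \sum_(i < n) `|G i w - Z i (word w)|)).
    by do 2 apply: int1Z; apply: int1_sum => i _; exact/sqint_int1/sN.
  have D1 : `|Er P (fun w => F (pG w)) - Er P (fun w => F (pZ (word w)))| <= L * e1.
    apply: le_trans (Er_dist iG iZ) _.
    apply: le_trans (Er_le (int1_norm (int1B iG iZ)) iD _) _.
      move=> w; apply: FL.2; [exact: cadlag_step|exact: cadlag_step|move=> v _].
      rewrite /pG /pZ /stepf -mulrBr -sumrB normrM gtr0_norm ?invr_gt0// ler_pM2l ?invr_gt0//.
      apply: le_trans (ler_norm_sum _ _ _) _; set l := minn _ n.
      rewrite -!(big_mkord xpredT (fun i => `|G i w - Z i (word w)|)).
      by rewrite [leRHS](big_cat_nat (n := l)) ?geq_minr//= lerDl sumr_ge0.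
    rewrite !ErZ; [|by apply: int1_sum => i _; exact/sqint_int1/sN|by apply: int1Z; apply: int1_sum => i _; exact/sqint_int1/sN].
    rewrite ler_pM2l// ler_pdivrMl// Er_sum; last by move=> i _; exact/sqint_int1/sN.
    apply: (@le_trans _ _ (\sum_(i < n) eta)).
      by apply: ler_sum => i _; apply: Er_L1; [exact: sGZ|exact: ltW|exact: cZ].
    rewrite sumr_const card_ord -mulr_natl; apply: le_trans (ler_wpM2l (ler0n _ _) eta1) _.
    by rewrite mulfV ?gt_eqF//; lra.
  have a0 : 0 < e1 * sq by rewrite mulr_gt0.
  have D2 : `|Er P (fun w => F (pZ (word w))) - avgs blk (n %/ b) (fun u => F (stepf n (fun l => \sum_(k < minn l n %/ b) u k))) (zeta (fun=> mu) n K b Z ^~ w0)| <= L * (sq^-1 * (4 * (2 * C) * Num.sqrt (n %/ b).+1%:R * (1 - rho)^-1 ^+ 2 + (b%:R * c + e1 * sq + b%:R / (e1 * sq) * (n%:R * del)))).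
    rewrite (br _ dF).2; exact: (bl_path (fun=> mmu) n0 (ltn0Sn b') CC rho01 c0 (fun i => (dZ i).1) hD hUI L0 FL a0).
  have := ler_normD (Er P (fun w => F (pG w)) - Er P (fun w => F (pZ (word w))))
    (Er P (fun w => F (pZ (word w))) - avgs blk (n %/ b) (fun u => F (stepf n (fun l => \sum_(k < minn l n %/ b) u k))) (zeta (fun=> mu) n K b Z ^~ w0)).
  rewrite addrA subrK => D3; apply: le_trans D3 _.
  apply: le_trans (lerD D1 D2) _; rewrite -mulrDr ler_pM2l//.
  rewrite (_ : 4 * (2 * C) * Num.sqrt (n %/ b).+1%:R * (1 - rho)^-1 ^+ 2 = A * Num.sqrt (n %/ b).+1%:R); last by rewrite /A; ring.
  have h1 : b%:R / (e1 * sq) * (n%:R * del) <= e1 * sq.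
    have -> : b%:R / (e1 * sq) * (n%:R * del) = e1 * sq / 4 by rewrite -sq2 /del; field; rewrite !gt_eqF.
    by rewrite ler_pdivrMr// ler_peMr ?(ltW a0)// ler1n.
  have h2 : sq^-1 * (A * Num.sqrt (n %/ b).+1%:R + (b%:R * c + e1 * sq + b%:R / (e1 * sq) * (n%:R * del))) <= 4 * e1.
    rewrite ler_pdivrMl// (_ : sq * (4 * e1) = 4 * (e1 * sq)); last by ring.
    exact: (sum_four_le hA y3 (lexx _) h1).
  by apply: le_trans (lerD (lexx e1) h2) _; exact: five_eighths.
Qed.
End BlockModel.

(** * Convergence of grouped block sums *)

Section Truncation.
Context {R : realType}.
Variable bl : nat -> (R -> R) -> R.
Hypothesis Hbl : forall k, is_mean (bl k).

Definition zero_below s (w : nat -> R) k := if (k < s)%N then 0 else w k.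
(** Outside the group the law is the Dirac mass at zero, so results about sums started at index 0
    apply to a group started at [s]. *)
Definition mean_on s r k : (R -> R) -> R := if (s <= k < r)%N then bl k else fun phi => phi 0.

Lemma mean_on_mean s r k : is_mean (mean_on s r k).
Proof. by rewrite /mean_on; case: ifP => // _; split. Qed.

Lemma mean_on_id s r k : (forall k, (k < r)%N -> bl k id = 0) -> mean_on s r k id = 0.
Proof. by move=> H; rewrite /mean_on; case: ifP => // /andP[_ /H]. Qed.

Lemma zero_below_upd s w j a : (s <= j)%N -> upd (zero_below s w) j a = zero_below s (upd w j a).
Proof.
move=> sj; apply/funext => k; rewrite /upd /zero_below.
by have [->|//] := eqVneq k j; rewrite ltnNge sj.
Qed.

Lemma avgs_mean_on s r j F w : (j <= r)%N ->
  avgs (mean_on s r) j F (zero_below s w) = avgs bl j (fun w => F (zero_below s w)) w.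
Proof.
elim: j w => // j IH w jr; rewrite /= /avg /mean_on jr andbT.
have [sj|sj] := leqP s j.
  by apply: eq_mean => a; rewrite zero_below_upd// IH// ltnW.
rewrite -[LHS](mean_cst (Hbl j)); apply: eq_mean => a; rewrite -IH ?(ltnW jr)//.
by congr (avgs _ _ _ _); apply/funext => k; rewrite /upd /zero_below; have [->|] := eqVneq k j; rewrite ?sj.
Qed.

Lemma sum_zero_below s r w : (s <= r)%N -> \sum_(k < r) zero_below s w k = \sum_(s <= k < r) w k.
Proof.
move=> sr; rewrite -(big_mkord xpredT (zero_below s w)) (big_cat_nat (n := s))//= big_nat big1 ?add0r; last first.
  by move=> k /andP[_ ks]; rewrite /zero_below ks.
by rewrite big_nat [RHS]big_nat; apply: eq_bigr => k /andP[sk _]; rewrite /zero_below ltnNge sk.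
Qed.

Lemma sum_mean_on s r (phi : R -> R) : (s <= r)%N -> phi 0 = 0 ->
  \sum_(k < r) mean_on s r k phi = \sum_(s <= k < r) bl k phi.
Proof.
move=> sr p0; rewrite -(big_mkord xpredT (fun k => mean_on s r k phi)) (big_cat_nat (n := s))//= big_nat big1 ?add0r; last first.
  by move=> k /andP[_ ks]; rewrite /mean_on leqNgt ks.
by rewrite big_nat [RHS]big_nat; apply: eq_bigr => k H; rewrite /mean_on H.
Qed.
End Truncation.

Definition clt_bound {R : realType} {d} {T : measurableType d} (Q : probability T R) (B : R -> T -> R)
    (M L tau e del : R) := forall (mu : nat -> (R -> R) -> R) r w,
    (forall k, is_mean (mu k)) -> (forall k, mu k id = 0) ->
    (forall k, (k < r)%N -> mu k (fun x => x ^+ 2) <= del) ->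
    `|\sum_(k < r) mu k (fun x => x ^+ 2) - tau| <= del ->
    \sum_(k < r) mu k m3 <= del ->
  forall phi : R -> R, (forall x, `|phi x| <= M) -> (forall x y, `|phi x - phi y| <= L * `|x - y|) ->
    `|avgs mu r (fun w => phi (\sum_(k < r) w k)) w - Er Q (fun w => phi (B tau w - B 0 w))| <= e.

Section Groups.
Context {R : realType} {d : measure_display} {T : measurableType d} (Q : probability T R).
Variable B : R -> T -> R.
Hypothesis BM : std_brownian Q B.

Lemma clt_bound_mono M L tau e del del' : del' <= del ->
  clt_bound Q B M L tau e del -> clt_bound Q B M L tau e del'.
Proof.
move=> dd H mu r w m1 m2 m3' m4 m5; apply: H => //.
- by move=> k kr; apply: le_trans (m3' k kr) dd.
- exact: le_trans m4 dd.
- exact: le_trans m5 dd.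
Qed.

(* Below a small threshold both sides are close to [phi 0], so the error bound holds uniformly down to variance zero. *)
Lemma clt_uniform M L hi e : 0 < M -> 0 < L -> 0 < e ->
  exists2 del, 0 < del & forall tau, 0 < tau -> tau <= hi -> clt_bound Q B M L tau e del.
Proof.
move=> M0 L0 e0; pose x := e / (4 * L).
have x0 : 0 < x by rewrite divr_gt0 ?mulr_gt0.
have Lx : L * x = e / 4 by rewrite /x; field; rewrite gt_eqF.
have lo0 : 0 < x ^+ 2 by rewrite exprn_gt0.
clearbody x.
have lohi : x ^+ 2 <= Num.max hi (x ^+ 2) by rewrite le_max lexx orbT.
have [d1 d10 H1] := clt BM M0 L0 lo0 lohi e0.
exists (Num.min d1 (x ^+ 2)) => [|tau tau0 th]; first by rewrite lt_min d10.
have [lot|tlo] := leP (x ^+ 2) tau.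
  apply: (@clt_bound_mono _ _ _ _ d1); first by rewrite ge_min lexx.
  by move=> mu r w; apply: H1 => //; rewrite le_max th.
move=> mu r w m1 mid m2 m4 m5 phi pM pL.
have E1 : avgs mu r (fun w => (\sum_(k < r) w k) ^+ 2) w <= (2 * x) ^+ 2.
  have := avgs_sum_sqr m1 0 w (r := 0) (r' := r) (fun k _ => mid k).
  rewrite expr0n add0r big_mkord => S1.
  rewrite (_ : (fun w0 : nat -> R => (\sum_(k < r) w0 k) ^+ 2) = fun u => (0 + \sum_(0 <= k < r) u k) ^+ 2); last first.
    by apply/funext => u; rewrite add0r big_mkord.
  rewrite S1; move: m4; rewrite ler_norml => /andP[_ m4].
  have : Num.min d1 (x ^+ 2) <= x ^+ 2 by rewrite ge_min lexx orbT.
  rewrite exprMn (_ : (2 : R) ^+ 2 = 4); last by rewrite expr2; ring.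
  move: m4 tlo lo0; lra.
have E2 := mean_L1 (avgs_mean m1 r w) (mulr_ge0 (ler0n R 2) (ltW x0)) E1.
have a1 : `|avgs mu r (fun w => phi (\sum_(k < r) w k)) w - phi 0| <= L * (2 * x).
  rewrite -{1}[phi 0](mean_cst (avgs_mean m1 r w)) -(meanB (avgs_mean m1 r w)).
  apply: le_trans (mean_norm (avgs_mean m1 r w) _) _.
  apply: (@le_trans _ _ (avgs mu r (fun w => L * `|\sum_(k < r) w k|) w)).
    by apply: (mean_le (avgs_mean m1 r w)) => u; rewrite -[X in _ <= L * `|X|]subr0.
  by rewrite (meanZ (avgs_mean m1 r w)) ler_pM2l.
have [sB eB] := bm_incr_sqint BM (lexx 0) (ltW tau0).
rewrite subr0 in eB.
have E3 : Er Q (fun w => `|B tau w - B 0 w|) <= x by apply: Er_L1 => //; [exact: ltW|rewrite eB ltW].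
have mphi : measurable_fun setT phi by exact: (lip_measurable pL).
have i1 : int1 Q (fun w => phi (B tau w - B 0 w)).
  by apply: (@int1_bnd _ _ _ Q _ M) => //; exact: (measurableT_comp mphi sB.1).
have a2 : `|Er Q (fun w => phi (B tau w - B 0 w)) - phi 0| <= L * x.
  rewrite -{1}[phi 0](Er_cst Q); apply: le_trans (Er_dist i1 (int1_cst Q _)) _.
  have iN := int1Z L (int1_norm (sqint_int1 sB)).
  apply: le_trans (Er_le (int1_norm (int1B i1 (int1_cst Q _))) iN _) _.
    by move=> u; rewrite -[X in _ <= L * `|X|]subr0.
  by rewrite ErZ ?ler_pM2l//; exact/int1_norm/sqint_int1.
have := ler_normB (avgs mu r (fun w => phi (\sum_(k < r) w k)) w - phi 0) (Er Q (fun w => phi (B tau w - B 0 w)) - phi 0).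
rewrite opprB addrA subrK => h; apply: le_trans h _; move: a1 a2.
rewrite mulrCA Lx => a1 a2; apply: le_trans (lerD a1 a2) _; lra.
Qed.

Variable bl : nat -> (R -> R) -> R.
Hypothesis Hbl : forall k, is_mean (bl k).

Section OneGroup.
Variables (s r : nat) (tau del : R).
Hypotheses (sr : (s <= r)%N) (b1 : forall k, (k < r)%N -> bl k id = 0).
Hypotheses (b2 : forall k, (k < r)%N -> bl k (fun x => x ^+ 2) <= del) (del0 : 0 < del).
Hypotheses (b3 : `|\sum_(s <= k < r) bl k (fun x => x ^+ 2) - tau| <= del).
Hypotheses (b4 : \sum_(s <= k < r) bl k m3 <= del).

Lemma group_clt M L e (phi : R -> R) u0 : clt_bound Q B M L tau e del ->
  (forall x, `|phi x| <= M) -> (forall x y, `|phi x - phi y| <= L * `|x - y|) ->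
  `|avgs bl r (fun u => phi (\sum_(s <= k < r) u k)) u0 - Er Q (fun w => phi (B tau w - B 0 w))| <= e.
Proof.
move=> H pM pL.
have z1 : (0 : R) ^+ 2 = 0 by rewrite expr0n.
have z2 : m3 (0 : R) = 0 by rewrite /m3 normr0 !expr0n minxx.
have S1 : \sum_(k < r) mean_on bl s r k (fun x => x ^+ 2) = \sum_(s <= k < r) bl k (fun x => x ^+ 2).
  by apply: sum_mean_on sr _; rewrite expr0n.
have := H (mean_on bl s r) r (zero_below s u0) (mean_on_mean Hbl s r) (fun k => mean_on_id s k b1).
rewrite S1 (sum_mean_on bl sr z2).
have h2 k : (k < r)%N -> mean_on bl s r k (fun x => x ^+ 2) <= del.
  by move=> kr; rewrite /mean_on; case: ifP => _; [exact: b2|rewrite z1 ltW].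
move=> /(_ h2 b3 b4 phi pM pL); rewrite avgs_mean_on//.
rewrite (_ : (fun w => phi (\sum_(k < r) zero_below s w k)) = fun u => phi (\sum_(s <= k < r) u k))//.
by apply/funext => w; rewrite sum_zero_below.
Qed.

(** The condition on [tau + del] gives Ottaviani's hypothesis by Chebyshev. The tail at the end of
    the group is then compared with the Gaussian one, whose fourth moment yields a bound quadratic
    in [tau] and hence summable over many short groups. *)
Lemma group_hit lam e u0 : 0 < lam -> 0 < tau -> clt_bound Q B 1 (2 / lam) tau e del ->
  tau + del <= lam ^+ 2 / 2 ->
  avgs bl r (fun u => (hit (2 * lam) r 0 (zero_below s u))%:R) u0 <= 2 * (16 / lam ^+ 4 * (64 * tau ^+ 2) + e).
Proof.
move=> l0 t0 H tl.
have l20 : 0 < lam ^+ 2 by rewrite exprn_gt0.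
have ind0 (x : R) : ((lam <= `|x|)%R%:R : R) <= x ^+ 2 / lam ^+ 2.
  case: (leP lam `|x|) => h; last by rewrite divr_ge0 ?sqr_ge0.
  by rewrite ler_pdivlMr// mul1r -[x ^+ 2]real_normK ?num_real// lerXn2r ?nnegrE ?(ltW l0).
set mu' := mean_on bl s r.
have Hmu' := mean_on_mean Hbl s r : forall k, is_mean (mu' k).
have pre j : (j <= r)%N -> avgs mu' j (fun w => (lam <= `|\sum_(k < j) w k|)%R%:R) (zero_below s u0) <= 2^-1.
  move=> jr.
  apply: (@le_trans _ _ (avgs mu' j (fun w => (lam ^+ 2)^-1 * (0 + \sum_(0 <= k < j) w k) ^+ 2) (zero_below s u0))).
    by apply: (mean_le (avgs_mean Hmu' _ _)) => w; rewrite add0r big_mkord mulrC.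
  rewrite (meanZ (avgs_mean Hmu' _ _)) avgs_sum_sqr//; last by move=> k _; exact: (mean_on_id s k b1).
  rewrite expr0n add0r ler_pdivrMl//.
  apply: (@le_trans _ _ (\sum_(k < r) mu' k (fun x => x ^+ 2))).
    rewrite -[leRHS](big_mkord xpredT (fun k => mu' k (fun x => x ^+ 2))) [leRHS](big_cat_nat (n := j))//= lerDl.
    by apply: sumr_ge0 => k _; apply: (mean_ge0 (Hmu' k)) => x; exact: sqr_ge0.
  rewrite /mu' (sum_mean_on bl sr) ?expr0n//.
  by move: b3; rewrite ler_norml => /andP[_]; rewrite lerBlDr addrC => h; apply: le_trans h tl.
rewrite -(avgs_mean_on Hbl s (fun w => (hit (2 * lam) r 0 w)%:R) u0 (leqnn r)).
apply: le_trans (ottaviani Hmu' 0 pre) _; rewrite ler_pM2l//.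
(* A Lipschitz majorant of the indicator of [lam <= |x|] that vanishes for [|x| <= lam / 2]; because
   of the vanishing it lies below [(2 * |x| / lam) ^+ 4]. *)
pose chi (x : R) := Num.min 1 (Num.max 0 (2 / lam * `|x| - 1)).
have chi0 x : 0 <= chi x by rewrite /chi le_min ler01/= le_max lexx.
have chi1 x : chi x <= 1 by rewrite /chi ge_min lexx.
have chiM x : `|chi x| <= 1 by rewrite ger0_norm.
have dm (a b c : R) : `|Num.max c a - Num.max c b| <= `|a - b|.
  have := ler_norm (a - b); have := ler_norm (b - a); rewrite (distrC b a) ler_norml => h1 h2.
  by have := normr_ge0 (a - b); case: (leP c a) => h3; case: (leP c b) => h4 h5; apply/andP; split; lra.
have dn (a b c : R) : `|Num.min c a - Num.min c b| <= `|a - b|.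
  have := ler_norm (a - b); have := ler_norm (b - a); rewrite (distrC b a) ler_norml => h1 h2.
  by have := normr_ge0 (a - b); case: (leP c a) => h3; case: (leP c b) => h4 h5; apply/andP; split; lra.
have k0 : 0 < 2 / lam by rewrite divr_gt0.
have chiL x y : `|chi x - chi y| <= 2 / lam * `|x - y|.
  apply: le_trans (dn _ _ _) _; apply: le_trans (dm _ _ _) _.
  rewrite opprB addrA subrK -mulrBr normrM gtr0_norm// ler_pM2l//; exact: ler_dist_dist.
have ind1 (x : R) : ((lam <= `|x|)%R%:R : R) <= chi x.
  case: (leP lam `|x|) => h; last exact: chi0.
  have h' : 2 <= 2 / lam * `|x| by rewrite mulrAC ler_pdivlMr// ler_pM2l.
  have h2 : 1 <= 2 / lam * `|x| - 1 by rewrite lerBrDr.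
  by rewrite /chi le_min lexx le_max h2 orbT.
have chi4 (x : R) : chi x <= 16 / lam ^+ 4 * x ^+ 4.
  have E : 16 / lam ^+ 4 * x ^+ 4 = (2 / lam * `|x|) ^+ 4.
    have n4 : `|x| ^+ 4 = x ^+ 4.
      by rewrite -normrX ger0_norm// exprn_even_ge0.
    by rewrite exprMn n4; congr (_ * _); rewrite expr_div_n; congr (_ / _); ring.
  rewrite E; have p4 : 0 <= (2 / lam * `|x|) ^+ 4 by rewrite exprn_ge0// mulr_ge0// ltW.
  have [h|h] := leP (2 / lam * `|x|) 1.
    by apply: le_trans p4; rewrite /chi ge_min ge_max lexx/= subr_le0 h orbT.
  by apply: le_trans (chi1 x) _; rewrite exprn_ege1// ltW.
have mchi : measurable_fun setT chi by apply: (lip_measurable chiL).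
have gs := bm_incr BM (lexx 0) t0; rewrite subr0 in gs.
have [i4 e4] := gaussian_moment4 gs ltac:(by rewrite sqrtr_gt0).
have t4 : Num.sqrt tau ^+ 4 = tau ^+ 2 by rewrite (@exprM _ _ 2 2) sqr_sqrtr// ltW.
rewrite t4 in e4.
have Echi : Er Q (fun w => chi (B tau w - B 0 w)) <= 16 / lam ^+ 4 * (64 * tau ^+ 2).
  apply: le_trans (Er_le _ (int1Z (16 / lam ^+ 4) i4) (fun w => chi4 _)) _.
    apply: (@int1_bnd _ _ _ Q _ 1) => //; exact: (measurableT_comp mchi gs.1).
  by rewrite ErZ// ler_pM2l// divr_gt0// exprn_gt0.
have := group_clt u0 H chiM chiL; rewrite ler_norml => /andP[_]; rewrite lerBlDr => h.
apply: (@le_trans _ _ (avgs bl r (fun u => chi (\sum_(s <= k < r) u k)) u0)).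
  rewrite avgs_mean_on//; apply: (mean_le (avgs_mean Hbl _ _)) => w.
  by rewrite add0r sum_zero_below.
by apply: le_trans h _; rewrite addrC lerD2r.
Qed.
End OneGroup.

Section ManyGroups.
Variables (m : nat) (t : nat -> R) (c : nat -> nat) (del : R).
Hypotheses (t0 : t 0%N = 0) (tS : forall i, t i < t i.+1).
Hypotheses (c0 : c 0%N = 0%N) (cS : forall i, (c i <= c i.+1)%N) (del0 : 0 < del).
Hypotheses (b1 : forall k, (k < c m)%N -> bl k id = 0).
Hypotheses (b2 : forall k, (k < c m)%N -> bl k (fun x => x ^+ 2) <= del).
Hypotheses (b3 : forall i, (i < m)%N -> `|\sum_(c i <= k < c i.+1) bl k (fun x => x ^+ 2) - (t i.+1 - t i)| <= del).
Hypotheses (b4 : \sum_(k < c m) bl k m3 <= del).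

Let cmono : {homo c : i j / (i <= j)%N >-> (i <= j)%N}.
Proof. by apply: homo_leq => // ? ? ?; exact: leq_trans. Qed.

Lemma group_m3 i : (i < m)%N -> \sum_(c i <= k < c i.+1) bl k m3 <= del.
Proof.
move=> im; apply: le_trans b4.
have p k : 0 <= bl k m3 by apply: (mean_ge0 (Hbl k)) => x; rewrite /m3 le_min sqr_ge0 exprn_ge0.
have cm : (c i.+1 <= c m)%N by exact: cmono.
rewrite -[leRHS](big_mkord xpredT (fun k => bl k m3)) [leRHS](big_cat_nat (n := c i))//=; last by apply: leq_trans cm.
rewrite [X in _ <= _ + X](big_cat_nat (n := c i.+1))//=.
by rewrite addrCA lerDl addr_ge0// sumr_ge0.
Qed.

(** Replacing the [m] group sums one at a time costs [2 * e] each: the one-dimensional theorem and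
    the quantization of the increment. Returning from quantized to true increments costs another
    [m * e]. *)
Lemma coarse_clt M L e (g : (nat -> R) -> R) u0 : 0 < M -> 0 < L -> 0 < e ->
  (forall i, (i < m)%N -> clt_bound Q B M L (t i.+1 - t i) e del) ->
  (forall a, `|g a| <= M) -> (forall a a', `|g a - g a'| <= L * \sum_(i < m) `|a i - a' i|) ->
  measurable_fun setT (fun w => g (incr B t ^~ w)) ->
  `|avgs bl (c m) (fun u => g (fun i => \sum_(c i <= k < c i.+1) u k)) u0 - Er Q (fun w => g (incr B t ^~ w))|
    <= 3 * (m%:R * e).
Proof.
move=> M0 L0 e0 H gM gL mg.
pose z i (u : nat -> R) := \sum_(c i <= k < c i.+1) u k.
have dz i : dep_on (fun k => (c i <= k < c i.+1)%N) (z i).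
  by move=> w w' E; rewrite /z big_nat [RHS]big_nat; apply: eq_bigr => k /E.
pose h := e / L; have h0 : 0 < h by rewrite divr_gt0.
have h20 : 0 < h ^+ 2 by rewrite exprn_gt0.
have [nu [D [Mnu nuE Dle Dc brn]]] := bm_quant BM t0 tS h20.
have gdep : dep_on (fun k => (k < m)%N) g.
  move=> a a' E; apply/eqP; rewrite -subr_eq0 -normr_le0; apply: le_trans (gL a a') _.
  by rewrite big1 ?mulr0// => i _; rewrite E// subrr normr0.
have inc_sq i := bm_incr_sqint BM (incr_ge0 t0 tS i) (ltW (tS i)).
have mD i : measurable_fun setT (D i) by have [_] := nuE i id.
have sD i : sqint Q (D i) by apply: sqint_le (inc_sq i).1 => // w; exact: Dle.
have sDi i : sqint Q (fun w => incr B t i w - D i w) by apply: sqintB => //; exact: (inc_sq i).1.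
have EDi i : Er Q (fun w => `|incr B t i w - D i w|) <= h by apply: Er_L1 => //; exact: ltW.
have [mgD EgD] := brn m g (fun i => z i u0) gdep.
have iN i : int1 Q (fun w => `|incr B t i w - D i w|) by exact/int1_norm/sqint_int1.
have s2 : `|Er Q (fun w => g (D ^~ w)) - Er Q (fun w => g (incr B t ^~ w))| <= m%:R * e.
  have iD : int1 Q (fun w => g (D ^~ w)) by apply: (@int1_bnd _ _ _ Q _ M).
  have iI : int1 Q (fun w => g (incr B t ^~ w)) by apply: (@int1_bnd _ _ _ Q _ M).
  apply: le_trans (Er_dist iD iI) _.
  have iS : int1 Q (fun w => L * \sum_(i < m) `|incr B t i w - D i w|) by apply: int1Z; exact: int1_sum.
  apply: le_trans (Er_le (int1_norm (int1B iD iI)) iS _) _.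
    by move=> w; apply: le_trans (gL _ _) _; rewrite ler_pM2l//; apply: ler_sum => i _; rewrite distrC.
  rewrite ErZ; last exact: int1_sum.
  rewrite Er_sum//; apply: (@le_trans _ _ (L * \sum_(i < m) h)).
    by rewrite ler_pM2l//; apply: ler_sum => i _; exact: EDi.
  by rewrite sumr_const card_ord -[h *+ m]mulr_natl mulrCA /h [L * _]mulrC divfK// gt_eqF.
have s1 : `|avgs bl (c m) (fun u => g (fun i => z i u)) u0 - avgs nu m g (fun i => z i u0)| <= \sum_(i < m) (2 * e).
  rewrite (avgs_blocks Hbl u0 cS dz).
  apply: (@hybrid _ _ _ (block_law_mean Hbl c z u0) Mnu M L (fun=> 2 * e)) => //.
    move=> w i a b im; apply: le_trans (gL _ _) _; rewrite ler_pM2l// (bigD1 (Ordinal im))//= /upd eqxx.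
    by rewrite big1 ?addr0// => j /negbTE jn; rewrite (_ : (j == i :> nat) = false) ?subrr ?normr0//; apply: jn.
  move=> i phi im pM pL.
  have ci : (c i.+1 <= c m)%N by exact: cmono.
  have k1 : `|block_law bl c z u0 i phi - Er Q (fun w => phi (B (t i.+1 - t i) w - B 0 w))| <= e.
    exact: (group_clt (cS i) (fun k kc => b1 (leq_trans kc ci)) (fun k kc => b2 (leq_trans kc ci)) del0
      (b3 im) (group_m3 im) u0 (H i im) pM pL).
  have mphi : measurable_fun setT phi by exact: (lip_measurable pL).
  have tau0 : 0 < t i.+1 - t i by rewrite subr_gt0.
  have mB s : measurable_fun setT (B s) by case: BM.
  have ip s s' : int1 Q (fun w => phi (B s w - B s' w)).
    apply: (@int1_bnd _ _ _ Q _ M) => //; apply: (measurableT_comp mphi); exact: measurable_funB.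
  have k2 : Er Q (fun w => phi (B (t i.+1 - t i) w - B 0 w)) = Er Q (fun w => phi (incr B t i w)).
    have add s s' : Er Q (fun w => phi (B s w - B s' w) + M) = Er Q (fun w => phi (B s w - B s' w)) + M.
      by rewrite (ErD (ip s s') (int1_cst Q M)) Er_cst.
    apply: (@addIr _ M); rewrite -!add; apply/esym.
    apply: (bm_eq_law BM (phi := fun x => phi x + M)) => //.
    - exact: (incr_ge0 t0 tS).
    - by rewrite subr0.
    - exact: measurable_funD.
    - by move=> x; have := pM x; rewrite ler_norml => /andP[h1 _]; rewrite -lerBlDr sub0r.
  have k3 : `|Er Q (fun w => phi (incr B t i w)) - nu i phi| <= e.
    rewrite (nuE i phi).1; have ipD : int1 Q (fun w => phi (D i w)).
      by apply: (@int1_bnd _ _ _ Q _ M) => //; exact: (nuE i phi).2.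
    apply: le_trans (Er_dist (ip _ _) ipD) _.
    apply: le_trans (Er_le (int1_norm (int1B (ip _ _) ipD)) (int1Z L (iN i)) (fun w => pL _ _)) _.
    by rewrite ErZ//; apply: le_trans (ler_wpM2l (ltW L0) (EDi i)) _; rewrite /h mulrCA mulfV ?mulr1// gt_eqF.
  rewrite -k2 in k3; have := lerD k1 k3; have := ler_normD (block_law bl c z u0 i phi - Er Q (fun w => phi (B (t i.+1 - t i) w - B 0 w)))
    (Er Q (fun w => phi (B (t i.+1 - t i) w - B 0 w)) - nu i phi).
  by rewrite addrA subrK => q1 q2; apply: le_trans q1 _; apply: le_trans q2 _; rewrite mulrDl mul1r.
rewrite sumr_const card_ord -[leRHS]mulr_natl -EgD in s1.
have := ler_normD (avgs bl (c m) (fun u => g (fun i => z i u)) u0 - Er Q (fun w => g (D ^~ w)))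
  (Er Q (fun w => g (D ^~ w)) - Er Q (fun w => g (incr B t ^~ w))).
rewrite addrA subrK => q; apply: le_trans q _; apply: le_trans (lerD s1 s2) _.
by rewrite mulrCA; set x := m%:R * e; lra.
Qed.

(* If no group has a large suffix sum, the partial sums over fine blocks stay close to those over whole groups. *)
Lemma coarse_path n b lam M L (F : (R -> R) -> R) (u : nat -> R) : (0 < m)%N -> (0 < n)%N -> (0 < b)%N -> 0 < lam ->
  0 < L -> 0 < M -> lipD M L F -> (forall i, c i = (n * i %/ m) %/ b)%N ->
  `|F (stepf n (fun l => \sum_(k < minn l n %/ b) u k)) -
    F (stepf m (fun i => \sum_(j < minn i m) \sum_(c j <= k < c j.+1) u k))| <=
  L * (4 * lam) + 2 * M * \sum_(i < m) (hit (2 * lam) (c i.+1) 0 (zero_below (c i) u))%:R.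
Proof.
move=> m0 n0 b0 l0 L0 M0 FL cE.
have tel i : \sum_(j < i) \sum_(c j <= k < c j.+1) u k = \sum_(0 <= k < c i) u k.
  elim: i => [|i IH]; first by rewrite big_ord0 c0 big_geq.
  by rewrite big_ord_recr/= IH [RHS](big_cat_nat (n := c i))//=.
have s0 : 0 <= \sum_(i < m) ((hit (2 * lam) (c i.+1) 0 (zero_below (c i) u))%:R : R) by apply: sumr_ge0.
have [/existsP[i hi]|nh] := boolP [exists i : 'I_m, hit (2 * lam) (c i.+1) 0 (zero_below (c i) u)].
  apply: (@le_trans _ _ (2 * M)).
    apply: le_trans (ler_normB _ _) _; rewrite mulrDl mul1r.
    by apply: lerD; apply: FL.1; exact: cadlag_step.
  apply: (@le_trans _ _ (2 * M * 1)); first by rewrite mulr1.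
  rewrite -[leLHS]add0r lerD//; first by rewrite !mulr_ge0// ltW.
  by rewrite ler_pM2l ?mulr_gt0// (bigD1 i)//= hi lerDl sumr_ge0.
apply: (@le_trans _ _ (L * (4 * lam))); last by rewrite lerDl mulr_ge0// mulr_ge0// ltW.
apply: FL.2; [exact: cadlag_step|exact: cadlag_step|move=> v Iv; rewrite /stepf].
have nR : 0 < n%:R :> R by rewrite ltr0n.
have mR : 0 < m%:R :> R by rewrite ltr0n.
have /andP[v0 v1] : 0 <= v <= 1 := Iv.
have ln := truncn_le_grid n Iv; have im := truncn_le_grid m Iv.
have /andP[l1 l2] := truncn_itv (mulr_ge0 (ltW nR) v0).
have /andP[i1 i2] := truncn_itv (mulr_ge0 (ltW mR) v0).
move: ln im l1 l2 i1 i2; set l := Num.truncn (n%:R * v); set i := Num.truncn (m%:R * v) => ln im l1 l2 i1 i2.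
rewrite (minn_idPl ln) (minn_idPl im) tel -(big_mkord xpredT u).
have lo : (n * i %/ m <= l)%N.
  rewrite -ltnS -(ltr_nat R); apply: le_lt_trans l2.
  rewrite -(ler_pM2r mR) -natrM; apply: (@le_trans _ _ (n * i)%:R); first by rewrite ler_nat leq_trunc_div.
  by rewrite natrM mulrAC -mulrA ler_pM2l// mulrC.
have cil : (c i <= l %/ b)%N by rewrite cE leq_div2r.
rewrite (big_cat_nat (n := c i) (p := l %/ b))//= addrAC subrr add0r.
have [im'|mi] := ltnP i m; last first.
  have ie : i = m by apply/eqP; rewrite eqn_leq im.
  have cm : c i = (n %/ b)%N by rewrite cE ie mulnK.
  by rewrite big_geq ?normr0 ?mulr_ge0 ?(ltW l0)// cm leq_div2r.
have hi : (l <= n * i.+1 %/ m)%N.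
  rewrite leq_divRL// -(ler_nat R) !natrM; apply: (@le_trans _ _ (n%:R * v * m%:R)); first by rewrite ler_pM2r.
  by rewrite -mulrA ler_pM2l// mulrC ltW.
have cil' : (l %/ b <= c i.+1)%N by rewrite cE leq_div2r.
have := nh; rewrite negb_exists => /forallP/(_ (Ordinal im'))/= nhi.
have suf j : (c i <= j)%N -> (j <= c i.+1)%N -> `|\sum_(j <= k < c i.+1) u k| < 2 * lam.
  move=> ij ji; have := hitPn nhi ji; rewrite add0r; congr (`|_| < _).
  by rewrite big_nat [RHS]big_nat; apply: eq_bigr => k /andP[jk _]; rewrite /zero_below ltnNge (leq_trans ij jk).
have a1 := suf _ (leqnn _) (cS i); have a2 := suf _ cil cil'.
have E : \sum_(c i <= k < l %/ b) u k = \sum_(c i <= k < c i.+1) u k - \sum_(l %/ b <= k < c i.+1) u k.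
  by rewrite [X in _ = X - _](big_cat_nat (n := (l %/ b)%N))//= addrK.
rewrite E; apply: le_trans (ler_normB _ _) _.
by rewrite (_ : 4 * lam = 2 * lam + 2 * lam); [apply: lerD; exact: ltW|rewrite -mulrDl -natrD].
Qed.
End ManyGroups.
End Groups.

Lemma Er_ae {R : realType} {d : measure_display} {T : measurableType d} (P : probability T R)
    (X Y : T -> R) (A : set T) : measurable_fun setT X -> measurable_fun setT Y -> measurable A -> P A = 0 ->
  (forall w, ~ A w -> X w = Y w) -> Er P X = Er P Y.
Proof.
move=> mX mY mA PA XY; rewrite !ErE /Rintegral; congr fine.
apply: ae_eq_integral => //; [exact/measurable_EFinP|exact/measurable_EFinP|].
exists A; split => // w /= H; apply: contrapT => nA; apply: H => _.
by rewrite (XY w nA).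
Qed.

Lemma exists_nat_gt {R : realType} (x : R) : exists n : nat, x < n%:R.
Proof.
have [x0|x0] := leP 0 x; last by exists 0%N.
by exists (Num.truncn x).+1; have /andP[] := truncn_itv x0.
Qed.

(** * The time-changed Brownian motion and its grid approximation *)

Section Limit.
Context {R : realType} {d d' : measure_display} {T : measurableType d} {T' : measurableType d'}.
Variables (P : probability T R) (Q : probability T' R) (B : R -> T' -> R).
Hypothesis BM : std_brownian Q B.
Variables (Sg : R -> R) (K : R) (Y : T' -> R -> R).
Hypotheses (K0 : 0 < K) (Sg0 : Sg 0 = 0).
Hypothesis SgI : forall s t, 0 <= s -> s <= t -> t <= 1 -> 0 <= Sg t - Sg s <= K * (t - s).
Hypothesis YE : forall w v, I01 v -> Y w v = B (Sg v) w.

Lemma time_ge0 v : I01 v -> 0 <= Sg v.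
Proof.
move=> Iv; have /andP[v0 v1] : 0 <= v <= 1 := Iv.
by have /andP[] := SgI (lexx 0) v0 v1; rewrite Sg0 subr0.
Qed.

Lemma time_lip s t : I01 s -> I01 t -> `|Sg s - Sg t| <= K * `|s - t|.
Proof.
wlog st : s t / s <= t.
  move=> H Is It; have [st|ts] := leP s t; first exact: H.
  by rewrite distrC [`|s - t|]distrC; apply: H => //; exact: ltW.
move=> Is It; have /andP[s0 s1] : 0 <= s <= 1 := Is; have /andP[t0 t1] : 0 <= t <= 1 := It.
have /andP[h1 h2] := SgI s0 st t1.
by rewrite distrC [`|s - t|]distrC !ger0_norm// subr_ge0.
Qed.

Lemma timed_cont w : cont01 (Y w).
Proof.
move=> t It e e0; case: BM => _ _ cB _ _.
have /subspace_continuousP/(_ (Sg t) (time_ge0 It))/cvgrPdist_lt/(_ e e0) := cB w.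
rewrite near_withinE => /nbhs_ballP[del /= del0 H].
exists (del / K); first by rewrite divr_gt0.
move=> s Is st; rewrite !YE// distrC; apply: H; last exact: time_ge0.
rewrite /ball/= distrC; apply: le_lt_trans (time_lip Is It) _.
by rewrite mulrC -ltr_pdivlMr.
Qed.

Lemma timed_meas u : I01 u -> measurable_fun setT (fun w => Y w u).
Proof.
move=> Iu; rewrite (_ : (fun w => Y w u) = B (Sg u)); first by case: BM.
by apply/funext => w; rewrite YE.
Qed.

(** The drift makes the times strictly increasing where the long-run variance vanishes, as required
    for the joint law of the increments. *)
Definition tgrid m (th : R) i := Sg (gridpt m i) + i%:R * th.
Definition gpath (F : (R -> R) -> R) m (a : nat -> R) := F (stepf m (fun i => \sum_(j < minn i m) a j)).

Lemma gridpt_step m i : (0 < m)%N -> 0 <= (gridpt m i.+1 : R) - gridpt m i <= m%:R^-1.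
Proof.
move=> m0; have mR : 0 < m%:R :> R by rewrite ltr0n.
have E : i.+1%:R / m%:R = i%:R / m%:R + m%:R^-1 :> R by rewrite -natr1 mulrDl mul1r.
have i0 : 0 < m%:R^-1 :> R by rewrite invr_gt0.
rewrite /gridpt E; set x := i%:R / m%:R; set z : R := m%:R^-1 in i0 *.
by apply/andP; case: (leP x 1) => h1; case: (leP (x + z) 1) => h2; split; lra.
Qed.

Lemma tgrid0 m th : tgrid m th 0 = 0.
Proof. by rewrite /tgrid /gridpt !mul0r addr0 minElt ltr01 Sg0. Qed.

Lemma tgrid_step m th i : (0 < m)%N -> 0 < th -> th <= tgrid m th i.+1 - tgrid m th i <= K / m%:R + th.
Proof.
move=> m0 th0; have /andP[g1 g2] := gridpt_step i m0.
have /andP[u0 u1] : 0 <= (gridpt m i : R) <= 1 := gridpt_I01 m i.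
have /andP[v0 v1] : 0 <= (gridpt m i.+1 : R) <= 1 := gridpt_I01 m i.+1.
have uv : gridpt m i <= gridpt m i.+1 :> R by rewrite -subr_ge0.
have /andP[s1 s2] := SgI u0 uv v1.
have s3 : Sg (gridpt m i.+1) - Sg (gridpt m i) <= K / m%:R by apply: le_trans s2 _; rewrite ler_pM2l.
have -> : tgrid m th i.+1 - tgrid m th i = (Sg (gridpt m i.+1) - Sg (gridpt m i)) + th.
  by rewrite /tgrid -natr1; ring.
by rewrite lerD2r lerDr s1.
Qed.

Lemma gpath_lip F m M L (a a' : nat -> R) : 0 < L -> lipD M L F ->
  `|gpath F m a - gpath F m a'| <= L * \sum_(i < m) `|a i - a' i|.
Proof.
move=> L0 FL; apply: FL.2; [exact: cadlag_step|exact: cadlag_step|move=> v Iv; rewrite /stepf -sumrB].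
set l := minn _ m; apply: le_trans (ler_norm_sum _ _ _) _.
rewrite -!(big_mkord xpredT (fun i => `|a i - a' i|)) [leRHS](big_cat_nat (n := l)) ?geq_minr//=.
by rewrite lerDl sumr_ge0.
Qed.

Lemma incr_meas t i : measurable_fun setT (incr B t i).
Proof. by case: BM => mB _ _ _ _; exact: measurable_funB. Qed.

Lemma gpath_meas F m M L t : 0 < L -> lipD M L F -> measurable_fun setT (fun w => gpath F m (incr B t ^~ w)).
Proof.
move=> L0 FL; apply: (meas_step (xi := fun i w => \sum_(j < minn i m) incr B t j w) m (lip_sup_cont L0 FL)) => i.
by apply: measurable_sum => j; exact: incr_meas.
Qed.

(** Each Brownian value moves by an increment of variance [i * th], at most [a ^+ 2]. The increments
    sum to [B (t i) - B 0], and [B 0] vanishes only almost surely, so the first equality holds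
    outside a null set. *)
Lemma grid_bridge F m M L th a : (0 < m)%N -> 0 < th -> 0 < L -> lipD M L F -> 0 <= a -> m%:R * th <= a ^+ 2 ->
  `|Er Q (fun w => gpath F m (incr B (tgrid m th) ^~ w)) - Er Q (fun w => F (stepf m (fun i => Y w (gridpt m i))))|
    <= L * (m.+1%:R * a).
Proof.
move=> m0 th0 L0 FL a0 mth.
have [mB B00 _ _ _] := BM; have cF := lip_sup_cont L0 FL.
pose t := tgrid m th; pose Z w := F (stepf m (fun i => B (t (minn i m)) w)).
have mZ : measurable_fun setT Z by apply: (meas_step (xi := fun i w => B (t (minn i m)) w) m cF).
have -> : Er Q (fun w => gpath F m (incr B t ^~ w)) = Er Q Z.
  apply: (@Er_ae _ _ _ Q _ _ [set w | B 0 w != 0]) => //; first exact: gpath_meas L0 FL.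
    rewrite (_ : [set w | B 0 w != 0] = setT `&` B 0 @^-1` (~` [set 0])).
      by apply: mB => //; apply: measurableC; exact: measurable_set1.
    by apply/seteqP; split => w /=; [move=> /eqP h; split|move=> [_ h]; exact/eqP].
  move=> w /= /negP; rewrite negbK => /eqP B0w; congr (F (stepf _ _)); apply/funext => i.
  by rewrite (bm_sum B (tgrid0 m th)) B0w subr0.
have mX : measurable_fun setT (fun w => F (stepf m (fun i => Y w (gridpt m i)))).
  by apply: (meas_step (xi := fun i w => Y w (gridpt m i)) m cF) => i; apply: timed_meas; exact: gridpt_I01.
have iZ : int1 Q Z by apply: (@int1_bnd _ _ _ Q _ M) => // w; apply: FL.1; exact: cadlag_step.
have iX : int1 Q (fun w => F (stepf m (fun i => Y w (gridpt m i)))).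
  by apply: (@int1_bnd _ _ _ Q _ M) => // w; apply: FL.1; exact: cadlag_step.
have inc i : sqint Q (fun w => B (t i) w - B (Sg (gridpt m i)) w) /\
    Er Q (fun w => (B (t i) w - B (Sg (gridpt m i)) w) ^+ 2) = i%:R * th.
  have h : Sg (gridpt m i) <= t i by rewrite /t /tgrid lerDl mulr_ge0// ltW.
  have [h1 h2] := bm_incr_sqint BM (time_ge0 (gridpt_I01 m i)) h; split => //.
  by rewrite h2 /t /tgrid addrC addKr.
have iN i : int1 Q (fun w => `|B (t i) w - B (Sg (gridpt m i)) w|) by exact/int1_norm/sqint_int1/(inc i).1.
have iS : int1 Q (fun w => L * \sum_(i < m.+1) `|B (t i) w - B (Sg (gridpt m i)) w|) by apply: int1Z; exact: int1_sum.
apply: le_trans (Er_dist iZ iX) _; apply: le_trans (Er_le (int1_norm (int1B iZ iX)) iS _) _.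
  move=> w; apply: FL.2; [exact: cadlag_step|exact: cadlag_step|move=> v Iv; rewrite /stepf].
  have := truncn_le_grid m Iv; set i := Num.truncn _ => im.
  rewrite (minn_idPl im) YE; last exact: gridpt_I01.
  have im' : (i < m.+1)%N by rewrite ltnS.
  by rewrite (bigD1 (Ordinal im'))//= lerDl sumr_ge0.
rewrite ErZ; last exact: int1_sum.
rewrite Er_sum// ler_pM2l//; apply: (@le_trans _ _ (\sum_(i < m.+1) a)).
  apply: ler_sum => i _; apply: Er_L1 => //; first exact: (inc i).1.
  by rewrite (inc i).2; apply: le_trans mth; rewrite ler_pM2r// ler_nat -ltnS.
by rewrite sumr_const card_ord -[a *+ _]mulr_natl.
Qed.

Variable bl : nat -> (R -> R) -> R.
Hypothesis Hbl : forall k, is_mean (bl k).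

Lemma fine_coarse F M L n m b lam h u0 (c : nat -> nat) : 0 < M -> 0 < L -> lipD M L F ->
  (0 < m)%N -> (0 < n)%N -> (0 < b)%N -> 0 < lam -> (forall i, c i = (n * i %/ m) %/ b)%N ->
  (forall i, (c i <= c i.+1)%N) ->
  (forall i, (i < m)%N -> avgs bl (c i.+1) (fun u => (hit (2 * lam) (c i.+1) 0 (zero_below (c i) u))%:R) u0 <= h) ->
  `|avgs bl (n %/ b) (fun u => F (stepf n (fun l => \sum_(k < minn l n %/ b) u k))) u0 -
    avgs bl (c m) (fun u => gpath F m (fun i => \sum_(c i <= k < c i.+1) u k)) u0| <=
  L * (4 * lam) + 2 * M * (m%:R * h).
Proof.
move=> M0 L0 FL m0 n0 b0 l0 cE cS hh.
have cm : c m = (n %/ b)%N by rewrite cE mulnK.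
have c0 : c 0%N = 0%N by rewrite cE muln0 !div0n.
have cmono : {homo c : i j / (i <= j)%N >-> (i <= j)%N} by apply: homo_leq => // ? ? ?; exact: leq_trans.
rewrite -cm -(meanB (avgs_mean Hbl (c m) u0)); apply: le_trans (mean_norm (avgs_mean Hbl (c m) u0) _) _.
apply: (@le_trans _ _ (avgs bl (c m) (fun u => 2 * M * (\sum_(i < m) (hit (2 * lam) (c i.+1) 0 (zero_below (c i) u))%:R) + L * (4 * lam)) u0)).
  apply: (mean_le (avgs_mean Hbl (c m) u0)) => u; rewrite [leRHS]addrC.
  exact: (coarse_path c0 cS u m0 n0 b0 l0 L0 M0 FL cE).
rewrite (mean_lin (avgs_mean Hbl (c m) u0)) (mean_cst (avgs_mean Hbl (c m) u0)) addrC lerD2l.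
rewrite ler_pM2l ?mulr_gt0// (mean_sum (avgs_mean Hbl (c m) u0)).
apply: (@le_trans _ _ (\sum_(i < m) h)); last by rewrite sumr_const card_ord -[h *+ _]mulr_natl.
apply: ler_sum => i _; apply: le_trans (hh i (ltn_ord i)).
rewrite (avgs_const Hbl u0 u0 (s := c i.+1)) ?cmono// => w w' E; congr (_ _); congr (nat_of_bool _).
by apply: hit_local => k kc; rewrite /zero_below; case: ifP => // _; exact: E.
Qed.
End Limit.

Section MainArith.
Context {R : realType}.
Implicit Types d e : R.

Lemma swap_div (k x e N : R) : 0 < k -> 0 < e -> 0 < N -> k * x / e <= N -> x / N <= e / k.
Proof.
by move=> k0 e0 N0; rewrite ler_pdivrMr// => h; rewrite ler_pdivrMr// mulrAC ler_pdivlMr// mulrC [e * N]mulrC.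
Qed.

Lemma dist_five (x v s1 s0 g1 g0 th d : R) : `|x - v| <= d / 8 -> `|v - (s1 - s0)| <= d / 8 ->
  `|s1 - g1| <= d / 16 -> `|s0 - g0| <= d / 16 -> 0 <= th -> th <= d / 4 -> `|x - (g1 - g0 + th)| <= d.
Proof.
rewrite !ler_norml => /andP[? ?] /andP[? ?] /andP[? ?] /andP[? ?] ? ?.
by apply/andP; split; lra.
Qed.

Lemma dist_chain (a0 a1 a2 a3 a4 a5 e : R) : 0 < e -> `|a0 - a1| <= e / 8 -> `|a2 - a1| <= e / 8 -> `|a3 - a2| <= e / 8 ->
  `|a4 - a3| <= e / 8 + (e / 8 + e / 8) -> `|a5 - a4| <= e / 8 -> `|a0 - a5| <= e.
Proof.
rewrite !ler_norml => ? /andP[? ?] /andP[? ?] /andP[? ?] /andP[? ?] /andP[? ?].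
by apply/andP; split; lra.
Qed.

Lemma floor_grid (n m i : nat) : (0 < n)%N -> (0 < m)%N ->
  `|(n * i %/ m)%:R / n%:R - i%:R / m%:R| <= n%:R^-1 :> R.
Proof.
move=> n0 m0; have nR : 0 < n%:R :> R by rewrite ltr0n.
have mR : 0 < m%:R :> R by rewrite ltr0n.
have E : n%:R * i%:R = (n * i %/ m)%:R * m%:R + (n * i %% m)%:R :> R.
  by rewrite -!natrM -natrD -divn_eq.
have r1 : (n * i %% m)%:R <= m%:R :> R by rewrite ler_nat ltnW// ltn_mod.
have -> : (n * i %/ m)%:R / n%:R - i%:R / m%:R = - ((n * i %% m)%:R / m%:R / n%:R) :> R.
  have -> : (n * i %% m)%:R = n%:R * i%:R - (n * i %/ m)%:R * m%:R :> R by rewrite E addrAC subrr add0r.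
  by field; rewrite !gt_eqF.
rewrite normrN ger0_norm ?divr_ge0 ?(ltW nR) ?(ltW mR)//.
by rewrite ler_pdivrMr// mulVf ?gt_eqF// ler_pdivrMr// mul1r.
Qed.
End MainArith.

Section Main.
Context {R : realType} {d' : measure_display} {T' : measurableType d'}.
Variables (Q : probability T' R) (B : R -> T' -> R).
Hypothesis BM : std_brownian Q B.
Variables (Sg : R -> R) (K : R) (Y : T' -> R -> R).
Hypotheses (K0 : 0 < K) (Sg0 : Sg 0 = 0).
Hypothesis SgI : forall s t, 0 <= s -> s <= t -> t <= 1 -> 0 <= Sg t - Sg s <= K * (t - s).
Hypothesis YE : forall w v, I01 v -> Y w v = B (Sg v) w.
Variables (V : nat -> nat -> nat -> R) (A : ((R -> R) -> R) -> nat -> R).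
Hypothesis blocks : forall e, 0 < e -> exists (b N : nat), (0 < b)%N /\ forall n, (N <= n)%N -> (0 < n)%N /\
  exists (bl : nat -> (R -> R) -> R) (u0 : nat -> R),
  [/\ forall k, is_mean (bl k),
      forall k, (k < n %/ b)%N -> bl k id = 0 /\ bl k (fun x => x ^+ 2) <= e,
      \sum_(k < n %/ b) bl k m3 <= e,
      forall l l', (l <= l')%N -> (l' <= n)%N ->
        `|\sum_(l %/ b <= k < l' %/ b) bl k (fun x => x ^+ 2) - V n l l'| <= e &
      forall F M L, 0 < L -> lipD M L F ->
        `|A F n - avgs bl (n %/ b) (fun u => F (stepf n (fun l => \sum_(k < minn l n %/ b) u k))) u0| <= L * e].
Hypothesis lim_var : forall e, 0 < e -> exists N, forall n l l', (N <= n)%N -> (l <= l')%N -> (l' <= n)%N ->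
  `|V n l l' - (Sg (l'%:R / n%:R) - Sg (l%:R / n%:R))| <= e.

(** The comparison chain runs from the limit path to its grid version, to the drifted grid, to the
    group sums, to the fine block sums, and to the original process. The number [m] of groups is
    fixed before the error [del] allowed per group, and [n] comes last. *)
Lemma functional_limit F M L : 0 < M -> 0 < L -> lipD M L F ->
  A F @ \oo --> Er Q (fun w => F (Y w)).
Proof.
move=> M0 L0 FL; apply/cvgrPdist_le => e e0; have K0' := K0.
have cY := timed_cont BM K0 Sg0 SgI YE.
have mY u : I01 u -> measurable_fun setT (fun w => Y w u) by move=> Iu; exact: (timed_meas BM YE Iu).
have e8 : 0 < e / 8 by rewrite divr_gt0.
have /cvgrPdist_le/(_ _ e8)[M1 _ HM1] := Er_stepY (P := Q) cY mY (lip_sup_cont L0 FL) FL.1.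
have [lam lam0 lamE] : exists2 lam : R, 0 < lam & L * (4 * lam) = e / 8.
  exists (e / (32 * L)); first by rewrite divr_gt0// mulr_gt0.
  by field; rewrite gt_eqF.
have l20 : 0 < lam ^+ 2 by rewrite exprn_gt0.
have l40 : 0 < lam ^+ 4 by rewrite exprn_gt0.
(* The probabilities of large excursions, summed over [m] groups of variance at most [2 * K / m] and
   weighted by [2 * M], amount to [X / m] apart from the swapping error [e1]. *)
pose X := 4 * M * (16 / lam ^+ 4 * (64 * (2 * K) ^+ 2)).
have X0 : 0 <= X by rewrite !mulr_ge0// ?sqr_ge0// ?invr_ge0 ltW.
have [M2 hM2] := exists_nat_gt (8 * X / e + 4 * (2 * K) / lam ^+ 2).
pose m := (M1 + M2).+1.
have m0 : (0 < m)%N by [].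
have mR : 0 < m%:R :> R by rewrite ltr0n.
have m1 : 1 <= m%:R :> R by rewrite ler1n.
have hm : 8 * X / e + 4 * (2 * K) / lam ^+ 2 <= m%:R.
  by apply: le_trans (ltW hM2) _; rewrite ler_nat /m leqW// leq_addl.
have p1 : 0 <= 8 * X / e by rewrite divr_ge0 ?(ltW e0)// mulr_ge0.
have p2 : 0 <= 4 * (2 * K) / lam ^+ 2 by rewrite divr_ge0 ?mulr_ge0// ltW.
have hX : X / m%:R <= e / 8.
  by apply: swap_div => //; apply: le_trans hm; rewrite lerDl.
have hK : 2 * K / m%:R <= lam ^+ 2 / 4.
  by apply: swap_div => //; apply: le_trans hm; rewrite lerDr.
have HM := HM1 m (leq_trans (leq_addr M2 M1) (leqnSn _)).
clearbody m; clear hm hM2 p1 p2 HM1.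
(* Both swapping errors are incurred once per group, so they are divided by [m], which is already
   fixed. *)
pose e1 := e / (32 * M * m%:R); have e10 : 0 < e1 by rewrite divr_gt0// !mulr_gt0.
pose e2 := e / (24 * m%:R); have e20 : 0 < e2 by rewrite divr_gt0// !mulr_gt0.
have [dA dA0 HA] := clt_uniform BM (2 * K) M0 L0 e20.
have [dB dB0 HB] := clt_uniform BM (2 * K) ltr01 (divr_gt0 (ltr0Sn R 1) lam0) e10.
have [del [del0 delA delB dell]] : exists del : R, [/\ 0 < del, del <= dA, del <= dB & del <= lam ^+ 2 / 4].
  exists (Num.min (Num.min dA dB) (lam ^+ 2 / 4)); split; rewrite ?lt_min ?dA0 ?dB0 ?divr_gt0//.
  - by rewrite ge_min ge_min lexx.
  - by rewrite ge_min ge_min lexx orbT.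
  - by rewrite ge_min lexx orbT.
have [a a0 aE] : exists2 a : R, 0 < a & L * (m.+1%:R * a) = e / 8.
  have z0 := ltr0Sn R m; set z := m.+1%:R in z0 *; clearbody z.
  exists (e / (8 * L * z)); first by rewrite divr_gt0// !mulr_gt0.
  by field; rewrite !gt_eqF.
have [th [th0 thK thd tha]] : exists th : R, [/\ 0 < th, th <= K / m%:R, th <= del / 4 & m%:R * th <= a ^+ 2].
  exists (Num.min (K / m%:R) (Num.min (del / 4) (a ^+ 2 / m%:R))); split.
  - by rewrite !lt_min !divr_gt0// exprn_gt0.
  - by rewrite ge_min lexx.
  - by rewrite !ge_min lexx orbT.
  - by rewrite mulrC -ler_pdivlMr// !ge_min lexx !orbT.
pose t := tgrid Sg m th.
have t0 : t 0%N = 0 by exact: tgrid0.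
have tau i : 0 < t i.+1 - t i /\ t i.+1 - t i <= 2 * K / m%:R.
  have /andP[h1 h2] := tgrid_step K0 SgI i m0 th0; split; first exact: lt_le_trans h1.
  by apply: le_trans h2 _; rewrite -mulrA mulrDl mul1r lerD2l.
have tS i : t i < t i.+1 by have [] := tau i; rewrite subr_gt0.
have tau2 i : t i.+1 - t i <= 2 * K.
  by apply: le_trans (tau i).2 _; rewrite ler_pdivrMr// ler_peMr// mulr_ge0// ltW.
have [eb [eb0 ebd ebL]] : exists eb : R, [/\ 0 < eb, eb <= del / 8 & L * eb <= e / 8].
  exists (Num.min (del / 8) (e / 8 / L)); split; first by rewrite lt_min !divr_gt0.
    by rewrite ge_min lexx.
  by rewrite mulrC -ler_pdivlMr// ge_min lexx orbT.
have [b [N1 [b0 HB1]]] := blocks eb0.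
have [N2 HN2] := lim_var (divr_gt0 del0 (ltr0Sn R 7)).
have [N3 hN3] := exists_nat_gt (16 * K / del).
exists (N1 + N2 + N3)%N => // n /= nN.
have n1 : (N1 <= n)%N by apply: leq_trans nN; rewrite -addnA leq_addr.
have n2 : (N2 <= n)%N by apply: leq_trans nN; rewrite -addnA addnCA leq_addr.
have n3 : (N3 <= n)%N by apply: leq_trans nN; rewrite leq_addl.
have [n0 [bl [u0 [Hbl W1 W3 W4 W5]]]] := HB1 n n1.
have nR : 0 < n%:R :> R by rewrite ltr0n.
have Kn : K / n%:R <= del / 16.
  by apply: swap_div => //; apply: le_trans (ltW hN3) _; rewrite ler_nat.
have ebdel : eb <= del by apply: le_trans ebd _; rewrite ler_pdivrMr// ler_peMr ?(ltW del0)// ler1n.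
pose l i := (n * i %/ m)%N; pose c i := (l i %/ b)%N.
have lS i : (l i <= l i.+1)%N by rewrite leq_div2r// leq_mul2l leqnSn orbT.
have cS i : (c i <= c i.+1)%N by rewrite leq_div2r.
have cm : c m = (n %/ b)%N by rewrite /c /l mulnK.
have ln i : (i <= m)%N -> (l i <= n)%N.
  by move=> im; rewrite -[leqRHS](mulnK n m0) leq_div2r// leq_mul2l im orbT.
have cmono : {homo c : i j / (i <= j)%N >-> (i <= j)%N} by apply: homo_leq => // ? ? ?; exact: leq_trans.
have b1 k : (k < c m)%N -> bl k id = 0 by rewrite cm => /W1[].
have b2 k : (k < c m)%N -> bl k (fun x => x ^+ 2) <= del.
  by rewrite cm => /W1[_ h]; apply: le_trans h ebdel.
have b4 : \sum_(k < c m) bl k m3 <= del by rewrite cm; apply: le_trans W3 ebdel.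
have gl i : (i <= m)%N -> `|Sg ((l i)%:R / n%:R) - Sg (gridpt m i)| <= del / 16.
  move=> im; have Il : I01 ((l i)%:R / n%:R : R).
    by rewrite /I01/= divr_ge0//= ler_pdivrMr// mul1r ler_nat ln.
  apply: le_trans (time_lip SgI Il (gridpt_I01 m i)) _; apply: le_trans Kn; rewrite ler_pM2l//.
  have -> : gridpt m i = i%:R / m%:R :> R by apply/min_idPl; rewrite ler_pdivrMr// mul1r ler_nat.
  exact: floor_grid.
have b3 i : (i < m)%N -> `|\sum_(c i <= k < c i.+1) bl k (fun x => x ^+ 2) - (t i.+1 - t i)| <= del.
  move=> im; have -> : t i.+1 - t i = Sg (gridpt m i.+1) - Sg (gridpt m i) + th.
    by rewrite /t /tgrid -natr1; ring.
  apply: dist_five (le_trans (W4 _ _ (lS i) (ln _ im)) ebd) (HN2 _ _ _ n2 (lS i) (ln _ im)) (gl _ im) (gl _ (ltnW im)) (ltW th0) thd.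
pose h := 2 * (16 / lam ^+ 4 * (64 * (2 * K / m%:R) ^+ 2) + e1).
have hh i : (i < m)%N -> avgs bl (c i.+1) (fun u => (hit (2 * lam) (c i.+1) 0 (zero_below (c i) u))%:R) u0 <= h.
  move=> im; have ci : (c i.+1 <= c m)%N by exact: cmono.
  have cb : clt_bound Q B 1 (2 / lam) (t i.+1 - t i) e1 del.
    by apply: clt_bound_mono delB (HB _ (tau i).1 (tau2 i)).
  have tl : t i.+1 - t i + del <= lam ^+ 2 / 2.
    have -> : lam ^+ 2 / 2 = lam ^+ 2 / 4 + lam ^+ 2 / 4 by field.
    by apply: lerD => //; apply: le_trans hK; exact: (tau i).2.
  apply: le_trans (group_hit BM Hbl (cS i) (fun k kc => b1 k (leq_trans kc ci)) (fun k kc => b2 k (leq_trans kc ci))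
    del0 (b3 i im) (group_m3 Hbl cS b4 im) u0 lam0 (tau i).1 cb tl) _.
  rewrite /h ler_pM2l// lerD2r ler_pM2l ?divr_gt0// ler_pM2l//.
  by rewrite lerXn2r ?nnegrE ?(ltW (tau i).1)// ?(tau i).2// divr_ge0 ?mulr_ge0// ltW.
have fc := fine_coarse Hbl M0 L0 FL m0 n0 b0 lam0 (fun i => erefl (c i)) cS hh.
have hE : 2 * M * (m%:R * h) = X / m%:R + e / 8.
  by rewrite /h /X /e1; field; rewrite !gt_eqF.
rewrite lamE hE in fc.
have cc := coarse_clt BM Hbl t0 tS cS del0 b1 b2 b3 b4 u0 M0 L0 e20
  (fun i _ => clt_bound_mono delA (HA _ (tau i).1 (tau2 i)))
  (fun x => FL.1 _ (cadlag_step m _)) (fun x y => gpath_lip m x y L0 FL) (gpath_meas BM m t L0 FL).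
have e2E : 3 * (m%:R * e2) = e / 8 by rewrite /e2; field; rewrite gt_eqF.
rewrite e2E in cc.
have gb := grid_bridge BM Sg0 SgI YE m0 th0 L0 FL (ltW a0) tha; rewrite aE in gb.
apply: (dist_chain e0 HM gb cc); last exact: le_trans (W5 F M L L0 FL) ebL.
by apply: le_trans fc _; rewrite lerD2l lerD2r.
Qed.
End Main.

(** * The invariance principle *)

Section Kernels.
Context {R : realType} {d : measure_display} {T : measurableType d} (P : probability T R).

Lemma sqint_pos (X : T -> R) c : 0 <= c -> sqint P X -> sqint P (fun w => pos (X w) c).
Proof.
move=> c0 sX; apply: sqint_le (sX) => [|w].
  apply: measurable_maxr => //; apply: measurable_funB => //.
  exact: (measurableT_comp (@normr_measurable R setT) sX.1).
by rewrite ger0_norm /pos ?le_max ?lexx// ge_max normr_ge0/= lerBlDr lerDl.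
Qed.

Lemma powR_tail_small (q A b del : R) : 2 < q -> 0 < A -> 0 < del ->
  exists c : R, [/\ 0 < c, b <= c & A * c `^ (2 - q) <= del].
Proof.
move=> q2 A0 d0; have q0 : 0 < q - 2 by rewrite subr_gt0.
pose x := A / del; have x0 : 0 < x by rewrite divr_gt0.
pose c := Num.max b (x `^ (q - 2)^-1).
have c1 : x `^ (q - 2)^-1 <= c by rewrite le_max lexx orbT.
have p0 : 0 < x `^ (q - 2)^-1 by exact: powR_gt0.
have c0 : 0 < c by exact: lt_le_trans c1.
exists c; split => //; first by rewrite le_max lexx.
have xc : x <= c `^ (q - 2).
  have -> : x = (x `^ (q - 2)^-1) `^ (q - 2) by rewrite -powRrM mulVf ?gt_eqF// powRr1// ltW.
  by apply: ge0_ler_powR => //; rewrite ?nnegrE ltW.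
rewrite -opprB powRN ler_pdivrMr ?powR_gt0//.
by rewrite -ler_pdivrMl// mulrC.
Qed.

(** Centring shifts the variable by at most [C]. With [c >= C] the shift is absorbed by doubling the
    truncation level from [c] to [2 * c]. *)
Lemma ctr_pos_small (q Cq C : R) eps (a : nat -> R -> (nat -> R) -> R) : 2 < q -> 0 < Cq -> 0 < C ->
  (forall n u, (0 < n)%N -> I01 u -> [/\ L2k P eps (a n u), nsq P eps (a n u) <= C ^+ 2 &
    forall c, 0 < c -> Er P (fun w => pos (a n u (eps_seq eps 0 w)) c ^+ 2) <= Cq * c `^ (2 - q)]) ->
  forall del, 0 < del -> exists2 c, 0 <= c & forall n u, (0 < n)%N -> I01 u ->
    Er P (fun w => pos (ctr P eps (a n u) (eps_seq eps 0 w)) c ^+ 2) <= del.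
Proof.
move=> q2 Cq0 C0 H del del0.
have [c [c0 Cc cs]] := powR_tail_small C q2 Cq0 del0.
have c20 : 0 <= 2 * c by rewrite mulr_ge0// ltW.
exists (2 * c) => // n u n0 Iu; have [La na Ha] := H n u n0 Iu.
apply: le_trans cs; apply: le_trans (Ha c c0).
have mC : `|Er P (fun w => a n u (eps_seq eps 0 w))| <= C.
  apply: le_trans (Er_norm (sqint_int1 La.2)) _.
  by apply: (Er_L1 La.2 (ltW C0)); exact: na.
have sc : sqint P (fun w => ctr P eps (a n u) (eps_seq eps 0 w)) by apply: sqintB (La.2) (sqint_cst P _).
apply: Er_le; [exact: (sqint_pos c20 sc).2|exact: (sqint_pos (ltW c0) La.2).2|move=> w].
have p0 (y b : R) : 0 <= pos y b by rewrite /pos le_max lexx.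
rewrite lerXn2r ?nnegrE//; set x := a n u _; rewrite {1}/pos ge_max p0/= /ctr -/x.
apply: (@le_trans _ _ (`|x| - c)); last by rewrite /pos le_max lexx orbT.
have := ler_normB x (Er P (fun w => a n u (eps_seq eps 0 w))).
move: mC; set z := `|Er _ _|; set y := `|x - _|; lra.
Qed.
End Kernels.

Lemma gap_mul_le {R : realDomainType} (x y M : R) : 0 <= M -> 0 <= x -> y <= 1 -> (y - x) * M <= M.
Proof. by move=> M0 x0 y1; rewrite ler_piMl// lerBlDr (le_trans y1)// lerDl. Qed.

(** Nonnegativity of the long-run variance is not proved pointwise: increments of its primitive
    between grid points are limits of normalized second moments, and the Lipschitz bound extends the
    sign to all times. *)
Lemma primitive_monotone {R : realType} (f : R -> R) (M : R) (V : nat -> nat -> nat -> R) :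
  0 <= M -> (forall s t, 0 <= s -> s <= t -> t <= 1 -> `|primitive f t - primitive f s| <= (t - s) * M) ->
  (forall n l l', 0 <= V n l l') ->
  (forall e, 0 < e -> exists N, forall n l l', (N <= n)%N -> (l <= l')%N -> (l' <= n)%N ->
    `|V n l l' - (primitive f (l'%:R / n%:R) - primitive f (l%:R / n%:R))| <= e) ->
  forall s t, 0 <= s -> s <= t -> t <= 1 -> 0 <= primitive f t - primitive f s.
Proof.
move=> M0 fL V0 fV s t s0 st t1; apply/ler_addgt0Pr => e e0.
have e2 : 0 < e / 2 by rewrite divr_gt0.
have [N HN] := fV _ e2; have [N' hN'] := exists_nat_gt (4 * M / e).
pose n := (N + N').+1; have nR : 0 < n%:R :> R by rewrite ltr0n.
have Mn : M / n%:R <= e / 4.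
  by apply: swap_div => //; apply: le_trans (ltW hN') _; rewrite ler_nat /n leqW// leq_addl.
have t0 : 0 <= t by exact: le_trans st.
have gap x : 0 <= x -> x <= 1 -> `|primitive f x - primitive f ((Num.truncn (n%:R * x))%:R / n%:R)| <= e / 4.
  move=> x0 x1; have /andP[h1 h2] := truncn_itv (mulr_ge0 (ltW nR) x0).
  move: h1 h2; set l := Num.truncn _ => h1 h2.
  have lx : l%:R / n%:R <= x by rewrite ler_pdivrMr// mulrC.
  have l0 : 0 <= l%:R / n%:R :> R by rewrite divr_ge0// ltW.
  apply: le_trans (fL _ _ l0 lx x1) _; apply: le_trans Mn; rewrite mulrC ler_wpM2l//.
  by rewrite lerBlDr -[X in _ <= X + _]mul1r -mulrDl ler_pdivlMr// mulrC nat1r ltW.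
have ll : (Num.truncn (n%:R * s) <= Num.truncn (n%:R * t))%N by apply: le_truncn; rewrite ler_pM2l.
have ln : (Num.truncn (n%:R * t) <= n)%N by apply: truncn_le_grid; rewrite /I01/= t0 t1.
have Nn : (N <= n)%N by rewrite /n leqW// leq_addr.
have := HN n _ _ Nn ll ln; have := V0 n (Num.truncn (n%:R * s)) (Num.truncn (n%:R * t)).
have := gap s s0 (le_trans st t1); have := gap t t0 t1.
move: (V _ _ _) (primitive f (_ / _)) (primitive f (_ / _)) (primitive f t) (primitive f s) => v a b y x.
rewrite !ler_norml => /andP[? ?] /andP[? ?] ? /andP[? ?]; lra.
Qed.

Theorem theorem2p1 (R : realType) (d : measure_display) (T : measurableType d)
    (P : probability T R) (eps epss : int -> T -> R)
    (Heps_meas : forall i, measurable_fun setT (eps i) /\ measurable_fun setT (epss i))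
    (Hindep : mutual_indep P (joint_family eps epss))
    (Hident : ident_distr P (joint_family eps epss))
    (q p CG rho : R) (Hq : 2 < q) (Hp : 1 <= p) (Hrho : 0 < rho < 1)
    (Gn : nat -> R -> (nat -> R) -> R) (G : R -> (nat -> R) -> R)
    (HGn_meas : forall n, kernel_measurable (Gn n))
    (HG_meas : kernel_measurable G)
    (A1 : forall e : R, 0 < e -> exists N : nat, forall n : nat, (N <= n)%N ->
       forall u, 0 <= u <= 1 ->
       (LqN P q (fun w => (Gn n u (eps_seq eps 0 w) - G u (eps_seq eps 0 w))%R)
          <= e%:E)%E)
    (A2 : (ereal_sup [set LqN P q (fun w => Gn nu.1 nu.2 (eps_seq eps 0 w))
                     | nu in [set nu : nat * R | (0 < nu.1)%N /\ (0 <= nu.2 <= 1)%R]]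
           + ereal_sup [set pvar P q p (Gn n) (eps_seq eps 0)
                       | n in [set n : nat | (0 < n)%N]] <= CG%:E)%E)
    (A3 : forall (j n : nat) (t : int) (u : R), (0 < n)%N -> 0 <= u <= 1 ->
       (LqN P q (fun w => (Gn n u (eps_seq eps t w)
                          - Gn n u (eps_tilde eps epss t j w))%R)
          <= (CG * rho ^+ j)%R%:E)%E) :
  let sigma2 : R -> R := fun u =>
    limn (fun N : nat => \sum_(i < (2 * N).+1)
      fine (covariance P (fun w => G u (eps_seq eps (i%:Z - N%:Z) w))
                         (fun w => G u (eps_seq eps 0 w)))) in
  let Sigma : R -> R := fun v =>
    fine (\int[lebesgue_measure]_(u in [set u : R | (0 <= u <= v)%R]) (sigma2 u)%:E)%E in
  let X : nat -> nat -> T -> R := fun t n w =>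
    Gn n (t%:R / n%:R) (eps_seq eps t%:Z w) in
  let S : nat -> T -> R -> R := fun n w v =>
    (Num.sqrt n%:R)^-1 *
      \sum_(1 <= t < (Num.truncn (n%:R * v)).+1) (X t n w - fine ('E_P[X t n])%E) in
  forall (d' : measure_display) (T' : measurableType d') (Q : probability T' R)
         (B : R -> T' -> R),
    std_brownian Q B ->
    weak_conv_D P S Q (fun w v => B (Sigma v) w).
Proof.
move=> sigma2 Sigma X S d' T' Q B BM.
have k1 := @centered_coupled _ _ _ P eps epss Heps_meas q p CG rho Hq Hrho Gn HGn_meas A2 A3.
have k2 := @centered_limit_L2k _ _ _ P eps epss Heps_meas q p CG Hq Gn G HGn_meas HG_meas A1 A2.
have k3 := @centered_kernel_cvg _ _ _ P eps epss Heps_meas q p CG Hq Gn G HGn_meas HG_meas A1 A2.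
have k4 := @centered_variation _ _ _ P eps epss Heps_meas q p CG Hq Hp Gn HGn_meas A2.
have k5 := @centered_cov_meas _ _ _ P eps epss Heps_meas Hindep Hident q p CG Hq Gn G HGn_meas HG_meas A1 A2.
have C0 : 0 < Cst CG by exact: (Cst_gt0 A2).
have sl := @sigma_limit _ _ _ P eps epss Heps_meas Hindep Hident _ rho _ _ C0 Hrho k1 k2 k3 k5 k4.
pose sg := sig P eps (cG P eps G); pose Mb := ckap (Cst CG) rho + (fun N : nat => 2 * ckap (Cst CG) rho / (1 - rho) * rho ^+ N) 0%N.
have sgb u : I01 u -> `|sg u| <= Mb.
  by move=> Iu; exact: (@sig_bound _ _ _ P eps epss Heps_meas Hindep Hident _ rho _ _ C0 Hrho k1 k2 k3 u Iu).
have sgm : measurable_fun I01 sg.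
  exact: (@sig_meas _ _ _ P eps epss Heps_meas Hindep Hident _ rho _ _ C0 Hrho k1 k2 k3 k5).
have Mb0 : 0 <= Mb by apply: le_trans (sgb 0 _); rewrite ?normr_ge0// /I01/= lexx ler01.
clearbody Mb.
(* Adding 1 keeps the Lipschitz constant positive, and makes it at least 1, so that it also bounds
   variances in the form [K ^+ 2]. *)
pose Sg := primitive sg; pose K := Mb + 1; have K0 : 0 < K by rewrite ltr_wpDl.
have SgL := primitive_lip sgm sgb.
pose Gw n i w := cGn P eps Gn n (i.+1%:R / n%:R) (eps_seq eps i.+1%:Z w).
pose V n l l' := n%:R^-1 * Er P (fun w => (\sum_(l <= i < l') Gw n i w) ^+ 2).
have V0 n l l' : 0 <= V n l l'.
  by rewrite mulr_ge0 ?invr_ge0//; apply: Er_ge0 => w; exact: sqr_ge0.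
have Sg0 : Sg 0 = 0 by exact: primitive0.
have SgI s t : 0 <= s -> s <= t -> t <= 1 -> 0 <= Sg t - Sg s <= K * (t - s).
  move=> s0 st t1; rewrite (primitive_monotone Mb0 SgL V0 sl s0 st t1)/=.
  apply: le_trans (ler_norm _) _; apply: le_trans (SgL s t s0 st t1) _.
  by rewrite mulrC ler_wpM2r ?subr_ge0// lerDl.
have [NB HNB] := sl 1 ltr01.
have KB n l l' : (NB <= n)%N -> (l <= l')%N -> (l' <= n)%N -> V n l l' <= K ^+ 2.
  move=> nB ll ln; have := HNB n l l' nB ll ln; rewrite ler_norml => /andP[_]; rewrite lerBlDr => h.
  (* For [n = 0] the convention that 0 has inverse 0 makes [V] vanish. *)
  have [n0|n0] := posnP n.
    by rewrite /V n0 invr0 mul0r sqr_ge0.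
  have nR : 0 < n%:R :> R by rewrite ltr0n.
  have i1 : 0 <= l%:R / n%:R :> R by rewrite divr_ge0.
  have i2 : l%:R / n%:R <= l'%:R / n%:R :> R by rewrite ler_pM2r ?invr_gt0// ler_nat.
  have i3 : l'%:R / n%:R <= 1 :> R by rewrite ler_pdivrMr// mul1r ler_nat.
  have d1 : Sg (l'%:R / n%:R) - Sg (l%:R / n%:R) <= Mb.
    apply: le_trans (ler_norm _) _; apply: le_trans (SgL _ _ i1 i2 i3) _.
    exact: (gap_mul_le Mb0 i1 i3).
  apply: (@le_trans _ _ K); first by apply: le_trans h _; rewrite /K addrC lerD2r.
  by rewrite expr2 ler_peMl ?(ltW K0)// /K lerDr.
have C1 : 0 < CG + 1 by move: C0; rewrite /Cst pmulr_rgt0.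
have KUI := ctr_pos_small Hq (powR_gt0 q C1) C0 (@Gn_L2k _ _ _ P eps epss Heps_meas q p CG Hq Gn HGn_meas A2).
have bm := block_model Heps_meas Hindep Hident C0 Hrho k1 KUI (ltW K0) KB.
pose Y w v := B (Sigma v) w.
(* The two-sided covariance series of [G] agrees with [sig] only for parameters in [[0, 1]], which
   is the range of integration when [v] lies there. *)
have SgE v : I01 v -> Sigma v = Sg v.
  move=> /andP[v0 v1]; apply: (congr1 fine); apply: eq_integral => u; rewrite inE /= => /andP[u0 uv]; apply: (congr1 EFin).
  apply: (@sigma2E _ _ _ P eps epss Heps_meas Hindep Hident q p CG rho Hq Hp Hrho Gn G HGn_meas HG_meas A1 A2).
  by rewrite /I01/= u0 (le_trans uv).
have YE w v : I01 v -> Y w v = B (Sg v) w by move=> /SgE Ev; rewrite /Y Ev.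
have cY := timed_cont BM K0 Sg0 SgI YE.
have mY u : I01 u -> measurable_fun setT (fun w => Y w u) by move=> Iu; exact: (timed_meas BM YE Iu).
have mseq t : measurable_fun setT (eps_seq eps t : T -> seqR) by apply: meas_seq => k; case: (Heps_meas (t - k%:Z)).
pose xs n l w := (Num.sqrt n%:R)^-1 * \sum_(1 <= t < l.+1) (X t n w - fine ('E_P[X t n])%E).
have mxs n l : measurable_fun setT (xs n l).
  apply: measurable_funM => //; apply: measurable_sum => t; apply: measurable_funB => //.
  exact: (measurableT_comp (kernel_section _ (HGn_meas n)) (mseq _)).
have cS n w : cadlag (S n w) by exact: (cadlag_step n (fun l => xs n l w)).
apply: (@skorokhod_reduction _ _ _ _ _ P Q S Y cS).
- by move=> w; exact: (cadlag_cont (cY w)).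
- move=> F cF; split; last exact: (meas_path cY mY cF).
  by move=> n; exact: (meas_step n cF (mxs n)).
move=> F M L M0 L0 FL; have cF := lip_sup_cont L0 FL.
apply/cvgrPdist_le => e e0.
have /cvgrPdist_le/(_ e e0)[N _ HN] := functional_limit (A := fun F n => Er P (fun w => F (stepf n (fun l =>
  (Num.sqrt n%:R)^-1 * \sum_(i < minn l n) Gw n i w)))) BM K0 Sg0 SgI YE bm sl M0 L0 FL.
exists N.+1 => // n /= nN; have n0 : (0 < n)%N by exact: leq_trans nN.
(* On [[0, 1]] the cap [minn l n] is inactive and index [i] corresponds to time [i + 1]. The
   subtracted mean at that time equals the one at time 0 used in [ctr], by stationarity. *)
have := HN n (ltnW nN); congr (`|_ - _| <= _); apply: eq_Er => w; apply: sup_cont_eq => //.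
  exact: cadlag_step.
move=> v Iv; rewrite /stepf /S; have := truncn_le_grid n Iv; set l := Num.truncn _ => ln.
rewrite (minn_idPl ln) big_add1/= big_mkord; congr (_ * _); apply: eq_bigr => i _.
have ii : (i < n)%N by exact: leq_trans (ltn_ord i) ln.
have Iu : I01 (i.+1%:R / n%:R : R).
  by rewrite /I01/= divr_ge0//= ler_pdivrMr ?ltr0n// mul1r ler_nat.
have [Lu _ _] := @Gn_L2k _ _ _ P eps epss Heps_meas q p CG Hq Gn HGn_meas A2 n _ n0 Iu.
rewrite /Gw /cGn /ctr /X; congr (_ - _).
by rewrite -(Er_at Heps_meas Hindep Hident i.+1%:Z Lu).
Qed.
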